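(* Let $n\ge1$ and let $P(\partial_z)=\sum_{i,j=1}^n a_{ij}\partial^2_{z_iz_j}$ ($z\in\mathbb{C}^n$) be a homogeneous elliptic operator of order $2$ with real coefficients, where $A=(a_{ij})$ is a real symmetric positive-definite matrix. Let $C$ be a real orthogonal matrix such that $\Lambda=C^TAC$ is diagonal (with positive diagonal entries) and let $\Lambda^{1/2}$ be the diagonal matrix of positive square roots. For $\varphi\in\mathcal{O}(D^n)$ define $$M_{\mu_B}(\varphi;z,t)=\frac{1}{\alpha(n)}\int_{B(0,1)}\varphi(z+tC\Lambda^{1/2}y)\,dy,\qquad M_{\mu_S}(\varphi;z,t)=\frac{1}{n\alpha(n)}\int_{S(0,1)}\varphi(z+tC\Lambda^{1/2}y)\,dS(y),$$ where $\alpha(n)=\pi^{n/2}/\Gamma(1+n/2)$, $dy$ is Lebesgue measure on the real unit ball $B(0,1)\subset\mathbb{R}^n$ and $dS$ is surface measure on the unit sphere $S(0,1)$. Let $d\in\mathbb{R}$ and let $\widehat u$ be the formal power series solution of $(\partial_t-P(\partial_z))u=0$, $u(0,z)=\varphi(z)$. Then: (i) $\widehat u$ converges to a holomorphic function $u\in\mathcal{O}(D^{n+1})$ if and only if $M_{\mu_B}(\varphi;z,t)\in\mathcal{O}^2(D^n\times\mathbb{C})$, and if and only if $M_{\mu_S}(\varphi;z,t)\in\mathcal{O}^2(D^n\times\mathbb{C})$; (ii) $\widehat u$ is $1$-summable in the direction $d$ if and only if $M_{\mu_B}(\varphi;z,t)\in\mathcal{O}^2(D^n\times(\widehat S_{d/2}\cup\widehat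 S_{d/2+\pi}))$, and if and only if $M_{\mu_S}(\varphi;z,t)\in\mathcal{O}^2(D^n\times(\widehat S_{d/2}\cup\widehat S_{d/2+\pi}))$.
   Context: Notation: $D^n_r=\{z\in\mathbb{C}^n:|z|<r\}$, $D_r=D^1_r$; $D^n$ denotes such a disc centred at the origin with some unspecified radius. The formal solution is $\widehat u(t,z)=\sum_{j\ge0}\frac{P^j(\partial_z)\varphi(z)}{j!}t^j$. Sectors: $S_d(\varepsilon)$ is the set of $t=\rho e^{i\theta}$ in the universal covering of $\mathbb{C}\setminus\{0\}$ with $\rho>0$, $|\theta-d|<\varepsilon/2$; a disc-sector $\widehat S_d(\varepsilon;r_1)=S_d(\varepsilon)\cup D_{r_1}$; $\widehat S_d$ denotes a disc-sector in direction $d$ with some unspecified $\varepsilon,r_1>0$. For $k>0$, a function $f(z,t)$ holomorphic on $D^n_r\times\widehat S_d(\varepsilon;r_1)$ belongs to $\mathcal{O}^k(D^n\times\widehat S_d)$ if for all $\tilde r<r$, $\tilde r_1<r_1$, $\tilde\varepsilon<\varepsilon$ there are $A,B$ with $\max_{|z|\le\tilde r}|f(z,t)|\le Ae^{B|t|^k}$ for $t\in\widehat S_d(\tilde\varepsilon;\tilde r_1)$; $\mathcal{O}^k(D^n\times\mathbb{C})$ analogously with $t\in\mathbb{C}$; membership in $\mathcal{O}^k(D^n\times(G_1\cup G_2))$ means membership for each of $G_1,G_2$. The same definitions apply with variable order $(t,z)$. A function initially defined only for small $|t|$ belongs to such a space if it extends holomorphically with the stated growth. $k$-summability: $\widehat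 u=\sum_j u_j(z)t^j$ (with $u_j\in\mathcal{O}(D^n)$) is $k$-summable in direction $d$ if there is a disc-sector $\widehat S_d$ with $\sum_j\frac{u_j(z)}{\Gamma(1+j/k)}t^j\in\mathcal{O}^k(\widehat S_d\times D^n)$. *)

(* Defs.v *)
(* Complex numbers are MathComp real_closed's
   [R[i]] (for [R : realType]), viewed as a numFieldType so that
   MathComp-Analysis' normed-space / differentiability theory applies. *)
From HB Require Import structures.
From mathcomp Require Import all_boot all_order all_algebra.
From mathcomp Require Import all_classical all_reals all_analysis.
From mathcomp Require Import complex.
Import Order.TTheory GRing.Theory Num.Theory.
Import numFieldNormedType.Exports.

Set Implicit Arguments.
Unset Strict Implicit.
Unset Printing Implicit Defensive.

Local Open Scope classical_set_scope.
Local Open Scope ring_scope.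

Section Defs.
Variable R : realType.

Definition Cx : numFieldType := R[i].

Definition cmod (t : Cx) : R := Num.sqrt (complex.Re t ^+ 2 + complex.Im t ^+ 2).

Definition enorm (n : nat) (z : 'rV[Cx]_n) : R :=
  Num.sqrt (\sum_(i < n) cmod (z 0 i) ^+ 2).

Definition Dn (n : nat) (r : R) : set 'rV[Cx]_n := [set z | enorm z < r].

Definition holo_on (V : normedModType Cx) (f : V -> Cx) (U : set V) : Prop :=
  forall p, U p -> differentiable f p.

(* Sector S_d(eps) = { rho e^{i theta} : rho > 0, |theta - d| < eps/2 };
   we only use openings eps < 2 pi, for which the sector (a subset of the
   universal covering of C \ {0}) is embedded in C. *)
Definition sector (d eps : R) : set Cx :=
  [set t | exists rho theta : R, 0 < rho /\ `|theta - d| < eps / 2 /\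
           t = ((rho * cos theta) +i* (rho * sin theta))%C].

Definition dsector (d eps r1 : R) : set Cx :=
  sector d eps `|` [set t | cmod t < r1].

Definition unc (n : nat) (F : 'rV[Cx]_n -> Cx -> Cx) : 'rV[Cx]_n * Cx -> Cx :=
  fun p => F p.1 p.2.

(* A "germ predicate" says how a candidate global function F relates to
   the object (defined only near the origin) that has to extend. *)
Definition germ_fun (n : nat) (M : 'rV[Cx]_n -> Cx -> Cx)
  (F : 'rV[Cx]_n -> Cx -> Cx) : Prop :=
  exists2 delta : R, 0 < delta &
    forall z t, enorm z < delta -> cmod t < delta -> F z t = M z t.

Definition psum (n : nat) (c : nat -> 'rV[Cx]_n -> Cx) z t (N : nat) : Cx :=
  \sum_(j < N) c j z * t ^+ j.

Definition germ_series (n : nat) (c : nat -> 'rV[Cx]_n -> Cx)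
  (F : 'rV[Cx]_n -> Cx -> Cx) : Prop :=
  exists2 delta : R, 0 < delta &
    forall z t, enorm z < delta -> cmod t < delta ->
      psum c z t @ \oo --> F z t.

Definition Ok_entire (n : nat) (k : R) (germ : ('rV[Cx]_n -> Cx -> Cx) -> Prop)
  : Prop :=
  exists r : R, 0 < r /\ exists F : 'rV[Cx]_n -> Cx -> Cx,
    [/\ germ F,
        holo_on (unc F) [set p | Dn r p.1] &
        forall r' : R, r' < r -> exists A B : R, forall z t,
          enorm z <= r' -> cmod (F z t) <= A * expR (B * cmod t `^ k)].

Definition Ok_sector (n : nat) (k d : R)
  (germ : ('rV[Cx]_n -> Cx -> Cx) -> Prop) : Prop :=
  exists r eps r1 : R, [/\ 0 < r, 0 < eps, eps < 2 * pi & 0 < r1] /\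
  exists F : 'rV[Cx]_n -> Cx -> Cx,
    [/\ germ F,
        holo_on (unc F) [set p | Dn r p.1 /\ dsector d eps r1 p.2] &
        forall r' eps' r1' : R, r' < r -> eps' < eps -> r1' < r1 ->
          exists A B : R, forall z t, enorm z <= r' -> dsector d eps' r1' t ->
            cmod (F z t) <= A * expR (B * cmod t `^ k)].

Definition Gamma (s : R) : R :=
  Rintegral (@lebesgue_measure R) `]0%R, +oo[%classic
    (fun x => x `^ (s - 1) * expR (- x)).

Definition alpha (n : nat) : R :=
  pi `^ (n%:R / 2) / Gamma (1 + n%:R / 2).

Definition k_summable (n : nat) (k d : R) (u : nat -> 'rV[Cx]_n -> Cx) : Prop :=
  Ok_sector k d
    (germ_series (fun j z => u j z / ((Gamma (1 + j%:R / k))%:C%C : Cx))).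

Definition converges_holo (n : nat) (u : nat -> 'rV[Cx]_n -> Cx) : Prop :=
  exists r : R, 0 < r /\ exists U : 'rV[Cx]_n -> Cx -> Cx,
    let D := [set p : 'rV[Cx]_n * Cx | enorm p.1 ^+ 2 + cmod p.2 ^+ 2 < r ^+ 2] in
    holo_on (unc U) D /\
    forall z t, D (z, t) -> psum u z t @ \oo --> U z t.

Definition unitv (n : nat) (i : 'I_n) : 'rV[Cx]_n := \row_k (k == i)%:R.

Definition Pop (n : nat) (A : 'M[R]_n) (f : 'rV[Cx]_n -> Cx) : 'rV[Cx]_n -> Cx :=
  fun z => \sum_(i < n) \sum_(j < n)
    ((A i j)%:C%C : Cx) * 'D_(unitv i) ('D_(unitv j) f) z.

(* coefficients of the formal solution  u^ = sum_j P^j(d_z) phi / j! t^j *)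
Definition formal_coef (n : nat) (A : 'M[R]_n) (phi : 'rV[Cx]_n -> Cx)
  (j : nat) (z : 'rV[Cx]_n) : Cx :=
  iter j (Pop A) phi z / ((j`!)%:R : Cx).

(* Real n-space is (n.-tuple R) with its product Borel sigma-algebra. *)
Definition lebesgue_n (n : nat) (mu : {measure set (n.-tuple R) -> \bar R})
  : Prop :=
  forall a b : n.-tuple R, (forall i, tnth a i <= tnth b i) ->
    mu [set x | forall i, tnth a i <= tnth x i <= tnth b i] =
    (\prod_(i < n) (tnth b i - tnth a i))%:E.

Definition rball (n : nat) : set (n.-tuple R) :=
  [set y | \sum_(i < n) tnth y i ^+ 2 < 1].
Definition rsphere (n : nat) : set (n.-tuple R) :=
  [set y | \sum_(i < n) tnth y i ^+ 2 = 1].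

Definition tscale (n : nat) (r : R) (y : n.-tuple R) : n.-tuple R :=
  [tuple of map (fun c => r * c) y].

Definition surface_n (n : nat) (mu sigma : {measure set (n.-tuple R) -> \bar R})
  : Prop :=
  forall E, measurable E ->
    sigma E = ((n%:R)%:E *
      mu [set tscale r y | r in `]0%R, 1%R]%classic & y in E `&` @rsphere n])%E.

Definition cint (n : nat) (mu : {measure set (n.-tuple R) -> \bar R})
  (D : set (n.-tuple R)) (f : n.-tuple R -> Cx) : Cx :=
  ((Rintegral mu D (fun y => complex.Re (f y)))%:C%C : Cx) +
  'i%C * ((Rintegral mu D (fun y => complex.Im (f y)))%:C%C : Cx).

Definition Lam (n : nat) (A Cm : 'M[R]_n) : 'M[R]_n := Cm^T *m A *m Cm.
Definition CLsqrt (n : nat) (A Cm : 'M[R]_n) : 'M[R]_n :=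
  Cm *m diag_mx (\row_i Num.sqrt (Lam A Cm i i)).

Definition shifted (n : nat) (A Cm : 'M[R]_n) (z : 'rV[Cx]_n) (t : Cx)
  (y : n.-tuple R) : 'rV[Cx]_n :=
  \row_i (z 0 i + t * (((\sum_(k < n) CLsqrt A Cm i k * tnth y k)%:C%C) : Cx)).

Definition M_B (n : nat) (mu : {measure set (n.-tuple R) -> \bar R})
  (A Cm : 'M[R]_n) (phi : 'rV[Cx]_n -> Cx) (z : 'rV[Cx]_n) (t : Cx) : Cx :=
  ((1 / alpha n)%:C%C : Cx) * cint mu (@rball n) (fun y => phi (shifted A Cm z t y)).

Definition M_S (n : nat) (sigma : {measure set (n.-tuple R) -> \bar R})
  (A Cm : 'M[R]_n) (phi : 'rV[Cx]_n -> Cx) (z : 'rV[Cx]_n) (t : Cx) : Cx :=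
  ((1 / (n%:R * alpha n))%:C%C : Cx) *
    cint sigma (@rsphere n) (fun y => phi (shifted A Cm z t y)).

End Defs.

(* Main.v *)
(** Put [T = C Lam^(1/2)], so that [T T^t = A] and [P] is the sum of the squares of
the derivatives along the columns of [T].  Expanding [phi (z + t T y)] along complex
lines and integrating over the ball kills the odd powers of [t], while an integration
by parts against [(1 - |y|^2)_+^2] turns the term of order [2j] into an explicit
multiple of [P^j phi (z)]; homogeneity relates the sphere to the ball.  Hence both
means have the form [\sum_j kap_j u_j(z) t^(2j)] with
[kap_j = kap_(j+1) * 2 (2j + h + 1)], where [h = n + 1] for the ball and [h = n - 1]
for the sphere.

(i) Since [kap_j] is [1/j!] up to a geometric factor, Cauchy estimates show that growth
of order 2 in [t] is equivalent to geometric bounds on the [u_j] near [0].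

(ii) Write [kap_j = kap_0 4^(-j) q_h(j)], so that [q_1(j) = 1/j!].  Consider the condition
that [\sum_j q_h(j) u_j s^j] continues to a disc-sector with
exponential growth.  This does not depend on [h]: averaging
[G(z, s sin^2 x) sin^h x] over [[0, pi/2]] passes from [h] to [h + 1], and
[2 s d_s G + (h + 1) G] passes from [h + 2] to [h].  For [h = 1] it is 1-summability; for the
[h] of the mean it is transported by [s = t^2 / 4]. *)

(* Holomorphy is mere complex differentiability at each point of a normed space, so the one-variable
   theory starts from Goursat: Cauchy's formula comes from contracting a circle to a point and
   yields Taylor expansions along complex lines. In several variables the second-difference
   estimates [Equad] do the work of Weierstrass- and Hartogs-type theorems: bounded pointwise
   limits, parameter integrals and derivatives stay holomorphic because these estimates survive.

   The measures are known only through [lebesgue_n] (values on boxes) and [surface_n] (volumes of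
   cones). All moments therefore rest on translating and dilating Lebesgue measure: a thin shell
   computes radial weights, a small translation integrates by parts, and no polar coordinates or
   boundary integrals appear.

   Passing from [h] to [h + 1] is an average and keeps the disc-sector. Passing from [h + 2] to [h]
   is a derivative, which costs a little opening; this is affordable because growth is only
   prescribed on strictly smaller disc-sectors. Raising by one and lowering by two connect any two
   values of [h], whatever the parity of [n]. *)
Require Import Defs.
From HB Require Import structures.
From mathcomp Require Import all_boot all_order all_algebra.
From mathcomp Require Import all_classical all_reals all_analysis.
From mathcomp Require Import complex.
From mathcomp Require Import measurable_realfun.
From mathcomp Require Import ring lra zify.
Import Order.TTheory GRing.Theory Num.Theory.
Import numFieldNormedType.Exports.
Set Implicit Arguments.
Unset Strict Implicit.
Unset Printing Implicit Defensive.
Local Open Scope classical_set_scope.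
Local Open Scope ring_scope.

(** * Complex modulus and complex-valued integrals *)

Section Cmod.
Variable R : realType.
Local Notation C := (Cx R).
Implicit Types x y z t : C.

Definition rc (a : R) : C := (a%:C)%C.

(** The norm of [Cx R] takes its values in [Cx R] itself; through [rc] every estimate is moved to
    the real-valued [cmod]. *)
Lemma cmodE t : `|t| = rc (cmod t).
Proof. exact: normc_def. Qed.

Lemma rc_le (a b : R) : (rc a <= rc b) = (a <= b).
Proof. exact: lecR. Qed.
Lemma rc_lt (a b : R) : (rc a < rc b) = (a < b).
Proof. exact: ltcR. Qed.
Lemma rcD a b : rc (a + b) = rc a + rc b.
Proof. exact: (rmorphD (real_complex R)). Qed.
Lemma rcN a : rc (- a) = - rc a.
Proof. exact: (rmorphN (real_complex R)). Qed.
Lemma rcB a b : rc (a - b) = rc a - rc b.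
Proof. exact: (rmorphB (real_complex R)). Qed.
Lemma rcM a b : rc (a * b) = rc a * rc b.
Proof. exact: (rmorphM (real_complex R)). Qed.
Lemma rcV a : rc (a^-1) = (rc a)^-1.
Proof. exact: (fmorphV (real_complex R)). Qed.
Lemma rcX a n : rc (a ^+ n) = rc a ^+ n.
Proof. exact: (rmorphXn (real_complex R)). Qed.
Lemma rc0 : rc 0 = 0. Proof. by []. Qed.
Lemma rc1 : rc 1 = 1. Proof. by []. Qed.
Lemma rc_nat n : rc n%:R = n%:R.
Proof. exact: (rmorph_nat (real_complex R)). Qed.
Lemma rc_sum (I : Type) (s : seq I) (F : I -> R) :
  rc (\sum_(i <- s) F i) = \sum_(i <- s) rc (F i).
Proof. exact: (rmorph_sum (real_complex R)). Qed.
Lemma rc_inj : injective rc.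
Proof. by move=> a b []. Qed.
Lemma rc_eq0 a : (rc a == 0) = (a == 0).
Proof. by rewrite -rc0 (inj_eq rc_inj). Qed.

Lemma cmod_ge0 t : 0 <= cmod t. Proof. exact: sqrtr_ge0. Qed.
Lemma cmodM x y : cmod (x * y) = cmod x * cmod y.
Proof. by apply: rc_inj; rewrite rcM -!cmodE normrM. Qed.
Lemma cmodD x y : cmod (x + y) <= cmod x + cmod y.
Proof. by rewrite -rc_le rcD -!cmodE ler_normD. Qed.
Lemma cmodN x : cmod (- x) = cmod x.
Proof. by apply: rc_inj; rewrite -!cmodE normrN. Qed.
Lemma cmodB x y : cmod (x - y) <= cmod x + cmod y.
Proof. by rewrite (le_trans (cmodD _ _)) // cmodN. Qed.
Lemma cmodC x y : cmod (x - y) = cmod (y - x).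
Proof. by rewrite -opprB cmodN. Qed.
Lemma cmod0 : cmod (0 : C) = 0.
Proof. by apply: rc_inj; rewrite -cmodE normr0. Qed.
Lemma cmod1 : cmod (1 : C) = 1.
Proof. by apply: rc_inj; rewrite -cmodE normr1. Qed.
Lemma cmodX x n : cmod (x ^+ n) = cmod x ^+ n.
Proof. by apply: rc_inj; rewrite rcX -!cmodE normrX. Qed.
Lemma cmodV x : cmod (x^-1) = (cmod x)^-1.
Proof. by apply: rc_inj; rewrite rcV -!cmodE normfV. Qed.
Lemma cmod_eq0 x : (cmod x == 0) = (x == 0).
Proof. by rewrite -rc_eq0 -cmodE normr_eq0. Qed.
Lemma cmod_gt0 x : (0 < cmod x) = (x != 0).
Proof. by rewrite -rc_lt -cmodE rc0 normr_gt0. Qed.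
Lemma cmod_rc a : cmod (rc a) = `|a|.
Proof. by rewrite /cmod /= expr0n /= addr0 sqrtr_sqr. Qed.
Lemma cmod_nat n : cmod (n%:R : C) = n%:R.
Proof. by rewrite -rc_nat cmod_rc normr_nat. Qed.
Lemma cmod_sum (I : Type) (s : seq I) (P : pred I) (F : I -> C) :
  cmod (\sum_(i <- s | P i) F i) <= \sum_(i <- s | P i) cmod (F i).
Proof.
elim/big_rec2: _ => [|i u v _ h]; first by rewrite cmod0.
by rewrite (le_trans (cmodD _ _)) // lerD2l.
Qed.
Lemma cmod_triB x y : cmod x - cmod y <= cmod (x - y).
Proof. by rewrite lerBlDr (le_trans _ (cmodD _ _)) // subrK. Qed.
Lemma Re_cmod x : `|complex.Re x| <= cmod x.
Proof.
by rewrite /cmod -sqrtr_sqr ler_wsqrtr // lerDl sqr_ge0.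
Qed.
Lemma Im_cmod x : `|complex.Im x| <= cmod x.
Proof.
by rewrite /cmod -sqrtr_sqr ler_wsqrtr // lerDr sqr_ge0.
Qed.
Lemma cmod_ReIm x : cmod x <= `|complex.Re x| + `|complex.Im x|.
Proof.
rewrite /cmod -[leRHS]ger0_norm ?addr_ge0// -[leRHS]sqrtr_sqr ler_wsqrtr//.
by rewrite sqrrD !real_normK ?num_real// lerD2r lerDl mulrn_wge0 // mulr_ge0.
Qed.

Lemma cReD x y : complex.Re (x + y) = complex.Re x + complex.Re y.
Proof. by case: x; case: y. Qed.
Lemma cImD x y : complex.Im (x + y) = complex.Im x + complex.Im y.
Proof. by case: x; case: y. Qed.
Lemma cReN x : complex.Re (- x) = - complex.Re x.
Proof. by case: x. Qed.
Lemma cImN x : complex.Im (- x) = - complex.Im x.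
Proof. by case: x. Qed.
Lemma cReM x y : complex.Re (x * y) =
  complex.Re x * complex.Re y - complex.Im x * complex.Im y.
Proof. by case: x; case: y. Qed.
Lemma cImM x y : complex.Im (x * y) =
  complex.Re x * complex.Im y + complex.Im x * complex.Re y.
Proof. by case: x; case: y => a b c d /=. Qed.
Lemma ReIm_eq x y : complex.Re x = complex.Re y ->
  complex.Im x = complex.Im y -> x = y.
Proof. by case: x; case: y => a b c d /= -> ->. Qed.

Lemma gt0_rc x : 0 < x -> exists2 e : R, 0 < e & x = rc e.
Proof.
case: x => a b; rewrite ltcE /= => /andP[/eqP b0 a0]; exists a => //.
by rewrite /rc -complexr0 -b0.
Qed.

Lemma cvgCP (u : nat -> C) (l : C) :
  u @ \oo --> l <->
  (forall e : R, 0 < e -> exists N, forall n, (N <= n)%N -> cmod (u n - l) < e).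
Proof.
split=> [/cvgrPdist_lt h e e0|h].
  have := h (rc e); rewrite -rc0 rc_lt => /(_ e0) [N _ hN].
  exists N => n Nn; have := hN n Nn.
  by rewrite /= cmodE rc_lt cmodC.
apply/cvgrPdist_lt => _ /gt0_rc[e e0 ->].
have [N hN] := h e e0; exists N => // n /= Nn.
by rewrite cmodE rc_lt cmodC hN.
Qed.

Lemma cvgC_ReIm (u : nat -> C) (a b : R) :
  (fun n => complex.Re (u n)) @ \oo --> a ->
  (fun n => complex.Im (u n)) @ \oo --> b ->
  u @ \oo --> ((a +i* b)%C : C).
Proof.
move=> /cvgrPdist_lt ha /cvgrPdist_lt hb; apply/cvgCP => e e0.
have e2 : 0 < e / 2 by rewrite divr_gt0.
have [N1 _ h1] := ha _ e2; have [N2 _ h2] := hb _ e2.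
exists (maxn N1 N2) => n; rewrite geq_max => /andP[n1 n2].
rewrite (le_lt_trans (cmod_ReIm _))// (splitr e) cReD cImD cReN cImN /=.
by rewrite ltrD // distrC ?h1 ?h2.
Qed.

(** Real and imaginary parts are 1-Lipschitz for [cmod], so both are Cauchy in [R] and completeness
    of [R] applies to each. *)
Lemma cauchyC (u : nat -> C) (b : nat -> R) :
  (forall n m, (n <= m)%N -> cmod (u m - u n) <= b n) ->
  b @ \oo --> (0 : R) -> exists l : C, u @ \oo --> l.
Proof.
move=> h /cvgrPdist_lt hb.
suff H (f : C -> R) : (forall x y, `|f x - f y| <= cmod (x - y)) ->
    exists a : R, (fun n => f (u n)) @ \oo --> a.
  have [a ha] : exists a : R, (fun n => complex.Re (u n)) @ \oo --> a.
    by apply: (H (@complex.Re R)) => x y; rewrite -cReN -cReD Re_cmod.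
  have [b' hb'] : exists a : R, (fun n => complex.Im (u n)) @ \oo --> a.
    by apply: (H (@complex.Im R)) => x y; rewrite -cImN -cImD Im_cmod.
  by eexists; apply: cvgC_ReIm; [exact: ha|exact: hb'].
move=> hf; suff /cauchy_cvgP h' : cauchy ((fun n => f (u n)) @ \oo) by exists (lim ((fun n => f (u n)) @ \oo)).
apply/cauchy_ballP => e e0.
have e2 : 0 < e / 2 by rewrite divr_gt0.
have [N _ hN] := hb _ e2.
have key n : (N <= n)%N -> `|f (u n) - f (u N)| < e / 2.
  move=> Nn; rewrite (le_lt_trans (hf _ _))// (le_lt_trans (h _ _ Nn))//.
  by have := hN N (leqnn N); rewrite /= sub0r normrN => /(le_lt_trans (ler_norm _)).
exists ([set f (u n) | n in [set n | (N <= n)%N]], [set f (u n) | n in [set n | (N <= n)%N]]) => /=.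
  by split; exists N => // n /= Nn; exists n.
move=> [x y] /= [[n Nn <-] [m Nm <-]]; rewrite /ball /= (splitr e).
rewrite (le_lt_trans (ler_distD (f (u N)) _ _))// ltrD ?key//.
by rewrite distrC key.
Qed.

Lemma cvgC_unique (u : nat -> C) (l l' : C) :
  u @ \oo --> l -> u @ \oo --> l' -> l = l'.
Proof. by move=> h h'; apply: (cvg_unique _ h h'); exact: norm_hausdorff. Qed.

(** Bounds that are uniform over partial sums or approximants pass to limits through this lemma. *)
Lemma cvgC_le (u : nat -> C) (l a : C) (M : R) :
  u @ \oo --> l -> (forall n, cmod (u n - a) <= M) -> cmod (l - a) <= M.
Proof.
move=> /cvgCP h hM; apply/ler_addgt0Pr => e e0.
have [N hN] := h e e0; have := hN N (leqnn _); have := hM N.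
have -> : l - a = (u N - a) - (u N - l) by ring.
by move=> h1 h2; rewrite (le_trans (cmodB _ _))// lerD // ltW.
Qed.
End Cmod.

(** * Integrals of complex-valued functions *)

Section ComplexIntegral.
Variable R : realType.
Local Notation C := (Cx R).

Lemma cvgCP_gen (T : Type) (F : set_system T) {FF : Filter F} (f : T -> C) (l : C) :
  f @ F --> l <-> (forall e : R, 0 < e -> \forall x \near F, cmod (f x - l) < e).
Proof.
split=> [/cvgrPdist_lt h e e0|h].
  have := h (rc e); rewrite -rc0 rc_lt => /(_ e0); apply: filterS => x.
  by rewrite cmodE rc_lt cmodC.
apply/cvgrPdist_lt => _ /gt0_rc[e e0 ->]; apply: filterS (h e e0) => x.
by rewrite cmodE rc_lt cmodC.
Qed.

Lemma contR_near (T : topologicalType) (f : T -> R) (x : T) :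
  (forall e : R, 0 < e -> \forall y \near x, `|f y - f x| < e) -> {for x, continuous f}.
Proof.
move=> h; apply/cvgrPdist_lt => e e0; apply: filterS (h e e0) => y.
by rewrite distrC.
Qed.

Lemma contC_near (T : topologicalType) (f : T -> C) (x : T) :
  (forall e : R, 0 < e -> \forall y \near x, cmod (f y - f x) < e) <->
  {for x, continuous f}.
Proof. by split=> [h|h]; [apply/cvgCP_gen|apply/cvgCP_gen]. Qed.

Lemma nearC (x : C) (e : R) : 0 < e -> \forall y \near x, cmod (y - x) < e.
Proof.
move=> e0; have h : {for x, continuous (@id C)} by exact: cvg_id.
exact: ((contC_near _ _).2 h).
Qed.

Lemma nearR (x : R) (e : R) : 0 < e -> \forall y \near x, `|y - x| < e.
Proof.
move=> e0; have /cvgrPdist_lt h : (id : R -> R) @ x --> x by exact: cvg_id.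
by apply: filterS (h e e0) => y; rewrite distrC.
Qed.

Lemma Re_continuous : continuous (fun x : C => complex.Re x : R).
Proof.
move=> x; apply: contR_near => e e0; apply: filterS (nearC x e0) => y.
by apply: le_lt_trans; rewrite -cReN -cReD Re_cmod.
Qed.

Lemma Im_continuous : continuous (fun x : C => complex.Im x : R).
Proof.
move=> x; apply: contR_near => e e0; apply: filterS (nearC x e0) => y.
by apply: le_lt_trans; rewrite -cImN -cImD Im_cmod.
Qed.

Lemma rc_continuous : continuous (fun x : R => rc x : C).
Proof.
move=> x; apply/contC_near => e e0; apply: filterS (nearR x e0) => y.
by rewrite -rcB cmod_rc.
Qed.

Lemma continuous_Re (T : topologicalType) (f : T -> C) x :
  {for x, continuous f} -> {for x, continuous (fun x => complex.Re (f x) : R)}.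
Proof.
move=> cf; exact: (@continuous_comp T C R f (fun x => complex.Re x) x cf
  (@Re_continuous (f x))).
Qed.

Lemma continuous_Im (T : topologicalType) (f : T -> C) x :
  {for x, continuous f} -> {for x, continuous (fun x => complex.Im (f x) : R)}.
Proof.
move=> cf; exact: (@continuous_comp T C R f (fun x => complex.Im x) x cf
  (@Im_continuous (f x))).
Qed.

Definition ic : C := 'i%C.

Section gen.
Context {d} {T : measurableType d} (mu : {measure set T -> \bar R}).
Variables (D : set T) (mD : measurable D).

(** Convertible with [cint], but over any measurable type, so that segments of [R], balls and
    spheres share one theory. *)
Definition CI (f : T -> C) : C :=
  rc (Rintegral mu D (fun y => complex.Re (f y))) +
  ic * rc (Rintegral mu D (fun y => complex.Im (f y))).

Definition CIble (f : T -> C) :=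
  mu.-integrable D (EFin \o (fun y => complex.Re (f y))) /\
  mu.-integrable D (EFin \o (fun y => complex.Im (f y))).

Lemma Re_CI f : complex.Re (CI f) = Rintegral mu D (fun y => complex.Re (f y)).
Proof. by rewrite /CI cReD cReM /= !mul0r mul1r subr0 addr0. Qed.
Lemma Im_CI f : complex.Im (CI f) = Rintegral mu D (fun y => complex.Im (f y)).
Proof. by rewrite /CI cImD cImM /= !mul0r mul1r !add0r. Qed.

Lemma eq_CI f g : (forall x, D x -> f x = g x) -> CI f = CI g.
Proof.
by move=> h; rewrite /CI; congr (rc _ + _ * rc _);
  apply: eq_Rintegral => x /set_mem /h ->.
Qed.

Lemma eq_CIble f g : (forall x, D x -> f x = g x) -> CIble f -> CIble g.
Proof.
move=> h [h1 h2]; split; [apply: eq_integrable h1|apply: eq_integrable h2] => //.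
  by move=> x /set_mem /h /= ->.
by move=> x /set_mem /h /= ->.
Qed.

Lemma CIbleD f g : CIble f -> CIble g -> CIble (fun x => f x + g x).
Proof.
move=> [f1 f2] [g1 g2]; split.
  by apply: eq_integrable (integrableD mD f1 g1) => // x _; rewrite [in RHS]/comp cReD.
by apply: eq_integrable (integrableD mD f2 g2) => // x _; rewrite [in RHS]/comp cImD.
Qed.

Lemma CI_D f g : CIble f -> CIble g -> CI (fun x => f x + g x) = CI f + CI g.
Proof.
move=> [f1 f2] [g1 g2].
apply: ReIm_eq.
  rewrite Re_CI cReD !Re_CI -RintegralD//.
  by apply: eq_Rintegral => x _; rewrite cReD.
rewrite Im_CI cImD !Im_CI -RintegralD//.
by apply: eq_Rintegral => x _; rewrite cImD.
Qed.

Lemma CIbleZ c f : CIble f -> CIble (fun x => c * f x).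
Proof.
move=> [f1 f2]; split.
  apply: eq_integrable (integrableB mD (integrableZl mD (complex.Re c) f1)
     (integrableZl mD (complex.Im c) f2)) => // x _.
  by rewrite [in RHS]/comp cReM.
apply: eq_integrable (integrableD mD (integrableZl mD (complex.Re c) f2)
     (integrableZl mD (complex.Im c) f1)) => // x _.
by rewrite [in RHS]/comp cImM.
Qed.

Lemma CI_Z c f : CIble f -> CI (fun x => c * f x) = c * CI f.
Proof.
move=> [f1 f2].
have iZ a (g : T -> R) : mu.-integrable D (EFin \o g) ->
    mu.-integrable D (EFin \o (fun x => a * g x)).
  by move=> ig; apply: eq_integrable (integrableZl mD a ig) => // x _ /=.
apply: ReIm_eq.
  rewrite Re_CI cReM Re_CI Im_CI -!RintegralZl// -RintegralB//; [|exact: iZ|exact: iZ].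
  by apply: eq_Rintegral => x _; rewrite cReM.
rewrite Im_CI cImM Re_CI Im_CI -!RintegralZl// -RintegralD//;
  [|exact: iZ|exact: iZ].
by apply: eq_Rintegral => x _; rewrite cImM.
Qed.

Lemma CIbleJ f : CIble f -> CIble (fun x => (f x)^*%C).
Proof.
move=> [f1 f2]; split.
  by apply: eq_integrable f1 => // x _ /=; case: (f x).
apply: eq_integrable (integrableZl mD (-1) f2) => // x _ /=.
by case: (f x) => a b /=; rewrite -EFinM mulN1r.
Qed.

Lemma CI_J f : CIble f -> CI (fun x => (f x)^*%C) = (CI f)^*%C.
Proof.
move=> [f1 f2]; have ReJ (x : C) : complex.Re (x^*%C) = complex.Re x by case: x.
have ImJ (x : C) : complex.Im (x^*%C) = - complex.Im x by case: x.
apply: ReIm_eq; rewrite ?ReJ ?ImJ !(Re_CI, Im_CI).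
  by apply: eq_Rintegral => x _; rewrite ReJ.
rewrite -mulN1r -RintegralZl//; apply: eq_Rintegral => x _.
by rewrite ImJ mulN1r.
Qed.

Lemma CIbleN f : CIble f -> CIble (fun x => - f x).
Proof.
by move=> /(CIbleZ (-1)); apply: eq_CIble => x _; rewrite mulN1r.
Qed.

Lemma CI_N f : CIble f -> CI (fun x => - f x) = - CI f.
Proof.
move=> h; rewrite -mulN1r -CI_Z//; apply: eq_CI => x _; by rewrite mulN1r.
Qed.

Lemma CIbleB f g : CIble f -> CIble g -> CIble (fun x => f x - g x).
Proof. by move=> f1 /CIbleN g1; exact: CIbleD. Qed.

Lemma CI_B f g : CIble f -> CIble g -> CI (fun x => f x - g x) = CI f - CI g.
Proof.
by move=> f1 g1; rewrite -CI_N// -CI_D//; exact: CIbleN.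
Qed.

Lemma CIble0 : CIble (fun=> 0).
Proof.
split; apply: eq_integrable (integrable0 mu D) => // x _.
Qed.

Lemma CI0 : CI (fun=> 0) = 0.
Proof.
by apply: ReIm_eq; rewrite (Re_CI, Im_CI) /Rintegral /= integral0.
Qed.

Lemma CIble_sum (f : nat -> T -> C) N : (forall j, CIble (f j)) ->
  CIble (fun x => \sum_(j < N) f j x).
Proof.
move=> h; elim: N => [|N IH].
  by apply: eq_CIble CIble0 => x _; rewrite big_ord0.
apply: eq_CIble (CIbleD IH (h N)) => x _.
by rewrite big_ord_recr.
Qed.

Lemma CI_sum (f : nat -> T -> C) N : (forall j, CIble (f j)) ->
  CI (fun x => \sum_(j < N) f j x) = \sum_(j < N) CI (f j).
Proof.
move=> h; elim: N => [|N IH].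
  by rewrite big_ord0 -[RHS]CI0; apply: eq_CI => x _; rewrite big_ord0.
rewrite big_ord_recr /= -IH -CI_D//; last exact: CIble_sum.
by apply: eq_CI => x _; rewrite big_ord_recr.
Qed.

Hypothesis muD : (mu D < +oo)%E.

Lemma bounded_integrable (f : T -> R) M : measurable_fun D f ->
  (forall x, D x -> `|f x| <= M) -> mu.-integrable D (EFin \o f).
Proof.
move=> mf hM; apply: measurable_bounded_integrable => //.
exists M; split; first exact: num_real.
by move=> x Mx y Dy; apply: (le_trans (hM y Dy)); exact: ltW.
Qed.

Lemma cst_integrable (c : R) : mu.-integrable D (EFin \o (fun=> c)).
Proof. by apply: (@bounded_integrable _ `|c|) => //; exact: measurable_cst. Qed.

Lemma Rint_bound (f : T -> R) M : mu.-integrable D (EFin \o f) ->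
  (forall x, D x -> `|f x| <= M) ->
  `|Rintegral mu D f| <= M * fine (mu D).
Proof.
move=> f1 hM; rewrite (le_trans (le_normr_Rintegral mD f1))//.
rewrite -Rintegral_cst//; apply: le_Rintegral => //.
  by apply: eq_integrable (integrable_norm f1) => // x _.
exact: cst_integrable.
Qed.

(** Real and imaginary parts are bounded separately, whence the factor 2. It is harmless: constants
    matter only up to a factor in what follows. *)
Lemma CI_bound f M : CIble f -> (forall x, D x -> cmod (f x) <= M) ->
  cmod (CI f) <= 2 * M * fine (mu D).
Proof.
move=> [f1 f2] hM; rewrite (le_trans (cmod_ReIm _))// Re_CI Im_CI.
rewrite -mulrA mulr_natl mulr2n lerD// Rint_bound// => x Dx.
  by rewrite (le_trans (Re_cmod _))// hM.
by rewrite (le_trans (Im_cmod _))// hM.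
Qed.

Lemma CI_cst c : CI (fun=> c) = c * rc (fine (mu D)).
Proof.
apply: ReIm_eq; rewrite (Re_CI, Im_CI) Rintegral_cst//.
  by rewrite cReM /= mulr0 subr0.
by rewrite cImM /= mulr0 add0r.
Qed.

End gen.

Section seg.
Local Notation leb := (@lebesgue_measure R).
Implicit Types (f g : R -> C) (a b : R).
Definition sI (f : R -> C) (a b : R) : C := CI leb `[a, b] f.

Lemma ccont_integrable (f : R -> R) a b : continuous f ->
  leb.-integrable `[a, b] (EFin \o f).
Proof.
move=> cf; apply: continuous_compact_integrable; first exact: segment_compact.
exact: continuous_subspaceT.
Qed.

Lemma ccont_CIble (f : R -> C) a b : continuous f -> CIble leb `[a, b] f.
Proof.
move=> cf; split; apply: ccont_integrable => x.
  by apply: continuous_Re; exact: cf.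
by apply: continuous_Im; exact: cf.
Qed.

Lemma leb_seg a b : a <= b -> leb `[a, b]%classic = (b - a)%:E.
Proof.
move=> ab; rewrite lebesgue_measure_itv/= lte_fin.
by case: ltgtP ab => // -> _; rewrite subrr.
Qed.

Lemma leb_seg_fin a b : a <= b -> (leb `[a, b]%classic < +oo)%E.
Proof. by move=> ab; rewrite leb_seg// ltry. Qed.

Lemma sI_bound f a b M : a <= b -> continuous f ->
  (forall x : R, a <= x <= b -> cmod (f x) <= M) -> cmod (sI f a b) <= 2 * M * (b - a).
Proof.
move=> ab cf h; have E : b - a = fine (leb `[a, b]%classic) by rewrite leb_seg.
rewrite E; apply: (CI_bound _ (leb_seg_fin ab) (ccont_CIble a b cf)) => //.
Qed.

Lemma sI_cst a b c : a <= b -> sI (fun=> c) a b = c * rc (b - a).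
Proof.
move=> ab; rewrite /sI (CI_cst leb (D := `[a, b]%classic))//.
by congr (_ * rc _); exact: (congr1 fine (leb_seg ab)).
Qed.

Lemma sI_B f g a b : continuous f -> continuous g ->
  sI (fun x => f x - g x) a b = sI f a b - sI g a b.
Proof. by move=> cf cg; apply: CI_B => //; exact: ccont_CIble. Qed.

Lemma sI_D f g a b : continuous f -> continuous g ->
  sI (fun x => f x + g x) a b = sI f a b + sI g a b.
Proof. by move=> cf cg; apply: CI_D => //; exact: ccont_CIble. Qed.

Lemma sI_Z c f a b : continuous f ->
  sI (fun x => c * f x) a b = c * sI f a b.
Proof. by move=> cf; apply: CI_Z => //; exact: ccont_CIble. Qed.

Lemma sI_sum (f : nat -> R -> C) N a b : (forall j, continuous (f j)) ->
  sI (fun x => \sum_(j < N) f j x) a b = \sum_(j < N) sI (f j) a b.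
Proof.
move=> cf; rewrite /sI -(@CI_sum _ _ leb `[a, b]%classic _ f N)// => j.
exact: ccont_CIble.
Qed.

Lemma Rint_cat (f : R -> R) a b c : a <= b -> b <= c -> continuous f ->
  Rintegral leb `[a, c] f = Rintegral leb `[a, b] f + Rintegral leb `[b, c] f.
Proof.
move=> ab bc cf.
have := @Rintegral_itvB R f (BLeft a) (BRight c) b (ccont_integrable a c cf).
rewrite !bnd_simp => /(_ ab bc) /eqP; rewrite subr_eq => /eqP ->.
rewrite addrC Rintegral_itv_obnd_cbnd//.
apply: integrableS (ccont_integrable b c cf) => //.
by apply: subset_itvr; rewrite bnd_simp.
Qed.

Lemma sI_cat f a b c : a <= b -> b <= c -> continuous f ->
  sI f a c = sI f a b + sI f b c.
Proof.
move=> ab bc cf.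
have cr : continuous (fun x => complex.Re (f x)).
  by move=> x; apply: continuous_Re; exact: cf.
have ci : continuous (fun x => complex.Im (f x)).
  by move=> x; apply: continuous_Im; exact: cf.
apply: ReIm_eq.
  by rewrite Re_CI cReD !Re_CI; exact: Rint_cat.
by rewrite Im_CI cImD !Im_CI; exact: Rint_cat.
Qed.
End seg.
End ComplexIntegral.

(** * The Goursat-Green theorem and Taylor expansion *)

Section Green.
Variable R : realType.
Local Notation C := (Cx R).

(** Total differentiability in two real variables, with partial derivatives [a] and [b] at the point
    and no continuity of these derivatives. *)
Definition hasD (u : R -> R -> C) (x0 y0 : R) (a b : C) :=
  forall e : R, 0 < e -> exists2 d : R, 0 < d & forall x y : R,
    `|x - x0| < d -> `|y - y0| < d ->
    cmod (u x y - u x0 y0 - rc (x - x0) * a - rc (y - y0) * b)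
      <= e * (`|x - x0| + `|y - y0|).

Variables P Q : R -> R -> C.
Hypothesis cP : forall y, continuous (fun x => P x y).
Hypothesis cQ : forall x, continuous (Q x).
Hypothesis hPQ : forall x y, exists a D b, hasD P x y a D /\ hasD Q x y D b.

(** The integral of [P dx + Q dy] along the boundary of the rectangle with lower left corner
    [(a, c)] and sides [l], [h], opposite sides being grouped. *)
Definition circul (a c l h : R) : C :=
  sI (fun y => Q (a + l) y - Q a y) c (c + h) -
  sI (fun x => P x (c + h) - P x c) a (a + l).

Let cQB x x' : continuous (fun y => Q x' y - Q x y).
Proof. by move=> y; apply: continuousB; exact: cQ. Qed.
Let cPB y y' : continuous (fun x => P x y' - P x y).
Proof. by move=> x; apply: (@continuousB _ _ _ (fun x => P x y') (fun x => P x y)); exact: cP. Qed.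

Lemma circul_split a c l h : 0 <= l -> 0 <= h ->
  circul a c (l + l) (h + h) =
  circul a c l h + circul (a + l) c l h + circul a (c + h) l h +
  circul (a + l) (c + h) l h.
Proof.
move=> l0 h0; rewrite /circul (addrA a) (addrA c).
have al : a <= a + l by rewrite lerDl.
have al2 : a + l <= a + l + l by rewrite lerDl.
have ch : c <= c + h by rewrite lerDl.
have ch2 : c + h <= c + h + h by rewrite lerDl.
rewrite (sI_cat ch ch2)// (sI_cat al al2)//.
rewrite !sI_B//; ring.
Qed.

(** The affine parts cancel: each of the two differences is constant to first order, [l D] and
    [h D], and integrates to the same [l h D]. Only first-order errors of size [e (l + h)] remain,
    integrated over sides of length [l] and [h]. *)
Lemma circul_small x0 y0 : forall e : R, 0 < e -> exists2 d : R, 0 < d &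
  forall a c l h, 0 <= l -> 0 <= h -> l < d -> h < d ->
    a <= x0 <= a + l -> c <= y0 <= c + h ->
    cmod (circul a c l h) <= 4 * e * (l + h) ^+ 2.
Proof.
move=> e e0; have [p [D [q [hP hQ]]]] := hPQ x0 y0.
have [d1 d10 h1] := hP e e0; have [d2 d20 h2] := hQ e e0.
exists (Num.min d1 d2); first by rewrite lt_min d10.
move=> a c l h l0 h0; rewrite !lt_min => /andP[ld1 ld2] /andP[hd1 hd2].
move=> /andP[ax xa] /andP[cy yc].
have al : a <= a + l by rewrite lerDl.
have ch : c <= c + h by rewrite lerDl.
have bx x : a <= x <= a + l -> `|x - x0| <= l.
  by move=> /andP[? ?]; rewrite ler_norml; apply/andP; split; lra.
have by' y : c <= y <= c + h -> `|y - y0| <= h.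
  by move=> /andP[? ?]; rewrite ler_norml; apply/andP; split; lra.
have -> : circul a c l h =
   sI (fun y => Q (a + l) y - Q a y - rc l * D) c (c + h) -
   sI (fun x => P x (c + h) - P x c - rc h * D) a (a + l).
  rewrite sI_B//; last by move=> ?; exact: cvg_cst.
  rewrite (@sI_B _ (fun x => P x (c + h) - P x c))//; last by move=> ?; exact: cvg_cst.
  rewrite !sI_cst// /circul; have -> : c + h - c = h by ring.
  have -> : a + l - a = l by ring.
  ring.
have bQ y : c <= y <= c + h ->
    cmod (Q (a + l) y - Q a y - rc l * D) <= 2 * e * (l + h).
  move=> hy; have hy' := by' _ hy.
  have k1 := @h2 (a + l) y (le_lt_trans (bx (a + l) _) ld2) (le_lt_trans hy' hd2).
  have k2 := @h2 a y (le_lt_trans (bx a _) ld2) (le_lt_trans hy' hd2).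
  have b1 : `|a + l - x0| <= l by apply: bx; rewrite al lexx.
  have b2 : `|a - x0| <= l by apply: bx; rewrite al lexx.
  have {}k1 := k1 _; have {}k2 := k2 _.
  rewrite (_ : Q (a + l) y - Q a y - rc l * D =
    (Q (a + l) y - Q x0 y0 - rc (a + l - x0) * D - rc (y - y0) * q) -
    (Q a y - Q x0 y0 - rc (a - x0) * D - rc (y - y0) * q)); last first.
    rewrite !rcB rcD; ring.
  rewrite (le_trans (cmodB _ _))//.
  have {}k1 := k1 (introT andP (conj al (lexx _))).
  have {}k2 := k2 (introT andP (conj (lexx _) al)).
  have : e * (`|a + l - x0| + `|y - y0|) <= e * (l + h).
    by rewrite ler_pM2l// lerD.
  have : e * (`|a - x0| + `|y - y0|) <= e * (l + h).
    by rewrite ler_pM2l// lerD.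
  lra.
have bP x : a <= x <= a + l ->
    cmod (P x (c + h) - P x c - rc h * D) <= 2 * e * (l + h).
  move=> hx; have hx' := bx _ hx.
  have b1 : `|c + h - y0| <= h by apply: by'; rewrite ch lexx.
  have b2 : `|c - y0| <= h by apply: by'; rewrite ch lexx.
  have k1 := @h1 x (c + h) (le_lt_trans hx' ld1) (le_lt_trans b1 hd1).
  have k2 := @h1 x c (le_lt_trans hx' ld1) (le_lt_trans b2 hd1).
  rewrite (_ : P x (c + h) - P x c - rc h * D =
    (P x (c + h) - P x0 y0 - rc (x - x0) * p - rc (c + h - y0) * D) -
    (P x c - P x0 y0 - rc (x - x0) * p - rc (c - y0) * D)); last first.
    rewrite !rcB rcD; ring.
  rewrite (le_trans (cmodB _ _))//.
  have : e * (`|x - x0| + `|c + h - y0|) <= e * (l + h).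
    by rewrite ler_pM2l// lerD.
  have : e * (`|x - x0| + `|c - y0|) <= e * (l + h).
    by rewrite ler_pM2l// lerD.
  lra.
have cQ' : continuous (fun y => Q (a + l) y - Q a y - rc l * D).
  by move=> y; apply: (@continuousB _ _ _ (fun y => Q (a + l) y - Q a y) (fun=> rc l * D));
   [exact: cQB|exact: cvg_cst].
have cP' : continuous (fun x => P x (c + h) - P x c - rc h * D).
  by move=> y; apply: (@continuousB _ _ _ (fun x => P x (c + h) - P x c) (fun=> rc h * D));
   [exact: cPB|exact: cvg_cst].
have := sI_bound ch cQ' bQ; have := sI_bound al cP' bP.
have -> : c + h - c = h by ring.
have -> : a + l - a = l by ring.
move=> k1 k2; rewrite (le_trans (cmodB _ _))// (le_trans (lerD k2 k1))//.
by rewrite (_ : _ + _ = 4 * e * (l + h) ^+ 2)//; ring.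
Qed.

(* Goursat's bisection: only pointwise differentiability with [Q_x = P_y] is assumed, not
   continuity of the derivatives. *)
Lemma green a c L H : 0 <= L -> 0 <= H -> circul a c L H = 0.
Proof.
move=> L0 H0; apply/eqP; rewrite -cmod_eq0; apply/negP => /negP nz.
set E := cmod (circul a c L H).
have E0 : 0 < E by rewrite lt_neqAle eq_sym nz cmod_ge0.
pose l n : R := L / 2 ^+ n; pose h n : R := H / 2 ^+ n.
have l0 n : 0 <= l n by rewrite divr_ge0// exprn_ge0.
have h0 n : 0 <= h n by rewrite divr_ge0// exprn_ge0.
have lS n : l n = l n.+1 + l n.+1.
  by rewrite /l exprS; field; rewrite expf_neq0.
have hS n : h n = h n.+1 + h n.+1.
  by rewrite /h exprS; field; rewrite expf_neq0.
(* If all four quarters carried less than a quarter of the circulation, [circul_split] and the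
   triangle inequality would contradict the lower bound; the booleans [q.1], [q.2] select the
   quarter. *)
have step n (p : R * R) : exists q : R * R,
   (E / 4 ^+ n <= cmod (circul p.1 p.2 (l n) (h n)) ->
    E / 4 ^+ n.+1 <= cmod (circul q.1 q.2 (l n.+1) (h n.+1))) /\
   [/\ p.1 <= q.1, q.1 + l n.+1 <= p.1 + l n, p.2 <= q.2
     & q.2 + h n.+1 <= p.2 + h n].
  case: p => x y /=.
  have [bad|/forallNP good] := pselect (exists q : bool * bool,
     E / 4 ^+ n.+1 <= cmod (circul (x + l n.+1 *+ q.1) (y + h n.+1 *+ q.2) (l n.+1) (h n.+1))).
    case: bad => -[u v] /= uv; exists (x + l n.+1 *+ u, y + h n.+1 *+ v) => /=.
    split => //; rewrite (lS n) (hS n); have := l0 n.+1; have := h0 n.+1.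
    by case: u v {uv} => -[] /=; rewrite ?mulr1n ?mulr0n => ? ?; split; lra.
  exists (x, y) => /=; split; last first.
    by rewrite (lS n) (hS n); have := l0 n.+1; have := h0 n.+1; split; lra.
  move=> hn; exfalso.
  have lt (u v : bool) : cmod (circul (x + l n.+1 *+ u) (y + h n.+1 *+ v) (l n.+1) (h n.+1))
      < E / 4 ^+ n.+1.
    by rewrite ltNge; apply/negP; exact: (good (u, v)).
  move: hn; rewrite (lS n) (hS n) circul_split// => hn.
  have := lt false false; have := lt false true; have := lt true false.
  have := lt true true; rewrite /= !mulr1n !mulr0n !addr0.
  have -> : E / 4 ^+ n.+1 = E / 4 ^+ n / 4.
    by rewrite exprS; field; rewrite expf_neq0.
  move: hn; set w := E / _.
  set c1 := circul _ _ _ _; set c2 := circul _ _ _ _; set c3 := circul _ _ _ _; set c4 := circul _ _ _ _.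
  have k1 := cmodD c1 c2; have k2 := cmodD (c1 + c2) c3.
  have k3 := cmodD (c1 + c2 + c3) c4.
  lra.
have /choice[f hf] : forall np : nat * (R * R), exists q : R * R,
   (E / 4 ^+ np.1 <= cmod (circul np.2.1 np.2.2 (l np.1) (h np.1)) ->
    E / 4 ^+ np.1.+1 <= cmod (circul q.1 q.2 (l np.1.+1) (h np.1.+1))) /\
   [/\ np.2.1 <= q.1, q.1 + l np.1.+1 <= np.2.1 + l np.1, np.2.2 <= q.2
     & q.2 + h np.1.+1 <= np.2.2 + h np.1].
  by move=> [n p]; exact: step.
pose s := fix s n := if n is m.+1 then f (m, s m) else (a, c).
have hs n : E / 4 ^+ n <= cmod (circul (s n).1 (s n).2 (l n) (h n)).
  elim: n => [|n IH]; first by rewrite /= /l /h !expr0 !divr1.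
  by have [/(_ IH)] := hf (n, s n).
have inc m n : (m <= n)%N -> [/\ (s m).1 <= (s n).1, (s n).1 + l n <= (s m).1 + l m,
    (s m).2 <= (s n).2 & (s n).2 + h n <= (s m).2 + h m].
  elim: n => [|n IH]; first by rewrite leqn0 => /eqP ->.
  rewrite leq_eqVlt => /predU1P[->//|]; rewrite ltnS => /IH[i1 i2 i3 i4].
  have [_ [j1 j2 j3 j4]] := hf (n, s n); split.
  - exact: le_trans i1 j1.
  - exact: le_trans j2 i2.
  - exact: le_trans i3 j3.
  - exact: le_trans j4 i4.
have limit (g k : nat -> R) : (forall m n, (m <= n)%N -> g m <= g n /\ g n <= g m + k m) ->
    exists z, forall n, g n <= z <= g n + k n.
  move=> gk; exists (sup (range g)) => n.
  have ub : ubound (range g) (g n + k n).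
    move=> _ [m _ <-]; have [nm|/ltnW mn] := leqP n m; first by have [] := gk _ _ nm.
    by have [? _] := gk _ _ mn; have [_] := gk _ _ (leqnn n) => /(le_trans _); exact.
  apply/andP; split; last by apply: ge_sup => //; exists (g 0%N), 0%N.
  by apply: ub_le_sup; [exists (g n + k n)|exists n].
have [x0 hx0] : exists z, forall n, (s n).1 <= z <= (s n).1 + l n.
  apply: (limit (fun n => (s n).1) l) => m n /inc[i1 i2 _ _]; split => //.
  by rewrite (le_trans _ i2)// lerDl.
have [y0 hy0] : exists z, forall n, (s n).2 <= z <= (s n).2 + h n.
  apply: (limit (fun n => (s n).2) h) => m n /inc[_ _ i1 i2]; split => //.
  by rewrite (le_trans _ i2)// lerDl.
(* Since [K] exceeds [4 (L + H)^2], the tolerance [E / 2 / K] in [circul_small] gives at most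
   [E / 2 / 4^n] on the [n]-th rectangle, against the lower bound [E / 4^n]. The added 1 keeps [K]
   positive. *)
pose K := 4 * (L + H) ^+ 2 + 1.
have K0 : 0 < K by rewrite ltr_wpDl// mulr_ge0// sqr_ge0.
have e0 : 0 < E / 2 / K by rewrite !divr_gt0.
have [d d0 hd] := circul_small x0 y0 e0.
have [n ln] : exists n, l n < d /\ h n < d.
  have [n hn] : exists n, (L + H) / d < 2 ^+ n.
    exists (Num.trunc ((L + H) / d)).+1.
    have := truncnS_gt ((L + H) / d); move/lt_le_trans; apply.
    by rewrite -natrX ler_nat ltnW// ltn_expl.
  exists n; move: hn; rewrite ltr_pdivrMr// mulrC -ltr_pdivrMr ?exprn_gt0//.
  move=> hn; split; apply: le_lt_trans hn; rewrite ler_pM2r ?invr_gt0 ?exprn_gt0//;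
    lra.
have := hd (s n).1 (s n).2 (l n) (h n) (l0 n) (h0 n) ln.1 ln.2 (hx0 n) (hy0 n).
have := hs n.
move=> k1 k2; have := le_trans k1 k2; apply/negP; rewrite -ltNge.
have -> : l n + h n = (L + H) / 2 ^+ n by rewrite /l /h mulrDl.
rewrite expr_div_n -exprM mulnC exprM (_ : 2 ^+ 2 = 4 :> R); last by rewrite -natrX.
rewrite (_ : _ * _ = E / 2 * ((4 * (L + H) ^+ 2) / K) / 4 ^+ n); last first.
  by field; rewrite expf_neq0//= gt_eqF.
rewrite ltr_pM2r ?invr_gt0 ?exprn_gt0//.
have : (4 * (L + H) ^+ 2) / K <= 1.
  by rewrite ler_pdivrMr// mul1r lerDl.
have : 0 <= (4 * (L + H) ^+ 2) / K.
  by rewrite divr_ge0 ?(ltW K0)// mulr_ge0// sqr_ge0.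
nra.
Qed.
End Green.

(** * Cauchy's formula on circles and Taylor expansion with remainder *)

Section Cauchy.
Variable R : realType.
Local Notation C := (Cx R).

Implicit Types (u v : R -> R -> C) (x y : R) (a b c : C).

Definition cdiff (k : C -> C) (z0 d : C) := forall e : R, 0 < e ->
  exists2 de : R, 0 < de & forall z, cmod (z - z0) < de ->
    cmod (k z - k z0 - d * (z - z0)) <= e * cmod (z - z0).

Lemma derive_eps (K : numFieldType) (f : K -> K) (x d : K) : is_derive x 1 f d ->
  forall e : K, 0 < e -> exists2 de : K, 0 < de & forall y : K, `|y - x| < de ->
    `|f y - f x - d * (y - x)| <= e * `|y - x|.
Proof.
move=> [df <-] e e0.
have /cvgrPdist_lt /(_ e e0) [de /= de0 h] :
  (fun h => h^-1 *: ((f \o shift x) (h *: 1) - f x)) @ 0^' --> 'D_1 f x := df.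
exists de => // y yx; have [->|yx0] := eqVneq y x.
  by rewrite !subrr mulr0 subr0 normr0 mulr0.
have yx0' : y - x != 0 by rewrite subr_eq0.
have := h (y - x); rewrite /= sub0r normrN => /(_ yx yx0').
rewrite /= [_ *: 1]mulr1 subrK => /ltW hle.
rewrite -ler_pdivrMr ?normr_gt0//; apply: le_trans hle.
rewrite -normf_div// distrC; rewrite le_eqVlt; apply/orP; left; apply/eqP.
congr (`|_|); rewrite /GRing.scale /= mulrBl mulfK//.
by rewrite mulrC.
Qed.

Lemma is_derive_cdiff (f : C -> C) (x d : C) : is_derive x 1 f d -> cdiff f x d.
Proof.
move=> h e e0; have e0' : 0 < (rc e : C) by rewrite -rc0 rc_lt.
have [_ /gt0_rc[de de0 ->] hd] := derive_eps h e0'.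
exists de => // z zx; have := hd z; rewrite !cmodE rc_lt => /(_ zx).
by rewrite -rcM rc_le.
Qed.

Lemma cdiff_is_derive (f : C -> C) (x d : C) : cdiff f x d -> is_derive x 1 f d.
Proof.
move=> h.
have H : (fun h : C => h^-1 *: ((f \o shift x) (h *: 1) - f x)) @ 0^' --> d.
  apply/cvgrPdist_le => _ /gt0_rc[e e0 ->]; have [de de0 hd] := h e e0.
  exists (rc de) => /=; first by rewrite -rc0 rc_lt.
  move=> y /=; rewrite sub0r normrN cmodE rc_lt => yd y0.
  have := hd (y + x); rewrite addrK => /(_ yd).
  have -> : y%:A = y by rewrite /GRing.scale /= mulr1.
  rewrite cmodE rc_le -ler_pdivrMr ?cmod_gt0// => /(le_trans _); apply.
  rewrite -cmodV -cmodM le_eqVlt; apply/orP; left; apply/eqP.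
  rewrite -cmodN; congr cmod; rewrite /GRing.scale /=; field.
  exact: y0.
split; first by apply/cvg_ex; exists d.
exact: cvg_lim.
Qed.

Lemma cdiff_inv (w0 : C) : w0 != 0 -> cdiff (fun w => w^-1) w0 (- (w0 ^- 2)).
Proof.
move=> w00 e e0; have n0 : 0 < cmod w0 by rewrite cmod_gt0.
exists (Num.min (cmod w0 / 2) (e * cmod w0 ^+ 3 / 2)).
  by rewrite lt_min !divr_gt0// mulr_gt0// exprn_gt0.
move=> w; rewrite lt_min => /andP[w1 w2].
have wn : cmod w0 / 2 <= cmod w.
  have := cmod_triB w0 w; rewrite cmodC; lra.
have wp : 0 < cmod w by apply: lt_le_trans wn; rewrite divr_gt0.
have w0' : w != 0 by rewrite -cmod_gt0.
have -> : w^-1 - w0^-1 - - w0 ^- 2 * (w - w0) = (w - w0) ^+ 2 / (w * w0 ^+ 2).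
  by field; rewrite w00.
rewrite cmodM cmodV (cmodM w) (cmodX (w - w0)) (cmodX w0) ler_pdivrMr; last by rewrite mulr_gt0// exprn_gt0.
set s := cmod (w - w0) in w1 w2 *; have s0 : 0 <= s by exact: cmod_ge0.
rewrite mulrAC expr2 ler_wpM2r//; apply: (le_trans (ltW w2)).
have -> : e * cmod w0 ^+ 3 / 2 = e * ((cmod w0 / 2) * cmod w0 ^+ 2) by field.
by rewrite ler_pM2l// ler_wpM2r// exprn_ge0// ltW.
Qed.

Definition rdiff (f : R -> C) (x0 : R) (d : C) := forall e : R, 0 < e ->
  exists2 de : R, 0 < de & forall x, `|x - x0| < de ->
    cmod (f x - f x0 - rc (x - x0) * d) <= e * `|x - x0|.

Lemma is_derive_rdiff (f : R -> R) (x d : R) : is_derive x 1 f d ->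
  rdiff (fun x => rc (f x)) x (rc d).
Proof.
move=> h e e0; have [de de0 hd] := derive_eps h e0.
exists de => // y yx; rewrite -rcM -!rcB cmod_rc mulrC; exact: hd.
Qed.

Lemma hasD_x (f : R -> C) x0 y0 d : rdiff f x0 d -> hasD (fun x _ => f x) x0 y0 d 0.
Proof.
move=> h e e0; have [de de0 hd] := h e e0; exists de => // x y xd _.
rewrite mulr0 subr0 (le_trans (hd _ xd))// ler_pM2l// lerDl//.
Qed.

Lemma hasD_y (f : R -> C) x0 y0 d : rdiff f y0 d -> hasD (fun _ y => f y) x0 y0 0 d.
Proof.
move=> h e e0; have [de de0 hd] := h e e0; exists de => // x y _ xd.
rewrite mulr0 subr0 (le_trans (hd _ xd))// ler_pM2l// lerDr//.
Qed.

Lemma hasD_lip u x0 y0 a b : hasD u x0 y0 a b -> exists2 d : R, 0 < d &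
  forall x y : R, `|x - x0| < d -> `|y - y0| < d ->
    cmod (u x y - u x0 y0) <= (1 + cmod a + cmod b) * (`|x - x0| + `|y - y0|).
Proof.
move=> h; have [d d0 hd] := h 1 ltr01; exists d => // x y xd yd.
have -> : u x y - u x0 y0 = (u x y - u x0 y0 - rc (x - x0) * a - rc (y - y0) * b) +
  (rc (x - x0) * a + rc (y - y0) * b) by ring.
rewrite (le_trans (cmodD _ _))// (le_trans (lerD (hd _ _ xd yd) (cmodD _ _)))//.
rewrite !cmodM !cmod_rc.
set s := `|x - x0|; set t := `|y - y0|.
have s0 : 0 <= s by exact: normr_ge0.
have t0 : 0 <= t by exact: normr_ge0.
have a0 := cmod_ge0 a; have b0 := cmod_ge0 b.
have k1 := mulr_ge0 s0 b0; have k2 := mulr_ge0 t0 a0.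
nra.
Qed.

Lemma hasD_comp k u x0 y0 a b d : cdiff k (u x0 y0) d -> hasD u x0 y0 a b ->
  hasD (fun x y => k (u x y)) x0 y0 (d * a) (d * b).
Proof.
move=> hk hu e e0; set K := 1 + cmod a + cmod b.
have K0 : 0 < K by rewrite /K -addrA ltr_pwDl// addr_ge0// cmod_ge0.
have [d1 d10 h1] := hasD_lip hu.
have D0 : 0 < cmod d + 1 by rewrite ltr_wpDl// cmod_ge0.
have e1 : 0 < e / 2 / (cmod d + 1) by rewrite !divr_gt0.
have [d2 d20 h2] := hu _ e1.
have e2 : 0 < e / 2 / K by rewrite !divr_gt0.
have [d3 d30 h3] := hk _ e2.
exists (Num.min (Num.min d1 d2) (d3 / (K * 2))).
  by rewrite !lt_min d10 d20 divr_gt0// mulr_gt0.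
move=> x y; rewrite !lt_min => /andP[/andP[x1 x2] x3] /andP[/andP[y1 y2] y3].
have {}h1 := h1 _ _ x1 y1; have {}h2 := h2 _ _ x2 y2.
set s := `|x - x0| + `|y - y0| in h1 h2 *.
have s0 : 0 <= s by rewrite addr_ge0.
have /h3 {}h3 : cmod (u x y - u x0 y0) < d3.
  apply: (le_lt_trans h1); rewrite -/K mulrC -ltr_pdivlMr//.
  have -> : d3 / K = d3 / (K * 2) + d3 / (K * 2) by field; rewrite gt_eqF.
  by rewrite ltrD.
have -> : k (u x y) - k (u x0 y0) - rc (x - x0) * (d * a) - rc (y - y0) * (d * b) =
  (k (u x y) - k (u x0 y0) - d * (u x y - u x0 y0)) +
  d * (u x y - u x0 y0 - rc (x - x0) * a - rc (y - y0) * b) by ring.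
rewrite (le_trans (cmodD _ _))// cmodM.
have l1 : e / 2 / K * cmod (u x y - u x0 y0) <= e / 2 * s.
  by rewrite -mulrA ler_pM2l ?divr_gt0// mulrC ler_pdivrMr// mulrC.
have l2 : cmod d * cmod (u x y - u x0 y0 - rc (x - x0) * a - rc (y - y0) * b) <= e / 2 * s.
  apply: (@le_trans _ _ ((cmod d + 1) * (e / 2 / (cmod d + 1) * s))).
    by apply: ler_pM => //; rewrite ?cmod_ge0// lerDl.
  by rewrite le_eqVlt; apply/orP; left; apply/eqP; field; rewrite gt_eqF.
apply: (le_trans (lerD (le_trans h3 l1) l2)).
by rewrite -mulrDl -splitr.
Qed.

Lemma hasD_mul u v (x0 y0 : R) a b a' b' : hasD u x0 y0 a b -> hasD v x0 y0 a' b' ->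
  hasD (fun x y => u x y * v x y) x0 y0
    (a * v x0 y0 + u x0 y0 * a') (b * v x0 y0 + u x0 y0 * b').
Proof.
move=> hu hv e e0.
set K := 1 + cmod a + cmod b; set K' := 1 + cmod a' + cmod b'.
have K0 : 0 < K by rewrite /K -addrA ltr_pwDl// addr_ge0// cmod_ge0.
have K'0 : 0 < K' by rewrite /K' -addrA ltr_pwDl// addr_ge0// cmod_ge0.
have [d1 d10 h1] := hasD_lip hu; have [d2 d20 h2] := hasD_lip hv.
pose S := 1 + cmod (u x0 y0) + cmod (v x0 y0).
have u0 := cmod_ge0 (u x0 y0); have v0 := cmod_ge0 (v x0 y0).
have S0 : 0 < S by rewrite /S; lra.
have e1 : 0 < e / 3 / S by rewrite !divr_gt0.
have [d3 d30 h3] := hu _ e1; have [d4 d40 h4] := hv _ e1.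
pose d5 := e / 3 / (K * K' * 2).
have d50 : 0 < d5 by rewrite !divr_gt0// !mulr_gt0.
exists (Num.min (Num.min (Num.min d1 d2) (Num.min d3 d4)) d5).
  by rewrite !lt_min d10 d20 d30 d40.
move=> x y; rewrite !lt_min => /andP[/andP[/andP[x1 x2] /andP[x3 x4]] x5].
move=> /andP[/andP[/andP[y1 y2] /andP[y3 y4]] y5].
have {}h1 := h1 _ _ x1 y1; have {}h2 := h2 _ _ x2 y2.
have {}h3 := h3 _ _ x3 y3; have {}h4 := h4 _ _ x4 y4.
set s := `|x - x0| + `|y - y0| in h1 h2 h3 h4 *.
have s0 : 0 <= s by rewrite addr_ge0.
have sd5 : s <= d5 + d5 by rewrite ltW// ltrD.
set X := u x y - u x0 y0 - _ - _ in h3; set Y := v x y - v x0 y0 - _ - _ in h4.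
have -> : u x y * v x y - u x0 y0 * v x0 y0 -
   rc (x - x0) * (a * v x0 y0 + u x0 y0 * a') -
   rc (y - y0) * (b * v x0 y0 + u x0 y0 * b') =
  X * v x0 y0 + u x0 y0 * Y + (u x y - u x0 y0) * (v x y - v x0 y0).
  by rewrite /X /Y; ring.
rewrite (le_trans (cmodD _ _))// (le_trans (lerD (cmodD _ _) (lexx _)))// !cmodM.
have l1 : cmod X * cmod (v x0 y0) <= e / 3 * s.
  apply: (@le_trans _ _ ((e / 3 / S * s) * S)).
    by apply: ler_pM => //; rewrite ?cmod_ge0// /S; lra.
  by rewrite le_eqVlt; apply/orP; left; apply/eqP; field; rewrite gt_eqF.
have l2 : cmod (u x0 y0) * cmod Y <= e / 3 * s.
  apply: (@le_trans _ _ (S * (e / 3 / S * s))).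
    by apply: ler_pM => //; rewrite ?cmod_ge0// /S; lra.
  by rewrite le_eqVlt; apply/orP; left; apply/eqP; field; rewrite gt_eqF.
have l3 : cmod (u x y - u x0 y0) * cmod (v x y - v x0 y0) <= e / 3 * s.
  apply: (@le_trans _ _ ((K * s) * (K' * (d5 + d5)))).
    apply: ler_pM => //; rewrite ?cmod_ge0//.
    by apply: (le_trans h2); rewrite ler_pM2l.
  by rewrite le_eqVlt; apply/orP; left; apply/eqP; rewrite /d5; field; rewrite !gt_eqF.
have -> : e * s = e / 3 * s + e / 3 * s + e / 3 * s by field.
by rewrite !lerD.
Qed.

Lemma hasD_cst c (x0 y0 : R) : hasD (fun _ _ => c) x0 y0 0 0.
Proof.
move=> e e0; exists 1 => // x y _ _.
by rewrite !mulr0 subrr !subr0 cmod0 mulr_ge0 ?addr_ge0// ltW.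
Qed.

Lemma hasD_add u v (x0 y0 : R) a b a' b' : hasD u x0 y0 a b -> hasD v x0 y0 a' b' ->
  hasD (fun x y => u x y + v x y) x0 y0 (a + a') (b + b').
Proof.
move=> hu hv e e0; have e2 : 0 < e / 2 by rewrite divr_gt0.
have [d1 d10 h1] := hu _ e2; have [d2 d20 h2] := hv _ e2.
exists (Num.min d1 d2); first by rewrite lt_min d10.
move=> x y; rewrite !lt_min => /andP[x1 x2] /andP[y1 y2].
have {}h1 := h1 _ _ x1 y1; have {}h2 := h2 _ _ x2 y2.
set X := (X in cmod X) in h1; set Y := (X in cmod X) in h2.
rewrite (_ : _ - _ - _ - _ = X + Y); last by rewrite /X /Y; ring.
by rewrite (le_trans (cmodD _ _))// (le_trans (lerD h1 h2))// -mulrDl -splitr.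
Qed.

Lemma hasD_eq u v (x0 y0 : R) a b a' b' : (forall x y, u x y = v x y) -> a = a' -> b = b' ->
  hasD u x0 y0 a b -> hasD v x0 y0 a' b'.
Proof.
by move=> uv <- <- hu e /hu[d d0 h]; exists d => // x y xd yd; rewrite -!uv; exact: h.
Qed.

Lemma hasD_cont u (x0 y0 : R) a b : hasD u x0 y0 a b ->
  {for x0, continuous (fun x => u x y0)} /\ {for y0, continuous (u x0)}.
Proof.
move=> /hasD_lip[d d0 h]; set K := 1 + cmod a + cmod b in h.
have K0 : 0 < K by rewrite /K -addrA ltr_pwDl// addr_ge0// cmod_ge0.
split; apply/contC_near => e e0.
  have d1 : 0 < Num.min d (e / K) by rewrite lt_min d0 divr_gt0.
  apply: filterS (nearR x0 d1) => x; rewrite lt_min => /andP[xd xe].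
  rewrite (le_lt_trans (h _ _ xd _))// ?subrr ?normr0// addr0.
  by rewrite mulrC -ltr_pdivlMr.
have d1 : 0 < Num.min d (e / K) by rewrite lt_min d0 divr_gt0.
apply: filterS (nearR y0 d1) => y; rewrite lt_min => /andP[xd xe].
rewrite (le_lt_trans (h _ _ _ xd))// ?subrr ?normr0// add0r.
by rewrite mulrC -ltr_pdivlMr.
Qed.

Definition cis (y : R) : C := rc (cos y) + ic R * rc (sin y).

Lemma cmod_cis y : cmod (cis y) = 1.
Proof.
rewrite /cmod cReD cImD cReM cImM /= !mul0r !mul1r subr0 addr0 !add0r.
by rewrite cos2Dsin2 sqrtr1.
Qed.

Lemma sqr_ic : ic R * ic R = -1.
Proof. exact: sqr_i. Qed.

Lemma rdiff_cis y : rdiff cis y (ic R * cis y).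
Proof.
move=> e e0; have e2 : 0 < e / 2 by rewrite divr_gt0.
have [d1 d10 h1] := is_derive_rdiff (is_derive_cos y) e2.
have [d2 d20 h2] := is_derive_rdiff (is_derive_sin y) e2.
exists (Num.min d1 d2); first by rewrite lt_min d10.
move=> x; rewrite lt_min => /andP[/h1 {}h1 /h2 {}h2].
set X := (X in cmod X) in h1; set Y := (X in cmod X) in h2.
rewrite (_ : _ - _ - _ = X + ic R * Y); last first.
  rewrite /X /Y /cis mulrDr mulrA sqr_ic rcN; ring.
rewrite (le_trans (cmodD _ _))// cmodM (_ : cmod (ic R) = 1) ?mul1r; last first.
  by rewrite /cmod /= expr0n add0r expr1n sqrtr1.
by rewrite (le_trans (lerD h1 h2))// -mulrDl -splitr.
Qed.

Section formula.
Variables (k : C -> C) (r : R).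
Hypothesis r0 : 0 < r.
Hypothesis hk : forall z, cmod z <= r -> exists d, cdiff k z d.

Definition circ (y : R) : C := rc r * cis y.

Lemma cmod_circ y : cmod (circ y) = r.
Proof. by rewrite cmodM cmod_rc cmod_cis mulr1 gtr0_norm. Qed.

Lemma circ_neq0 y : circ y != 0.
Proof. by rewrite -cmod_gt0 cmod_circ. Qed.

Lemma rdiff_circ y : rdiff circ y (ic R * circ y).
Proof.
have h := @hasD_mul _ _ 0 y _ _ _ _ (hasD_cst (rc r) 0 y) (hasD_y 0 (rdiff_cis y)).
move=> e /h[d d0 {}h]; exists d => // x xd.
have := h 0 x; rewrite subrr normr0 d0 => /(_ isT xd).
rewrite rc0 mul0r subr0 add0r mul0r add0r.
by rewrite /circ (_ : ic R * (rc r * cis y) = rc r * (ic R * cis y)); last ring.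
Qed.

Section kernel.
Variable z : C.
Hypothesis zr : cmod z < r.

(** The form [dw / (w - z)] in the angle: on [w = circ y] one has [dw = ic R * w dy]. *)
Definition cker (y : R) : C := ic R * (circ y / (circ y - z)).

Lemma circ_subz y : circ y - z != 0.
Proof.
rewrite subr_eq0; apply: contraTneq zr => <-.
by rewrite cmod_circ ltxx.
Qed.

Lemma hasD_cker x y : exists d, hasD (fun _ y => cker y) x y 0 d.
Proof.
have nz := circ_subz y.
have h1 := hasD_add (hasD_y x (rdiff_circ y)) (hasD_cst (- z) x y).
have h2 := hasD_comp (cdiff_inv nz) h1.
have h3 := hasD_mul (hasD_cst (ic R) x y) (hasD_mul (hasD_y x (rdiff_circ y)) h2).
eexists; apply: hasD_eq h3 => //.
by rewrite !(mul0r, mulr0, addr0, add0r).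
Qed.

Lemma continuous_cker : continuous cker.
Proof. by move=> y; have [d /hasD_cont[_]] := hasD_cker 0 y. Qed.

(** A contraction factor that equals 1 at 0, tends to 0 at infinity and never vanishes. It is smooth
    on the whole line, where [green] wants differentiability, and so is its logarithmic
    derivative. *)
Definition shr (x : R) : R := (1 + x ^+ 2)^-1.
Definition shm (x : R) : R := - (x * 2) / (1 + x ^+ 2).

Let sx (x : R) : 0 < 1 + x ^+ 2. Proof. by rewrite ltr_pwDl// sqr_ge0. Qed.

Lemma shr01 x : 0 < shr x <= 1.
Proof. by rewrite invr_gt0 sx invf_le1// lerDl sqr_ge0. Qed.

Lemma is_derive_shr (x : R) : is_derive x 1 shr (shm x * shr x).
Proof.
have h : is_derive x 1 (fun x : R => (1 + x ^+ 2)) (x * 2).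
  by apply: is_derive_eq; rewrite /GRing.scale /=; ring.
have := @is_deriveV _ (fun x : R => 1 + x ^+ 2) x _ 1 (lt0r_neq0 (sx x)) h.
move=> h'; apply: is_derive_eq; rewrite /shm /shr /GRing.scale /=; field.
exact: lt0r_neq0.
Qed.

Lemma hasD_shm x y : exists d, hasD (fun x _ => rc (shm x)) x y d 0.
Proof.
have h1 : is_derive x 1 (fun x : R => - (x * 2)) (- 2).
  by apply: is_derive_eq; rewrite /GRing.scale /=; ring.
have := hasD_mul (hasD_x y (is_derive_rdiff h1)) (hasD_x y (is_derive_rdiff (is_derive_shr x))).
move=> h; eexists; apply: hasD_eq h => //; first by move=> *; rewrite -rcM.
by rewrite mul0r mulr0 addr0.
Qed.

Definition homot (x y : R) : C := z + rc (shr x) * (circ y - z).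

Lemma homot_r x y : cmod (homot x y) <= r.
Proof.
have /andP[s0 s1] := shr01 x.
have -> : homot x y = rc (1 - shr x) * z + rc (shr x) * circ y.
  by rewrite /homot rcB rc1; ring.
rewrite (le_trans (cmodD _ _))// (cmodM _ z) (cmodM _ (circ y)) cmod_circ !cmod_rc.
rewrite !ger0_norm ?subr_ge0//; last exact: ltW.
have : (1 - shr x) * cmod z <= (1 - shr x) * r by rewrite ler_wpM2l ?subr_ge0// ltW.
by lra.
Qed.

Lemma hasD_homot x y : hasD homot x y (rc (shm x * shr x) * (circ y - z))
   (rc (shr x) * (ic R * circ y)).
Proof.
have h1 := hasD_x y (is_derive_rdiff (is_derive_shr x)).
have h2 := hasD_add (hasD_y x (rdiff_circ y)) (hasD_cst (- z) x y).
have h3 := hasD_add (hasD_cst z x y) (hasD_mul h1 h2).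
by apply: hasD_eq h3 => //; ring.
Qed.

(* Up to the factor [ic], the components of the pull-back of [k w dw / (w - z)] along [homot],
   which contracts the circle to [z]; [shm] is the logarithmic derivative of [shr]. *)
Let P x y := rc (shm x) * k (homot x y).
Let Q x y := k (homot x y) * cker y.

Lemma hasD_PQ x y : exists a D b, hasD P x y a D /\ hasD Q x y D b.
Proof.
have [d hd] := hk (homot_r x y).
have hkh := hasD_comp hd (hasD_homot x y).
have [m hm] := hasD_shm x y; have [c hc] := hasD_cker x y.
have h1 := hasD_mul hm hkh; have h2 := hasD_mul hkh hc.
do 3 eexists; split; first exact: h1.
apply: hasD_eq h2 => //.
by rewrite mulr0 mul0r addr0 add0r /cker rcM; field; exact: circ_subz.
Qed.

(** By [green] and periodicity in [y], the integral of [Q T] over a period does not depend on [T].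
    At [T = 0] it is the left side; for large [T] the contracted circle is uniformly close to [z],
    which gives the right side. The integral of the kernel itself is left for [sI_cker]. *)
Lemma cauchy_kernel : sI (fun y => k (circ y) * cker y) 0 (2 * pi) = k z * sI cker 0 (2 * pi).
Proof.
have pi0 : 0 <= 2 * pi :> R by rewrite mulr_ge0// pi_ge0.
have cP y : continuous (fun x => P x y).
  by move=> x; have [a [D [b [/hasD_cont[]]]]] := hasD_PQ x y.
have cQ x : continuous (Q x).
  by move=> y; have [a [D [b [_ /hasD_cont[]]]]] := hasD_PQ x y.
have step T : 0 <= T -> sI (Q T) 0 (2 * pi) = sI (fun y => k (circ y) * cker y) 0 (2 * pi).
  move=> T0; have := green cP cQ hasD_PQ 0 0 T0 pi0.
  rewrite /circul !add0r (_ : (fun x => P x (2 * pi) - P x 0) = fun=> 0); last first.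
    apply/funext => x; rewrite /P /homot /circ /cis.
    by rewrite mulr_natl cos2pi sin2pi cos0 sin0 subrr.
  rewrite sI_cst// mul0r subr0 sI_B// => /eqP; rewrite subr_eq0 => /eqP ->.
  congr (sI _ _ _); apply/funext => y; rewrite /Q; congr (k _ * _).
  rewrite /homot /shr expr0n addr0 invr1 rc1; ring.
apply/eqP; rewrite -subr_eq0 -cmod_eq0 eq_le cmod_ge0 andbT.
apply/ler_addgt0Pr => e e0; rewrite add0r.
pose B := r / (r - cmod z).
have B0 : 0 < B by rewrite divr_gt0// subr_gt0.
have bB y : cmod (cker y) <= B.
  rewrite cmodM (cmodM (circ y)) cmodV cmod_circ (_ : cmod (ic R) = 1) ?mul1r; last first.
    by rewrite /cmod /= expr0n add0r expr1n sqrtr1.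
  rewrite ler_pM2l// lef_pV2 ?posrE ?subr_gt0// ?cmod_gt0 ?circ_subz//.
  by rewrite -{1}(cmod_circ y) cmod_triB.
have pi0' : 0 < pi :> R by exact: pi_gt0.
pose e1 := e / (4 * pi * B).
have e10 : 0 < e1 by apply: divr_gt0 => //; apply: mulr_gt0 => //; apply: mulr_gt0.
have [d hd] := hk (ltW zr).
have [dk dk0 {}hd] := hd 1 ltr01.
pose K := cmod d + 1.
have K0 : 0 < K by rewrite ltr_wpDl// cmod_ge0.
pose m := Num.min dk (e1 / K).
have m0 : 0 < m by rewrite lt_min dk0 divr_gt0.
(* Here [m * T = 2 * r + m] and [T >= 1], so [2 * r / (1 + T ^+ 2) < m]: the contracted circle lies
   within [m] of [z]. *)
pose T := (2 * r) / m + 1.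
have T0 : 0 < T by rewrite ltr_wpDl// divr_ge0 ?mulr_ge0// ltW.
have hT y : cmod (k (homot T y) - k z) <= e1.
  have hz : cmod (homot T y - z) < m.
    rewrite /homot addrC addKr cmodM cmod_rc gtr0_norm; last by case/andP: (shr01 T).
    rewrite /shr mulrC ltr_pdivrMr ?sx//.
    apply: (@le_lt_trans _ _ (2 * r)).
      by rewrite (le_trans (cmodB _ _))// cmod_circ mulr_natl mulr2n lerD2l ltW.
    have mT : m * T = 2 * r + m by rewrite /T; field; rewrite gt_eqF.
    have T1 : 1 <= T by rewrite lerDr divr_ge0 ?mulr_ge0// ltW.
    have := ler_wpM2l (ltW m0) T1; rewrite mulr1 mulrDr mulr1 => h1.
    apply: (@lt_le_trans _ _ (m * T)); first by rewrite mT ltrDl.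
    rewrite ler_pM2l//; apply: (@le_trans _ _ (T ^+ 2)); last by rewrite lerDr.
    by rewrite expr2 ler_peMl// ltW.
  move: hz; rewrite lt_min => /andP[/hd h1 h2].
  have -> : k (homot T y) - k z = (k (homot T y) - k z - d * (homot T y - z))
     + d * (homot T y - z) by ring.
  rewrite (le_trans (cmodD _ _))// cmodM (le_trans (lerD h1 (lexx _)))//.
  by rewrite -mulrDl addrC mulrC -ler_pdivlMr// ltW.
rewrite -(step T (ltW T0)) -sI_Z; last exact: continuous_cker.
rewrite -sI_B//; last first.
  by move=> y; apply: continuousM; [exact: cvg_cst|exact: continuous_cker].
have h : forall y : R, 0 <= y <= 2 * pi -> cmod (Q T y - k z * cker y) <= e1 * B.
  move=> y _; rewrite /Q -mulrBl cmodM ler_pM ?cmod_ge0//.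
have cc : continuous (fun y => Q T y - k z * cker y).
  move=> y; apply: continuousB; first exact: cQ.
  by apply: continuousM; [exact: cvg_cst|exact: continuous_cker].
apply: (le_trans (sI_bound pi0 cc h)).
rewrite le_eqVlt; apply/orP; left; apply/eqP; rewrite subr0 /e1.
have : forall p : R, p != 0 -> 2 * (e / (4 * p * B) * B) * (2 * p) = e.
  by move=> p pn; field; rewrite pn gt_eqF.
by apply; rewrite gt_eqF.
Qed.
End kernel.
End formula.

Lemma continuous_comp_circ (k : C -> C) r : 0 < r ->
  (forall z, cmod z <= r -> exists d, cdiff k z d) ->
  continuous (fun y : R => k (circ r y)).
Proof.
move=> r0 hk y; have cr := cmod_circ r0 y.
have [d hd] : exists d, cdiff k (circ r y) d by apply: hk; rewrite cr.
by have [_] := hasD_cont (hasD_comp (u := fun _ => circ r) (x0 := 0) hd (hasD_y 0 (rdiff_circ r y))).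
Qed.

Lemma contM (T : topologicalType) (f g : T -> C) (x : T) : {for x, continuous f} ->
  {for x, continuous g} -> {for x, continuous (fun y : T => f y * g y)}.
Proof. by move=> cf cg; exact: (@continuousM C T f g x cf cg). Qed.

Lemma contD (T : topologicalType) (f g : T -> C) (x : T) : {for x, continuous f} ->
  {for x, continuous g} -> {for x, continuous (fun y : T => f y + g y)}.
Proof. by move=> cf cg; exact: (@continuousD C C T f g x cf cg). Qed.

Lemma cont_sum (T : topologicalType) (f : nat -> T -> C) (N : nat) (x : T) :
  (forall m, {for x, continuous (f m)}) ->
  {for x, continuous (fun y : T => \sum_(m < N) f m y)}.
Proof.
move=> cf; elim: N => [|N IH].
  rewrite (_ : (fun y : T => _) = fun=> 0); first exact: cvg_cst.
  by apply/funext => y; rewrite big_ord0.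
rewrite (_ : (fun y : T => _) = fun y : T => \sum_(m < N) f m y + f N y); first exact: (@contD T (fun y : T => \sum_(m < N) f m y) (f N) x IH (cf N)).
by apply/funext => y; rewrite big_ord_recr.
Qed.

Lemma contX (T : topologicalType) (f : T -> C) (n : nat) (x : T) : {for x, continuous f} ->
  {for x, continuous (fun y : T => f y ^+ n)}.
Proof.
move=> cf; elim: n => [|n IH].
  rewrite (_ : (fun y : T => _) = fun=> 1); first exact: cvg_cst.
  by apply/funext => y; rewrite expr0.
rewrite (_ : (fun y : T => _) = fun y : T => f y * f y ^+ n); first exact: contM.
by apply/funext => y; rewrite exprS.
Qed.

Lemma continuous_circVX r m : 0 < r -> continuous (fun y : R => (circ r y)^-1 ^+ m).
Proof.
move=> r0 y; apply: (@contX R (fun y => (circ r y)^-1)).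
have hi := hasD_comp (u := fun _ => circ r) (x0 := 0) (cdiff_inv (circ_neq0 r0 y)) (hasD_y 0 (rdiff_circ r y)).
by have [_] := hasD_cont hi.
Qed.

Definition tcoef (k : C -> C) (r : R) (m : nat) : C :=
  rc ((2 * pi)^-1) * sI (fun y => k (circ r y) * (circ r y)^-1 ^+ m) 0 (2 * pi).

(** Cauchy's formula for [w ^+ m] at the centre, where the kernel is the constant [ic R] and the
    value of the function is 0. *)
Lemma sI_circX r m : 0 < r -> (0 < m)%N -> sI (fun y => circ r y ^+ m) 0 (2 * pi) = 0.
Proof.
move=> r0 m0.
have hk : forall z, cmod z <= r -> exists d, cdiff (fun w : C => w ^+ m) z d.
  by move=> z _; exists ('D_1 (@GRing.exp C ^~ m) z); apply: is_derive_cdiff; apply: DeriveDef => //; exact: exprn_derivable.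
have z0 : cmod (0 : C) < r by rewrite cmod0.
have := cauchy_kernel r0 hk z0; rewrite expr0n eqn0Ngt m0 mul0r.
have -> : (fun y => circ r y ^+ m * cker r 0 y) = (fun y => ic R * circ r y ^+ m).
  apply/funext => y; rewrite /cker subr0 divff ?circ_neq0// mulr1 mulrC//.
rewrite sI_Z; last exact: (continuous_comp_circ r0 hk).
by move/eqP; rewrite mulf_eq0 => /orP[/eqP[/eqP]|/eqP//]; rewrite oner_eq0.
Qed.

(** On the circle a negative power is a real multiple of the conjugate of the positive power, so its
    mean vanishes together with that of [sI_circX]. *)
Lemma tcoef1 r m : 0 < r -> tcoef (fun=> 1) r m = (m == 0%N)%:R.
Proof.
move=> r0; have p0 : 0 < 2 * pi :> R by rewrite mulr_gt0// pi_gt0.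
rewrite /tcoef; have [->|m0] := eqVneq m 0%N.
  rewrite (_ : (fun _ => _) = fun=> 1); last by apply/funext => y; rewrite expr0 mulr1.
  by rewrite sI_cst ?(ltW p0)// mul1r subr0 -rcM mulVf ?gt_eqF.
rewrite (_ : sI _ _ _ = 0) ?mulr0//.
have h : sI (fun y => circ r y ^+ m) 0 (2 * pi) = 0 by apply: sI_circX; rewrite ?lt0n.
have E y : 1 * (circ r y)^-1 ^+ m = rc (r ^- (2 * m)) * (circ r y ^+ m)^*%C.
  have n0 := circ_neq0 r0 y.
  rewrite mul1r exprVn; apply: (@mulfI _ (circ r y ^+ m)); first by rewrite expf_neq0.
  rewrite divff ?expf_neq0// mulrCA -sqr_normc cmodE cmodX cmod_circ//.
  by rewrite -rcX -rcM -exprM mulnC mulVf// expf_neq0// gt_eqF.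
have cm : continuous (fun y => circ r y ^+ m).
  apply: (continuous_comp_circ (k := fun w => w ^+ m)) => // z _.
  by exists ('D_1 (@GRing.exp C ^~ m) z); apply: is_derive_cdiff; apply: DeriveDef => //; exact: exprn_derivable.
rewrite /sI (_ : (fun y => _) = fun y => rc (r ^- (2 * m)) * (circ r y ^+ m)^*%C); last first.
  by apply/funext => y; exact: E.
have ib := ccont_CIble 0 (2 * pi) cm.
rewrite CI_Z//; last exact: CIbleJ.
by rewrite CI_J// -/(sI _ _ _) h conjc0 mulr0.
Qed.

(** A finite geometric series with its exact remainder, so that it can be integrated termwise
    without exchanging a limit and an integral. *)
Lemma ckerE r z y N : 0 < r -> cmod z < r ->
  cker r z y = ic R * (\sum_(m < N) z ^+ m * (circ r y)^-1 ^+ m)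
    + cker r z y * (z / circ r y) ^+ N.
Proof.
move=> r0 zr; have n0 := circ_neq0 r0 y; have n1 := circ_subz r0 zr y.
set w := z / circ r y.
have w1 : 1 - w != 0.
  have E : circ r y - z = circ r y * (1 - w) by rewrite /w mulrBr mulr1 mulrCA divff// mulr1.
  by apply: contra_neq n1 => w1; rewrite E w1 mulr0.
have -> : \sum_(m < N) z ^+ m * (circ r y)^-1 ^+ m = (1 - w ^+ N) / (1 - w).
  have := subrXX 1 w N; rewrite expr1n => ->; rewrite mulrC mulKf//; apply: eq_bigr => i _.
  by rewrite expr1n mul1r exprMn.
have -> : cker r z y = ic R * (1 - w)^-1.
  by rewrite /cker /w; congr (_ * _); field; rewrite n1 n0.
field; exact: w1.
Qed.

Lemma taylor_aux (k : C -> C) (r M : R) : 0 < r ->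
  (forall z, cmod z <= r -> exists d, cdiff k z d) ->
  (forall z, cmod z <= r -> cmod (k z) <= M) ->
  forall z N, cmod z < r ->
  cmod (sI (fun y => k (circ r y) * cker r z y) 0 (2 * pi) -
        ic R * rc (2 * pi) * \sum_(m < N) tcoef k r m * z ^+ m)
   <= 4 * pi * (M * (r / (r - cmod z)) * (cmod z / r) ^+ N).
Proof.
move=> r0 hk hM z N zr.
have p0 : 0 < 2 * pi :> R by rewrite mulr_gt0// pi_gt0.
have cinv m : continuous (fun y : R => k (circ r y) * (circ r y)^-1 ^+ m).
  by move=> y; apply: (@contM R (fun y => k (circ r y))); [exact: continuous_comp_circ|exact: continuous_circVX].
have ck : continuous (fun y => k (circ r y) * cker r z y).
  move=> y; apply: (@continuousM C R (fun y => k (circ r y))).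
    exact: continuous_comp_circ.
  exact: continuous_cker.
have cs : continuous (fun y => ic R * \sum_(m < N) z ^+ m * (k (circ r y) * (circ r y)^-1 ^+ m)).
  move=> y; apply: (@contM R (fun=> ic R)); first exact: cvg_cst.
  apply: (@cont_sum R (fun m y => z ^+ m * (k (circ r y) * (circ r y)^-1 ^+ m))) => m.
  by apply: (@contM R (fun=> z ^+ m)); [exact: cvg_cst|exact: cinv].
have -> : ic R * rc (2 * pi) * (\sum_(m < N) tcoef k r m * z ^+ m) =
    sI (fun y => ic R * \sum_(m < N) z ^+ m * (k (circ r y) * (circ r y)^-1 ^+ m)) 0 (2 * pi).
  have cz m : continuous (fun y : R => z ^+ m * (k (circ r y) * (circ r y)^-1 ^+ m)).
    by move=> y; apply: (@contM R (fun=> z ^+ m)); [exact: cvg_cst|exact: cinv].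
  have csum : continuous (fun y : R => \sum_(m < N) z ^+ m * (k (circ r y) * (circ r y)^-1 ^+ m)).
    by move=> y; exact: (@cont_sum R (fun m y => z ^+ m * (k (circ r y) * (circ r y)^-1 ^+ m)) N y (fun m => cz m y)).
  rewrite (sI_Z _ _ _ csum) (sI_sum N 0 (2 * pi) cz).
  rewrite -mulrA; congr (_ * _); rewrite mulr_sumr; apply: eq_bigr => m _.
  rewrite (sI_Z _ _ _ (cinv m)).
  by rewrite /tcoef mulrA mulrA -rcM divff ?gt_eqF// mul1r mulrC.
rewrite -sI_B//.
have cc : continuous (fun y => k (circ r y) * cker r z y - ic R * \sum_(m < N) z ^+ m * (k (circ r y) * (circ r y)^-1 ^+ m)).
  by move=> y; apply: (@continuousB _ C R); [exact: ck|exact: cs].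
have hb : forall y : R, 0 <= y <= 2 * pi -> cmod (k (circ r y) * cker r z y - ic R * \sum_(m < N) z ^+ m * (k (circ r y) * (circ r y)^-1 ^+ m)) <= M * (r / (r - cmod z)) * (cmod z / r) ^+ N.
  move=> y _; have -> : ic R * (\sum_(m < N) z ^+ m * (k (circ r y) * (circ r y)^-1 ^+ m)) =
     k (circ r y) * (ic R * (\sum_(m < N) z ^+ m * (circ r y)^-1 ^+ m)).
    rewrite !mulr_sumr; apply: eq_bigr => m _; ring.
  rewrite -mulrBr {1}(ckerE y N r0 zr) [_ + _ * _]addrC addrK.
  rewrite cmodM cmodM cmodX cmodM cmodV cmod_circ// mulrA.
  apply: ler_wpM2r; first by rewrite exprn_ge0// divr_ge0// ?cmod_ge0// ltW.
  apply: ler_pM; rewrite ?cmod_ge0//; first by apply: hM; rewrite cmod_circ.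
  rewrite cmodM (cmodM (circ r y)) cmodV cmod_circ// (_ : cmod (ic R) = 1) ?mul1r; last first.
    by rewrite /cmod /= expr0n add0r expr1n sqrtr1.
  rewrite ler_pM2l// lef_pV2 ?posrE ?subr_gt0// ?cmod_gt0 ?circ_subz//.
  by rewrite -{1}(cmod_circ r0 y) cmod_triB.
apply: (le_trans (sI_bound (ltW p0) cc hb)).
by rewrite subr0 le_eqVlt; apply/orP; left; apply/eqP; ring.
Qed.

(** [taylor_aux] for the constant function 1: all its coefficients beyond the first vanish by
    [tcoef1], and the remainder tends to 0 as [N] grows. This yields [2 pi i] without a
    logarithm. *)
Lemma sI_cker r z : 0 < r -> cmod z < r -> sI (cker r z) 0 (2 * pi) = ic R * rc (2 * pi).
Proof.
move=> r0 zr.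
have hk : forall z, cmod z <= r -> exists d, cdiff (fun=> 1 : C) z d.
  move=> z' _; exists 0 => e e0; exists 1 => // w _.
  by rewrite subrr mul0r subr0 cmod0 mulr_ge0 ?cmod_ge0// ltW.
have h := @taylor_aux (fun=> 1) r 1 r0 hk (fun _ _ => ltac:(rewrite cmod1; exact: lexx)) z.
apply/eqP; rewrite -subr_eq0 -cmod_eq0 eq_le cmod_ge0 andbT.
apply/ler_addgt0Pr => e e0; rewrite add0r.
set K := 4 * pi * (1 * (r / (r - cmod z))) + 1.
have K0 : 0 < K.
  by rewrite ltr_wpDl// !mulr_ge0 ?pi_ge0 ?(ltW r0)// invr_ge0 subr_ge0 ltW.
have q0 : 0 <= cmod z / r by rewrite divr_ge0 ?cmod_ge0// ltW.
have q1 : `|cmod z / r| < 1 by rewrite ger0_norm// ltr_pdivrMr// mul1r.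
have /cvgrPdist_lt/(_ (e / K)) := cvg_expr q1.
rewrite divr_gt0// => /(_ isT)[N _ hN].
have := hN N (leqnn N); rewrite /= sub0r normrN normrX ger0_norm// => hN'.
have := h N.+1 zr; rewrite big_ord_recl big1 ?addr0; last first.
  by move=> i _; rewrite tcoef1// mul0r.
rewrite tcoef1//= expr0 !mulr1 (_ : (fun y => _) = cker r z); last first.
  by apply/funext => y; rewrite mul1r.
move/le_trans; apply.
have : (cmod z / r) ^+ N.+1 <= e / K.
  by apply: (le_trans _ (ltW hN')); rewrite exprS ler_piMl ?exprn_ge0// ltW// -(ger0_norm q0).
move=> hq; rewrite mulrA (@le_trans _ _ (K * (e / K)))//; last first.
  by rewrite le_eqVlt; apply/orP; left; apply/eqP; field; rewrite gt_eqF.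
apply: ler_pM => //; rewrite ?exprn_ge0//; last by rewrite lerDl.
by rewrite !mulr_ge0 ?pi_ge0 ?(ltW r0)// invr_ge0 subr_ge0 ltW.
Qed.

Lemma tcoef_bound (k : C -> C) (r M : R) m : 0 < r ->
  (forall z, cmod z <= r -> exists d, cdiff k z d) ->
  (forall z, cmod z <= r -> cmod (k z) <= M) ->
  cmod (tcoef k r m) <= 2 * M / r ^+ m.
Proof.
move=> r0 hk hM.
have p0 : 0 < 2 * pi :> R by rewrite mulr_gt0// pi_gt0.
have cinv : continuous (fun y : R => k (circ r y) * (circ r y)^-1 ^+ m).
  by move=> y; apply: (@contM R (fun y => k (circ r y))); [exact: continuous_comp_circ|exact: continuous_circVX].
rewrite /tcoef cmodM cmod_rc gtr0_norm ?invr_gt0//.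
rewrite mulrC ler_pdivrMr//.
have hb : forall y : R, 0 <= y <= 2 * pi -> cmod (k (circ r y) * (circ r y)^-1 ^+ m) <= M / r ^+ m.
  move=> y _; rewrite cmodM cmodX cmodV cmod_circ// exprVn.
  apply: ler_wpM2r; first by rewrite invr_ge0 exprn_ge0// ltW.
  by apply: hM; rewrite cmod_circ.
apply: (le_trans (sI_bound (ltW p0) cinv hb)).
by rewrite subr0 le_eqVlt; apply/orP; left; apply/eqP; ring.
Qed.

Theorem taylor (k : C -> C) (r M : R) : 0 < r ->
  (forall z, cmod z <= r -> exists d, cdiff k z d) ->
  (forall z, cmod z <= r -> cmod (k z) <= M) ->
  exists c : nat -> C, (forall m, cmod (c m) <= 2 * M / r ^+ m) /\
   forall z N, cmod z < r -> cmod (k z - \sum_(m < N) c m * z ^+ m) <=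
     2 * M * (r / (r - cmod z)) * (cmod z / r) ^+ N.
Proof.
move=> r0 hk hM; exists (tcoef k r); split; first by move=> m; exact: tcoef_bound.
move=> z N zr; have := taylor_aux r0 hk hM N zr.
rewrite cauchy_kernel// sI_cker// [k z * _]mulrC -mulrBr cmodM.
have p0 : 0 < 2 * pi :> R by rewrite mulr_gt0// pi_gt0.
rewrite cmodM cmod_rc (_ : cmod (ic R) = 1) ?mul1r ?gtr0_norm//; last first.
  by rewrite /cmod /= expr0n add0r expr1n sqrtr1.
rewrite mulrC -ler_pdivlMr// => /le_trans; apply.
rewrite le_eqVlt; apply/orP; left; apply/eqP.
have : forall p q : R, p != 0 -> q != 0 ->
  4 * p * (M * (r / q) * (cmod z / r) ^+ N) / (2 * p) = 2 * M * (r / q) * (cmod z / r) ^+ N.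
  by move=> p q pn qn; field; rewrite ?pn ?qn ?gt_eqF.
by apply; rewrite ?gt_eqF ?subr_gt0 ?pi_gt0.
Qed.
End Cauchy.

(** * Holomorphic functions on normed spaces *)

Section Criterion.
Variable R : realType.
Local Notation C := (Cx R).
Variable V : normedModType C.
Implicit Types (p q v w : V) (g : V -> C).

(** The norm of [V] is a nonnegative element of [C]; its real part carries all of it. *)
Definition rnorm v : R := complex.Re `|v|.

Lemma rnormE v : `|v| = rc (rnorm v).
Proof.
have : 0 <= `|v| := normr_ge0 v.
rewrite /rnorm; case: `|v| => a b; rewrite lecE /= => /andP[/eqP b0 _].
by rewrite /rc -complexr0 b0.
Qed.

Lemma rnorm_ge0 v : 0 <= rnorm v.
Proof. by rewrite -rc_le -rnormE normr_ge0. Qed.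
Lemma rnormD v w : rnorm (v + w) <= rnorm v + rnorm w.
Proof. by rewrite -rc_le rcD -!rnormE ler_normD. Qed.
Lemma rnormZ (a : C) v : rnorm (a *: v) = cmod a * rnorm v.
Proof. by apply: rc_inj; rewrite rcM -!rnormE normrZ cmodE. Qed.
Lemma rnorm0 : rnorm 0 = 0.
Proof. by rewrite /rnorm normr0. Qed.
Lemma rnorm_eq0 v : (rnorm v == 0) = (v == 0).
Proof. by rewrite -rc_eq0 -rnormE normr_eq0. Qed.

Lemma near_rnorm p (P : V -> Prop) : (\forall q \near p, P q) <->
  exists2 r : R, 0 < r & forall q, rnorm (q - p) < r -> P q.
Proof.
split=> [/nbhs_normP[_ /gt0_rc[e e0 ->] h]|[r r0 h]].
  exists e => // q qp; apply: h; rewrite /= distrC rnormE rc_lt//.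
apply/nbhs_normP; exists (rc r) => /=; first by rewrite -rc0 rc_lt.
by move=> q /=; rewrite distrC rnormE rc_lt => /h.
Qed.

Lemma cvg_eps p g (l : C) : g @ p --> l <-> forall e : R, 0 < e ->
  exists2 r : R, 0 < r & forall q, rnorm (q - p) < r -> cmod (g q - l) < e.
Proof.
split=> [/cvgCP_gen h e /h /near_rnorm[r r0 hr]|h]; first by exists r.
by apply/cvgCP_gen => e /h hr; apply/near_rnorm.
Qed.

Lemma diff_criterion g p (L : {linear V -> C}) (K : R) (d : R) : 0 < d ->
  (forall v, cmod (L v) <= K * rnorm v) ->
  (forall v, rnorm v <= d -> cmod (g (p + v) - g p - L v) <= K * rnorm v ^+ 2) ->
  differentiable g p /\ forall v, 'D_v g p = L v.
Proof.
move=> d0 hL hg.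
pose K1 := `|K| + 1; have K10 : 0 < K1 by rewrite ltr_wpDl.
have KK1 : K <= K1 by rewrite /K1 (le_trans (ler_norm _))// lerDl.
have cL : continuous L.
  move=> v; apply/cvg_eps => e e0; exists (e / K1); first by rewrite divr_gt0.
  move=> q qv; rewrite -raddfB (le_lt_trans (hL _))//.
  rewrite (@le_lt_trans _ _ (K1 * rnorm (q - v)))//; first by rewrite ler_wpM2r// rnorm_ge0.
  by rewrite mulrC -ltr_pdivlMr.
have hd : g \o shift p = cst (g p) + L +o_ (0 : V) id.
  apply/eqaddoP => _ /gt0_rc[e e0 ->].
  apply/near_rnorm; exists (Num.min d (e / K1)); first by rewrite lt_min d0 divr_gt0.
  move=> v; rewrite subr0 lt_min => /andP[vd ve].
  rewrite rnormE cmodE -rcM rc_le.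
  rewrite (_ : _ v = g (p + v) - g p - L v); last first.
    by change (g (v + p) - (g p + L v) = g (p + v) - g p - L v); rewrite [v + p]addrC; ring.
  rewrite (le_trans (hg _ (ltW vd)))// expr2 mulrA ler_wpM2r ?rnorm_ge0//.
  rewrite (@le_trans _ _ (K1 * rnorm v))//; first by rewrite ler_wpM2r// rnorm_ge0.
  by rewrite mulrC -ler_pdivlMr// ltW.
have E := diff_unique cL hd.
have dg : differentiable g p by apply/diff_locallyP; rewrite E.
by split => // v; rewrite deriveE// E.
Qed.

Lemma diff_eps g p : differentiable g p -> forall e : R, 0 < e ->
  exists2 r : R, 0 < r & forall v, rnorm v < r ->
    cmod (g (p + v) - g p - 'D_v g p) <= e * rnorm v.
Proof.
move=> dg e e0; have /diff_locallyP[_ h] := dg.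
have e0' : 0 < rc e by rewrite -rc0 rc_lt.
move: h => /eqaddoP /(_ _ e0') /near_rnorm[r r0 h]; exists r => // v vr.
have := h v; rewrite subr0 rnormE cmodE -rcM rc_le => /(_ vr).
rewrite (_ : _ v = g (p + v) - g p - 'D_v g p)//.
rewrite deriveE//; change (g (v + p) - (g p + 'd g p v) = g (p + v) - g p - 'd g p v).
by rewrite [v + p]addrC; ring.
Qed.

Lemma derive_lin g p : differentiable g p -> forall (a : C) v w,
  'D_(a *: v + w) g p = a * 'D_v g p + 'D_w g p.
Proof. by move=> dg a v w; rewrite !deriveE// linearP. Qed.

Lemma diff_line g p v (t : C) : differentiable g (p + t *: v) ->
  cdiff (fun s => g (p + s *: v)) t ('D_v g (p + t *: v)).
Proof.
move=> dg e e0; set K := rnorm v + 1.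
have K0 : 0 < K by rewrite ltr_wpDl// rnorm_ge0.
have e1 : 0 < e / K by rewrite divr_gt0.
have [r r0 h] := diff_eps dg e1; exists (r / K); first by rewrite divr_gt0.
move=> s st.
have hs : rnorm ((s - t) *: v) <= cmod (s - t) * K.
  by rewrite rnormZ ler_wpM2l ?cmod_ge0// lerDl.
have E : p + t *: v + (s - t) *: v = p + s *: v.
  by rewrite -addrA -scalerDl [t + _]addrC subrK.
have := h ((s - t) *: v); rewrite E => h'.
rewrite -(addr0 ((s - t) *: v)) derive_lin ?derive0 ?addr0// in h'.
rewrite [_ * (s - t)]mulrC; apply: (le_trans (h' _)).
  by apply: (le_lt_trans hs); rewrite -ltr_pdivlMr.
rewrite (@le_trans _ _ (e / K * (cmod (s - t) * K)))//.
  by rewrite ler_wpM2l// ltW.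
by rewrite le_eqVlt; apply/orP; left; apply/eqP; field; rewrite gt_eqF.
Qed.

Lemma cdiff_derive (k : C -> C) (t d d' : C) : cdiff k t d -> cdiff k t d' -> d = d'.
Proof.
move=> h h'; have [_ <-] := cdiff_is_derive h.
by have [_ <-] := cdiff_is_derive h'.
Qed.

Lemma cdiff_quad (k : C -> C) (c : C) (K : R) :
  (forall z, cmod z <= 1 -> cmod (k z - k 0 - c * z) <= K * cmod z ^+ 2) -> cdiff k 0 c.
Proof.
move=> h e e0; set K1 := `|K| + 1.
have K0 : 0 < K1 by rewrite ltr_wpDl.
have KK1 : K <= K1 by rewrite /K1 (le_trans (ler_norm _))// lerDl.
exists (Num.min 1 (e / K1)); first by rewrite lt_min ltr01 divr_gt0.
move=> z; rewrite subr0 lt_min => /andP[z1 z2].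
apply: (le_trans (h z (ltW z1))).
rewrite expr2 mulrA ler_wpM2r ?cmod_ge0//.
apply: (@le_trans _ _ (K1 * cmod z)); first by rewrite ler_wpM2r ?cmod_ge0.
by rewrite mulrC -ler_pdivlMr// ltW.
Qed.

Section bounded.
Variables (g : V -> C) (p : V) (rho M : R).
Hypothesis rho0 : 0 < rho.
Hypothesis hg : forall q, rnorm (q - p) < rho -> differentiable g q /\ cmod (g q) <= M.

Let M0 : 0 <= M.
Proof.
have := @hg p; rewrite subrr rnorm0 => /(_ rho0)[_].
exact: le_trans (cmod_ge0 _).
Qed.

(** On the disc of radius [r] the line through [p] stays within [rho / 2] of [p]. The condition on
    [v] makes [r >= 2], so that [r / (r - cmod z) <= 2] on the unit disc; this is where the constant
    [4 * M] comes from. *)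
Lemma line_taylor v : rnorm v <= rho / 4 -> v != 0 ->
  exists c : nat -> C, let r := rho / (2 * rnorm v) in
    2 <= r /\ (forall m, cmod (c m) <= 2 * M / r ^+ m) /\
   forall z N, cmod z <= 1 -> cmod (g (p + z *: v) - \sum_(m < N) c m * z ^+ m) <=
     4 * M * (cmod z / r) ^+ N.
Proof.
move=> vr v0; set r := rho / _.
have n0 : 0 < rnorm v by rewrite lt_neqAle eq_sym rnorm_eq0 v0 rnorm_ge0.
have r2 : 2 <= r by rewrite ler_pdivlMr ?mulr_gt0//; lra.
have r0 : 0 < r by apply: lt_le_trans r2.
have inb z : cmod z <= r -> rnorm (p + z *: v - p) < rho.
  rewrite addrC addKr rnormZ => zr.
  rewrite (@le_lt_trans _ _ (r * rnorm v))//; first by rewrite ler_wpM2r// ltW.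
  have -> : r * rnorm v = rho / 2 by rewrite /r; field; rewrite gt_eqF.
  lra.
have h1 z : cmod z <= r -> exists d, cdiff (fun s => g (p + s *: v)) z d.
  by move=> /inb /hg[dg _]; eexists; exact: diff_line.
have h2 z : cmod z <= r -> cmod (g (p + z *: v)) <= M by move=> /inb /hg[].
have [c [c1 c2]] := taylor r0 h1 h2; exists c; split => //; split => // z N z1.
have zr : cmod z < r by apply: le_lt_trans z1 _; lra.
apply: (le_trans (c2 z N zr)).
have rz : 0 < r - cmod z by rewrite subr_gt0.
have : r / (r - cmod z) <= 2 by rewrite ler_pdivrMr//; lra.
move=> h; apply: ler_wpM2r; first by rewrite exprn_ge0// divr_ge0 ?cmod_ge0// ltW.
have := ler_wpM2l (mulr_ge0 (ler0n R 2) M0) h; lra.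
Qed.

Lemma line_taylor0 v (c : nat -> C) r : 0 < r -> (forall z N, cmod z <= 1 ->
  cmod (g (p + z *: v) - \sum_(m < N) c m * z ^+ m) <= 4 * M * (cmod z / r) ^+ N) ->
  c 0%N = g p /\ c 1%N = 'D_v g p.
Proof.
move=> r0 h.
have h0 : c 0%N = g p.
  have := h 0 1%N; rewrite cmod0 big_ord_recl big_ord0 expr0 addr0 mulr1 scale0r addr0.
  rewrite mul0r expr1 mulr0 => /(_ ler01) hh; apply/eqP; rewrite eq_sym -subr_eq0 -cmod_eq0.
  by rewrite eq_le hh cmod_ge0.
split => //.
have dg : differentiable g (p + 0 *: v).
  by rewrite scale0r addr0; have [] := @hg p _; rewrite ?subrr ?rnorm0.
have := diff_line dg; rewrite scale0r addr0 => hd; apply: cdiff_derive hd.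
apply: (@cdiff_quad _ _ (4 * M / r ^+ 2)) => z z1.
have := h z 2%N z1; rewrite big_ord_recl big_ord1 /= expr0 mulr1 h0 expr1.
rewrite scale0r addr0 opprD addrA expr_div_n => /le_trans; apply.
by rewrite le_eqVlt; apply/orP; left; apply/eqP; field; rewrite gt_eqF.
Qed.

(** The expansion along the line truncated at [N = 1] and taken at [z = 1], where [cmod z / r] is
    [2 * rnorm v / rho]. Truncating at [N = 2] instead gives [quad_bound]. *)
Lemma lip_bound v : rnorm v <= rho / 4 ->
  cmod (g (p + v) - g p) <= 8 * M * rnorm v / rho.
Proof.
move=> vr; have [->|v0] := eqVneq v 0.
  by rewrite addr0 subrr cmod0 rnorm0 mulr0 mul0r.
have n0 : 0 < rnorm v by rewrite lt_neqAle eq_sym rnorm_eq0 v0 rnorm_ge0.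
have [c] := line_taylor vr v0; set r := rho / _ => -[r2 [_ h]].
have r0 : 0 < r by apply: lt_le_trans r2.
have [h0 _] := line_taylor0 r0 h.
have := h 1 1%N; rewrite cmod1 lexx scale1r big_ord_recl big_ord0 addr0 expr0 mulr1 h0.
move=> /(_ isT) /le_trans; apply.
by rewrite expr1 /r le_eqVlt; apply/orP; left; apply/eqP; field; rewrite !gt_eqF.
Qed.

Lemma quad_bound v : rnorm v <= rho / 4 ->
  cmod (g (p + v) - g p - 'D_v g p) <= 16 * M / rho ^+ 2 * rnorm v ^+ 2.
Proof.
move=> vr; have [->|v0] := eqVneq v 0.
  by rewrite addr0 subrr derive0 subr0 cmod0 rnorm0 expr0n mulr0.
have n0 : 0 < rnorm v by rewrite lt_neqAle eq_sym rnorm_eq0 v0 rnorm_ge0.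
have [c] := line_taylor vr v0; set r := rho / _ => -[r2 [_ h]].
have r0 : 0 < r by apply: lt_le_trans r2.
have [h0 h1] := line_taylor0 r0 h.
have := h 1 2%N; rewrite cmod1 lexx scale1r big_ord_recl big_ord1 /= expr0 mulr1 h0 h1.
rewrite expr1n mulr1 opprD addrA.
move=> /(_ isT) /le_trans; apply.
by rewrite /r le_eqVlt; apply/orP; left; apply/eqP; field; rewrite !gt_eqF.
Qed.

End bounded.

(* Second-difference estimates which characterise holomorphy near [p] and, unlike
   differentiability, visibly pass to bounded pointwise limits and to integrals. *)
Definition Equad g p (d K : R) := forall v w, rnorm v <= d -> rnorm w <= d ->
  cmod (g (p + v + w) - g (p + v) - g (p + w) + g p) <= K * rnorm v * rnorm w /\
  forall a : C, cmod a <= 1 ->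
    cmod (g (p + a *: v) - g p - a * (g (p + v) - g p)) <= K * rnorm v ^+ 2.

Lemma double_le16 (y : R) : 0 <= y -> y + y <= 16 * y.
Proof. by move=> y0; lra. Qed.

(** The mixed difference is an increment of [G q = g (q + w) - g q]: [lip_bound] first shows that
    [G] is of size [rnorm w], then applies to [G] itself. The defect of homogeneity is compared with
    the derivative by [quad_bound] at [v] and at [a *: v]. *)
Lemma holo_Equad g p rho M : 0 < rho ->
  (forall q, rnorm (q - p) < rho -> differentiable g q /\ cmod (g q) <= M) ->
  Equad g p (rho / 8) (16 * 16 * M / rho ^+ 2).
Proof.
move=> rho0 hg v w vr wr.
have M0 : 0 <= M.
  have := hg p; rewrite subrr rnorm0 => /(_ rho0)[_].
  exact: le_trans (cmod_ge0 _).
have v0 := rnorm_ge0 v; have w0 := rnorm_ge0 w.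
split=> [|a a1].
  pose G q := g (q + w) - g q.
  have hG q : rnorm (q - p) < rho / 2 -> differentiable G q /\ cmod (G q) <= 16 * M * rnorm w / rho.
    move=> qp; have dq : differentiable g q by have [] := hg q; first lra.
    have dqw : differentiable g (q + w).
      have [] := hg (q + w) => //; rewrite addrAC (le_lt_trans (rnormD _ _))//; lra.
    split.
      apply: (@differentiableB _ _ _ (g \o (fun x => x + w)) g) => //.
      apply: differentiable_comp; last exact: dqw.
      by apply: (@differentiableD _ _ _ id (cst w)).
    have hq x : rnorm (x - q) < rho / 2 -> differentiable g x /\ cmod (g x) <= M.
      move=> xq; apply: hg; rewrite -(subrK q x) -addrA (le_lt_trans (rnormD _ _))//; lra.
    have rho2 : 0 < rho / 2 by lra.
    have := lip_bound rho2 hq (v := w); rewrite -/(G q) => /(_ _) h.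
    have {}h : cmod (G q) <= 8 * M * rnorm w / (rho / 2) by apply: h; lra.
    apply: (le_trans h).
    by rewrite le_eqVlt; apply/orP; left; apply/eqP; field; rewrite gt_eqF.
  have rho2 : 0 < rho / 2 by lra.
  have h := lip_bound rho2 hG (v := v).
  have {}h : cmod (G (p + v) - G p) <= 8 * (16 * M * rnorm w / rho) * rnorm v / (rho / 2).
    by apply: h; lra.
  rewrite (_ : _ - _ - _ + _ = G (p + v) - G p); last by rewrite /G; ring.
  apply: (le_trans h).
  by rewrite le_eqVlt; apply/orP; left; apply/eqP; field; rewrite gt_eqF.
have dp : differentiable g p by have [] := hg p; rewrite ?subrr ?rnorm0.
have av : rnorm (a *: v) <= rnorm v by rewrite rnormZ ler_piMl.
have h1 := quad_bound rho0 hg (v := v); have h2 := quad_bound rho0 hg (v := a *: v).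
have {}h1 : cmod (g (p + v) - g p - 'D_v g p) <= 16 * M / rho ^+ 2 * rnorm v ^+ 2.
  by apply: h1; lra.
have {}h2 : cmod (g (p + a *: v) - g p - 'D_(a *: v) g p) <= 16 * M / rho ^+ 2 * rnorm (a *: v) ^+ 2.
  by apply: h2; lra.
have E : 'D_(a *: v) g p = a * 'D_v g p.
  by rewrite -[a *: v]addr0 derive_lin// derive0 addr0.
rewrite (_ : _ - _ - _ = (g (p + a *: v) - g p - 'D_(a *: v) g p) -
   a * (g (p + v) - g p - 'D_v g p)); last by rewrite E; ring.
rewrite (le_trans (cmodB _ _))// cmodM.
have c0 : 0 <= 16 * M / rho ^+ 2 by rewrite divr_ge0 ?exprn_ge0 ?mulr_ge0// ltW.
have s1 : rnorm (a *: v) ^+ 2 <= rnorm v ^+ 2 by rewrite lerXn2r ?nnegrE ?rnorm_ge0.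
apply: (le_trans (lerD (le_trans h2 (ler_wpM2l c0 s1)) (le_trans (ler_piMl (cmod_ge0 _) a1) h1))).
rewrite [leRHS](_ : _ = 16 * (16 * M / rho ^+ 2 * rnorm v ^+ 2)); last by field; rewrite gt_eqF.
by apply: double_le16; rewrite mulr_ge0 ?sqr_ge0.
Qed.

Section converse.
Variables (g : V -> C) (p : V) (d K M : R).
Hypothesis d0 : 0 < d.
Hypothesis K0 : 0 <= K.
Hypothesis hE : Equad g p d K.
Hypothesis hM : forall q, rnorm (q - p) <= d -> cmod (g q) <= M.

Let hf (k : nat) : C := rc (2 ^- k).
Let hf0 k : 0 < (2 ^- k : R). Proof. by rewrite invr_gt0 exprn_gt0. Qed.
Definition dquo v k : C := rc (2 ^+ k) * (g (p + hf k *: v) - g p).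

Lemma rnorm_hf k v : rnorm (hf k *: v) = 2 ^- k * rnorm v.
Proof. by rewrite rnormZ cmod_rc gtr0_norm. Qed.

(** Halving the increment exhibits the difference of two successive quotients as a mixed difference
    with equal increments. The true bound [K * rnorm v ^+ 2 * 2 ^- k / 4] is weakened to a
    difference of powers so that it telescopes in [dquo_cauchy]. *)
Lemma dquo_step v k : 2 ^- k.+1 * rnorm v <= d ->
  cmod (dquo v k.+1 - dquo v k) <= K * rnorm v ^+ 2 * (2 ^- k - 2 ^- k.+1).
Proof.
move=> vd; set u := hf k.+1 *: v.
have un : rnorm u <= d by rewrite rnorm_hf.
have uu : hf k *: v = u + u.
  rewrite -scalerDl -rcD; congr (rc _ *: _).
  by rewrite exprS; field; rewrite expf_neq0.
have [h _] := hE un un.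
rewrite /dquo uu -/u exprS rcM addrA -cmodN.
rewrite (_ : - _ = rc (2 ^+ k) * (g (p + u + u) - g (p + u) - g (p + u) + g p)); last first.
  by rewrite rc_nat; ring.
rewrite cmodM cmod_rc gtr0_norm ?exprn_gt0//.
have := ler_wpM2l (exprn_ge0 k (ler0n R 2)) h => /le_trans; apply.
rewrite rnorm_hf exprS.
have e2 : (2 ^+ k : R) != 0 by rewrite expf_neq0.
rewrite -subr_ge0.
have -> : K * rnorm v ^+ 2 * (2 ^- k - (2 * 2 ^+ k)^-1) -
   2 ^+ k * (K * ((2 * 2 ^+ k)^-1 * rnorm v) * ((2 * 2 ^+ k)^-1 * rnorm v)) =
   K * rnorm v ^+ 2 * (2 ^- k / 4) by field.
by rewrite mulr_ge0 ?divr_ge0 ?(ltW (hf0 _))// mulr_ge0 ?sqr_ge0.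
Qed.

Lemma dquo_cauchy v m n : 2 ^- m * rnorm v <= d -> (m <= n)%N ->
  cmod (dquo v n - dquo v m) <= K * rnorm v ^+ 2 * (2 ^- m - 2 ^- n).
Proof.
move=> vd; elim: n => [|n IH].
  by rewrite leqn0 => /eqP ->; rewrite !subrr cmod0 mulr0.
rewrite leq_eqVlt => /predU1P[<-|]; first by rewrite !subrr cmod0 mulr0.
rewrite ltnS => mn; rewrite (_ : _ - _ = (dquo v n.+1 - dquo v n) + (dquo v n - dquo v m)); last by ring.
rewrite (le_trans (cmodD _ _))// (_ : 2 ^- m - 2 ^- n.+1 = (2 ^- n - 2 ^- n.+1) + (2 ^- m - 2 ^- n)); last by ring.
rewrite mulrDr lerD ?IH// dquo_step// (le_trans _ vd)// ler_wpM2r ?rnorm_ge0//.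
by rewrite lef_pV2 ?posrE ?exprn_gt0// ler_eXn2l ?ltr1n// ltnW.
Qed.

Lemma pow2_small (x e : R) : 0 < e -> exists n, 2 ^- n * x < e.
Proof.
move=> e0; pose n := (Num.trunc (`|x| / e)).+1; exists n.
have hn : `|x| / e < 2 ^+ n.
  apply: (@lt_le_trans _ _ n%:R); first exact: truncnS_gt.
  by rewrite -natrX ler_nat ltnW// ltn_expl.
rewrite mulrC ltr_pdivrMr ?exprn_gt0// (le_lt_trans (ler_norm _))//.
by move: hn; rewrite ltr_pdivrMr// mulrC.
Qed.

Lemma pow2_le (x : R) n m : 0 <= x -> (n <= m)%N -> 2 ^- m * x <= 2 ^- n * x.
Proof.
by move=> x0 nm; rewrite ler_wpM2r// lef_pV2 ?posrE ?exprn_gt0// ler_eXn2l ?ltr1n.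
Qed.

Lemma dquo_cvg v : exists l : C, dquo v @ \oo --> l.
Proof.
have [k0 hk0] := pow2_small (rnorm v) d0.
have [l hl] : exists l : C, (fun n => dquo v (n + k0)) @ \oo --> l.
  apply: (@cauchyC _ _ (fun n => 2 ^- (n + k0) * (K * rnorm v ^+ 2))) => [n m nm|].
    have h := @dquo_cauchy v (n + k0) (m + k0) _.
    apply: (le_trans (h _ _)); rewrite ?leq_add2r//.
      by rewrite (le_trans _ (ltW hk0))// pow2_le ?rnorm_ge0// leq_addl.
    rewrite [leRHS]mulrC; apply: ler_wpM2l; first by rewrite mulr_ge0 ?sqr_ge0.
    by rewrite gerBl ltW.
  apply/cvgrPdist_lt => e e0; have [n hn] := pow2_small (K * rnorm v ^+ 2) e0.
  exists n => // m /= nm; rewrite sub0r normrN ger0_norm; last first.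
    by rewrite mulr_ge0 ?(ltW (hf0 _))// mulr_ge0 ?sqr_ge0.
  apply: le_lt_trans hn; apply: pow2_le; first by rewrite mulr_ge0 ?sqr_ge0.
  by rewrite (leq_trans nm)// leq_addr.
exists l; apply/cvgCP => e e0; have [N hN] := (cvgCP _ _).1 hl e e0.
exists (N + k0)%N => n nN; rewrite -(subnK (leq_trans (leq_addl N k0) nN)).
by apply: hN; rewrite leq_subRL ?(leq_trans (leq_addl N k0) nN)// addnC.
Qed.

(** The derivative is the limit [L] of the dyadic quotients. The mixed difference makes [L]
    additive, the second estimate makes it homogeneous, and the telescoped bound from level 0 is the
    quadratic remainder that [diff_criterion] wants. *)
Theorem Equad_diff : differentiable g p.
Proof.
have [L hL] := choice dquo_cvg.
have lim0 (u : nat -> C) (x : R) l : u @ \oo --> l -> 0 <= x ->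
    (exists k0, forall n, (k0 <= n)%N -> cmod (u n) <= 2 ^- n * x) -> l = 0.
  move=> /cvgCP ul x0 [k0 hk]; apply/eqP; rewrite -cmod_eq0 eq_le cmod_ge0 andbT.
  apply/ler_addgt0Pr => e e0; rewrite add0r; have e2 : 0 < e / 2 by rewrite divr_gt0.
  have [N hN] := ul _ e2; have [n hn] := pow2_small x e2.
  pose m := maxn N (maxn n k0).
  have h1 : cmod (u m - l) < e / 2 by apply: hN; rewrite leq_maxl.
  have h2 : cmod (u m) <= 2 ^- m * x by apply: hk; rewrite !leq_max leqnn !orbT.
  have h3 : 2 ^- m * x <= 2 ^- n * x by apply: pow2_le => //; rewrite !leq_max leqnn orbT.
  have -> : l = u m - (u m - l) by ring.
  rewrite (le_trans (cmodB _ _))// (splitr e) lerD ?(ltW h1)//.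
  by rewrite (le_trans h2)// (le_trans h3)// ltW.
have LD v w : L (v + w) = L v + L w.
  apply/eqP; rewrite -subr_eq0; apply/eqP.
  have hc : (fun n => dquo (v + w) n - (dquo v n + dquo w n)) @ \oo --> L (v + w) - (L v + L w).
    by apply: cvgB => //; apply: cvgD.
  apply: (lim0 _ (K * rnorm v * rnorm w) _ hc).
    by rewrite !mulr_ge0 ?rnorm_ge0.
  have [k1 hk1] := pow2_small (rnorm v) d0; have [k2 hk2] := pow2_small (rnorm w) d0.
  exists (maxn k1 k2) => n; rewrite geq_max => /andP[n1 n2].
  have v1 : rnorm (hf n *: v) <= d.
    by rewrite rnorm_hf (le_trans _ (ltW hk1))// pow2_le ?rnorm_ge0.
  have w1 : rnorm (hf n *: w) <= d.
    by rewrite rnorm_hf (le_trans _ (ltW hk2))// pow2_le ?rnorm_ge0.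
  have [h _] := hE v1 w1.
  rewrite /dquo scalerDr addrA.
  rewrite (_ : _ - _ = rc (2 ^+ n) * (g (p + hf n *: v + hf n *: w) - g (p + hf n *: v) - g (p + hf n *: w) + g p)); last by ring.
  rewrite cmodM cmod_rc gtr0_norm ?exprn_gt0//.
  have := ler_wpM2l (exprn_ge0 n (ler0n R 2)) h => /le_trans; apply.
  rewrite !rnorm_hf le_eqVlt; apply/orP; left; apply/eqP; field.
  by rewrite expf_neq0.
have LZ1 (a : C) v : cmod a <= 1 -> L (a *: v) = a * L v.
  move=> a1; apply/eqP; rewrite -subr_eq0; apply/eqP.
  have hc : (fun n => dquo (a *: v) n - a * dquo v n) @ \oo --> L (a *: v) - a * L v.
    by apply: cvgB => //; apply: cvgM => //; exact: cvg_cst.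
  apply: (lim0 _ (K * rnorm v ^+ 2) _ hc).
    by rewrite mulr_ge0 ?sqr_ge0.
  have [k1 hk1] := pow2_small (rnorm v) d0.
  exists k1 => n n1.
  have v1 : rnorm (hf n *: v) <= d.
    by rewrite rnorm_hf (le_trans _ (ltW hk1))// pow2_le ?rnorm_ge0.
  have [_ /(_ a a1) h] := hE v1 v1.
  rewrite /dquo.
  rewrite (_ : _ - _ = rc (2 ^+ n) * (g (p + a *: (hf n *: v)) - g p - a * (g (p + hf n *: v) - g p))); last first.
    by rewrite !scalerA [hf n * a]mulrC; ring.
  rewrite cmodM cmod_rc gtr0_norm ?exprn_gt0//.
  have := ler_wpM2l (exprn_ge0 n (ler0n R 2)) h => /le_trans; apply.
  rewrite !rnorm_hf le_eqVlt; apply/orP; left; apply/eqP; field.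
  by rewrite expf_neq0.
(* Scalars of modulus above 1 are reached by applying [LZ1] to their inverse. *)
have LZ (a : C) v : L (a *: v) = a * L v.
  have [a1|a1] := leP (cmod a) 1; first exact: LZ1.
  have a0 : a != 0 by rewrite -cmod_gt0 (lt_trans ltr01).
  rewrite -[v in RHS](scalerK a0) (LZ1 a^-1) ?mulVKf//.
  by rewrite cmodV invf_le1 ?(lt_trans ltr01)// ltW.
have Llin : linear L by move=> a v w; rewrite LD LZ.
pose Ll : {linear V -> C} := HB.pack L (GRing.isLinear.Build _ _ _ _ L Llin).
have hq v : rnorm v <= d -> cmod (g (p + v) - g p - L v) <= K * rnorm v ^+ 2.
  move=> vd; have : cmod (L v - (g (p + v) - g p)) <= K * rnorm v ^+ 2.
    apply: (cvgC_le (hL v)) => n.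
    have := @dquo_cauchy v 0 n; rewrite expr0 invr1 mul1r => /(_ vd (leq0n _)).
    rewrite {2}/dquo expr0 mul1r /hf expr0 invr1 scale1r => /le_trans; apply.
    by apply: ler_piMr; rewrite ?gerBl ?(ltW (hf0 _))// mulr_ge0 ?sqr_ge0.
  by rewrite -cmodN opprB.
(* Rescaling [v] to norm [d] compares [L] with an actual increment of [g], which [M] controls. *)
have bL v : cmod (L v) <= (2 * M + K * d ^+ 2) / d * rnorm v.
  have [->|v0] := eqVneq v 0.
    by rewrite rnorm0 mulr0 -(scale0r (0 : V)) LZ mul0r cmod0.
  have n0 : 0 < rnorm v by rewrite lt_neqAle eq_sym rnorm_eq0 v0 rnorm_ge0.
  pose a : C := rc (d / rnorm v).
  have an : rnorm (a *: v) = d.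
    by rewrite rnormZ cmod_rc gtr0_norm ?divr_gt0// divfK ?gt_eqF.
  have := hq (a *: v); rewrite an lexx => /(_ isT) h.
  have h1 : cmod (g (p + a *: v)) <= M by apply: hM; rewrite addrC addKr an.
  have h2 : cmod (g p) <= M by apply: hM; rewrite subrr rnorm0 ltW.
  have h3 : cmod (L (a *: v)) <= 2 * M + K * d ^+ 2.
    rewrite (_ : L _ = (g (p + a *: v) - g p) - (g (p + a *: v) - g p - L (a *: v))); last by ring.
    rewrite (le_trans (cmodB _ _))// lerD//.
    by rewrite (le_trans (cmodB _ _))// mulr_natl mulr2n lerD.
  move: h3; rewrite LZ cmodM cmod_rc gtr0_norm ?divr_gt0// => h3.
  rewrite mulrAC ler_pdivlMr// -ler_pdivrMr// (le_trans _ h3)//.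
  by rewrite le_eqVlt; apply/orP; left; apply/eqP; field; rewrite gt_eqF.
pose K2 := Num.max ((2 * M + K * d ^+ 2) / d) K.
have h1 v : cmod (Ll v) <= K2 * rnorm v.
  by rewrite (le_trans (bL v))// ler_wpM2r ?rnorm_ge0// le_max lexx.
have h2 v : rnorm v <= d -> cmod (g (p + v) - g p - Ll v) <= K2 * rnorm v ^+ 2.
  by move=> /hq /le_trans; apply; rewrite ler_wpM2r ?sqr_ge0// le_max lexx orbT.
by have [] := diff_criterion d0 h1 h2.
Qed.
End converse.
End Criterion.

(** * Limits, parameter integrals and derivatives of holomorphic functions *)

Section Closure.
Variable R : realType.
Local Notation C := (Cx R).
Variable V : normedModType C.
Implicit Types (p q v w : V) (g : V -> C).

Lemma addKl (U : zmodType) (x y : U) : x + y - x = y.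
Proof. by rewrite addrC addKr. Qed.

Lemma rnorm_ball p q v (r s : R) : rnorm (q - p) < r -> rnorm v <= s ->
  rnorm (q + v - p) < r + s.
Proof.
by move=> qp vs; rewrite addrAC (le_lt_trans (rnormD _ _))// ltr_leD.
Qed.

Lemma rnorm_balls p q x (r s : R) : rnorm (q - p) < r -> rnorm (x - q) < s ->
  rnorm (x - p) < r + s.
Proof.
move=> qp xq; rewrite -(subrK q x) -addrA addrC.
by rewrite (le_lt_trans (rnormD _ _))// ltrD.
Qed.

(** The bound [M] is part of the notion because [rho] and [M] alone determine the constants in
    [holo_Equad]. *)
Definition holoball g p (rho M : R) :=
  forall q, rnorm (q - p) < rho -> differentiable g q /\ cmod (g q) <= M.

Lemma holoball_sub g p q (r s M : R) : holoball g p (r + s) M -> rnorm (q - p) < r ->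
  holoball g q s M.
Proof. by move=> h qp x xq; apply: h; exact: rnorm_balls qp xq. Qed.

Lemma holoball_ge0 g p (rho M : R) : 0 < rho -> holoball g p rho M -> 0 <= M.
Proof.
move=> r0 /(_ p); rewrite subrr rnorm0 => /(_ r0)[_]; exact: le_trans (cmod_ge0 _).
Qed.

(** Each inequality in [Equad] involves finitely many values of the function, and its constant is
    the same for all [u N]; pointwise convergence is therefore enough. *)
Lemma limit_differentiable (u : nat -> V -> C) g p (rho M : R) : 0 < rho ->
  (forall N, holoball (u N) p rho M) ->
  (forall q, rnorm (q - p) < rho -> (fun N => u N q) @ \oo --> g q) ->
  differentiable g p.
Proof.
move=> r0 hu ug; have M0 := holoball_ge0 r0 (hu 0%N).
have d0 : 0 < rho / 8 by rewrite divr_gt0.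
have K0 : 0 <= 16 * 16 * M / rho ^+ 2 by rewrite divr_ge0 ?exprn_ge0 ?(ltW r0)// mulr_ge0// mulr_ge0.
have r2 : rho / 8 + rho / 8 < rho by rewrite -mulrDl; lra.
have r1 : rho / 8 < rho by lra.
have inb v : rnorm v <= rho / 8 -> rnorm (p + v - p) < rho.
  by rewrite addrC addKr => /le_lt_trans; apply.
have pr : rnorm (p - p) < rho by rewrite subrr rnorm0.
apply: (@Equad_diff _ _ g p (rho / 8) (16 * 16 * M / rho ^+ 2) M) => //; last first.
  move=> q qp; rewrite -[g q]subr0; apply: (cvgC_le (ug q _)) => [|N].
    exact: le_lt_trans qp r1.
  by rewrite subr0; apply: (hu N q _).2; exact: le_lt_trans qp r1.
move=> v w vr wr.
have hp := ug p pr; have hv := ug (p + v) (inb v vr); have hw := ug (p + w) (inb w wr).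
have hvw : (fun N => u N (p + v + w)) @ \oo --> g (p + v + w).
  apply: ug; rewrite -(addrA p v w) addKl (le_lt_trans (rnormD _ _))//.
  by rewrite (le_lt_trans (lerD vr wr)).
split.
  rewrite -[X in cmod X]subr0.
  apply: (@cvgC_le _ (fun N => u N (p + v + w) - u N (p + v) - u N (p + w) + u N p)).
    exact: (cvgD (cvgB (cvgB hvw hv) hw) hp).
  by move=> N; rewrite subr0; have [] := holo_Equad r0 (hu N) vr wr.
move=> a a1; rewrite -[X in cmod X]subr0.
have hav : (fun N => u N (p + a *: v)) @ \oo --> g (p + a *: v).
  by apply: ug; apply: inb; apply: le_trans vr; rewrite rnormZ ler_piMl// rnorm_ge0.
apply: (@cvgC_le _ (fun N => u N (p + a *: v) - u N p - a * (u N (p + v) - u N p))).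
  exact: (cvgB (cvgB hav hp) (cvgM (cvg_cst a) (cvgB hv hp))).
by move=> N; rewrite subr0; have [_] := holo_Equad r0 (hu N) vr wr; apply.
Qed.

Lemma limit_holoball (u : nat -> V -> C) g p (rho M : R) : 0 < rho ->
  (forall N, holoball (u N) p rho M) ->
  (forall q, rnorm (q - p) < rho -> (fun N => u N q) @ \oo --> g q) ->
  holoball g p rho M.
Proof.
move=> r0 hu ug q qp; split; last first.
  rewrite -[g q]subr0; apply: (cvgC_le (ug q qp)) => N.
  by rewrite subr0; apply: (hu N q _).2.
have e0 : 0 < rho - rnorm (q - p) by rewrite subr_gt0.
have qp2 : rnorm (q - p) < rnorm (q - p) + (rho - rnorm (q - p)) / 2.
  by rewrite ltrDl divr_gt0.
have E : rnorm (q - p) + (rho - rnorm (q - p)) / 2 + (rho - rnorm (q - p)) / 2 = rho by field.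
apply: (@limit_differentiable u g q ((rho - rnorm (q - p)) / 2) M); first by rewrite divr_gt0.
  by move=> N; apply: holoball_sub qp2; rewrite E.
move=> x xq; apply: ug; have := rnorm_balls qp2 xq; rewrite E; exact.
Qed.

Lemma derive_scale g p v (a : C) : differentiable g p -> 'D_(a *: v) g p = a * 'D_v g p.
Proof. by move=> dg; rewrite -[a *: v]addr0 derive_lin// derive0 addr0. Qed.

Lemma deriv_compare (A B a b t x y : C) :
  t * (x - y) = (A - B) - (a - b) - ((A - a - t * x) - (B - b - t * y)).
Proof. ring. Qed.

Lemma limit_derive (u : nat -> V -> C) g p (rho M : R) v : 0 < rho ->
  (forall N, holoball (u N) p rho M) ->
  (forall q, rnorm (q - p) < rho -> (fun N => u N q) @ \oo --> g q) ->
  (fun N => 'D_v (u N) p) @ \oo --> 'D_v g p.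
Proof.
move=> r0 hu ug; have M0 := holoball_ge0 r0 (hu 0%N).
have hg := limit_holoball r0 hu ug.
apply/cvgCP => e e0; set K := 16 * M / rho ^+ 2 * rnorm v ^+ 2 + 1.
have c0 : 0 <= 16 * M / rho ^+ 2 * rnorm v ^+ 2.
  by rewrite mulr_ge0 ?sqr_ge0// divr_ge0 ?mulr_ge0 ?exprn_ge0// ltW.
have K0 : 0 < K by rewrite /K ltr_wpDl.
pose t := Num.min (rho / 4 / (rnorm v + 1)) (e / 4 / K).
have nv : 0 < rnorm v + 1 by rewrite ltr_wpDl// rnorm_ge0.
have t0 : 0 < t by rewrite lt_min !divr_gt0.
have tv : rnorm (rc t *: v) <= rho / 4.
  rewrite rnormZ cmod_rc gtr0_norm// (@le_trans _ _ (t * (rnorm v + 1)))//.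
    by rewrite ler_wpM2l ?(ltW t0)// lerDl.
  by rewrite -ler_pdivlMr// ge_min lexx.
have inb : rnorm (p + rc t *: v - p) < rho.
  by rewrite addrC addKr (le_lt_trans tv)// ltr_pdivrMr// ltr_pMr// ltr1n.
have pr : rnorm (p - p) < rho by rewrite subrr rnorm0.
have e4 : 0 < t * e / 4 by rewrite divr_gt0// mulr_gt0.
have [N1 h1] := (cvgCP _ _).1 (ug _ inb) _ e4.
have [N2 h2] := (cvgCP _ _).1 (ug _ pr) _ e4.
exists (maxn N1 N2) => n; rewrite geq_max => /andP[/h1 {}h1 /h2 {}h2].
have q1 := quad_bound r0 (hu n) tv; have q2 := quad_bound r0 hg tv.
have [dn _] := hu n p pr; have [dg _] := hg p pr.
rewrite derive_scale// in q1; rewrite derive_scale// in q2.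
have E : 16 * M / rho ^+ 2 * rnorm (rc t *: v) ^+ 2 = 16 * M / rho ^+ 2 * rnorm v ^+ 2 * t ^+ 2.
  rewrite rnormZ cmod_rc gtr0_norm// exprMn; ring.
rewrite E in q1 q2; clear E.
have tK : t * K <= e / 4 by rewrite -ler_pdivlMr// ge_min lexx orbT.
have b : 16 * M / rho ^+ 2 * rnorm v ^+ 2 * t ^+ 2 <= t * e / 4.
  rewrite (@le_trans _ _ (t * (t * K)))//.
    rewrite mulrA -expr2 mulrC ler_wpM2l ?sqr_ge0// lerDl//.
  by rewrite -mulrA ler_pM2l.
rewrite -(ltr_pM2l t0) -[X in X * cmod _](gtr0_norm t0) -cmod_rc -cmodM.
set A := u n (p + rc t *: v) in h1 q1; set B := g (p + rc t *: v) in h1 q2.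
rewrite (deriv_compare A B (u n p) (g p)).
rewrite (le_lt_trans (cmodB _ _))//.
apply: (le_lt_trans (lerD (cmodB _ _) (cmodB _ _))).
apply: (@lt_le_trans _ _ ((t * e / 4 + t * e / 4) + (t * e / 4 + t * e / 4))).
  rewrite ltr_leD// ?ltrD//; rewrite lerD//.
    exact: le_trans q1 b.
  exact: le_trans q2 b.
by rewrite le_eqVlt; apply/orP; left; apply/eqP; field.
Qed.

(** The differences in [Equad] commute with the integral, so the estimates of the integrand
    integrate over the segment and [Equad_diff] concludes. *)
Lemma integral_differentiable (K : V -> R -> C) (a b : R) p (rho M : R) : 0 < rho -> a <= b ->
  (forall q, rnorm (q - p) < rho -> continuous (K q)) ->
  (forall t : R, a <= t <= b -> holoball (fun q => K q t) p rho M) ->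
  differentiable (fun q => sI (K q) a b) p.
Proof.
move=> r0 ab cK hK.
have M0 : 0 <= M by apply: (@holoball_ge0 _ p rho M r0 (hK a _)); rewrite lexx.
have d0 : 0 < rho / 8 by rewrite divr_gt0.
set K1 := 16 * 16 * M / rho ^+ 2.
have K0 : 0 <= K1 by rewrite divr_ge0 ?exprn_ge0 ?(ltW r0)// mulr_ge0// mulr_ge0.
have ba : 0 <= b - a by rewrite subr_ge0.
have r2 : rho / 8 + rho / 8 < rho by rewrite -mulrDl; lra.
have r1 : rho / 8 < rho by lra.
have inb v : rnorm v <= rho / 8 -> rnorm (p + v - p) < rho.
  by rewrite addrC addKr => /le_lt_trans; apply.
have pr : rnorm (p - p) < rho by rewrite subrr rnorm0.
apply: (@Equad_diff _ _ _ p (rho / 8) (2 * K1 * (b - a)) (2 * M * (b - a))) => //.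
- by apply: mulr_ge0 => //; apply: mulr_ge0.
- move=> v w vr wr.
  have cp := cK p pr; have cv := cK (p + v) (inb v vr); have cw := cK (p + w) (inb w wr).
  have cvw : continuous (K (p + v + w)).
    apply: cK; rewrite -(addrA p v w) addKl (le_lt_trans (rnormD _ _))//.
    by rewrite (le_lt_trans (lerD vr wr)).
  have cB (f h : R -> C) : continuous f -> continuous h -> continuous (fun x => f x - h x).
    by move=> cf ch x; exact: (@continuousB _ C R f h x (cf x) (ch x)).
  have cD (f h : R -> C) : continuous f -> continuous h -> continuous (fun x => f x + h x).
    by move=> cf ch x; exact: (contD (cf x) (ch x)).
  have cZ (c : C) (f : R -> C) : continuous f -> continuous (fun x => c * f x).
    by move=> cf x; exact: (@contM R R (fun=> c) f x (@cst_continuous _ _ c x) (cf x)).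
  split.
    rewrite -(sI_B a b cvw cv) -(sI_B a b (cB _ _ cvw cv) cw).
    rewrite -(sI_D a b (cB _ _ (cB _ _ cvw cv) cw) cp).
    rewrite (_ : _ * rnorm w = 2 * (K1 * rnorm v * rnorm w) * (b - a)); last by ring.
    apply: (sI_bound ab (cD _ _ (cB _ _ (cB _ _ cvw cv) cw) cp)).
    by move=> t tab; have [] := holo_Equad r0 (hK t tab) vr wr.
  move=> c c1.
  have cav : continuous (K (p + c *: v)).
    by apply: cK; apply: inb; rewrite rnormZ (le_trans _ vr)// ler_piMl// rnorm_ge0.
  rewrite -(sI_B a b cav cp) -(sI_B a b cv cp) -(sI_Z c a b (cB _ _ cv cp)).
  rewrite -(sI_B a b (cB _ _ cav cp) (cZ c _ (cB _ _ cv cp))).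
  rewrite (_ : _ * rnorm v ^+ 2 = 2 * (K1 * rnorm v ^+ 2) * (b - a)); last by ring.
  apply: (sI_bound ab (cB _ _ (cB _ _ cav cp) (cZ c _ (cB _ _ cv cp)))).
  by move=> t tab; have [_] := holo_Equad r0 (hK t tab) vr wr; apply.
- move=> q qp; have qr : rnorm (q - p) < rho by apply: le_lt_trans qp r1.
  apply: (sI_bound ab (cK q qr)).
  by move=> t tab; have [] := hK t tab q qr.
Qed.

Lemma differentiable_bounded g p : differentiable g p ->
  exists2 r : R, 0 < r & forall q, rnorm (q - p) < r -> cmod (g q) <= cmod (g p) + 1.
Proof.
move=> /differentiable_continuous /cvg_eps /(_ 1 ltr01)[r r0 h]; exists r => // q /h qp.
rewrite -[g q](subrK (g p)) addrC (le_trans (cmodD _ _))// lerD2l ltW//.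
Qed.

Lemma differentiable_shift g q v : differentiable g (q + v) ->
  differentiable (fun x => g (x + v)) q.
Proof.
move=> dg; apply: (@differentiable_comp _ _ _ _ (fun x => x + v) g) => //.
Qed.

Lemma derive_shift_pt g q v w : 'D_w (fun x => g (x + v)) q = 'D_w g (q + v).
Proof.
rewrite /derive; apply: (congr1 (fun f : C -> C => lim (f @ 0^'))).
by apply/funext => h /=; rewrite addrA.
Qed.

Definition tn (N : nat) : C := rc (N.+1%:R^-1).

Lemma cvg_quotient g q v : differentiable g q ->
  (fun N => rc (N.+1%:R) * (g (q + tn N *: v) - g q)) @ \oo --> 'D_v g q.
Proof.
move=> dg; apply/cvgCP => e e0; set K := rnorm v + 1.
have K0 : 0 < K by rewrite ltr_wpDl// rnorm_ge0.
have [r r0 h] := diff_eps dg (divr_gt0 e0 K0).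
exists (Num.trunc (K / r)) => N Nt.
have n0 : 0 < N.+1%:R :> R by [].
have hN : K / r < N.+1%:R.
  by apply: lt_le_trans (truncnS_gt _) _; rewrite ler_nat.
have hr : rnorm (tn N *: v) < r.
  rewrite rnormZ cmod_rc gtr0_norm ?invr_gt0// mulrC ltr_pdivrMr//.
  rewrite mulrC (@lt_trans _ _ K)//; first by rewrite ltrDl.
  by rewrite -ltr_pdivrMr.
have := h _ hr; rewrite derive_scale// => h'.
rewrite (_ : _ - _ = rc N.+1%:R * (g (q + tn N *: v) - g q - tn N * 'D_v g q)); last first.
  by rewrite [RHS]mulrBr [in RHS]mulrA -rcM divff// mul1r.
rewrite cmodM cmod_rc gtr0_norm// (@le_lt_trans _ _ (N.+1%:R * (e / K * rnorm (tn N *: v))))//.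
  by rewrite ler_pM2l.
rewrite rnormZ cmod_rc gtr0_norm ?invr_gt0//.
rewrite (_ : _ * _ = e * (rnorm v / K)); last by field; rewrite !gt_eqF.
by rewrite -[ltRHS]mulr1 ltr_pM2l// ltr_pdivrMr// mul1r ltrDl.
Qed.

Lemma quotient_holoball g p v (rho M : R) : 0 < rho -> holoball g p (rho + rho) M ->
  exists N0, forall N, (N0 <= N)%N -> rnorm (tn N *: v) <= rho / 4 /\ holoball
    (fun q => rc (N.+1%:R) * (g (q + tn N *: v) - g q)) p (rho / 2) (16 * M * rnorm v / rho).
Proof.
move=> r0 hg; set K := rnorm v + 1.
have K0 : 0 < K by rewrite ltr_wpDl// rnorm_ge0.
exists (Num.trunc (K / (rho / 4))) => N Nt.
have n0 : 0 < N.+1%:R :> R by [].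
have hN : K / (rho / 4) < N.+1%:R.
  by apply: lt_le_trans (truncnS_gt _) _; rewrite ler_nat.
have hr : rnorm (tn N *: v) <= rho / 4.
  rewrite rnormZ cmod_rc gtr0_norm ?invr_gt0// mulrC ler_pdivrMr//.
  rewrite mulrC ltW// (@lt_trans _ _ K)//; first by rewrite ltrDl.
  by rewrite -ltr_pdivrMr// divr_gt0.
split; first exact: hr.
move=> q qp; have qp' : rnorm (q - p) < rho by move: qp r0; clear; lra.
have dq : differentiable g q by have [] := hg q => //; move: qp r0; clear; lra.
have dqv : differentiable g (q + tn N *: v).
  by have [] := hg (q + tn N *: v) => //; have := rnorm_ball qp hr; move: r0; clear; lra.
split.
  exact: (differentiableZ (rc N.+1%:R) (differentiableB (differentiable_shift dqv) dq)).
have := lip_bound r0 (holoball_sub hg qp') hr.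
rewrite cmodM cmod_rc gtr0_norm// rnormZ cmod_rc gtr0_norm ?invr_gt0// => h.
rewrite (@le_trans _ _ (N.+1%:R * (8 * M * (N.+1%:R^-1 * rnorm v) / rho)))//.
  by rewrite ler_pM2l.
have M0 : 0 <= M by apply: holoball_ge0 hg; lra.
rewrite (_ : _ * _ = 8 * M * rnorm v / rho); last by field; rewrite !gt_eqF.
by rewrite -!mulrA ler_wpM2r ?ler_nat// mulr_ge0// divr_ge0 ?rnorm_ge0// ltW.
Qed.

Lemma near_holoball g p : (\forall q \near p, differentiable g q) ->
  exists rho M : R, 0 < rho /\ holoball g p (rho + rho) M.
Proof.
move=> /near_rnorm[r r0 h].
have [] := @differentiable_bounded g p; first by apply: h; rewrite subrr rnorm0.
move=> s s0 hs; exists (Num.min r s / 2), (cmod (g p) + 1).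
split; first by rewrite divr_gt0// lt_min r0.
move=> q; rewrite -splitr lt_min => /andP[qr qs]; split; first exact: h.
exact: hs.
Qed.

(** ['D_v g] is a bounded pointwise limit of difference quotients, hence differentiable. By
    [limit_derive] its derivative along [w] is the limit of the quotients of ['D_w g] along [v],
    that is ['D_v ('D_w g)]: symmetry of second derivatives comes with no continuity assumption. *)
Lemma differentiable_derive g p v : (\forall q \near p, differentiable g q) ->
  differentiable ('D_v g) p /\
  forall w, 'D_w ('D_v g) p = 'D_v ('D_w g) p.
Proof.
move=> /near_holoball[rho [M [r0 hg]]].
suff H v' : differentiable ('D_v' g) p /\ forall w, exists N0,
    (fun N => rc ((N + N0).+1%:R) * ('D_w g (p + tn (N + N0) *: v') - 'D_w g p))
     @ \oo --> 'D_w ('D_v' g) p.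
  have [dv hv] := H v; split; first exact: dv.
  move=> w; have [N0 h1] := hv w.
  have [dw _] := H w; have h2 := @cvg_quotient _ _ v dw.
  apply: (cvgC_unique h1); apply/cvgCP => e /((cvgCP _ _).1 h2)[N hN].
  by exists N => n nN; apply: hN; rewrite (leq_trans nN)// leq_addr.
move: v' => {}v.
have [N0 hN0] := quotient_holoball v r0 hg.
pose u N q := rc ((N + N0).+1%:R) * (g (q + tn (N + N0) *: v) - g q).
have hu N : holoball (u N) p (rho / 2) (16 * M * rnorm v / rho).
  by have [] := hN0 (N + N0)%N (leq_addl _ _).
have r2 : 0 < rho / 2 by rewrite divr_gt0.
have ug q : rnorm (q - p) < rho / 2 -> (fun N => u N q) @ \oo --> 'D_v g q.
  move=> qp; have dq : differentiable g q by have [] := hg q => //; move: qp r0; clear; lra.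
  have h2 := @cvg_quotient _ _ v dq.
  apply/cvgCP => e /((cvgCP _ _).1 h2)[N hN]; exists N => n nN.
  by apply: hN; rewrite (leq_trans nN)// leq_addr.
split=> [|w]; first exact: limit_differentiable hu ug.
exists N0; have := @limit_derive u _ p _ _ w r2 hu ug.
rewrite (_ : (fun N => 'D_w (u N) p) = (fun N => rc ((N + N0).+1%:R) *
   ('D_w g (p + tn (N + N0) *: v) - 'D_w g p)))//; apply/funext => N.
have [hr _] := hN0 (N + N0)%N (leq_addl _ _).
have pr : rnorm (p - p) < rho by rewrite subrr rnorm0.
have dp : differentiable g p by have [] := hg p => //; move: pr r0; clear; lra.
have dpv : differentiable g (p + tn (N + N0) *: v).
  by have [] := hg (p + tn (N + N0) *: v) => //; have := rnorm_ball pr hr; move: r0; clear; lra.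
have d1 := differentiable_shift dpv.
have -> : u N = rc ((N + N0).+1%:R) \*: ((fun q => g (q + tn (N + N0) *: v)) - g) by [].
rewrite deriveZ; last by apply: diff_derivable; apply: differentiableB.
rewrite deriveB; [|exact: diff_derivable|exact: diff_derivable].
by rewrite derive_shift_pt.
Qed.
End Closure.

(** * Moments of the ball and of the sphere *)

Section transfer.
Variables (R : realType) (d1 d2 : measure_display).
Variables (X : measurableType d1) (Y : measurableType d2).
Variables (phi : X -> Y) (mphi : measurable_fun [set: X] phi).
Variables (m1 : {measure set X -> \bar R}) (m2 : {measure set Y -> \bar R}).
Variables (c : R) (c0 : 0 <= c) (D : set Y) (mD : measurable D).
Hypothesis m12 : forall A, measurable A -> A `<=` D -> m1 (phi @^-1` A) = (c%:E * m2 A)%E.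
Hypothesis fD : (m2 D < +oo)%E.

Let phi_mixin := isMeasurableFun.Build _ _ _ _ _ mphi.
Let phi' : {mfun X >-> Y} := HB.pack phi phi_mixin.

(** Inside [D] the image of [m1] under [phi] is [c] times [m2]. The lemma serves dilations
    ([c = r ^- n]), translations ([c = 1]) and the radial projection onto the sphere
    ([c = n^-1]). *)
Lemma Rint_transfer (f : Y -> R) M : measurable_fun setT f ->
  (forall y, D y -> `|f y| <= M) ->
  Rintegral m1 (phi @^-1` D) (f \o phi) = c * Rintegral m2 D f.
Proof.
move=> mf hM.
have mphiD : measurable (phi @^-1` D) by rewrite -[X in measurable X]setTI; exact: mphi.
have f1D : (m1 (phi @^-1` D) < +oo)%E.
  have fin : m2 D \is a fin_num by rewrite ge0_fin_numE.
  by rewrite m12// -(fineK fin) -EFinM ltry.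
have if1 : m1.-integrable (phi @^-1` D) (EFin \o (f \o phi)).
  apply: (@bounded_integrable _ _ _ m1 _ mphiD f1D _ M) => [|x /hM//].
  by apply: measurable_funTS; exact: (measurableT_comp mf mphi).
have if2 : m2.-integrable D (EFin \o f).
  apply: (@bounded_integrable _ _ _ m2 _ mD fD _ M) => [|x /hM//].
  exact: measurable_funTS.
have mEf : measurable_fun setT (EFin \o f) by apply/measurable_EFinP.
have -> : Rintegral m1 (phi @^-1` D) (f \o phi) =
    fine (\int[pushforward m1 phi]_(y in D) (EFin \o f) y)%E.
  by rewrite (integral_pushforward mphi mEf if1 mD).
pose c' : {nonneg R} := NngNum c0.
have E : (\int[pushforward m1 phi]_(y in D) (EFin \o f) y =
   \int[mscale c' m2]_(y in D) (EFin \o f) y)%E.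
  apply: (@eq_measure_integral _ _ _ D (mscale c' m2) (pushforward m1 phi')).
  by move=> A mA AD; rewrite /= /mscale /pushforward /= m12.
rewrite E integralE ge0_integral_mscale//; last first.
  by apply: measurable_funTS; exact: measurable_funepos.
rewrite ge0_integral_mscale//; last first.
  by apply: measurable_funTS; exact: measurable_funeneg.
rewrite /Rintegral [in RHS]integralE /=.
have h1 := integrable_pos_fin_num mD if2.
have h2 := integrable_neg_fin_num mD if2.
by rewrite -(fineK h1) -(fineK h2) -!EFinM -!EFinB /= mulrBr.
Qed.

Definition cmeas d (T : measurableType d) (f : T -> Cx R) :=
  measurable_fun setT (fun y => complex.Re (f y)) /\
  measurable_fun setT (fun y => complex.Im (f y)).

Lemma CI_transfer (f : Y -> Cx R) M : cmeas f ->
  (forall y, D y -> cmod (f y) <= M) ->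
  CI m1 (phi @^-1` D) (f \o phi) = rc c * CI m2 D f.
Proof.
move=> [mr mi] hM; rewrite /CI.
rewrite (@Rint_transfer (fun y => complex.Re (f y)) M)//; last first.
  by move=> y /hM; apply: le_trans; exact: Re_cmod.
rewrite (@Rint_transfer (fun y => complex.Im (f y)) M)//; last first.
  by move=> y /hM; apply: le_trans; exact: Im_cmod.
by rewrite !rcM mulrDr; congr (_ + _); rewrite mulrCA.
Qed.
End transfer.

(** * Lebesgue measure recovered from its values on boxes *)

Section tuple_measure.
Variables (R : realType) (n : nat).
Local Notation T := (n.-tuple R).

Definition tbox (a b : T) : set T := [set x | forall i, tnth a i <= tnth x i <= tnth b i].

Definition tboxes : set (set T) := [set A | exists a b, A = tbox a b].

Lemma tbox_measurable a b : measurable (tbox a b).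
Proof.
have -> : tbox a b = \bigcap_(i in [set: 'I_n]) ((fun x : T => tnth x i) @^-1` `[tnth a i, tnth b i]).
  apply/seteqP; split=> x /= h i; first by move=> _; rewrite /= in_itv /=; exact: h.
  by have := h i I; rewrite /= in_itv.
apply: fin_bigcap_measurable; first exact: finite_finset.
move=> i _; rewrite -[X in measurable X]setTI; apply: measurable_tnth => //.
Qed.

Lemma tbox_setI : setI_closed tboxes.
Proof.
move=> _ _ [a [b ->]] [a' [b' ->]].
exists [tuple Num.max (tnth a i) (tnth a' i) | i < n].
exists [tuple Num.min (tnth b i) (tnth b' i) | i < n].
apply/seteqP; split=> x.
  by move=> [h h'] i; rewrite !tnth_mktuple ge_max le_min; move: (h i) (h' i) => /andP[-> ->] /andP[-> ->].
move=> h; split=> i; have := h i; rewrite !tnth_mktuple ge_max le_min;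
  by move=> /andP[/andP[h1 h2] /andP[h3 h4]]; apply/andP; split.
Qed.

Definition cube (k : R) : set T := tbox [tuple - k | i < n] [tuple k | i < n].

Lemma cubeE k x : cube k x <-> forall i, `|tnth x i| <= k.
Proof.
split=> h i; have := h i; rewrite ?tnth_mktuple ler_norml //.
Qed.

Lemma abs_le_trunc (x : R) (k : nat) : (Num.trunc `|x| < k)%N -> `|x| <= k%:R.
Proof.
move=> h; apply: ltW; rewrite (lt_le_trans (truncnS_gt _))// ler_nat.
exact: h.
Qed.

Lemma cube_cover : \bigcup_(k : nat) (cube k%:R) = setT.
Proof.
rewrite -subTset => x _.
exists (\max_(i < n) (Num.trunc `|tnth x i|).+1)%N => //.
apply/cubeE => i; apply: abs_le_trunc.
exact: (leq_bigmax_cond (F := fun i => (Num.trunc `|tnth x i|).+1)).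
Qed.

Lemma measurable_tboxes (A : set T) : measurable A -> (<<s tboxes >>) A.
Proof.
move=> mA; have mid : measurable_fun [set: g_sigma_algebraType tboxes]
    (id : g_sigma_algebraType tboxes -> T).
  apply/measurable_fun_tnthP => i.
  apply: (measurability (@RGenCInfty.G R)) => [|/= _ [_] [r] -> <-].
    exact: RGenCInfty.measurableE.
  rewrite setTI.
  have -> : (fun x => tnth (id x) i) @^-1` `[r, +oo[ =
    \bigcup_(k : nat) tbox [tuple if j == i then r else - k%:R | j < n] [tuple k%:R | j < n].
    apply/seteqP; split=> x /=.
      rewrite in_itv /= andbT => rx.
      have : setT x by []. rewrite -cube_cover => -[k _ /cubeE h].
      exists k => // j; rewrite !tnth_mktuple; have := h j; rewrite ler_norml => /andP[h1 h2].
      by rewrite h2 andbT; case: eqP => // ->.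
    move=> [k _ h]; have := h i; rewrite !tnth_mktuple eqxx in_itv /= andbT.
    by case/andP.
  apply: bigcupT_measurable => k; apply: sub_sigma_algebra.
  by eexists; eexists.
by have := mid measurableT A mA; rewrite setTI.
Qed.

(** Boxes are stable under intersection and generate the product sigma-algebra, and the integer
    cubes exhaust the space with finite measure. A box with some [b] below [a] is empty, so
    agreement is only asked on genuine boxes. *)
Lemma tuple_measure_unique (m1 m2 : {measure set T -> \bar R}) :
  (forall a b : T, (forall i, tnth a i <= tnth b i) -> m1 (tbox a b) = m2 (tbox a b)) ->
  (forall k : nat, (m1 (cube k%:R) < +oo)%E) ->
  forall E, measurable E -> m1 E = m2 E.
Proof.
move=> h f E /measurable_tboxes.
apply: (@g_sigma_algebra_measure_unique _ _ _ tboxes _ (fun k => cube k%:R)) => //.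
- by move=> _ [a [b ->]]; exact: tbox_measurable.
- by move=> k; eexists; eexists.
- exact: cube_cover.
- exact: tbox_setI.
move=> _ [a [b ->]].
have [/h//|] := pselect (forall i, tnth a i <= tnth b i).
move=> /existsNP[i ab]; have -> : tbox a b = set0.
  by rewrite -subset0 => x /(_ i) /andP[h1 h2]; apply: ab; exact: le_trans h1 h2.
by rewrite !measure0.
Qed.

Definition aff (r : R) (v : T) (y : T) : T := [tuple r * tnth y i + tnth v i | i < n].

Lemma tnth_aff r v y i : tnth (aff r v y) i = r * tnth y i + tnth v i.
Proof. by rewrite tnth_mktuple. Qed.

Lemma measurable_aff r v : measurable_fun setT (aff r v).
Proof.
apply/measurable_fun_tnthP => i.
apply: (eq_measurable_fun (fun y : T => r * tnth y i + tnth v i)).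
  by move=> x _; rewrite /= tnth_aff.
apply: measurable_funD; last exact: measurable_cst.
by apply: measurable_funM; [exact: measurable_cst|exact: measurable_tnth].
Qed.

Variables (mu : {measure set T -> \bar R}) (mu_leb : lebesgue_n mu).

Lemma mu_cube k : 0 <= k -> mu (cube k) = ((k *+ 2) ^+ n)%:E.
Proof.
move=> k0; rewrite mu_leb.
  congr EFin; rewrite (eq_bigr (fun=> k *+ 2)); last first.
    by move=> i _; rewrite !tnth_mktuple opprK -mulr2n.
  by rewrite prodr_const card_ord.
by move=> i; rewrite !tnth_mktuple ge0_cp.
Qed.

(** Both sides are measures in [E] that agree on boxes: invariance under translations and the
    scaling law follow from [lebesgue_n] alone. *)
Lemma mu_aff r v E : 0 < r -> measurable E ->
  mu (aff r v @^-1` E) = ((r ^- n)%:E * mu E)%E.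
Proof.
move=> r0; have mphi := measurable_aff r v.
have c0 : 0 <= r ^- n by rewrite invr_ge0 exprn_ge0// ltW.
pose phi_mixin := isMeasurableFun.Build _ _ _ _ _ mphi.
pose phi : {mfun T >-> T} := HB.pack (aff r v) phi_mixin.
pose c' : {nonneg R} := NngNum c0.
have aP a b : aff r v @^-1` tbox a b =
    tbox [tuple r^-1 * (tnth a i - tnth v i) | i < n] [tuple r^-1 * (tnth b i - tnth v i) | i < n].
  apply/seteqP; split=> x /= h i; have := h i; rewrite !tnth_mktuple;
    by rewrite !ler_pdivrMl ?ler_pdivlMl// lerBlDr lerBrDr.
move: E; apply: (@tuple_measure_unique (pushforward mu phi) (mscale c' mu)).
- move=> a b ab; rewrite /= /pushforward /mscale /= aP mu_leb; last first.
    by move=> i; rewrite !tnth_mktuple ler_pM2l ?invr_gt0// lerD2r.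
  rewrite mu_leb// -EFinM; congr EFin.
  rewrite (eq_bigr (fun i => r^-1 * (tnth b i - tnth a i))).
    by rewrite big_split /= prodr_const card_ord exprVn.
  by move=> i _; rewrite !tnth_mktuple; ring.
- move=> k; rewrite /= /pushforward /= aP mu_leb ?ltry//.
  by move=> i; rewrite !tnth_mktuple ler_pM2l ?invr_gt0// lerD2r ge0_cp.
Qed.
End tuple_measure.

Section cmeas_rules.
Variables (R : realType) (d : measure_display) (T : measurableType d).
Local Notation C := (Cx R).
Implicit Types f g : T -> C.

Lemma cmeas_cst (c : C) : cmeas (fun _ : T => c).
Proof. by split; exact: measurable_cst. Qed.

Lemma cmeasD f g : cmeas f -> cmeas g -> cmeas (fun y => f y + g y).
Proof.
move=> [f1 f2] [g1 g2]; split.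
  by apply: (eq_measurable_fun (fun y => complex.Re (f y) + complex.Re (g y)));
    [move=> y _; rewrite cReD|exact: measurable_funD].
by apply: (eq_measurable_fun (fun y => complex.Im (f y) + complex.Im (g y)));
  [move=> y _; rewrite cImD|exact: measurable_funD].
Qed.

Lemma cmeasM f g : cmeas f -> cmeas g -> cmeas (fun y => f y * g y).
Proof.
move=> [f1 f2] [g1 g2]; split.
  apply: (eq_measurable_fun (fun y => complex.Re (f y) * complex.Re (g y) -
     complex.Im (f y) * complex.Im (g y))); first by move=> y _; rewrite cReM.
  by apply: measurable_funB; exact: measurable_funM.
apply: (eq_measurable_fun (fun y => complex.Re (f y) * complex.Im (g y) +
  complex.Im (f y) * complex.Re (g y))); first by move=> y _; rewrite cImM.
by apply: measurable_funD; exact: measurable_funM.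
Qed.

Lemma cmeas_rc (f : T -> R) : measurable_fun setT f -> cmeas (fun y => rc (f y)).
Proof. by move=> mf; split => //=; exact: measurable_cst. Qed.

Lemma cmeas_sum n (f : 'I_n -> T -> C) : (forall i, cmeas (f i)) ->
  cmeas (fun y => \sum_(i < n) f i y).
Proof.
move=> h; elim: n f h => [|n IH] f h.
  by rewrite (_ : (fun y => _) = fun=> 0); [exact: cmeas_cst|apply: funext => y; rewrite big_ord0].
rewrite (_ : (fun y => _) = fun y => f ord0 y + \sum_(i < n) f (lift ord0 i) y).
  by apply: cmeasD => //; exact: IH.
by apply: funext => y; rewrite big_ord_recl.
Qed.

Variable (mu : {measure set T -> \bar R}).

Lemma CIble_bd (D : set T) f M : measurable D -> (mu D < +oo)%E -> cmeas f ->
  (forall y, D y -> cmod (f y) <= M) -> CIble mu D f.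
Proof.
move=> mD fD [f1 f2] hM; split; apply: (@bounded_integrable _ _ _ mu _ mD fD _ M);
  do ?exact: measurable_funTS; move=> y /hM; apply: le_trans;
  [exact: Re_cmod|exact: Im_cmod].
Qed.

Lemma CI_setU (A B : set T) f : measurable A -> measurable B -> [disjoint A & B] ->
  CIble mu (A `|` B) f -> CI mu (A `|` B) f = CI mu A f + CI mu B f.
Proof.
move=> mA mB dAB [f1 f2]; apply: ReIm_eq.
  by rewrite cReD !Re_CI Rintegral_setU.
by rewrite cImD !Im_CI Rintegral_setU.
Qed.

Lemma CI_sub (A B : set T) f : A `<=` B ->
  (forall y, B y -> ~ A y -> f y = 0) -> CI mu B f = CI mu A f.
Proof.
move=> AB f0; rewrite /CI; congr (rc _ + _ * rc _);
  rewrite [LHS]Rintegral_mkcond [RHS]Rintegral_mkcond; congr Rintegral;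
  apply: funext => y; rewrite /patch;
  case: ifPn => [/set_mem By|nB]; case: ifPn => [/set_mem Ay|nA] //.
- by rewrite f0// => Ay; move: nA; rewrite mem_set.
- by move: nB; rewrite mem_set//; exact: AB.
- by rewrite f0// => Ay; move: nA; rewrite mem_set.
- by move: nB; rewrite mem_set//; exact: AB.
Qed.
End cmeas_rules.

Section real_facts.
Variable R : realType.

Lemma onesub_pow (x : R) k : 0 <= x <= 1 -> 0 <= 1 - x ^+ k <= k%:R * (1 - x).
Proof.
move=> /andP[x0 x1]; elim: k => [|k /andP[h1 h2]]; first by rewrite expr0 subrr mul0r lexx.
have xk : 0 <= x ^+ k by rewrite exprn_ge0.
rewrite exprS -[k.+1]addn1 natrD; move: (x ^+ k) xk h1 h2 => p p0 h1 h2.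
have : p <= 1 by lra.
move: (k%:R : R) h2 => q h2 h3; apply/andP; split; nra.
Qed.

(** The second-order expansion of a power at 1, with an explicit constant; it spares all derivatives
    with respect to the radius. *)
Lemma onesub_pow2 (x : R) k : 0 <= x <= 1 ->
  `|1 - x ^+ k - k%:R * (1 - x)| <= (k * k)%:R * (1 - x) ^+ 2.
Proof.
move=> /andP[x0 x1]; elim: k => [|k IH].
  by rewrite expr0 mul0r !subr0 subrr normr0 mul0n mul0r.
have x01 : 0 <= x <= 1 by rewrite x0.
have /andP[h1 h2] := onesub_pow k x01.
have -> : 1 - x ^+ k.+1 - k.+1%:R * (1 - x) =
  (1 - x ^+ k - k%:R * (1 - x)) - (1 - x) * (1 - x ^+ k).
  by rewrite exprS -[k.+1]addn1 natrD; ring.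
apply: le_trans (ler_normB _ _) _.
have x1' : 0 <= 1 - x by lra.
have e : (k.+1 * k.+1)%:R = (k * k)%:R + k%:R + k.+1%:R :> R.
  by rewrite -!natrD; congr (_%:R); lia.
rewrite e; move: IH; set q := 1 - _ - _; move: q => q IH.
have -> : ((k * k)%:R + k%:R + k.+1%:R) * (1 - x) ^+ 2 = (k * k)%:R * (1 - x) ^+ 2 +
  (k%:R + k.+1%:R) * (1 - x) ^+ 2 by ring.
apply: lerD => //.
rewrite normrM !ger0_norm// (le_trans (ler_wpM2l x1' h2))//.
rewrite (_ : (1 - x) * (k%:R * (1 - x)) = k%:R * (1 - x) ^+ 2); last by ring.
by rewrite ler_wpM2r ?exprn_ge0// lerDl.
Qed.

Lemma small_eq0 (w : Cx R) (K : R) :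
  (forall h : R, 0 < h -> h < 1 -> cmod w <= K * h) -> w = 0.
Proof.
move=> H; apply/eqP; rewrite -cmod_eq0; apply/eqP/le_anti; rewrite cmod_ge0 andbT.
apply/ler_addgt0Pr => e e0; rewrite add0r.
pose h := Num.min (1/2) (e / (`|K| + 1)).
have K1 : 0 < `|K| + 1 by rewrite ltr_wpDl.
have h0 : 0 < h by rewrite /h lt_min divr_gt0// divr_gt0.
have h1 : h < 1 by rewrite /h gt_min; apply/orP; left; lra.
apply: le_trans (H h h0 h1) _.
have : h <= e / (`|K| + 1) by rewrite /h ge_min lexx orbT.
rewrite ler_pdivlMr// => h2; apply: le_trans h2.
rewrite mulrC ler_wpM2l// ?(ltW h0)//.
by rewrite (le_trans (ler_norm _))// lerDl.
Qed.
End real_facts.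

(** * The Euclidean ball: volume, dilations and radial weights *)

Section ball.
Variables (R : realType) (n : nat).
Local Notation T := (n.-tuple R).
Local Notation C := (Cx R).
Implicit Types (y : T) (f : T -> C) (r : R).

Definition sqn y : R := \sum_(i < n) tnth y i ^+ 2.
Definition nrm y : R := Num.sqrt (sqn y).

Lemma sqn_ge0 y : 0 <= sqn y.
Proof. by apply: sumr_ge0 => i _; exact: sqr_ge0. Qed.
Lemma nrm_ge0 y : 0 <= nrm y. Proof. exact: sqrtr_ge0. Qed.
Lemma nrm_sqr y : nrm y ^+ 2 = sqn y. Proof. by rewrite sqr_sqrtr// sqn_ge0. Qed.

Lemma coord_nrm y i : `|tnth y i| <= nrm y.
Proof.
rewrite -sqrtr_sqr ler_wsqrtr// /sqn (bigD1 i)//= lerDl.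
by apply: sumr_ge0 => j _; exact: sqr_ge0.
Qed.

Lemma tnth_tscale r y i : tnth (tscale r y) i = r * tnth y i.
Proof. by rewrite tnth_map. Qed.

Lemma sqn_scale r y : sqn (tscale r y) = r ^+ 2 * sqn y.
Proof.
rewrite /sqn mulr_sumr; apply: eq_bigr => i _.
by rewrite tnth_tscale exprMn.
Qed.

Lemma nrm_scale r y : 0 <= r -> nrm (tscale r y) = r * nrm y.
Proof. by move=> r0; rewrite /nrm sqn_scale sqrtrM ?sqr_ge0// sqrtr_sqr ger0_norm. Qed.

Definition oball r : set T := [set y | nrm y < r].

Lemma rballE : @rball R n = oball 1.
Proof.
apply/seteqP; split=> y /=; rewrite /rball /oball /= -/(sqn y) -nrm_sqr => h.
  by rewrite -(ltr_pXn2r (n := 2))// ?nnegrE ?nrm_ge0// expr1n.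
by rewrite expr_lt1// nrm_ge0.
Qed.

Lemma measurable_sqn : measurable_fun setT sqn.
Proof.
apply: measurable_sum => i; apply: measurable_funX; exact: measurable_tnth.
Qed.

Lemma measurable_nrm : measurable_fun setT nrm.
Proof.
apply: (measurableT_comp (f := @Num.sqrt R) (g := sqn)); last exact: measurable_sqn.
by apply: continuous_measurable_fun; exact: sqrt_continuous.
Qed.

Lemma oball_measurable r : measurable (oball r).
Proof.
have -> : oball r = nrm @^-1` `]-oo, r[ by apply/seteqP; split=> y; rewrite /= in_itv.
by rewrite -[X in measurable X]setTI; exact: measurable_nrm.
Qed.

Definition ozero : T := [tuple 0 | i < n].

Lemma aff0 r y : aff r ozero y = tscale r y.
Proof. by apply: eq_from_tnth => i; rewrite tnth_aff tnth_tscale tnth_mktuple addr0. Qed.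

Variables (mu : {measure set T -> \bar R}) (mu_leb : lebesgue_n mu).

Lemma cube_fin k : 0 <= k -> (mu (@cube R n k) < +oo)%E.
Proof. by move=> k0; rewrite mu_cube// ltry. Qed.

Lemma ball_sub_cube r k : r <= k -> oball r `<=` @cube R n k.
Proof.
move=> rk y yr; apply/cubeE => i; apply: le_trans (coord_nrm _ _) _.
by apply: ltW; exact: lt_le_trans rk.
Qed.

Lemma oball_fin r : (mu (oball r) < +oo)%E.
Proof.
apply: (@le_lt_trans _ _ (mu (@cube R n `|r|))); last exact: cube_fin.
apply: le_measure; rewrite ?inE; [exact: oball_measurable|exact: tbox_measurable|].
by apply: ball_sub_cube; exact: ler_norm.
Qed.

Definition vol : R := fine (mu (oball 1)).

Lemma volE : mu (oball 1) = vol%:E.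
Proof. by rewrite fineK// ge0_fin_numE//; exact: oball_fin. Qed.

Lemma vol_gt0 : 0 < vol.
Proof.
have k0 : 0 < (n.+1%:R : R)^-1 by rewrite invr_gt0.
(* A cube of half-side [1 / (n + 1)] fits in the unit ball because [n < (n + 1)^2]. *)
have h : (mu (@cube R n (n.+1%:R)^-1) <= mu (oball 1))%E.
  apply: le_measure; rewrite ?inE; [exact: tbox_measurable|exact: oball_measurable|].
  move=> y /cubeE hy; rewrite -rballE /rball /=.
  apply: (@le_lt_trans _ _ (\sum_(i < n) (n.+1%:R : R)^-1 ^+ 2)).
    by apply: ler_sum => i _; rewrite -[leLHS]real_normK ?num_real// lerXn2r ?nnegrE// ltW.
  rewrite sumr_const card_ord -[_ *+ n]mulr_natl exprVn ltr_pdivrMr ?exprn_gt0//.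
  by rewrite mul1r -natrX ltr_nat; nia.
rewrite -lte_fin -volE; apply: lt_le_trans h.
by rewrite mu_cube ?(ltW k0)// lte_fin exprn_gt0// pmulrn_rgt0.
Qed.

Lemma mu_ball r : 0 < r -> fine (mu (oball r)) = r ^+ n * vol.
Proof.
move=> r0; have := mu_aff mu_leb ozero r0 (oball_measurable r).
have -> : aff r ozero @^-1` oball r = oball 1.
  apply/seteqP; split=> y; rewrite /= /oball /= aff0 nrm_scale ?(ltW r0)//.
    by rewrite -ltr_pdivlMl// mulVf// gt_eqF.
  by rewrite -ltr_pdivlMl// mulVf// gt_eqF.
rewrite volE => /(congr1 (fun x => (r ^+ n)%:E * x)%E).
have rn : r ^+ n != 0 by rewrite expf_neq0// gt_eqF.
by rewrite (muleA (r ^+ n)%:E (r ^- n)%:E) -[((r ^+ n)%:E * (r ^- n)%:E)%E]EFinM (mulfV rn) mul1e => <-; rewrite -EFinM.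
Qed.

Lemma CI_ball_scale r f M : 0 < r -> cmeas f ->
  (forall y, oball r y -> cmod (f y) <= M) ->
  CI mu (oball r) f = rc (r ^+ n) * CI mu (oball 1) (fun y => f (tscale r y)).
Proof.
move=> r0 mf hM.
have H := @CI_transfer R _ _ T T (aff r ozero) (measurable_aff r ozero) mu mu
  (r ^- n) _ (oball r) (oball_measurable r) _ (oball_fin r) f M mf hM.
have e : aff r ozero @^-1` oball r = oball 1.
  apply/seteqP; split=> y; rewrite /= /oball /= aff0 nrm_scale ?(ltW r0)//.
    by rewrite -ltr_pdivlMl// mulVf// gt_eqF.
  by rewrite -ltr_pdivlMl// mulVf// gt_eqF.
rewrite (_ : (fun y => _) = f \o aff r ozero); last first.
  by apply: funext => y; rewrite /= aff0.
rewrite -e H.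
- by rewrite mulrA -rcM mulfV ?expf_neq0 ?gt_eqF// rc1 mul1r.
- by rewrite invr_ge0 exprn_ge0// ltW.
- by move=> A mA _; exact: mu_aff.
Qed.

Lemma cmeas_nrm m : cmeas (fun y : T => rc (nrm y ^+ m)).
Proof. by apply: cmeas_rc; apply: measurable_funX; exact: measurable_nrm. Qed.

Lemma nrm_pow_le r y m : oball r y -> nrm y ^+ m <= r ^+ m.
Proof.
by move=> yr; rewrite lerXn2r ?nnegrE ?nrm_ge0// ?(ltW yr)// (le_trans (nrm_ge0 y))// ltW.
Qed.

Lemma nrm_pow_le1 y m : oball 1 y -> nrm y ^+ m <= 1.
Proof. by move=> /(nrm_pow_le m); rewrite expr1n. Qed.

(** Dividing the balance equation by [1 - r] and letting [r] tend to 1 would give [N X = m t0]; this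
    is the quantitative form that [small_eq0] can exploit. *)
Lemma shell_alg (X t0 E : C) (r M : R) (N m : nat) : 0 < r -> r < 1 -> 0 <= M ->
  rc (1 - r ^+ N) * X = rc (1 - r ^+ m) * t0 + E ->
  cmod E <= M * (1 - r) ^+ 2 ->
  cmod (N%:R * X - m%:R * t0) <= ((N * N)%:R * cmod X + (m * m)%:R * cmod t0 + M) * (1 - r).
Proof.
move=> r0 r1 M0 H hE.
have r01 : 0 <= r <= 1 by lra.
have hr : 0 < 1 - r by lra.
rewrite -(ler_pM2l hr) -[1 - r in leLHS]ger0_norm ?(ltW hr)// -cmod_rc -cmodM.
have -> : rc (1 - r) * (N%:R * X - m%:R * t0) =
   E - (rc (1 - r ^+ N - N%:R * (1 - r)) * X - rc (1 - r ^+ m - m%:R * (1 - r)) * t0).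
  have -> : E = rc (1 - r ^+ N) * X - rc (1 - r ^+ m) * t0 by rewrite H addrAC subrr add0r.
  by rewrite !rcB !rcM !rc_nat !rcB; ring.
apply: le_trans (cmodB _ _) _.
apply: le_trans (lerD hE (cmodB _ _)) _.
rewrite !cmodM !cmod_rc.
have h1 := ler_wpM2r (cmod_ge0 X) (onesub_pow2 N r01).
have h2 := ler_wpM2r (cmod_ge0 t0) (onesub_pow2 m r01).
move: h1 h2; move: (`|_| * _) (`|_| * _) => u v h1 h2.
rewrite (_ : (1 - r) * _ = (N * N)%:R * (1 - r) ^+ 2 * cmod X +
  (m * m)%:R * (1 - r) ^+ 2 * cmod t0 + M * (1 - r) ^+ 2); last by ring.
by rewrite addrC lerD2r lerD.
Qed.

(* Splitting the integral of [(r^m - |y|^m) f] over the unit ball into the ball of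
   radius [r] (evaluated by scaling) and a shell (of second order in [1 - r]). *)
Lemma shell f M a m : cmeas f -> (forall y, oball 1 y -> cmod (f y) <= M) ->
  (forall r y, 0 < r -> r < 1 -> oball 1 y -> f (tscale r y) = rc (r ^+ a) * f y) ->
  (n + m + a)%:R * (CI mu (oball 1) f - CI mu (oball 1) (fun y => rc (nrm y ^+ m) * f y)) =
  m%:R * CI mu (oball 1) f.
Proof.
move=> mf hM hf.
have M0 : 0 <= M.
  have b0 : oball 1 (ozero).
    rewrite /oball /= /nrm /sqn big1 ?sqrtr0// => i _; by rewrite tnth_mktuple expr0n.
  exact: le_trans (cmod_ge0 _) (hM _ b0).
have mB := oball_measurable; have fB := oball_fin.
set t0 := CI mu (oball 1) f; set tm := CI _ _ _.
have if0 : CIble mu (oball 1) f by exact: (CIble_bd (M := M)).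
have ifm : CIble mu (oball 1) (fun y => rc (nrm y ^+ m) * f y).
  apply: (CIble_bd (M := M)) => //; first exact: cmeasM (cmeas_nrm m) mf.
  move=> y y1; rewrite cmodM cmod_rc ger0_norm ?exprn_ge0 ?nrm_ge0//.
  rewrite -[leRHS]mul1r ler_pM ?exprn_ge0 ?nrm_ge0 ?cmod_ge0//; last exact: hM.
  exact: nrm_pow_le1.
apply/eqP; rewrite -subr_eq0; apply/eqP.
apply: (@small_eq0 _ _ (((n + m + a) * (n + m + a))%:R * cmod (t0 - tm) + (m * m)%:R * cmod t0
  + 2 * (m%:R * M) * (n%:R * vol))) => h h0 h1.
pose r := 1 - h; have r0 : 0 < r by rewrite /r; lra.
have r1 : r < 1 by rewrite /r; lra.
have r01 : 0 <= r <= 1 by rewrite !ltW.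
rewrite (_ : h = 1 - r); last by rewrite /r; ring.
pose g y := rc (r ^+ m - nrm y ^+ m) * f y.
have mg : cmeas g.
  apply: cmeasM mf; apply: cmeas_rc; apply: measurable_funB; first exact: measurable_cst.
  by apply: measurable_funX; exact: measurable_nrm.
have gE : g = fun y => rc (r ^+ m) * f y - rc (nrm y ^+ m) * f y.
  by apply: funext => y; rewrite /g rcB mulrBl.
have ig : CI mu (oball 1) g = rc (r ^+ m) * t0 - tm.
  rewrite gE CI_B//; last exact: CIbleZ.
  by rewrite CI_Z.
have igb : CIble mu (oball 1) g by rewrite gE; apply: CIbleB => //; exact: CIbleZ.
pose S := oball 1 `\` oball r.
have mS : measurable S by apply: measurableD; exact: mB.
have BS : oball 1 = oball r `|` S.
  by rewrite /S setDUK// => y yr; exact: lt_trans yr r1.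
have e1 : CI mu (oball 1) g = CI mu (oball r) g + CI mu S g.
  have dS : [disjoint oball r & S] by apply/disj_setPS => y [h2 []].
  have h2 := @CI_setU _ _ _ mu (oball r) S g (mB r) mS dS.
  by rewrite {1}BS h2// -BS.
have Br_sub : oball r `<=` oball 1 by move=> y /lt_trans; apply.
have e2 : CI mu (oball r) g = rc (r ^+ (n + m + a)) * (t0 - tm).
  rewrite (@CI_ball_scale r g M)//; last first.
    move=> y yr; rewrite /g cmodM cmod_rc -[leRHS]mul1r ler_pM ?cmod_ge0//.
      have h2 := nrm_pow_le m yr.
      rewrite ger0_norm ?subr_ge0// lerBlDr (le_trans (_ : _ <= 1))//.
        by have := onesub_pow m r01; lra.
      by rewrite lerDl exprn_ge0// nrm_ge0.
    by apply: hM; exact: Br_sub.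
  rewrite (_ : CI _ _ _ = rc (r ^+ (m + a)) * (t0 - tm)).
    by rewrite mulrA -rcM -exprD addnA.
  rewrite -CI_B// -CI_Z//; last exact: CIbleB.
  apply: eq_CI => y y1; rewrite /g hf// nrm_scale ?(ltW r0)// exprMn exprD.
  by rewrite !rcB !rcM; ring.
(* Two factors of order [1 - r] meet here: the volume of the shell and the weight
   [r ^+ m - nrm y ^+ m] on it. *)
have e3 : cmod (CI mu S g) <= (2 * (m%:R * M) * (n%:R * vol)) * (1 - r) ^+ 2.
  have hs : fine (mu S) = (1 - r ^+ n) * vol.
    rewrite /S (measureD (mB 1) (mB r) (fB 1)).
    rewrite setIidr// fineB ?ge0_fin_numE//; [|exact: fB|exact: fB].
    by rewrite (mu_ball r0) -/vol mulrBl mul1r.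
  have gS y : S y -> cmod (g y) <= m%:R * (1 - r) * M.
    move=> [y1 /negP]; rewrite /oball /= -leNgt => yr.
    rewrite /g cmodM cmod_rc ler_pM ?cmod_ge0//; last exact: hM.
    have h2 : r ^+ m <= nrm y ^+ m by rewrite lerXn2r ?nnegrE ?nrm_ge0// ltW.
    have h3 := nrm_pow_le1 m y1; have /andP[_ h4] := onesub_pow m r01.
    rewrite ler0_norm ?subr_le0// opprB; apply: le_trans h4.
    by rewrite lerD2r.
  apply: le_trans (@CI_bound R _ _ mu S mS _ g (m%:R * (1 - r) * M) _ gS) _ => //.
  - apply: le_lt_trans (fB 1); apply: le_measure; rewrite ?inE//.
    by move=> y [].
  - apply: (CIble_bd (M := m%:R * (1 - r) * M)) => //.
    apply: le_lt_trans (fB 1); apply: le_measure; rewrite ?inE//; by move=> y [].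
  rewrite hs; have /andP[h2 h3] := onesub_pow n r01.
  have hr : 0 <= 1 - r by rewrite subr_ge0 ltW.
  have K0 : 0 <= 2 * (m%:R * (1 - r) * M) by rewrite !mulr_ge0.
  apply: le_trans (ler_wpM2l K0 (ler_wpM2r (ltW vol_gt0) h3)) _.
  rewrite le_eqVlt; apply/orP; left; apply/eqP; ring.
have K0 : 0 <= 2 * (m%:R * M) * (n%:R * vol) by rewrite !mulr_ge0// ltW// vol_gt0.
apply: (@shell_alg (t0 - tm) t0 (CI mu S g) r _ (n + m + a) m r0 r1 K0).
  have e4 : CI mu S g = rc (r ^+ m) * t0 - tm - rc (r ^+ (n + m + a)) * (t0 - tm).
    by rewrite -ig -e2 e1 addrAC subrr add0r.
  by rewrite e4 !rcB !rc1; ring.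
exact: e3.
Qed.
End ball.

Section CI_sum_ord.
Variables (R : realType) (d : measure_display) (T : measurableType d).
Variables (mu : {measure set T -> \bar R}) (D : set T) (mD : measurable D).

Lemma CI_sum_ord m (f : 'I_m -> T -> Cx R) : (forall j, CIble mu D (f j)) ->
  CIble mu D (fun y => \sum_(j < m) f j y) /\
  CI mu D (fun y => \sum_(j < m) f j y) = \sum_(j < m) CI mu D (f j).
Proof.
elim: m f => [|m IH] f h.
  rewrite big_ord0 (_ : (fun y => _) = fun=> 0); last by apply: funext => y; rewrite big_ord0.
  by split; [exact: CIble0|exact: CI0].
have [i1 i2] := IH (fun j => f (lift ord0 j)) (fun j => h (lift ord0 j)).
rewrite (_ : (fun y => _) = fun y => f ord0 y + \sum_(j < m) f (lift ord0 j) y); last first.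
  by apply: funext => y; rewrite big_ord_recl.
by split; [exact: CIbleD|rewrite CI_D// i2 big_ord_recl].
Qed.
End CI_sum_ord.

(** * Integration by parts and moments of the ball *)

Section ibp.
Variables (R : realType) (n : nat).
Local Notation T := (n.-tuple R).
Local Notation C := (Cx R).
Implicit Types (y : T) (p q f : T -> C) (r h : R) (i j : 'I_n).

Definition shift i h : T -> T := aff 1 [tuple if j == i then h else 0 | j < n].

Lemma tnth_shift i h y j : tnth (shift i h y) j = tnth y j + (if j == i then h else 0).
Proof. by rewrite tnth_aff mul1r tnth_mktuple. Qed.

(* [q] is the [i]-th partial derivative of [p] on a cube, up to a uniform second-order remainder. *)
Definition nice i p q : Prop := exists K : R, forall y h, @cube R n 2 y -> `|h| <= 1 ->
  [/\ cmod (p y) <= K, cmod (q y) <= K &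
      cmod (p (shift i h y) - p y - rc h * q y) <= K * h ^+ 2].

Lemma nice_ext i p q p' q' : nice i p q -> (forall y, p y = p' y) -> (forall y, q y = q' y) -> nice i p' q'.
Proof. by move=> + /funext <- /funext <-. Qed.

Lemma nice_cst i (c : C) : nice i (fun=> c) (fun=> 0).
Proof.
exists (cmod c) => y h _ _; split=> //; first by rewrite cmod0 cmod_ge0.
by rewrite subrr mulr0 subr0 cmod0 mulr_ge0 ?cmod_ge0// sqr_ge0.
Qed.

Lemma niceD i p q p' q' : nice i p q -> nice i p' q' ->
  nice i (fun y => p y + p' y) (fun y => q y + q' y).
Proof.
move=> [K1 h1] [K2 h2]; exists (K1 + K2) => y h yq hh.
have [a1 a2 a3] := h1 y h yq hh; have [b1 b2 b3] := h2 y h yq hh.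
split; [by rewrite (le_trans (cmodD _ _))// lerD|by rewrite (le_trans (cmodD _ _))// lerD|].
rewrite [X in cmod X](_ : _ = (p (shift i h y) - p y - rc h * q y) +
  (p' (shift i h y) - p' y - rc h * q' y)); last by ring.
by rewrite mulrDl (le_trans (cmodD _ _))// lerD.
Qed.

Lemma nice_mul_alg (a b c d hh u v e f : C) (K L h : R) : cmod hh = h -> h <= 1 ->
  cmod a <= K -> cmod b <= L -> cmod c <= K -> cmod d <= L ->
  cmod e <= K * h ^+ 2 -> cmod f <= L * h ^+ 2 ->
  u - a - hh * c = e -> v - b - hh * d = f ->
  cmod (u * v - a * b - hh * (c * b + a * d)) <= 9 * (K * L) * h ^+ 2.
Proof.
move=> hE h1 ha hb hc hd he hf hu hv.
have -> : u * v - a * b - hh * (c * b + a * d) =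
  e * (b + hh * d + f) + (a + hh * c) * f + hh * hh * (c * d).
  have -> : u = e + a + hh * c by rewrite -hu; ring.
  have -> : v = f + b + hh * d by rewrite -hv; ring.
  ring.
have h0 : 0 <= h by rewrite -hE cmod_ge0.
have K0 : 0 <= K by exact: le_trans (cmod_ge0 _) ha.
have L0 : 0 <= L by exact: le_trans (cmod_ge0 _) hb.
have hh2 : h ^+ 2 <= 1 by rewrite expr_le1.
have s1 : cmod (hh * d) <= L.
  by rewrite cmodM hE -[leRHS]mul1r ler_pM ?cmod_ge0.
have s2 : cmod (hh * c) <= K.
  by rewrite cmodM hE -[leRHS]mul1r ler_pM ?cmod_ge0.
have s3 : cmod f <= L.
  by apply: le_trans hf _; rewrite -[leRHS]mulr1 ler_wpM2l.
have t1 : cmod (b + hh * d + f) <= 3 * L.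
  have := cmodD (b + hh * d) f; have := cmodD b (hh * d); lra.
have t2 : cmod (a + hh * c) <= 2 * K by have := cmodD a (hh * c); lra.
have q1 : cmod (e * (b + hh * d + f)) <= K * h ^+ 2 * (3 * L).
  by rewrite cmodM ler_pM ?cmod_ge0.
have q2 : cmod ((a + hh * c) * f) <= 2 * K * (L * h ^+ 2).
  by rewrite cmodM ler_pM ?cmod_ge0.
have q3 : cmod (hh * hh * (c * d)) <= h * h * (K * L).
  by rewrite 3!cmodM hE ler_pM ?mulr_ge0 ?cmod_ge0// ler_pM ?cmod_ge0.
have t3 := cmodD (e * (b + hh * d + f) + (a + hh * c) * f) (hh * hh * (c * d)).
have t4 := cmodD (e * (b + hh * d + f)) ((a + hh * c) * f).
have KL : 0 <= K * L * h ^+ 2 by rewrite !mulr_ge0.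
apply: le_trans t3 _; apply: le_trans (lerD t4 (lexx _)) _.
apply: le_trans (lerD (lerD q1 q2) q3) _.
rewrite (_ : K * h ^+ 2 * (3 * L) + 2 * K * (L * h ^+ 2) + h * h * (K * L) =
  6 * (K * L * h ^+ 2)); last by ring.
rewrite -[9 * _ * _]mulrA ler_wpM2r//; lra.
Qed.

Lemma niceM i p q p' q' : nice i p q -> nice i p' q' ->
  nice i (fun y => p y * p' y) (fun y => q y * p' y + p y * q' y).
Proof.
move=> [K1 h1] [K2 h2]; exists (9 * (K1 * K2)) => y h yq hh.
have [a1 a2 a3] := h1 y h yq hh; have [b1 b2 b3] := h2 y h yq hh.
have K0 : 0 <= K1 by exact: le_trans (cmod_ge0 _) a1.
have L0 : 0 <= K2 by exact: le_trans (cmod_ge0 _) b1.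
have KL : 0 <= K1 * K2 by rewrite mulr_ge0.
split.
- rewrite cmodM (le_trans (ler_pM (cmod_ge0 _) (cmod_ge0 _) a1 b1))//; lra.
- rewrite (le_trans (cmodD _ _))// 2!cmodM.
  have := ler_pM (cmod_ge0 _) (cmod_ge0 _) a2 b1.
  have := ler_pM (cmod_ge0 _) (cmod_ge0 _) a1 b2; lra.
- rewrite -(real_normK (num_real h)).
  rewrite -(real_normK (num_real h)) in a3 b3.
  exact: (nice_mul_alg (cmod_rc h) hh a1 b1 a2 b2 a3 b3 (erefl _) (erefl _)).
Qed.

Lemma nice_sum i m (p q : 'I_m -> T -> C) : (forall j : 'I_m, nice i (p j) (q j)) ->
  nice i (fun y => \sum_(j < m) p j y) (fun y => \sum_(j < m) q j y).
Proof.
elim: m p q => [|m IH] p q H.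
  by apply: nice_ext (nice_cst i 0) _ _ => y; rewrite big_ord0.
have := niceD (H ord0) (IH (fun k : 'I_m => p (lift ord0 k)) (fun k : 'I_m => q (lift ord0 k))
  (fun k : 'I_m => H (lift ord0 k))).
by move=> /nice_ext; apply=> y; rewrite big_ord_recl.
Qed.

Lemma nice_coord i j : nice i (fun y => rc (tnth y j)) (fun=> (j == i)%:R).
Proof.
exists 2 => y h /cubeE hy hh; split.
- by rewrite cmod_rc.
- by case: (j == i); rewrite ?cmod1 ?cmod0 ?ler1n.
- rewrite tnth_shift rcD (addrC (rc (tnth y j))) addrK; case: (j == i);
  by rewrite ?mulr1 ?mulr0 ?rc0 subrr cmod0 mulr_ge0// sqr_ge0.
Qed.

Lemma sqn_shift i h y : sqn (shift i h y) = sqn y + 2 * h * tnth y i + h ^+ 2.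
Proof.
rewrite /sqn (bigD1 i)//= [in RHS](bigD1 i)//= tnth_shift eqxx.
rewrite (eq_bigr (fun j => tnth y j ^+ 2)); first by ring.
by move=> j /negbTE ji; rewrite tnth_shift ji addr0.
Qed.

(* The square of [wgt] vanishes to second order on the unit sphere, so integrations by parts
   against it have no boundary term. *)
Definition wgt y : R := Num.max 0 (1 - sqn y).

Lemma max0_sqr (s d : R) :
  `|Num.max 0 (s + d) ^+ 2 - Num.max 0 s ^+ 2 - 2 * Num.max 0 s * d| <= d ^+ 2.
Proof.
have [h1|h1] := leP 0 s; have [h2|h2] := leP 0 (s + d).
- rewrite (_ : _ - _ = d ^+ 2); last by ring.
  by rewrite ger0_norm// sqr_ge0.
- rewrite ler_norml; apply/andP; split; nra.
- rewrite ler_norml; apply/andP; split; nra.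
- by rewrite expr0n /= mulr0 mul0r !subrr normr0 sqr_ge0.
Qed.

Lemma wgt_le1 y : 0 <= wgt y <= 1.
Proof. by rewrite /wgt le_max lexx ge_max ler01 /= lerBlDr lerDl sqn_ge0. Qed.

(** The square of a positive part is differentiable up to the square of the increment ([max0_sqr]).
    For [y] in the cube and [h] at most 1, the increment of [sqn] is at most [5 |h|]; this gives
    [25 h^2], and its own quadratic part adds [2 h^2]. The value 50 is a comfortable common
    bound. *)
Lemma nice_wgt i : nice i (fun y => rc (wgt y ^+ 2)) (fun y => rc (- 4 * tnth y i * wgt y)).
Proof.
exists 50 => y h /cubeE hy hh; have /andP[w0 w1] := wgt_le1 y; split.
- rewrite cmod_rc ger0_norm ?sqr_ge0//; nra.
- rewrite cmod_rc !normrM (ger0_norm w0) normrN normr_nat.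
  by have := hy i; have := normr_ge0 (tnth y i); nra.
- rewrite -rcM -!rcB cmod_rc {1}/wgt sqn_shift.
  have -> : 1 - (sqn y + 2 * h * tnth y i + h ^+ 2) = (1 - sqn y) + (- 2 * h * tnth y i - h ^+ 2).
    by ring.
  have H := max0_sqr (1 - sqn y) (- 2 * h * tnth y i - h ^+ 2).
  have hi := hy i; rewrite -/(wgt y) in H.
  move: H; move: (Num.max _ _ ^+ 2) => A H.
  rewrite (_ : A - _ - _ = (A - wgt y ^+ 2 - 2 * wgt y * (- 2 * h * tnth y i - h ^+ 2))
    - 2 * wgt y * h ^+ 2); last by ring.
  apply: le_trans (ler_normB _ _) _; apply: le_trans (lerD H (lexx _)) _.
  rewrite [`|2 * _ * _|]ger0_norm; last by apply: mulr_ge0; [exact: mulr_ge0|exact: sqr_ge0].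
  have h2 : 0 <= h ^+ 2 by exact: sqr_ge0.
  have -> : (- 2 * h * tnth y i - h ^+ 2) ^+ 2 = h ^+ 2 * (2 * tnth y i + h) ^+ 2 by ring.
  have : (2 * tnth y i + h) ^+ 2 <= 25.
    move: hi hh; rewrite !ler_norml => /andP[? ?] /andP[? ?]; nra.
  move: ((2 * tnth y i + h) ^+ 2) => B hB.
  have : h ^+ 2 * B <= h ^+ 2 * 25 by rewrite ler_wpM2l.
  have : 2 * wgt y * h ^+ 2 <= 2 * h ^+ 2 by rewrite ler_wpM2r//; lra.
  by lra.
Qed.

Variables (mu : {measure set T -> \bar R}) (mu_leb : lebesgue_n mu).
Local Notation "<< f >>B" := (CI mu (@oball R n 1) f).

Lemma nice_bound i p q : nice i p q -> exists K : R, forall y, oball 1 y -> cmod (p y) <= K /\ cmod (q y) <= K.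
Proof.
move=> [K hK]; exists K => y yb.
have yc : @cube R n 2 y by apply: ball_sub_cube yb; lra.
by have [] := hK y 0 yc; rewrite ?normr0.
Qed.

(** A translation by [h] along the axis [i] leaves the integral of [p] unchanged, while the
    integrand changes by [h q] up to order [h^2]; hence the integral of [q] is of order [h].
    Supports in the unit ball stay inside the cube of half-side 2 under these shifts. *)
Lemma ibp i p q : cmeas p -> cmeas q -> nice i p q ->
  (forall y, ~ oball 1 y -> p y = 0) -> (forall y, ~ oball 1 y -> q y = 0) -> << q >>B = 0.
Proof.
move=> mp mq [K hK] p0 q0.
have Q2 : (mu (@cube R n 2) < +oo)%E by exact: cube_fin.
have mQ : measurable (@cube R n 2) by exact: tbox_measurable.
have bQ : oball 1 `<=` @cube R n 2 by apply: ball_sub_cube; lra.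
rewrite -(CI_sub mu bQ (fun y _ => @q0 y)).
apply: (@small_eq0 _ _ (2 * K * fine (mu (@cube R n 2)))) => h h0 h1.
have hh : `|h| <= 1 by rewrite ger0_norm ltW.
have K0 : 0 <= K.
  have y0 : @cube R n 2 (ozero R n) by apply/cubeE => j; rewrite tnth_mktuple normr0.
  by have [/(le_trans (cmod_ge0 _))] := hK _ h y0 hh.
have msh := @measurable_aff R n 1 [tuple if j == i then h else 0 | j < n].
have pb y : oball 1 y -> cmod (p y) <= K by move=> /bQ /hK /(_ hh)[].
have mps : cmeas (p \o shift i h).
  by case: mp => m1 m2; split; [exact: (measurableT_comp m1 msh)|exact: (measurableT_comp m2 msh)].
have shQ : shift i h @^-1` oball 1 `<=` @cube R n 2.
  move=> y yb; apply/cubeE => j; have := coord_nrm (shift i h y) j.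
  rewrite tnth_shift; move: yb; rewrite /oball /= => yb yj.
  have : `|tnth y j + (if j == i then h else 0)| <= 1 by exact: le_trans yj (ltW yb).
  by case: (j == i); rewrite !ler_norml => /andP[? ?]; apply/andP; split; lra.
have e1 : CI mu (@cube R n 2) (p \o shift i h) = CI mu (@cube R n 2) p.
  rewrite (CI_sub mu shQ); last by move=> y _ /p0.
  rewrite (CI_sub mu bQ (fun y _ => @p0 y)).
  rewrite (@CI_transfer R _ _ T T _ msh mu mu 1 _ _ (oball_measurable 1) _ (oball_fin mu_leb 1) p K mp pb)//.
    by rewrite rc1 mul1r.
  by move=> A mA _; rewrite mu_aff// expr1n invr1.
have ip : CIble mu (@cube R n 2) p.
  by apply: (CIble_bd (M := K)) => // y yQ; have [] := hK y h yQ hh.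
have iq : CIble mu (@cube R n 2) q.
  by apply: (CIble_bd (M := K)) => // y yQ; have [] := hK y h yQ hh.
have ips : CIble mu (@cube R n 2) (p \o shift i h).
  apply: (CIble_bd (M := 3 * K)) => // y yQ; have [b1 b2 b3] := hK y h yQ hh.
  rewrite (_ : (p \o shift i h) y = (p (shift i h y) - p y - rc h * q y) + (p y + rc h * q y)); last first.
    by rewrite /=; ring.
  have h2 : K * h ^+ 2 <= K by rewrite -[leRHS]mulr1 ler_wpM2l// expr_le1// ltW.
  have : cmod (rc h * q y) <= K by rewrite cmodM cmod_rc -[leRHS]mul1r ler_pM ?cmod_ge0.
  have := cmodD (p (shift i h y) - p y - rc h * q y) (p y + rc h * q y).
  have := cmodD (p y) (rc h * q y); lra.
pose rem y := (p \o shift i h) y - p y - rc h * q y.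
have irem : CIble mu (@cube R n 2) rem.
  by apply: CIbleB => //; [exact: CIbleB|exact: CIbleZ].
have e2 : CI mu (@cube R n 2) rem = - (rc h * CI mu (@cube R n 2) q).
  rewrite CI_B//; [|exact: CIbleB|exact: CIbleZ].
  by rewrite CI_B// e1 subrr sub0r CI_Z.
have b : cmod (CI mu (@cube R n 2) rem) <= 2 * (K * h ^+ 2) * fine (mu (@cube R n 2)).
  by apply: CI_bound => // y yQ; have [] := hK y h yQ hh.
rewrite -(ler_pM2l h0) -{1}(ger0_norm (ltW h0)) -cmod_rc -cmodM -cmodN -e2.
by apply: le_trans b _; rewrite le_eqVlt; apply/orP; left; apply/eqP; ring.
Qed.

Definition homog p k := forall r y, 0 < r -> r < 1 -> oball 1 y ->
  p (tscale r y) = rc (r ^+ k) * p y.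

(** Elimination: [a], [a2], [a4] are the integrals of [q] against 1, [|y|^2], [|y|^4], and [b], [b2]
    those of [y_i p] against 1, [|y|^2]. The relations with factors [N + 2] and [N + 4] come from
    [shell], the remaining one from integrating by parts against [(1 - |y|^2)^2]. *)
Lemma ibp_moment_alg (a a2 a4 b b2 N : C) : N + 2 != 0 -> N + 4 != 0 ->
  (N + 2) * (a - a2) = 2 * a -> (N + 4) * (a - a4) = 4 * a ->
  (N + 4) * (b - b2) = 2 * b -> a - 2 * a2 + a4 = 4 * (b - b2) -> a = (N + 2) * b.
Proof.
move=> n2 n4 h1 h2 h3 h4.
have e1 : a - a2 = 2 * a / (N + 2) by rewrite -h1 mulrC mulKf.
have e2 : a - a4 = 4 * a / (N + 4) by rewrite -h2 mulrC mulKf.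
have e3 : b - b2 = 2 * b / (N + 4) by rewrite -h3 mulrC mulKf.
have e4 : 2 * (2 * a / (N + 2)) - 4 * a / (N + 4) = 4 * (2 * b / (N + 4)).
  by rewrite -e1 -e2 -e3 -h4; ring.
have e5 : 8 * a / ((N + 2) * (N + 4)) = 8 * ((N + 2) * b) / ((N + 2) * (N + 4)).
  transitivity (2 * (2 * a / (N + 2)) - 4 * a / (N + 4)).
    by field; rewrite n2 n4.
  by rewrite e4; field; rewrite n2 n4.
move: e5 => /(mulIf _) e5.
have n0 : ((N + 2) * (N + 4))^-1 != 0 by rewrite invr_neq0// mulf_neq0.
have /(mulfI _) e6 := e5 n0; apply: e6.
by rewrite (_ : 8 = rc 8) ?rc_nat// rc_eq0 pnatr_eq0.
Qed.
(** This is Gauss's formula on the ball in disguise: the flux term is the sphere integral of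
    [y_i p], which has degree [k + 1] and so equals [n + k + 1] times the ball integral. The weight
    [wgt] replaces the flux. The second alternative covers constants [p], whose derivative has no
    degree [k - 1]. *)
Lemma ibp_moment i p q k k' : cmeas p -> cmeas q -> nice i p q ->
  homog p k -> homog q k' -> k = k'.+1 \/ (forall y, q y = 0) ->
  << q >>B = (n + k.+1)%:R * << (fun y => rc (tnth y i) * p y) >>B.
Proof.
move=> mp mq npq hp hq hk.
have [M hM] := nice_bound npq.
have mB := @oball_measurable R n; have fB := oball_fin mu_leb.
pose P y := rc (wgt y ^+ 2) * p y.
pose Q y := rc (- 4 * tnth y i * wgt y) * p y + rc (wgt y ^+ 2) * q y.
have mw : measurable_fun setT (wgt : T -> R).
  apply: measurable_maxr; first exact: measurable_cst.
  by apply: measurable_funB; [exact: measurable_cst|exact: measurable_sqn].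
have mco : cmeas (fun y : T => rc (tnth y i)) by apply: cmeas_rc; exact: measurable_tnth.
have wgt0 y : ~ oball 1 y -> wgt y = 0.
  move=> /negP; rewrite /oball /= -leNgt => h; apply/max_idPl.
  by rewrite subr_le0 -nrm_sqr expr_ge1 ?nrm_ge0.
have mP : cmeas P by apply: cmeasM mp; apply: cmeas_rc; exact: measurable_funX.
have mQ : cmeas Q.
  apply: cmeasD; last by apply: cmeasM mq; apply: cmeas_rc; exact: measurable_funX.
  apply: cmeasM mp; apply: cmeas_rc; apply: measurable_funM mw.
  apply: measurable_funM; [exact: measurable_cst|exact: measurable_tnth].
have H := ibp mP mQ (niceM (nice_wgt i) npq).
have {}H : << Q >>B = 0.
  by apply: H => y /wgt0; rewrite /P /Q => ->; rewrite expr0n /= ?mulr0 rc0 !mul0r ?addr0.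
pose nq m y := rc (nrm y ^+ m) * q y.
pose np m y := rc (nrm y ^+ m) * (rc (tnth y i) * p y).
have M0 : 0 <= M.
  apply: le_trans (cmod_ge0 _) (hM (ozero R n) _).1.
  rewrite /oball /= /nrm /sqn big1 ?sqrtr0// => j _; by rewrite tnth_mktuple expr0n.
have yp y : oball 1 y -> cmod (rc (tnth y i) * p y) <= M.
  move=> y1; rewrite cmodM cmod_rc -[leRHS]mul1r ler_pM ?cmod_ge0 ?(hM _ y1).1//.
  exact: le_trans (coord_nrm _ _) (ltW y1).
have yq y : oball 1 y -> cmod (q y) <= M by move=> /hM[].
have inrm m (f : T -> C) : cmeas f -> (forall y, oball 1 y -> cmod (f y) <= M) ->
    CIble mu (oball 1) (fun y => rc (nrm y ^+ m) * f y).
  move=> mf hf; apply: (CIble_bd (M := M)) => //.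
    by apply: cmeasM mf; exact: cmeas_nrm.
  move=> y y1; rewrite cmodM cmod_rc -[leRHS]mul1r ler_pM ?cmod_ge0 ?hf//.
  by rewrite ger0_norm ?exprn_ge0 ?nrm_ge0// nrm_pow_le1.
have mpi := cmeasM mco mp.
have iq m : CIble mu (oball 1) (nq m) by exact: inrm.
have ip m : CIble mu (oball 1) (np m) by exact: inrm.
have q0 : << q >>B = << nq 0%N >>B by apply: eq_CI => y _; rewrite /nq expr0 rc1 mul1r.
have p0 : << (fun y => rc (tnth y i) * p y) >>B = << np 0%N >>B.
  by apply: eq_CI => y _; rewrite /np expr0 rc1 mul1r.
have hpi : homog (fun y => rc (tnth y i) * p y) k.+1.
  by move=> r y r0 r1 y1; rewrite hp// tnth_tscale exprS !rcM; ring.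
have eQ : << Q >>B = << nq 0%N >>B - 2 * << nq 2%N >>B + << nq 4%N >>B
    - 4 * (<< np 0%N >>B - << np 2%N >>B).
  have i1 : CIble mu (oball 1) (fun y => nq 0%N y - 2 * nq 2%N y).
    by apply: CIbleB => //; exact: CIbleZ.
  have i2 : CIble mu (oball 1) (fun y => np 0%N y - np 2%N y) by exact: CIbleB.
  transitivity (<< (fun y => nq 0%N y - 2 * nq 2%N y + nq 4%N y - 4 * (np 0%N y - np 2%N y)) >>B).
    apply: eq_CI => y y1; rewrite /Q /nq /np.
    have -> : wgt y = 1 - nrm y ^+ 2.
      rewrite nrm_sqr; apply/max_idPr; rewrite subr_ge0 -nrm_sqr.
      by rewrite expr_le1 ?nrm_ge0// ltW.
    rewrite (_ : 4%N = (2 * 2)%N)// exprM expr0; move: (nrm y ^+ 2) => s.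
    rewrite rc1 !(rcM, rcX, rcB, rcN) rc1 rc_nat; ring.
  rewrite CI_B//; [|exact: CIbleD|exact: CIbleZ].
  by rewrite CI_D// CI_B// ?CI_Z// ?CI_B//; exact: CIbleZ.
rewrite q0 p0.
have s1 m := shell mu_leb m mpi yp hpi.
have s2 m := shell mu_leb m mq yq hq.
rewrite -/(nq _) in s2.
have {}s1 m : (n + m + k.+1)%:R * (<< np 0%N >>B - << np m >>B) = m%:R * << np 0%N >>B.
  by rewrite -p0; exact: s1.
have {}s2 m : (n + m + k')%:R * (<< nq 0%N >>B - << nq m >>B) = m%:R * << nq 0%N >>B.
  by rewrite -q0; exact: s2.
case: hk => [kk|qz].
  have nz m : (n + k')%:R + m.+1%:R != 0 :> C by rewrite -natrD pnatr_eq0; lia.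
  have -> : (n + k.+1)%:R = (n + k')%:R + 2 :> C by rewrite -natrD kk; congr (_%:R); lia.
  apply: (@ibp_moment_alg _ << nq 2%N >>B << nq 4%N >>B _ << np 2%N >>B); try exact: nz.
  - by rewrite -(s2 2%N) -natrD; congr (_%:R * _); lia.
  - by rewrite -(s2 4%N) -natrD; congr (_%:R * _); lia.
  - by rewrite -(s1 2%N) -natrD; congr (_%:R * _); lia.
  - by move: H; rewrite eQ => /eqP; rewrite subr_eq0 => /eqP.
(* When [q] vanishes, integration by parts equates the integrals of [y_i p] with and without the
   weight [|y|^2], and [shell] then forces both to be 0. *)
have z m : << nq m >>B = 0.
  by rewrite (eq_CI _ (g := fun=> 0)) ?CI0// => y _; rewrite /nq qz mulr0.
move: H; rewrite eQ !z => H.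
have := s1 2%N; have -> : << np 0%N >>B - << np 2%N >>B = 0.
  apply/eqP; move/eqP: H; rewrite mulr0 subr0 addr0 sub0r oppr_eq0 mulf_eq0.
  by rewrite pnatr_eq0 /= => ->.
rewrite mulr0 => /esym/eqP; rewrite mulf_eq0 pnatr_eq0 /= => /eqP ->.
by rewrite mulr0.
Qed.

(* [qk k a y] is the sum over [i1, ..., ik] of [y_i1 ... y_ik a [:: i1; ...; ik]]; when [a]
   lists the iterated partial derivatives of a function it is a [k]-th directional derivative. *)
Fixpoint qk k (a : seq 'I_n -> C) y : C :=
  if k is k'.+1 then \sum_(i < n) rc (tnth y i) * qk k' (fun s => a (i :: s)) y else a [::].

Definition symseq (a : seq 'I_n -> C) := forall s1 i j s2, a (s1 ++ i :: j :: s2) = a (s1 ++ j :: i :: s2).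

Lemma symseq_cons a i : symseq a -> symseq (fun s => a (i :: s)).
Proof. by move=> h s1 j k s2; exact: (h (i :: s1)). Qed.

Definition lap (a : seq 'I_n -> C) (s : seq 'I_n) : C := \sum_(i < n) a (i :: i :: s).

Lemma symseq_lap a : symseq a -> symseq (lap a).
Proof. by move=> h s1 j k s2; apply: eq_bigr => i _; exact: (h (i :: i :: s1)). Qed.

Lemma qk_meas k a : cmeas (qk k a).
Proof.
elim: k a => [|k IH] a; first exact: cmeas_cst.
by apply: cmeas_sum => i; apply: cmeasM (IH _); apply: cmeas_rc; exact: measurable_tnth.
Qed.

Lemma qk_scale k a r y : qk k a (tscale r y) = rc (r ^+ k) * qk k a y.
Proof.
elim: k a => [|k IH] a; first by rewrite /= expr0 rc1 mul1r.
rewrite /= mulr_sumr; apply: eq_bigr => i _; rewrite IH tnth_tscale exprS !rcM; ring.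
Qed.

Lemma qk_sum k m (b : 'I_m -> seq 'I_n -> C) y :
  qk k (fun s => \sum_(l < m) b l s) y = \sum_(l < m) qk k (b l) y.
Proof.
elim: k b => [|k IH] b //=.
under eq_bigr do rewrite IH mulr_sumr.
by rewrite exchange_big.
Qed.

(** Symmetry of [a] makes the [k] terms of the product rule equal. In degree 0 the factor [k%:R]
    kills the meaningless [k.-1]. *)
Lemma qk_nice k a i : symseq a ->
  nice i (qk k a) (fun y => k%:R * qk k.-1 (fun s => a (i :: s)) y).
Proof.
elim: k a => [|k IH] a sa.
  by apply: nice_ext (nice_cst i (a [::])) _ _ => y //; rewrite mul0r.
have H j := niceM (nice_coord i j) (IH _ (symseq_cons j sa)).
apply: nice_ext (nice_sum H) _ _ => y //.
rewrite big_split /= (bigD1 i)//= eqxx mul1r big1 ?addr0; last first.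
  by move=> j /negbTE ->; rewrite mul0r.
rewrite -[k.+1]addn1 natrD mulrDl mul1r addrC; congr (_ + _).
case: k {IH H} => [|k]; first by rewrite mul0r big1// => j _; rewrite mul0r mulr0.
rewrite /= mulr_sumr; apply: eq_bigr => j _.
rewrite mulrCA; congr (_ * (_ * _)); congr (qk k _ y).
by apply: funext => s; exact: (sa [::]).
Qed.

Lemma qk_bound k a : exists M : R, forall y, nrm y <= 1 -> cmod (qk k a y) <= M.
Proof.
elim: k a => [|k IH] a; first by exists (cmod (a [::])).
have /choice[M hM] : forall i : 'I_n, exists M : R, forall y, nrm y <= 1 ->
  cmod (qk k (fun s => a (i :: s)) y) <= M by move=> i; exact: IH.
exists (\sum_(i < n) M i) => y y1; apply: le_trans (cmod_sum _ _ _) _.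
apply: ler_sum => i _; rewrite cmodM cmod_rc -[leRHS]mul1r ler_pM ?cmod_ge0 ?hM//.
exact: le_trans (coord_nrm _ _) y1.
Qed.

Lemma qk_int k a : CIble mu (oball 1) (qk k a).
Proof.
have [M hM] := qk_bound k a.
apply: (CIble_bd (M := M)) => //; [exact: oball_measurable|exact: oball_fin|exact: qk_meas|].
by move=> y /ltW /hM.
Qed.

Lemma qk_moment_coord k a i : symseq a ->
  k%:R * << qk k.-1 (fun s => a (i :: s)) >>B =
  (n + k.+1)%:R * << (fun y => rc (tnth y i) * qk k a y) >>B.
Proof.
move=> sa; rewrite -CI_Z; [|exact: oball_measurable|exact: qk_int].
apply: (@ibp_moment i (qk k a) _ k k.-1).
- exact: qk_meas.
- by apply: cmeasM (qk_meas _ _); exact: cmeas_cst.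
- exact: qk_nice.
- by move=> r y *; exact: qk_scale.
- by move=> r y *; rewrite qk_scale mulrCA.
- case: k => [|k]; last by left.
  by right=> y; rewrite mul0r.
Qed.

Lemma CI_qkS k a : << qk k.+1 a >>B =
  \sum_(i < n) << (fun y => rc (tnth y i) * qk k (fun s => a (i :: s)) y) >>B.
Proof.
have ii (i : 'I_n) : CIble mu (oball 1) (fun y => rc (tnth y i) * qk k (fun s => a (i :: s)) y).
  have [M hM] := qk_bound k (fun s => a (i :: s)).
  apply: (CIble_bd (M := M)) => //; [exact: oball_measurable|exact: oball_fin| |].
    by apply: cmeasM (qk_meas _ _); apply: cmeas_rc; exact: measurable_tnth.
  move=> y y1; rewrite cmodM cmod_rc -[leRHS]mul1r ler_pM ?cmod_ge0 ?hM ?(ltW y1)//.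
  exact: le_trans (coord_nrm _ _) (ltW y1).
exact: (CI_sum_ord (oball_measurable 1) ii).2.
Qed.

(** One coordinate [y_i] is traded for a derivative along [i], which inserts a second index [i] and
    the factor [k + 1]; the sum over [i] is [lap]. *)
Lemma qk_step k a : symseq a ->
  (n + k.+2)%:R * << qk k.+2 a >>B = k.+1%:R * << qk k (lap a) >>B.
Proof.
move=> sa; rewrite CI_qkS mulr_sumr.
rewrite (eq_bigr (fun i => k.+1%:R * << qk k (fun s => a (i :: i :: s)) >>B)); last first.
  by move=> i _; rewrite -qk_moment_coord//; exact: symseq_cons.
rewrite -mulr_sumr; congr (_ * _).
rewrite -(CI_sum_ord (oball_measurable 1) (fun i => qk_int k (fun s => a (i :: i :: s)))).2.
by apply: eq_CI => y _; rewrite qk_sum.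
Qed.

(** [qk_step] lowers the degree by two until it is 1, where the derivative traded for [y_i] is that
    of a constant. *)
Lemma qk_odd (j : nat) a : symseq a -> << qk j.*2.+1 a >>B = 0.
Proof.
elim: j a => [|j IH] a sa; apply/eqP.
  rewrite CI_qkS big1// => i _; apply/eqP.
  have /esym/eqP := qk_moment_coord 0 i (symseq_cons i sa).
  by rewrite mul0r mulf_eq0 pnatr_eq0 addn1.
have /eqP := qk_step j.*2.+1 sa; rewrite IH ?mulr0; last exact: symseq_lap.
by rewrite mulf_eq0 pnatr_eq0 addnS.
Qed.

(** For positive [n] this is the integral of the [2j]-th power of one coordinate over the unit ball,
    as produced by the recursion of [qk_step]. *)
Fixpoint cB (j : nat) : R := if j is j'.+1 then cB j' * (j'.*2.+1%:R / (n + j'.*2.+2)%:R) else vol mu.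

Lemma qk_even (j : nat) a : symseq a -> << qk j.*2 a >>B = rc (cB j) * iter j lap a [::].
Proof.
elim: j a => [|j IH] a sa.
  rewrite (CI_cst _ (oball_measurable 1)) ?oball_fin// mulrC.
  by congr (rc _ * _).
have n0 : (n + j.*2.+2)%:R != 0 :> C by rewrite pnatr_eq0 addnS.
apply: (mulfI n0); rewrite doubleS qk_step// IH; last exact: symseq_lap.
rewrite -iterSr /= !rcM rcV !rc_nat.
by move: (lap _ _) (rc (cB j)) ((n + _)%:R : C) n0 => u v w n0; field.
Qed.
End ibp.

(** * Sphere integrals of homogeneous functions *)

Section sphere.
Variables (R : realType) (n : nat) (hn : (0 < n)%N).
Local Notation T := (n.-tuple R).
Local Notation C := (Cx R).
Variables (mu : {measure set T -> \bar R}) (mu_leb : lebesgue_n mu).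
Variables (sigma : {measure set T -> \bar R}) (sig : surface_n mu sigma).
Implicit Types (y : T) (f : T -> C).

Lemma rsphereE y : @rsphere R n y <-> nrm y = 1.
Proof.
rewrite /rsphere /= -/(sqn y) -nrm_sqr; split=> [|->]; last by rewrite expr1n.
move=> h; apply/eqP; rewrite -(eqrXn2 (n := 2))// ?nrm_ge0//.
by rewrite h expr1n.
Qed.

Lemma rsphere_measurable : measurable (@rsphere R n).
Proof.
have -> : @rsphere R n = (@nrm R n) @^-1` [set 1].
  by apply/seteqP; split=> y /rsphereE.
by rewrite -[X in measurable X]setTI; exact: measurable_nrm.
Qed.

(* Radial projection of the punctured closed unit ball; all other points are sent to the
   origin, which is off the sphere. *)
Definition radial y : T := if nrm y <= 1 then tscale (nrm y)^-1 y else ozero R n.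

Lemma nrm0 : nrm (ozero R n) = 0.
Proof. by rewrite /nrm /sqn big1 ?sqrtr0// => j _; rewrite tnth_mktuple expr0n. Qed.

Lemma nrm_eq0 y : nrm y = 0 -> y = ozero R n.
Proof.
move=> h; apply: eq_from_tnth => i; rewrite tnth_mktuple; apply/eqP.
by rewrite -normr_le0 (le_trans (coord_nrm _ _))// h.
Qed.

Lemma measurable_radial : measurable_fun setT radial.
Proof.
have mn := @measurable_nrm R n.
apply: measurable_fun_ifT.
- by apply: measurable_fun_ler => //; exact: measurable_cst.
- apply/measurable_fun_tnthP => i.
  apply: (eq_measurable_fun (fun y : T => nrm y `^ (-1) * tnth y i)).
    move=> y _; rewrite /= tnth_tscale; congr (_ * _).
    have [->|h] := eqVneq (nrm y) 0; first by rewrite powRN powRr1// invr0.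
    by rewrite powR_inv1// nrm_ge0.
  apply: measurable_funM; last exact: measurable_tnth.
  exact: (measurableT_comp (measurable_powR (-1)) mn).
- exact: measurable_cst.
Qed.

Lemma radial_preimage (A : set T) : A `<=` @rsphere R n ->
  radial @^-1` A = [set tscale r y | r in `]0%R, 1%R]%classic & y in A `&` @rsphere R n].
Proof.
move=> AS; apply/seteqP; split=> y; rewrite /= /radial.
  case: ifPn => y1 Ay; last first.
    by move/AS/rsphereE: Ay => /eqP; rewrite nrm0 eq_sym oner_eq0.
  have ny : nrm y != 0.
    apply/eqP => h; move/AS/rsphereE: Ay; rewrite nrm_scale ?invr_ge0 ?nrm_ge0// h mulr0.
    by move/eqP; rewrite eq_sym oner_eq0.
  exists (nrm y); first by rewrite in_itv /= lt_def ny nrm_ge0.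
  exists (tscale (nrm y)^-1 y); first by split=> //; exact: AS.
  by apply: eq_from_tnth => i; rewrite !tnth_tscale mulrA mulfV// mul1r.
move=> [r]; rewrite in_itv /= => /andP[r0 r1] [x [Ax /rsphereE x1] <-].
rewrite nrm_scale ?(ltW r0)// x1 mulr1 r1.
rewrite (_ : tscale _ _ = x)//.
by apply: eq_from_tnth => i; rewrite !tnth_tscale mulrA mulVf ?gt_eqF// mul1r.
Qed.

Let S := radial @^-1` @rsphere R n.

Lemma mem_S y : S y <-> 0 < nrm y <= 1.
Proof.
rewrite /S /=; split; rewrite /radial.
  case: ifPn => y1 /rsphereE; last by move/eqP; rewrite nrm0 eq_sym oner_eq0.
  rewrite nrm_scale ?invr_ge0 ?nrm_ge0// => h; rewrite andbT lt_def nrm_ge0 andbT.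
  by apply/eqP => h0; move/eqP: h; rewrite h0 mulr0 eq_sym oner_eq0.
move=> /andP[h0 ->]; apply/rsphereE; rewrite nrm_scale ?invr_ge0 ?nrm_ge0// mulVf//.
by rewrite gt_eqF.
Qed.

Lemma mu_radial A : measurable A -> A `<=` @rsphere R n ->
  mu (radial @^-1` A) = ((n%:R^-1)%:E * sigma A)%E.
Proof.
move=> mA AS; rewrite radial_preimage// sig// muleA -EFinM mulVf ?mul1e//.
by rewrite pnatr_eq0 -lt0n.
Qed.

Lemma S_fin : (mu S < +oo)%E.
Proof.
apply: le_lt_trans (oball_fin mu_leb 2); apply: le_measure; rewrite ?inE.
- by rewrite -[X in measurable X]setTI; apply: measurable_radial => //; exact: rsphere_measurable.
- exact: oball_measurable.
- by move=> y /mem_S /andP[_ h]; apply: le_lt_trans h _; rewrite ltr1n.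
Qed.

Lemma sigma_fin : (sigma (@rsphere R n) < +oo)%E.
Proof.
rewrite sig; last exact: rsphere_measurable.
rewrite -radial_preimage// -/S.
have fin : mu S \is a fin_num by rewrite ge0_fin_numE// S_fin.
by rewrite -(fineK fin) -EFinM ltry.
Qed.

(** The sphere of radius [r] lies in the shell between the balls of radius [r] and 1, whose volume
    is of order [1 - r], while its measure is [r ^+ n] times that of the unit sphere. *)
Lemma mu_sphere0 : fine (mu (@rsphere R n)) = 0.
Proof.
set m := fine _; have mS := rsphere_measurable.
have Sle : @rsphere R n `<=` oball 2 by move=> y /rsphereE h; rewrite /oball /= h ltr1n.
have fS : (mu (@rsphere R n) < +oo)%E.
  by apply: le_lt_trans (oball_fin mu_leb 2); apply: le_measure; rewrite ?inE//; exact: oball_measurable.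
have finS : mu (@rsphere R n) \is a fin_num by rewrite ge0_fin_numE.
have m0 : 0 <= m by exact: fine_ge0.
apply: rc_inj; rewrite rc0; apply: (@small_eq0 _ _ (n%:R * (vol mu + m))) => h h0 h1.
rewrite cmod_rc ger0_norm//.
pose r := 1 - h; have r0 : 0 < r by rewrite /r; lra.
have r1 : r < 1 by rewrite /r; lra.
have r01 : 0 <= r <= 1 by rewrite !ltW.
pose Sr := [set y : T | nrm y = r].
have mSr : measurable Sr.
  have -> : Sr = (@nrm R n) @^-1` [set r] by [].
  by rewrite -[X in measurable X]setTI; exact: measurable_nrm.
have e : aff r (ozero R n) @^-1` Sr = @rsphere R n.
  apply/seteqP; split=> y; rewrite /= /Sr /= aff0 nrm_scale ?(ltW r0)//.
    by move=> h2; apply/rsphereE; apply: (mulfI (lt0r_neq0 r0)); rewrite mulr1.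
  by move=> /rsphereE ->; rewrite mulr1.
have e2 := mu_aff mu_leb (ozero R n) r0 mSr; rewrite e in e2.
have le1 : (mu Sr <= mu (oball 1 `\` oball r))%E.
  apply: le_measure; rewrite ?inE//; first by apply: measurableD; exact: oball_measurable.
  by move=> y; rewrite /Sr /= => yr; split; rewrite /oball /= yr ?ltxx.
have finSr : mu Sr \is a fin_num.
  rewrite ge0_fin_numE//; apply: le_lt_trans (oball_fin mu_leb 1).
  apply: le_measure; rewrite ?inE//; first exact: oball_measurable.
  by move=> y; rewrite /Sr /oball /= => ->.
rewrite (measureD (oball_measurable 1) (oball_measurable r) (oball_fin mu_leb 1)) in le1.
rewrite setIidr in le1; last by move=> y /lt_trans; apply.
have {}le1 : (mu Sr <= (vol mu)%:E - mu (oball r))%E by rewrite -(volE mu_leb); exact: le1.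
have fr : mu (oball r) \is a fin_num by rewrite ge0_fin_numE// oball_fin.
rewrite -(fineK fr) (mu_ball mu_leb r0) -(fineK finSr) -EFinB lee_fin in le1.
have em : m = r ^- n * fine (mu Sr) by rewrite /m e2 -(fineK finSr) -EFinM.
have em2 : r ^+ n * m = fine (mu Sr) by rewrite em mulrA mulfV ?mul1r// expf_neq0// gt_eqF.
have /andP[h2 h3] := onesub_pow n r01.
have v0 : 0 < vol mu := vol_gt0 mu_leb.
have h4 : (1 - r ^+ n) * (vol mu + m) <= n%:R * (1 - r) * (vol mu + m).
  by apply: ler_wpM2r h3; apply: addr_ge0 => //; exact: ltW.
rewrite (_ : h = 1 - r); last by rewrite /r; ring.
rewrite mulrAC; apply: le_trans h4.
have aux (x u v : R) : x * u <= v - x * v -> u <= (1 - x) * (v + u) by move=> *; lra.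
by apply: aux; rewrite em2.
Qed.

Lemma mu_origin0 : fine (mu [set ozero R n]) = 0.
Proof.
have -> : [set ozero R n] = tbox (ozero R n) (ozero R n).
  apply/seteqP; split=> y /=.
    by move=> -> i; rewrite lexx.
  by move=> h; apply: eq_from_tnth => i; apply/le_anti; rewrite andbC; exact: h.
rewrite mu_leb//; case: n hn mu mu_leb => // k _ _ _.
by rewrite big_ord_recl subrr mul0r.
Qed.

Lemma CI_null (D : set T) f M : measurable D -> cmeas f -> (mu D < +oo)%E ->
  (forall y, D y -> cmod (f y) <= M) -> fine (mu D) = 0 -> CI mu D f = 0.
Proof.
move=> mD mf fD hM z; apply/eqP; rewrite -cmod_eq0 -normr_le0 ger0_norm ?cmod_ge0//.
apply: le_trans (CI_bound mD fD (CIble_bd mD fD mf hM) hM) _.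
by rewrite z mulr0.
Qed.

(** By [surface_n], [radial] carries [mu] to [sigma / n], so the sphere integral is [n] times the
    ball integral of [g], the extension of [f] of degree 0. On the ball [f] is [|y|^k g], and
    [shell] with [a = 0], [m = k] trades [n] for [n + k]. *)
Lemma sphere_ball f k M : cmeas f -> (forall y, nrm y <= 1 -> cmod (f y) <= M) ->
  (forall r y, 0 <= r -> f (tscale r y) = rc (r ^+ k) * f y) ->
  CI sigma (@rsphere R n) f = (n + k)%:R * CI mu (oball 1) f.
Proof.
move=> mf hM hf.
have mS := rsphere_measurable; have mr := measurable_radial.
have n0 : n%:R != 0 :> R by rewrite pnatr_eq0 -lt0n.
have ng : (0 : R) <= n%:R^-1 by rewrite invr_ge0.
have H := @CI_transfer R _ _ T T radial mr mu sigma n%:R^-1 ng (@rsphere R n) mS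
  mu_radial sigma_fin f M mf _.
have {}H := H (fun y ys => hM y (eq_ind_r (fun x => x <= 1) (lexx 1) ((rsphereE y).1 ys))).
pose g := f \o radial.
have mg : cmeas g.
  by case: mf => m1 m2; split; [exact: (measurableT_comp m1 mr)|exact: (measurableT_comp m2 mr)].
have rad1 y : nrm (radial y) <= 1.
  rewrite /radial; case: ifPn => y1; last by rewrite nrm0.
  rewrite nrm_scale ?invr_ge0 ?nrm_ge0//.
  by have [->|h] := eqVneq (nrm y) 0; [rewrite mulr0|rewrite mulVf].
have gM y : cmod (g y) <= M by exact: hM.
pose E := [set y : T | nrm y <= 1].
have mE : measurable E.
  have -> : E = (@nrm R n) @^-1` `]-oo, 1] by apply/seteqP; split=> y; rewrite /= in_itv.
  by rewrite -[X in measurable X]setTI; exact: measurable_nrm.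
have fE : (mu E < +oo)%E.
  apply: le_lt_trans (oball_fin mu_leb 2); apply: le_measure; rewrite ?inE//; first exact: oball_measurable.
  by move=> y h; apply: le_lt_trans h _; rewrite ltr1n.
have iE : CIble mu E g by exact: (CIble_bd (M := M)).
have mS' : measurable S by rewrite -[X in measurable X]setTI; exact: mr.
have m1 : measurable [set ozero R n].
  have -> : [set ozero R n] = tbox (ozero R n) (ozero R n).
    apply/seteqP; split=> y /=.
      by move=> -> i; rewrite lexx.
    by move=> h; apply: eq_from_tnth => i; apply/le_anti; rewrite andbC; exact: h.
  exact: tbox_measurable.
have fsub (D : set T) : measurable D -> D `<=` E -> (mu D < +oo)%E.
  by move=> mD DE; apply: le_lt_trans fE; apply: le_measure; rewrite ?inE.
(* The preimage [S] of the sphere is the closed ball without its centre; passing to the open ball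
   costs the centre and the sphere, both null. *)
have E1 : CI mu E g = CI mu S g.
  have e : E = S `|` [set ozero R n].
    apply/seteqP; split=> y /=.
      rewrite /E /= => y1; have [z|nz] := eqVneq (nrm y) 0; first by right; exact: nrm_eq0.
      by left; apply/mem_S; rewrite lt_def nz nrm_ge0.
    by move=> [/mem_S/andP[]//|->]; rewrite /E /= nrm0.
  have ds : [disjoint S & [set ozero R n]].
    by apply/disj_setPS => y [/mem_S h /= e0]; move: h; rewrite e0 nrm0 ltxx.
  have := CI_setU mS' m1 ds (f := g) (mu := mu).
  rewrite -e => /(_ iE) ->.
  rewrite (CI_null (M := M) m1 mg)// ?addr0//; last exact: mu_origin0.
  by apply: fsub => // y /= ->; rewrite /E /= nrm0.
have E2 : CI mu E g = CI mu (oball 1) g.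
  have e : E = oball 1 `|` @rsphere R n.
    apply/seteqP; split=> y /=.
      rewrite /E /= le_eqVlt => /orP[/eqP h|h]; [by right; apply/rsphereE|by left].
    by move=> [/ltW//|/rsphereE h]; rewrite /E /= h.
  have ds : [disjoint oball 1 & @rsphere R n].
    by apply/disj_setPS => y [h /rsphereE h2]; move: h; rewrite /oball /= h2 ltxx.
  have := CI_setU (oball_measurable 1) mS ds (f := g) (mu := mu).
  rewrite -e => /(_ iE) ->.
  rewrite (CI_null (M := M) mS mg)// ?addr0//; last exact: mu_sphere0.
  by apply: fsub => // y /rsphereE h; rewrite /E /= h.
have gf y : oball 1 y -> rc (nrm y ^+ k) * g y = f y.
  move=> /ltW y1; rewrite /g /= /radial y1 -hf ?nrm_ge0//; congr f.
  apply: eq_from_tnth => i; rewrite !tnth_tscale.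
  have [z|nz] := eqVneq (nrm y) 0; last by rewrite mulrA mulfV// mul1r.
  by rewrite z mul0r (nrm_eq0 z) tnth_mktuple.
have g0 r y : 0 < r -> r < 1 -> oball 1 y -> g (tscale r y) = rc (r ^+ 0) * g y.
  move=> r0 r1 y1; rewrite expr0 rc1 mul1r /g /= /radial nrm_scale ?(ltW r0)//.
  have y1' := ltW y1.
  rewrite y1' mulr_ile1 ?nrm_ge0 ?(ltW r0) ?(ltW r1)//; congr f.
  apply: eq_from_tnth => i; rewrite !tnth_tscale invfM.
  by rewrite mulrACA mulVf ?gt_eqF// mul1r.
have := shell mu_leb k mg (fun y _ => gM y) g0.
have -> : CI mu (oball 1) (fun y => rc (nrm y ^+ k) * g y) = CI mu (oball 1) f.
  by apply: eq_CI => y /gf.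
rewrite -E2 E1 -/g addn0 H => h.
have {}h : (n + k)%:R * CI mu (oball 1) f = n%:R * (rc n%:R^-1 * CI sigma (@rsphere R n) f).
  move: h; set u := rc _ * _; rewrite natrD.
  move: (CI mu (oball 1) f) u (n%:R : C) (k%:R : C) => p u a b h.
  have -> : (a + b) * p = (a + b) * u - (a + b) * (u - p) by ring.
  by rewrite h; ring.
by rewrite h mulrA -(rc_nat R n) -rcM mulfV// rc1 mul1r.
Qed.
End sphere.

(** * Power series and expansion along lines *)

Section PowerSeries.
Variable R : realType.
Local Notation C := (Cx R).
Implicit Types (c : nat -> C) (z : C) (K r : R).

Definition ps c z (N : nat) : C := \sum_(j < N) c j * z ^+ j.

Definition gbound c K r := forall m, cmod (c m) <= K / r ^+ m.

Lemma gbound_ge0 c K r : gbound c K r -> 0 <= K.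
Proof. by move=> /(_ 0%N); rewrite expr0 divr1; apply: le_trans; exact: cmod_ge0. Qed.

Lemma geo_sum (x : R) N : 0 <= x -> x < 1 -> \sum_(m < N) x ^+ m <= (1 - x)^-1.
Proof.
move=> x0 x1; have h : 0 < 1 - x by rewrite subr_gt0.
rewrite -[leRHS]mul1r ler_pdivlMr// mulrC -[X in _ - X]/x.
have -> : (1 - x) * \sum_(m < N) x ^+ m = 1 - x ^+ N.
  elim: N => [|N IH]; first by rewrite big_ord0 mulr0 expr0 subrr.
  by rewrite big_ord_recr /= mulrDr IH exprS; ring.
by rewrite lerBlDr lerDl exprn_ge0.
Qed.

Lemma ps_term c K r z m : 0 < r -> gbound c K r -> cmod (c m * z ^+ m) <= K * (cmod z / r) ^+ m.
Proof.
move=> r0 hc; rewrite cmodM cmodX expr_div_n mulrA mulrAC ler_wpM2r ?exprn_ge0 ?cmod_ge0//.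
Qed.

Lemma ps_tail c K r z N m : 0 < r -> gbound c K r -> cmod z < r ->
  cmod (ps c z (N + m) - ps c z N) <= K * (cmod z / r) ^+ N / (1 - cmod z / r).
Proof.
move=> r0 hc zr; have K0 := gbound_ge0 hc.
have x0 : 0 <= cmod z / r by rewrite divr_ge0 ?cmod_ge0// ltW.
have x1 : cmod z / r < 1 by rewrite ltr_pdivrMr// mul1r.
have -> : ps c z (N + m) - ps c z N = \sum_(j < m) c (N + j)%N * z ^+ (N + j).
  by rewrite /ps big_split_ord /= addrAC subrr add0r.
apply: le_trans (cmod_sum _ _ _) _.
apply: (@le_trans _ _ (\sum_(j < m) K * (cmod z / r) ^+ N * (cmod z / r) ^+ j)).
  by apply: ler_sum => j _; rewrite -mulrA -exprD; exact: ps_term.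
rewrite -mulr_sumr ler_wpM2l ?mulr_ge0 ?exprn_ge0//; exact: geo_sum.
Qed.

Lemma ps_bound c K r z N : 0 < r -> gbound c K r -> cmod z < r ->
  cmod (ps c z N) <= K / (1 - cmod z / r).
Proof.
move=> r0 hc zr; have := ps_tail 0 N r0 hc zr.
by rewrite add0n /ps big_ord0 subr0 expr0 mulr1.
Qed.

Lemma geo_cvg (K x : R) : 0 <= x -> x < 1 -> (fun N => K * x ^+ N) @ \oo --> (0 : R).
Proof.
move=> x0 x1; rewrite -[X in _ --> X](mulr0 K).
apply: cvgM; first exact: cvg_cst.
by apply: cvg_expr; rewrite ger0_norm.
Qed.

Lemma ps_cvg c K r z : 0 < r -> gbound c K r -> cmod z < r ->
  exists l : C, ps c z @ \oo --> l.
Proof.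
move=> r0 hc zr.
have x0 : 0 <= cmod z / r by rewrite divr_ge0 ?cmod_ge0// ltW.
have x1 : cmod z / r < 1 by rewrite ltr_pdivrMr// mul1r.
apply: (@cauchyC _ _ (fun N => K / (1 - cmod z / r) * (cmod z / r) ^+ N)); last exact: geo_cvg.
move=> n m nm; rewrite -(subnKC nm) mulrAC; exact: ps_tail.
Qed.

Lemma ps_rem c K r z l N : 0 < r -> gbound c K r -> cmod z < r -> ps c z @ \oo --> l ->
  cmod (l - ps c z N) <= K * (cmod z / r) ^+ N / (1 - cmod z / r).
Proof.
move=> r0 hc zr cl.
have cl' : (fun m => ps c z (N + m)) @ \oo --> l.
  apply/cvgCP => e e0; have [M hM] := (cvgCP _ _).1 cl e e0.
  by exists M => m Mm; apply: hM; rewrite (leq_trans Mm)// leq_addl.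
apply: (cvgC_le cl') => m; exact: ps_tail.
Qed.

Lemma gbound_sub c K r r' : 0 < r' -> r' <= r -> gbound c K r -> gbound c K r'.
Proof.
move=> r0 rr hc m; have K0 := gbound_ge0 hc.
apply: le_trans (hc m) _; rewrite ler_wpM2l// lef_pV2 ?posrE ?exprn_gt0//.
- by rewrite lerXn2r ?nnegrE// ltW// (lt_le_trans r0).
- exact: lt_le_trans rr.
Qed.

(** Once the coefficients below [m] vanish, the tail bound at the point [h * e], divided by its
    [m]-th power, shows that [c m] is of order [h]. *)
Lemma ps_zero c K r (d : R) : 0 < r -> 0 < d -> gbound c K r ->
  (forall z, cmod z < d -> ps c z @ \oo --> (0 : C)) -> forall m, c m = 0.
Proof.
move=> r0 d0 hc hz; elim/ltn_ind => m IH; have K0 := gbound_ge0 hc.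
pose e := Num.min d (r / 2); have e0 : 0 < e by rewrite lt_min d0 divr_gt0.
apply: (@small_eq0 _ _ (2 * K / r ^+ m.+1 * e)) => h h0 h1.
have he0 : 0 < h * e by rewrite mulr_gt0.
have hee : h * e < e by rewrite -[ltRHS]mul1r ltr_pM2r.
pose z : C := rc (h * e).
have cz : cmod z = h * e by rewrite cmod_rc ger0_norm// ltW.
have zd : cmod z < d by rewrite cz (lt_le_trans hee)// ge_min lexx.
have zr : cmod z < r / 2 by rewrite cz (lt_le_trans hee)// ge_min lexx orbT.
have zr' : cmod z < r by apply: lt_trans zr _; rewrite ltr_pdivrMr// ltr_pMr// ltr1n.
have := ps_rem m.+1 r0 hc zr' (hz z zd).
have -> : ps c z m.+1 = c m * z ^+ m.
  rewrite /ps big_ord_recr /= big1 ?add0r// => j _; by rewrite IH ?mul0r.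
rewrite sub0r cmodN cmodM cmodX cz => H.
have x1 : h * e / r <= 1 / 2.
  by rewrite ler_pdivrMr// mul1r [_^-1 * r]mulrC -cz ltW.
have hk : (1 - h * e / r)^-1 <= 2.
  by rewrite invf_ple ?posrE//; lra.
have hm : 0 < (h * e) ^+ m by rewrite exprn_gt0.
rewrite -(ler_pM2r hm); apply: le_trans H _.
have P0 : 0 <= K * (h * e / r) ^+ m.+1.
  by rewrite mulr_ge0// exprn_ge0// divr_ge0// ltW.
apply: le_trans (ler_wpM2l P0 hk) _.
rewrite expr_div_n exprS le_eqVlt; apply/orP; left; apply/eqP.
by move: ((h * e) ^+ m) ((r ^+ m.+1)^-1) => u v; ring.
Qed.

Lemma psB c c' z N : ps (fun m => c m - c' m) z N = ps c z N - ps c' z N.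
Proof. by rewrite /ps -sumrB; apply: eq_bigr => j _; rewrite mulrBl. Qed.

Lemma ps_uniq c c' K K' r r' (d : R) (f : C -> C) : 0 < r -> 0 < r' -> 0 < d ->
  gbound c K r -> gbound c' K' r' ->
  (forall z, cmod z < d -> ps c z @ \oo --> f z) ->
  (forall z, cmod z < d -> ps c' z @ \oo --> f z) -> forall m, c m = c' m.
Proof.
move=> r0 r0' d0 hc hc' h h' m; apply/eqP; rewrite -subr_eq0; apply/eqP.
pose rr := Num.min r r'; have rr0 : 0 < rr by rewrite lt_min r0.
have b1 : gbound c K rr by apply: gbound_sub hc => //; rewrite ge_min lexx.
have b2 : gbound c' K' rr by apply: gbound_sub hc' => //; rewrite ge_min lexx orbT.
apply: (@ps_zero (fun m => c m - c' m) (K + K') rr d rr0 d0).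
- by move=> k; rewrite (le_trans (cmodB _ _))// mulrDl lerD.
- move=> z zd; rewrite (_ : ps _ z = fun N => ps c z N - ps c' z N); last first.
    by apply: funext => N; exact: psB.
  have := cvgB (h z zd) (h' z zd); rewrite subrr; exact.
Qed.

Lemma ps_is_derive c N z : is_derive z (1 : C) (fun z : C => ps c z N)
   (\sum_(j < N) c j * (j%:R * z ^+ j.-1)).
Proof.
elim: N => [|N IH].
  rewrite big_ord0 (_ : (fun z => _) = cst 0); first exact: is_derive_cst.
  by apply: funext => x; rewrite /ps big_ord0.
rewrite big_ord_recr /= (_ : (fun z => _) = (fun z => ps c z N) + (c N \*: (id ^+ N : C -> C))); last first.
  by apply: funext => x; rewrite /ps big_ord_recr /= !fctE.
have h := is_deriveZ (c N) (is_deriveX N (is_derive_id z (1 : C))).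
have h2 := is_deriveD IH h.
have e : c N *: ((N%:R * (id z : C) ^+ N.-1) *: (1 : C)) = c N * (N%:R * z ^+ N.-1).
  by rewrite -[X in c N *: X]/(_ * 1) mulr1.
by rewrite -e; exact: h2.
Qed.

Definition dcoef c m : C := m.+1%:R * c m.+1.

(** The factor [m + 1] is at most [2 ^+ m], and halving the radius absorbs it. *)
Lemma dcoef_bound c K r : 0 < r -> gbound c K r -> gbound (dcoef c) (K / r) (r / 2).
Proof.
move=> r0 hc m; have K0 := gbound_ge0 hc.
rewrite /dcoef cmodM cmod_nat.
apply: (@le_trans _ _ (2 ^+ m * (K / r ^+ m.+1))).
  rewrite ler_pM ?cmod_ge0//; rewrite -natrX ler_nat; exact: ltn_expl.
rewrite expr_div_n exprS invfM [X in _ <= X](_ : _ = 2 ^+ m * (K * (r^-1 / r ^+ m)))//.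
by rewrite invf_div; move: (2 ^+ m) (r^-1) ((r ^+ m)^-1) => u v w; ring.
Qed.

Lemma ps_derivE c N z : 'D_1 (fun z : C => ps c z N.+1) z = ps (dcoef c) z N.
Proof.
have [_ ->] := ps_is_derive c N.+1 z.
rewrite big_ord_recl mul0r mulr0 add0r; apply: eq_bigr => j _.
by rewrite /dcoef /= /bump /= add1n mulrCA mulrA.
Qed.

Lemma rnormC z : rnorm z = cmod z.
Proof. by rewrite /rnorm cmodE. Qed.

Lemma ps_holoball c K r z : 0 < r -> gbound c K r -> cmod z < r -> forall N,
  holoball (fun w : C => ps c w N) z ((r - cmod z) / 2) (K / (1 - ((r + cmod z) / 2 / r))).
Proof.
move=> r0 hc zr N q; rewrite rnormC => hq; have K0 := gbound_ge0 hc.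
have qr : cmod q < (r + cmod z) / 2.
  have := cmodD (q - z) z; rewrite subrK => h; apply: le_lt_trans h _.
  by move: hq; clear -zr; lra.
have qr' : cmod q < r by apply: lt_trans qr _; clear -zr; lra.
split.
  by apply/derivable1_diffP; case: (ps_is_derive c N q).
apply: le_trans (ps_bound N r0 hc qr') _.
have h1 : (r + cmod z) / 2 / r < 1 by rewrite ltr_pdivrMr// mul1r; clear -zr; lra.
have h2 : cmod q / r <= (r + cmod z) / 2 / r by rewrite ler_pM2r ?invr_gt0// ltW.
rewrite ler_wpM2l// lef_pV2 ?posrE ?subr_gt0//; last exact: le_lt_trans h1.
by rewrite lerD2l lerN2.
Qed.

Lemma ps_deriv c K r (f : C -> C) : 0 < r -> gbound c K r ->
  (forall z, cmod z < r -> ps c z @ \oo --> f z) ->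
  forall z, cmod z < r -> differentiable f z /\ ps (dcoef c) z @ \oo --> 'D_1 f z.
Proof.
move=> r0 hc hf z zr.
have e0 : 0 < (r - cmod z) / 2 by rewrite divr_gt0// subr_gt0.
have HB := ps_holoball r0 hc zr.
have cf q : rnorm (q - z) < (r - cmod z) / 2 -> (fun N => ps c q N) @ \oo --> f q.
  rewrite rnormC => hq; apply: hf; have := cmodD (q - z) z; rewrite subrK.
  by move: hq; move: (cmod (q - z)) (cmod q) (cmod z) zr => a b d; clear; lra.
split; first exact: limit_differentiable e0 HB cf.
have := @limit_derive _ _ _ _ z _ _ (1 : C) e0 HB cf.
move=> /cvgCP h; apply/cvgCP => e ee; have [M hM] := h e ee.
exists M => N MN; rewrite -ps_derivE; apply: hM; exact: leqW.
Qed.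

Lemma ps0 c N : ps c 0 N.+1 = c 0%N.
Proof.
rewrite /ps big_ord_recl expr0 mulr1 big1 ?addr0// => j _.
by rewrite exprS mul0r mulr0.
Qed.

Lemma taylor_gbound (k : C -> C) (r M : R) : 0 < r ->
  (forall z, cmod z <= r -> exists d, cdiff k z d) ->
  (forall z, cmod z <= r -> cmod (k z) <= M) ->
  exists c, gbound c (2 * M) r /\ forall z, cmod z < r -> ps c z @ \oo --> k z.
Proof.
move=> r0 dk hk; have [c [hc ht]] := taylor r0 dk hk.
exists c; split=> // z zr.
have x0 : 0 <= cmod z / r by rewrite divr_ge0 ?cmod_ge0// ltW.
have x1 : cmod z / r < 1 by rewrite ltr_pdivrMr// mul1r.
apply/cvgCP => e e0.
have /cvgrPdist_lt /(_ e e0) [N _ hN] := geo_cvg (2 * M * (r / (r - cmod z))) x0 x1.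
exists N => n Nn; rewrite cmodC; apply: le_lt_trans (ht z n zr) _.
have := hN n Nn; rewrite /= sub0r normrN; apply: le_lt_trans; exact: ler_norm.
Qed.

(** Differentiating shifts both the family [k] and the coefficients. The radius in the coefficient
    bound halves each time, which is why it is quantified separately from the radius of the
    domain. *)
Lemma taylor_iter (k : nat -> C -> C) (r K r' : R) c : 0 < r -> 0 < r' ->
  (forall m z, cmod z < r -> cdiff (k m) z (k m.+1 z)) ->
  gbound c K r' -> (forall z, cmod z < r -> ps c z @ \oo --> k 0%N z) ->
  forall m, c m = k m 0 / (m`!)%:R.
Proof.
move=> + + + + + m; elim: m k c K r r' => [|m IH] k c K r r' r0 r0' dk hc hk.
  rewrite fact0 divr1; apply: (@cvgC_unique _ (ps c 0)); last by apply: hk; rewrite cmod0.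
  by apply/cvgCP => e e0; exists 1%N => -[//|N] _; rewrite ps0 subrr cmod0.
pose rr := Num.min r r'; have rr0 : 0 < rr by rewrite lt_min r0.
have rrr : rr <= r by rewrite ge_min lexx.
have hc' : gbound c K rr by apply: gbound_sub hc => //; rewrite ge_min lexx orbT.
have hk' z : cmod z < rr -> ps c z @ \oo --> k 0%N z.
  by move=> zr; apply: hk; exact: lt_le_trans rrr.
have rr2 : 0 < rr / 2 by rewrite divr_gt0.
have dk' j z : cmod z < rr -> cdiff (k j.+1) z (k j.+2 z).
  by move=> zr; apply: dk; exact: lt_le_trans rrr.
have hd z : cmod z < rr -> ps (dcoef c) z @ \oo --> k 1%N z.
  move=> zr; have [_] := ps_deriv rr0 hc' hk' zr.
  by have [_ ->] := cdiff_is_derive (dk 0%N z (lt_le_trans zr rrr)).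
have H := IH (fun j => k j.+1) (dcoef c) (K / rr) rr (rr / 2) rr0 rr2 dk' (dcoef_bound rr0 hc') hd.
have n0 : (m.+1%:R : C) != 0 by rewrite pnatr_eq0.
by apply: (mulfI n0); rewrite -/(dcoef c m) H factS natrM invfM mulrCA mulVKf.
Qed.
End PowerSeries.

Section norms.
Variable R : realType.
Local Notation C := (Cx R).

Lemma rnorm_leP n (v : 'rV[C]_n) (b : R) : 0 <= b ->
  rnorm v <= b <-> forall i, cmod (v 0 i) <= b.
Proof.
move=> b0; have b0' : (0 : C) <= rc b by rewrite -rc0 rc_le.
have E : `|v| = (\big[Num.max/0%:nng]_i `|v i.1 i.2|%:nng)%:num := mx_normE v.
rewrite -rc_le -rnormE E -[rc b]/((NngNum b0')%:num) num_le.
split=> [/bigmax_leP[_ h] i|h].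
  have := h (0, i) isT; by rewrite -num_le /= cmodE rc_le.
apply/bigmax_leP; split; first by rewrite -num_le.
move=> [i j] _; rewrite -num_le /= cmodE rc_le (ord1 i); exact: h.
Qed.

Lemma rnorm_coord n (v : 'rV[C]_n) i : cmod (v 0 i) <= rnorm v.
Proof. by move: i; apply/rnorm_leP => //; exact: rnorm_ge0. Qed.

Lemma enorm_coord n (v : 'rV[C]_n) i : cmod (v 0 i) <= enorm v.
Proof.
rewrite /enorm -[leLHS]ger0_norm ?cmod_ge0// -sqrtr_sqr ler_wsqrtr//.
by rewrite (bigD1 i)//= lerDl sumr_ge0// => j _; rewrite sqr_ge0.
Qed.

Lemma enorm_ge0 n (v : 'rV[C]_n) : 0 <= enorm v. Proof. exact: sqrtr_ge0. Qed.

Lemma rnorm_enorm n (v : 'rV[C]_n) : rnorm v <= enorm v.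
Proof. by apply/rnorm_leP; [exact: enorm_ge0|exact: enorm_coord]. Qed.

Lemma enorm_rnorm n (v : 'rV[C]_n) : enorm v <= n%:R * rnorm v.
Proof.
rewrite -[leRHS]ger0_norm ?mulr_ge0 ?rnorm_ge0// -sqrtr_sqr ler_wsqrtr//.
apply: (@le_trans _ _ (\sum_(i < n) rnorm v ^+ 2)).
  by apply: ler_sum => i _; rewrite lerXn2r ?nnegrE ?cmod_ge0 ?rnorm_ge0// rnorm_coord.
rewrite sumr_const card_ord -[leLHS]mulr_natl exprMn ler_wpM2r ?sqr_ge0//.
by rewrite -natrX ler_nat; case: n {v} => // n; rewrite expnS expn1 leq_pmulr.
Qed.

(** The bridge from the Euclidean norm of the definitions to the supremum norm of ['rV[C]_n];
    dividing by [n.+1] keeps the inequality strict and the quotient meaningful for every [n]. *)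
Lemma enorm_small n (v : 'rV[C]_n) (r : R) : 0 < r -> rnorm v < r / n.+1%:R -> enorm v < r.
Proof.
move=> r0 h; apply: le_lt_trans (enorm_rnorm v) _.
have h2 : n%:R * rnorm v <= n%:R * (r / n.+1%:R) by rewrite ler_wpM2l// ltW.
apply: le_lt_trans h2 _; rewrite mulrCA -[ltRHS]mulr1 ltr_pM2l//.
by rewrite ltr_pdivrMr// mul1r ltr_nat.
Qed.

Lemma rnorm_prodP (V W : normedModType C) (p : V * W) (b : R) :
  rnorm p < b <-> rnorm p.1 < b /\ rnorm p.2 < b.
Proof.
have pn : `|p| = Num.max `|p.1| `|p.2| by exact: prod_normE.
have pm (x y : R) : Num.max (rc x) (rc y) = rc (Num.max x y).
  by rewrite /Order.max rc_lt; case: ifP.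
rewrite -(rc_lt _ b) -rnormE pn !rnormE pm rc_lt gt_max.
by split=> [/andP[]|[-> ->]].
Qed.
End norms.

(** * Iterated directional derivatives *)

Section dirseq.
Variables (R : realType) (V : normedModType (Cx R)).
Local Notation C := (Cx R).
Variables (n : nat) (e : 'I_n -> V).
Implicit Types (g : V -> C) (s : seq 'I_n).

Definition Dseq g s : V -> C := foldr (fun i f => 'D_(e i) f) g s.

Variables (rho : R).
Let U : set V := [set z | rnorm z < rho].

Lemma U_near z : U z -> \forall q \near z, U q.
Proof.
move=> zU; apply/near_rnorm; exists (rho - rnorm z); first by rewrite subr_gt0.
move=> q h; have := rnormD (q - z) z; rewrite subrK /U /= => h2.
by apply: le_lt_trans h2 _; rewrite -ltrBrDr.
Qed.

Lemma U_diff g : holo_on g U -> forall z, U z -> \forall q \near z, differentiable g q.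
Proof. by move=> hg z /U_near; apply: filterS => q; exact: hg. Qed.

Lemma holo_derive g v : holo_on g U -> holo_on ('D_v g) U.
Proof. by move=> hg z zU; have [] := differentiable_derive v (U_diff hg zU). Qed.

Lemma derive_comm g v w z : holo_on g U -> U z -> 'D_w ('D_v g) z = 'D_v ('D_w g) z.
Proof. move=> hg zU; have [_ h] := differentiable_derive v (U_diff hg zU); exact: (h w). Qed.

Lemma derive_local (f g : V -> C) v z : (forall q, U q -> f q = g q) -> U z -> 'D_v f z = 'D_v g z.
Proof. by move=> fg zU; apply: near_eq_derive; apply: filterS (U_near zU). Qed.

(** The function [g] is the limit of the constant sequence [f] near each point, so
    [limit_differentiable] transports holomorphy. *)
Lemma holo_local (f g : V -> C) : (forall q, U q -> f q = g q) -> holo_on f U -> holo_on g U.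
Proof.
move=> fg hf z zU; have [d dz] := near_holoball (U_diff hf zU).
have [M [d0 hb]] := dz.
have /near_rnorm[r r0 hr] := U_near zU.
pose s := Num.min d r; have s0 : 0 < s by rewrite lt_min d0.
apply: (@limit_differentiable _ _ (fun _ => f) g z s M s0).
  move=> _ q hq; apply: hb; apply: (lt_trans (y := d)); first by rewrite (lt_le_trans hq)// ge_min lexx.
  by rewrite ltrDl.
move=> q hq; rewrite fg; first exact: cvg_cst.
by apply: hr; rewrite (lt_le_trans hq)// ge_min lexx orbT.
Qed.

Lemma holo_Dseq g s : holo_on g U -> holo_on (Dseq g s) U.
Proof. by move=> hg; elim: s => //= i s; exact: holo_derive. Qed.

Lemma Dseq_local (f g : V -> C) s z : (forall q, U q -> f q = g q) -> U z -> Dseq f s z = Dseq g s z.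
Proof.
move=> fg; elim: s z => [|i s IH] z zU; first exact: fg.
by apply: derive_local.
Qed.

Lemma Dseq_sym g z : holo_on g U -> U z -> symseq (Dseq g ^~ z).
Proof.
move=> hg zU s1 i j s2; rewrite /Dseq !foldr_cat; apply: Dseq_local zU => q qU /=.
by apply: derive_comm => //; exact: holo_Dseq.
Qed.

Lemma derive_sumU m (f : 'I_m -> V -> C) v z : (forall i, holo_on (f i) U) -> U z ->
  'D_v (fun q => \sum_(i < m) f i q) z = \sum_(i < m) 'D_v (f i) z.
Proof.
move=> hf zU; rewrite -derive_sum; last by move=> i; apply: diff_derivable; exact: hf.
by congr ('D_v _ z); apply: funext => q; rewrite fct_sumE.
Qed.

Lemma holo_sum m (f : 'I_m -> V -> C) : (forall i, holo_on (f i) U) ->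
  holo_on (fun q => \sum_(i < m) f i q) U.
Proof.
move=> hf z zU.
rewrite (_ : (fun q => _) = \sum_(i < m) f i); last by apply: funext => q; rewrite fct_sumE.
apply: differentiable_sum => i; exact: hf.
Qed.

Lemma holo_Z (c : C) g : holo_on g U -> holo_on (fun q => c * g q) U.
Proof. by move=> hg z zU; apply: (@differentiableZ _ _ _ g c z); exact: hg. Qed.

Lemma derive_ZU (c : C) g v z : differentiable g z -> 'D_v (fun q => c * g q) z = c * 'D_v g z.
Proof. by move=> hg; apply: (@deriveZ _ _ _ g c z v); exact: diff_derivable. Qed.

Lemma Dseq_sum m (f : 'I_m -> V -> C) s z : (forall i, holo_on (f i) U) -> U z ->
  Dseq (fun q => \sum_(i < m) f i q) s z = \sum_(i < m) Dseq (f i) s z.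
Proof.
move=> hf; elim: s z => [//|i s IH] z zU /=.
rewrite (derive_local (g := fun q => \sum_(i < m) Dseq (f i) s q))//.
by rewrite derive_sumU// => j; exact: holo_Dseq.
Qed.

Definition lapl g q : C := \sum_(i < n) 'D_(e i) ('D_(e i) g) q.

Lemma holo_lapl g : holo_on g U -> holo_on (lapl g) U.
Proof. by move=> hg; apply: holo_sum => i; do 2 apply: holo_derive. Qed.

Lemma perm_move (a : seq 'I_n -> C) i s s' : symseq a -> a (i :: s ++ s') = a (s ++ i :: s').
Proof.
move=> sa; elim: s a sa => [//|j s IH] a sa; rewrite cat_cons.
by rewrite (sa [::]) /=; apply: (IH (fun s => a (j :: s))); exact: symseq_cons.
Qed.

(** In [lap] the repeated pair of derivatives is outermost, in [Dseq (lapl g)] it is innermost;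
    symmetry lets the pair travel through [s]. *)
Lemma lap_Dseq g z : holo_on g U -> U z -> lap (Dseq g ^~ z) = Dseq (lapl g) ^~ z.
Proof.
move=> hg zU; apply: funext => s; rewrite /lapl Dseq_sum//; last first.
  by move=> i; do 2 apply: holo_derive.
apply: eq_bigr => i _; have sa := Dseq_sym hg zU.
have -> : Dseq g (i :: i :: s) z = Dseq g (s ++ [:: i; i]) z.
  rewrite -(perm_move i s [:: i] sa).
  have := perm_move i s [::] (symseq_cons i sa); by rewrite cats0 => ->.
by rewrite /Dseq foldr_cat.
Qed.

Lemma iter_lap_Dseq g z j : holo_on g U -> U z ->
  iter j (@lap R n) (Dseq g ^~ z) [::] = iter j lapl g z.
Proof.
move=> hg zU; suff -> : iter j (@lap R n) (Dseq g ^~ z) = Dseq (iter j lapl g) ^~ z by [].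
elim: j g hg => [//|j IH] g hg; rewrite !iterSr lap_Dseq// IH//; exact: holo_lapl.
Qed.

Definition wdir (y : n.-tuple R) : V := \sum_(i < n) rc (tnth y i) *: e i.

Lemma derive_wdir g y z : differentiable g z ->
  'D_(wdir y) g z = \sum_(i < n) rc (tnth y i) * 'D_(e i) g z.
Proof.
move=> hg; rewrite deriveE// /wdir linear_sum; apply: eq_bigr => i _.
by rewrite linearZ deriveE.
Qed.

Definition itD v m g := iter m (fun f => 'D_v f) g.

Lemma holo_itD v m g : holo_on g U -> holo_on (itD v m g) U.
Proof. by move=> hg; elim: m => //= m; exact: holo_derive. Qed.

Lemma qk_holo k (a : seq 'I_n -> V -> C) y : (forall s, holo_on (a s) U) ->
  holo_on (fun q => qk k (a ^~ q) y) U /\ forall v z, U z ->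
  'D_v (fun q => qk k (a ^~ q) y) z = qk k (fun s => 'D_v (a s) z) y.
Proof.
elim: k a => [|k IH] a ha; first by split=> //; exact: ha.
have hi i := IH (fun s => a (i :: s)) (fun s => ha (i :: s)).
split.
  by apply: holo_sum => i; apply: holo_Z; exact: (hi i).1.
move=> v z zU; rewrite /= derive_sumU//; last first.
  by move=> i; apply: holo_Z; exact: (hi i).1.
apply: eq_bigr => i _; rewrite derive_ZU; first by rewrite (hi i).2.
exact: (hi i).1.
Qed.

Lemma itD_qk g y m z : holo_on g U -> U z -> itD (wdir y) m g z = qk m (Dseq g ^~ z) y.
Proof.
move=> hg; elim: m z => [//|m IH] z zU /=.
rewrite (derive_local (g := fun q => qk m (Dseq g ^~ q) y))//.
have [h1 h2] := qk_holo m y (fun s => @holo_Dseq g s hg).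
rewrite derive_wdir; last exact: h1.
by apply: eq_bigr => i _; rewrite h2.
Qed.
End dirseq.

(** * Expansion along complex lines, integrated over directions *)

Section line_expansion.
Variables (R : realType) (V : normedModType (Cx R)).
Local Notation C := (Cx R).
Variables (n : nat) (e : 'I_n -> V).
Local Notation T := (n.-tuple R).
Variables (g : V -> C) (rho M tau : R).
Hypotheses (rho0 : 0 < rho) (tau0 : 0 < tau) (hg : holoball g 0 (rho + rho) M).
Hypothesis htau : forall y : T, nrm y <= 1 -> rnorm (wdir e y) <= tau.

Lemma hgU : holo_on g [set z | rnorm z < rho + rho].
Proof. by move=> z zU; have [] := hg (_ : rnorm (z - 0) < rho + rho); rewrite ?subr0. Qed.

Lemma rt0 : 0 < rho / tau. Proof. exact: divr_gt0. Qed.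

Definition lcoef z y m : C := qk m (Dseq e g ^~ z) y / (m`!)%:R.

(** With [cmod t <= rho / tau] the point [z + t *: wdir e y] stays in the ball of radius
    [rho + rho]. [taylor_iter] identifies the Taylor coefficients in [t] with iterated derivatives
    along [wdir e y], and [itD_qk] expands these as polynomials in [y]. *)
Lemma line_exp z y : rnorm z < rho -> nrm y <= 1 ->
  gbound (lcoef z y) (2 * M) (rho / tau) /\
  forall t, cmod t < rho / tau -> ps (lcoef z y) t @ \oo --> g (z + t *: wdir e y).
Proof.
move=> zr y1; set w := wdir e y; have r0 := rt0.
have inU t : cmod t <= rho / tau -> rnorm (z + t *: w) < rho + rho.
  move=> ht; apply: le_lt_trans (rnormD _ _) _; rewrite rnormZ ltr_leD//.
  apply: le_trans (ler_pM (cmod_ge0 _) (rnorm_ge0 _) ht (htau y1)) _.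
  by rewrite divfK// gt_eqF.
have hU := hgU.
have dk m t : cmod t <= rho / tau ->
    cdiff (fun s => itD w m g (z + s *: w)) t (itD w m.+1 g (z + t *: w)).
  move=> ht; apply: diff_line; apply: (holo_itD w m hU); exact: inU.
have [c [hc ct]] := @taylor_gbound R (fun s => g (z + s *: w)) (rho / tau) M r0
  (fun t ht => ex_intro _ _ (dk 0%N t ht))
  (fun t ht => (hg (eq_ind_r (fun x => rnorm x < rho + rho) (inU t ht) (subr0 _))).2).
have cE : c = lcoef z y.
  apply: funext => m.
  have := @taylor_iter R (fun m s => itD w m g (z + s *: w)) _ _ _ c r0 r0
    (fun m t ht => dk m t (ltW ht)) hc ct m.
  rewrite scale0r addr0 => ->; rewrite /lcoef; congr (_ / _); apply: itD_qk hU _.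
  by apply: lt_trans zr _; rewrite ltrDl.
by rewrite -cE; split.
Qed.

Variables (nu : {measure set T -> \bar R}) (D : set T).
Hypotheses (mD : measurable D) (fD : (nu D < +oo)%E) (D1 : forall y, D y -> nrm y <= 1).

Lemma qk_int_gen k (a : seq 'I_n -> C) : CIble nu D (qk k a).
Proof.
have [K hK] := qk_bound k a.
apply: (CIble_bd (M := K)) => //; first exact: qk_meas.
by move=> y /D1 /hK.
Qed.

(** The integrand of the mean is a pointwise limit on [D] of polynomials in [y], which is how it is
    shown to be measurable. *)
Lemma cmeas_lim (f : nat -> T -> C) (h : T -> C) : (forall N, cmeas (f N)) ->
  (forall y, D y -> (fun N => f N y) @ \oo --> h y) ->
  measurable_fun D (fun y => complex.Re (h y)) /\ measurable_fun D (fun y => complex.Im (h y)).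
Proof.
move=> mf hf; split.
  apply: (@measurable_fun_cvg _ _ _ D (fun N y => complex.Re (f N y))).
    by move=> N; apply: measurable_funTS; exact: (mf N).1.
  move=> y Dy; apply/cvgrPdist_lt => x x0; have [N hN] := (cvgCP _ _).1 (hf y Dy) x x0.
  exists N => // m Nm; rewrite /= distrC; apply: le_lt_trans (hN m Nm).
  by rewrite -cReN -cReD; exact: Re_cmod.
apply: (@measurable_fun_cvg _ _ _ D (fun N y => complex.Im (f N y))).
  by move=> N; apply: measurable_funTS; exact: (mf N).2.
move=> y Dy; apply/cvgrPdist_lt => x x0; have [N hN] := (cvgCP _ _).1 (hf y Dy) x x0.
exists N => // m Nm; rewrite /= distrC; apply: le_lt_trans (hN m Nm).
by rewrite -cImN -cImD; exact: Im_cmod.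
Qed.

Definition mcoef z m : C := CI nu D (qk m (Dseq e g ^~ z)) / (m`!)%:R.

Lemma CI_line z : rnorm z < rho ->
  gbound (mcoef z) (4 * M * fine (nu D)) (rho / tau) /\
  forall t, cmod t < rho / tau -> ps (mcoef z) t @ \oo --> CI nu D (fun y => g (z + t *: wdir e y)).
Proof.
move=> zr; have r0 := rt0; have M0 : 0 <= M.
  by apply: holoball_ge0 hg; rewrite addr_gt0.
have V0 : 0 <= fine (nu D) by exact: fine_ge0.
have int m c : CIble nu D (fun y => c * qk m (Dseq e g ^~ z) y) by apply: CIbleZ => //; exact: qk_int_gen.
have mE m : mcoef z m = CI nu D (fun y => lcoef z y m).
  rewrite /mcoef mulrC -CI_Z//; last exact: qk_int_gen.
  by apply: eq_CI => y _; rewrite /lcoef mulrC.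
have intl m : CIble nu D (fun y => lcoef z y m).
  by apply: eq_CIble (int m (m`!%:R^-1)) => // y _; rewrite /lcoef mulrC.
split.
  move=> m; rewrite mE; apply: le_trans (CI_bound mD fD (intl m) (M := 2 * M / (rho / tau) ^+ m) _) _.
    by move=> y /D1 y1; have [h _] := line_exp zr y1; exact: h.
  rewrite le_eqVlt; apply/orP; left; apply/eqP; ring.
move=> t tr.
have x0 : 0 <= cmod t / (rho / tau) by rewrite divr_ge0 ?cmod_ge0// ltW.
have x1 : cmod t / (rho / tau) < 1 by rewrite ltr_pdivrMr// mul1r.
pose K := 2 * M / (1 - cmod t / (rho / tau)).
(* The remainder is uniform in [y], so it can be integrated and the series for the mean follows
   termwise. *)
have rem y N : D y -> cmod (g (z + t *: wdir e y) - ps (lcoef z y) t N) <=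
    K * (cmod t / (rho / tau)) ^+ N.
  move=> /D1 y1; have [h1 h2] := line_exp zr y1.
  apply: le_trans (ps_rem N r0 h1 tr (h2 t tr)) _.
  by rewrite /K mulrAC.
have ips N : CIble nu D (fun y => ps (lcoef z y) t N).
  rewrite /ps; apply: (@CI_sum_ord _ _ _ nu D mD N (fun j y => lcoef z y j * t ^+ j) _).1 => j.
  by apply: eq_CIble (CIbleZ mD (t ^+ j) (intl j)) => // y _; rewrite mulrC.
have psE N : ps (mcoef z) t N = CI nu D (fun y => ps (lcoef z y) t N).
  rewrite /ps (@CI_sum_ord _ _ _ nu D mD N (fun j y => lcoef z y j * t ^+ j) _).2.
    apply: eq_bigr => j _; rewrite mE mulrC -CI_Z//.
    by apply: eq_CI => y _; rewrite mulrC.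
  by move=> j; apply: eq_CIble (CIbleZ mD (t ^+ j) (intl j)) => // y _; rewrite mulrC.
have mlc N : cmeas (fun y => ps (lcoef z y) t N).
  rewrite /ps; apply: cmeas_sum => j; apply: cmeasM; last exact: cmeas_cst.
  by apply: cmeasM; [exact: qk_meas|exact: cmeas_cst].
have [m1 m2] : measurable_fun D (fun y => complex.Re (g (z + t *: wdir e y))) /\
    measurable_fun D (fun y => complex.Im (g (z + t *: wdir e y))).
  apply: (cmeas_lim mlc) => y /D1 y1; exact: (line_exp zr y1).2.
have gM y : D y -> cmod (g (z + t *: wdir e y)) <= K.
  by move=> Dy; have := rem y 0%N Dy; rewrite /ps big_ord0 subr0 expr0 mulr1.
have ig : CIble nu D (fun y => g (z + t *: wdir e y)).
  split; apply: (@bounded_integrable _ _ _ nu _ mD fD _ K) => // y /gM; apply: le_trans;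
  [exact: Re_cmod|exact: Im_cmod].
apply/cvgCP => eps e0.
have /cvgrPdist_lt /(_ eps e0) [N _ hN] := geo_cvg (2 * K * fine (nu D)) x0 x1.
exists N => m Nm; rewrite cmodC psE -CI_B//.
apply: le_lt_trans (CI_bound mD fD (CIbleB mD ig (ips m)) (fun y Dy => rem y m Dy)) _.
have := hN m Nm; rewrite /= sub0r normrN; apply: le_lt_trans.
have aux (a b c : R) : 2 * (a * b) * c <= `|2 * a * c * b|.
  by rewrite (_ : 2 * (a * b) * c = 2 * a * c * b) ?ler_norm//; ring.
exact: aux.
Qed.

Lemma ps_even (d : nat -> C) t N : (forall j, d j.*2.+1 = 0) ->
  ps d t N.*2 = ps (fun j => d j.*2) (t ^+ 2) N.
Proof.
move=> d0; elim: N => [|N IH]; first by rewrite /ps !big_ord0.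
rewrite doubleS /ps !big_ord_recr /= d0 mul0r addr0 -/(ps d t N.*2) IH.
by rewrite -exprM mul2n.
Qed.

Variables (kap : nat -> R).
Hypotheses (modd : forall (j : nat) (a : seq 'I_n -> C), symseq a -> CI nu D (qk j.*2.+1 a) = 0).
Hypotheses (meven : forall (j : nat) (a : seq 'I_n -> C), symseq a ->
  CI nu D (qk j.*2 a) = rc (kap j) * iter j (@lap R n) a [::]).

Lemma CI_line_even z : rnorm z < rho ->
  let c j := rc (kap j / (j.*2`!)%:R) * iter j (lapl e) g z in
  gbound c (4 * M * fine (nu D)) ((rho / tau) ^+ 2) /\
  forall t, cmod t < rho / tau ->
    ps c (t ^+ 2) @ \oo --> CI nu D (fun y => g (z + t *: wdir e y)).
Proof.
move=> zr c; have [h1 h2] := CI_line zr.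
have zU : rnorm z < rho + rho by apply: lt_trans zr _; rewrite ltrDl.
have sa := Dseq_sym e hgU zU.
have dE j : mcoef z j.*2 = c j.
  by rewrite /mcoef meven// (iter_lap_Dseq e j hgU zU) /c rcM rcV rc_nat mulrAC.
have dO j : mcoef z j.*2.+1 = 0 by rewrite /mcoef modd// mul0r.
split.
  by move=> j; rewrite -dE -exprM mul2n; exact: h1.
move=> t tr; apply/cvgCP => eps e0; have [N hN] := (cvgCP _ _).1 (h2 t tr) eps e0.
exists N => m Nm; have := hN m.*2; rewrite ps_even// (_ : (fun j => _) = c).
  by apply; rewrite (leq_trans Nm)// -addnn leq_addr.
by apply: funext.
Qed.
End line_expansion.

(** * The operator as a sum of squares of directional derivatives *)

Section concrete.
Variables (R : realType) (n : nat).
Local Notation C := (Cx R).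
Local Notation V := 'rV[C]_n.
Local Notation T := (n.-tuple R).
Variables (A Cm : 'M[R]_n).

(* The columns of [C Lam^(1/2)]. *)
Definition Tv (k : 'I_n) : V := \row_i rc (CLsqrt A Cm i k).

Lemma shiftedE (z : V) (t : C) (y : T) : shifted A Cm z t y = z + t *: wdir Tv y.
Proof.
apply/rowP => i; rewrite !mxE /wdir summxE; congr (_ + _ * _).
rewrite -/(rc _) rc_sum; apply: eq_bigr => k _.
by rewrite !mxE rcM mulrC.
Qed.

Lemma Tv_sum k : Tv k = \sum_(i < n) rc (CLsqrt A Cm i k) *: unitv R i.
Proof.
apply/rowP => j; rewrite summxE [LHS]mxE.
have en i (a : C) : (a *: unitv R i) 0 j = a * (j == i)%:R by rewrite mxE [X in _ * X]mxE.
rewrite (eq_bigr _ (fun i _ => en i _)) (bigD1 j)//= eqxx mulr1 big1 ?addr0// => i ij.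
by rewrite eq_sym (negbTE ij) mulr0.
Qed.

Lemma derive_Tv (g : V -> C) k z : differentiable g z ->
  'D_(Tv k) g z = \sum_(i < n) rc (CLsqrt A Cm i k) * 'D_(unitv R i) g z.
Proof.
move=> hg; rewrite deriveE// Tv_sum linear_sum; apply: eq_bigr => i _.
by rewrite linearZ deriveE.
Qed.

Hypothesis Cm_orth : Cm^T *m Cm = 1%:M.
Hypothesis Lam_diag : is_diag_mx (Lam A Cm).
Hypothesis A_posdef : forall x : 'rV[R]_n, x != 0 -> 0 < (x *m A *m x^T) 0 0.

Lemma Lam_gt0 i : 0 < Lam A Cm i i.
Proof.
have h := A_posdef (x := row i Cm^T).
have -> : Lam A Cm i i = (row i Cm^T *m A *m (row i Cm^T)^T) 0 0.
  rewrite /Lam -!row_mul tr_row trmxK !mxE; apply: eq_bigr => j _.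
  by rewrite !mxE.
apply: h; apply/eqP => h0.
have : (row i Cm^T *m Cm) = row i 1%:M by rewrite -row_mul Cm_orth.
rewrite h0 mul0mx => /rowP /(_ i); rewrite !mxE eqxx => /eqP.
by rewrite eq_sym oner_eq0.
Qed.

Lemma CLsqrt_sqr : CLsqrt A Cm *m (CLsqrt A Cm)^T = A.
Proof.
have oC : Cm *m Cm^T = 1%:M by exact: mulmx1C.
rewrite /CLsqrt trmx_mul tr_diag_mx mulmxA -(mulmxA Cm) mulmx_diag.
have -> : diag_mx (\row_j ((\row_i Num.sqrt (Lam A Cm i i)) 0 j * (\row_i Num.sqrt (Lam A Cm i i)) 0 j)) = Lam A Cm.
  have := Lam_gt0; move: (Lam A Cm) Lam_diag => L hL L0; apply/matrixP => i j; rewrite !mxE.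
  have [->|ij] := eqVneq i j; first by rewrite mulr1n -expr2 sqr_sqrtr// ltW.
  by rewrite mulr0n; move/is_diag_mxP: hL => ->.
by rewrite /Lam !mulmxA oC mul1mx -mulmxA oC mulmx1.
Qed.

Variables (rho : R).
Let U : set V := [set z | rnorm z < rho].

Lemma Pop_lapl (g : V -> C) z : holo_on g U -> U z -> Pop A g z = lapl Tv g z.
Proof.
move=> hg zU; rewrite /lapl.
have e k : 'D_(Tv k) ('D_(Tv k) g) z = \sum_(i < n) \sum_(j < n)
    rc (CLsqrt A Cm i k * CLsqrt A Cm j k) * 'D_(unitv R i) ('D_(unitv R j) g) z.
  have hT : holo_on ('D_(Tv k) g) U by exact: holo_derive.
  apply: (etrans (derive_Tv k (hT z zU))).
  apply: eq_bigr => i _.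
  have hj j : holo_on ('D_(unitv R j) g) U by exact: holo_derive.
  pose h (j : 'I_n) (q : V) := rc (CLsqrt A Cm j k) * 'D_(unitv R j) g q.
  have hh j : holo_on (h j) U := @holo_Z _ _ rho (rc (CLsqrt A Cm j k)) ('D_(unitv R j) g) (hj j).
  have e1 : 'D_(unitv R i) ('D_(Tv k) g) z = 'D_(unitv R i) (fun q => \sum_(j < n) h j q) z.
    apply: (@derive_local _ _ rho ('D_(Tv k) g)) zU => q qU.
    exact: (derive_Tv k (hg q qU)).
  have e2 := @derive_sumU _ _ rho _ h (unitv R i) z hh zU.
  apply: (etrans (congr1 (fun x => rc (CLsqrt A Cm i k) * x) (etrans e1 e2))).
  apply: (etrans (mulr_sumr _ _ _ _)); apply: eq_bigr => j _.
  have e3 := @derive_ZU _ _ (rc (CLsqrt A Cm j k)) _ (unitv R i) z (hj j z zU).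
  apply: (etrans (congr1 (fun x => rc (CLsqrt A Cm i k) * x) e3)).
  by rewrite rcM mulrA.
under [RHS]eq_bigr do rewrite e.
rewrite exchange_big /=; apply: eq_bigr => i _.
rewrite exchange_big /=; apply: eq_bigr => j _.
rewrite -mulr_suml -rc_sum; congr (rc _ * _).
have := congr1 (fun N : 'M[R]_n => N i j) CLsqrt_sqr; rewrite mxE => <-.
by apply: eq_bigr => k _; congr (_ * _); rewrite [LHS]mxE.
Qed.

(** The two operators agree only where the function is holomorphic, so equality and holomorphy of
    the iterates on [U] are carried together; derivatives being local, equality on [U] is enough to
    continue. *)
Lemma iter_Pop (g : V -> C) j z : holo_on g U -> U z -> iter j (Pop A) g z = iter j (lapl Tv) g z.
Proof.
move=> hg; elim: j z => [//|j IH] z zU /=.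
have hl : holo_on (iter j (lapl Tv) g) U by elim: j {IH} => //= j; exact: holo_lapl.
have hp : holo_on (iter j (Pop A) g) U by apply: (@holo_local _ _ rho (iter j (lapl Tv) g)) hl => q qU; exact: (esym (IH q qU)).
rewrite (Pop_lapl hp zU); apply: eq_bigr => i _.
apply: (@derive_local _ _ rho ('D_(Tv i) (iter j (Pop A) g)) ('D_(Tv i) (iter j (lapl Tv) g)) _ z _ zU) => q qU.
exact: (@derive_local _ _ rho (iter j (Pop A) g) (iter j (lapl Tv) g) _ q IH qU).
Qed.

Lemma holo_iter_Pop (g : V -> C) j : holo_on g U -> holo_on (iter j (Pop A) g) U.
Proof.
move=> hg; have hl : holo_on (iter j (lapl Tv) g) U by elim: j => //= j; exact: holo_lapl.
apply: holo_local hl => q qU; exact: (esym (iter_Pop j hg qU)).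
Qed.

Lemma wdir_bound : exists2 tau : R, 0 < tau & forall y : T, nrm y <= 1 -> rnorm (wdir Tv y) <= tau.
Proof.
exists (1 + \sum_(i < n) rnorm (Tv i)).
  by rewrite ltr_pwDl// sumr_ge0// => i _; exact: rnorm_ge0.
move=> y y1; rewrite /wdir; apply: (@le_trans _ _ (\sum_(i < n) rnorm (Tv i))); last by rewrite lerDr.
apply: (@le_trans _ _ (\sum_(i < n) rnorm (rc (tnth y i) *: Tv i))).
  elim/big_rec2 : _ => [|i x v _ h]; first by rewrite rnorm0.
  by apply: le_trans (rnormD _ _) _; rewrite lerD2l.
apply: ler_sum => i _; rewrite rnormZ cmod_rc -[leRHS]mul1r ler_wpM2r ?rnorm_ge0//.
exact: le_trans (coord_nrm _ _) y1.
Qed.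
End concrete.

(** * Joint holomorphy in the space and time variables *)

Section product_tools.
Variables (R : realType) (V : normedModType (Cx R)).
Local Notation C := (Cx R).

Lemma diff_fst (p : V * C) : differentiable (fun q : V * C => q.1) p.
Proof. by apply: (@linear_differentiable _ _ _ (@fst V C)) => q; exact: (@cvg_fst _ _ (nbhs q.1) (nbhs q.2)). Qed.

Lemma diff_snd (p : V * C) : differentiable (fun q : V * C => q.2) p.
Proof. by apply: (@linear_differentiable _ _ _ (@snd V C)) => q; exact: (@cvg_snd _ _ (nbhs q.1) (nbhs q.2)). Qed.

Lemma diff_mul (W : normedModType C) (f g : W -> C) p : differentiable f p -> differentiable g p ->
  differentiable (fun q => f q * g q) p.
Proof. by move=> hf hg; exact: (differentiableM hf hg). Qed.

Lemma diff_add (W : normedModType C) (f g : W -> C) p : differentiable f p -> differentiable g p ->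
  differentiable (fun q => f q + g q) p.
Proof. by move=> hf hg; exact: (differentiableD hf hg). Qed.

Lemma diff_pow (W : normedModType C) (f : W -> C) m p : differentiable f p ->
  differentiable (fun q => f q ^+ m) p.
Proof.
move=> hf; elim: m => [|m IH].
  by rewrite (_ : (fun q => _) = cst 1); [exact: differentiable_cst|apply: funext => q; rewrite expr0].
rewrite (_ : (fun q => _) = fun q => f q * f q ^+ m); first exact: diff_mul.
by apply: funext => q; rewrite exprS.
Qed.

Lemma diff_bigsum (W : normedModType C) (f : nat -> W -> C) N p :
  (forall j, differentiable (f j) p) -> differentiable (fun q => \sum_(j < N) f j q) p.
Proof.
move=> hf; rewrite (_ : (fun q => _) = \sum_(j < N) f j); last by apply: funext => q; rewrite fct_sumE.
by apply: differentiable_sum => i.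
Qed.

Lemma pair_line (z : V) (s t : C) : (z, s) + t *: ((0 : V), (1 : C)) = (z, s + t).
Proof.
have -> : (z, s) + t *: ((0 : V), (1 : C)) = (z + t *: 0, s + t * 1) by [].
by rewrite scaler0 addr0 mulr1.
Qed.

Lemma slice_cdiff (F : V -> C -> C) z t : differentiable (fun p : V * C => F p.1 p.2) (z, t) ->
  exists d, cdiff (F z) t d.
Proof.
move=> h; have h' : differentiable (fun p : V * C => F p.1 p.2) ((z, 0) + t *: ((0 : V), (1 : C))).
  by rewrite pair_line add0r.
have := diff_line h'; set d := derive _ _ _ => hd; exists d.
apply: (eq_ind _ (fun k => cdiff k t d) hd); apply: funext => s.
by rewrite pair_line add0r.
Qed.

Variables (c : nat -> V -> C) (rho K r : R).
Hypotheses (r0 : 0 < r) (rho0 : 0 < rho).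
Hypothesis ch : forall j, holo_on (c j) [set z | rnorm z < rho].
Hypothesis cb : forall z, rnorm z < rho -> gbound (c ^~ z) K r.

(** Partial sums are polynomials in the second variable with holomorphic coefficients, hence jointly
    differentiable. They are uniformly bounded on a small ball of the product space, so
    [limit_differentiable] gives joint holomorphy of the sum directly. *)
Lemma series_holo (G : V -> C -> C) :
  (forall z t, rnorm z < rho -> cmod t < r -> ps (c ^~ z) t @ \oo --> G z t) ->
  forall z t, rnorm z < rho -> cmod t < r -> differentiable (fun p : V * C => G p.1 p.2) (z, t).
Proof.
move=> hG z t zr tr.
pose s := Num.min (rho - rnorm z) ((r - cmod t) / 2).
have s0 : 0 < s by rewrite lt_min subr_gt0 zr divr_gt0// subr_gt0.
have inD (q : V * C) : rnorm (q - (z, t)) < s -> rnorm q.1 < rho /\ cmod q.2 < (r + cmod t) / 2.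
  move=> /rnorm_prodP [h1 h2]; split.
    have := rnormD (q.1 - z) z; rewrite subrK => h; apply: le_lt_trans h _.
    rewrite -ltrBrDr; apply: lt_le_trans h1 _; by rewrite ge_min lexx.
  have := cmodD (q.2 - t) t; rewrite subrK => h; apply: le_lt_trans h _.
  have h3 : cmod (q.2 - t) < (r - cmod t) / 2.
    rewrite -rnormC; apply: lt_le_trans h2 _; by rewrite ge_min lexx orbT.
  by move: h3; move: (cmod (q.2 - t)) (cmod t) => a b; lra.
have x1 : (r + cmod t) / 2 < r by move: tr; move: (cmod t) => b; lra.
apply: (@limit_differentiable _ _ (fun N p => ps (c ^~ p.1) p.2 N) _ (z, t) s
   (K / (1 - (r + cmod t) / 2 / r)) s0).
  move=> N q /inD [q1 q2]; split.
    apply: (diff_bigsum (f := fun j (p : V * C) => c j p.1 * p.2 ^+ j)) => j; apply: diff_mul.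
      apply: (@differentiable_comp _ _ _ _ (fun p : V * C => p.1) (c j)); first exact: diff_fst.
      exact: ch.
    by apply: diff_pow; exact: diff_snd.
  apply: le_trans (ps_bound N r0 (cb q1) (lt_trans q2 x1)) _.
  have K0 := gbound_ge0 (cb q1).
  have h1 : (r + cmod t) / 2 / r < 1 by rewrite ltr_pdivrMr// mul1r.
  have h2 : cmod q.2 / r <= (r + cmod t) / 2 / r by rewrite ler_pM2r ?invr_gt0// ltW.
  rewrite ler_wpM2l// lef_pV2 ?posrE ?subr_gt0//; last exact: le_lt_trans h1.
  by rewrite lerD2l lerN2.
move=> q /inD [q1 q2]; apply: hG => //; exact: lt_trans q2 x1.
Qed.
End product_tools.

Section sums.
Variable R : realType.
Local Notation C := (Cx R).

(* Junk value [0] where the series diverges. *)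
Definition psl (c : nat -> C) (t : C) : C :=
  match pselect (exists l : C, ps c t @ \oo --> l) with
  | left h => projT1 (cid h) | right _ => 0 end.

Lemma psl_cvg c t : (exists l : C, ps c t @ \oo --> l) -> ps c t @ \oo --> psl c t.
Proof. by move=> h; rewrite /psl; case: pselect => // h'; exact: (projT2 (cid h')). Qed.

Lemma psl_gb c K r t : 0 < r -> gbound c K r -> cmod t < r -> ps c t @ \oo --> psl c t.
Proof. by move=> r0 hc tr; apply: psl_cvg; exact: ps_cvg hc tr. Qed.

Lemma exp_term (x : R) m : 0 <= x -> x ^+ m / (m`!)%:R <= expR x.
Proof.
move=> x0; have nd : nondecreasing_seq (series (exp_coeff x)).
  by apply/nondecreasing_seqP => k; rewrite /series /= big_nat_recr//= lerDl exp_coeff_ge0.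
have := nondecreasing_cvgn_le nd (is_cvg_series_exp_coeff x) m.+1.
rewrite /series /= big_nat_recr//= => h; apply: le_trans h.
by rewrite /exp_coeff /= lerDr sumr_ge0// => i _; exact: exp_coeff_ge0.
Qed.

(** The terms of a convergent series are bounded: beyond [N] they are at most 2, as differences of
    partial sums within 1 of the limit, and the finitely many earlier ones are added to the
    constant. *)
Lemma ps_cvg_gbound c (t l : C) : t != 0 -> ps c t @ \oo --> l -> exists K, gbound c K (cmod t).
Proof.
move=> t0 hc; have t0' : 0 < cmod t by rewrite cmod_gt0.
have [N hN] := (cvgCP _ _).1 hc 1 ltr01.
exists (2 + \sum_(j < N) cmod (c j) * cmod t ^+ j) => m.
rewrite ler_pdivlMr ?exprn_gt0//.
have [mN|Nm] := ltnP m N.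
  rewrite (bigD1 (Ordinal mN))//= addrCA lerDl addr_ge0// sumr_ge0// => j _.
  by rewrite mulr_ge0 ?cmod_ge0// exprn_ge0 ?cmod_ge0.
have : cmod (c m) * cmod t ^+ m <= 2.
  rewrite -cmodX -cmodM.
  have -> : c m * t ^+ m = (ps c t m.+1 - l) - (ps c t m - l).
    by rewrite /ps big_ord_recr /=; ring.
  apply: le_trans (cmodB _ _) _.
  have := hN m Nm; have := hN m.+1 (leqW Nm); lra.
move=> h; apply: le_trans h _; rewrite lerDl sumr_ge0// => j _.
by rewrite mulr_ge0 ?cmod_ge0// exprn_ge0 ?cmod_ge0.
Qed.

Definition evenc (c : nat -> C) (m : nat) : C := if odd m then 0 else c m./2.

Lemma evenc_gbound c K r : 0 < r -> r <= 1 -> gbound c K (r ^+ 2) -> gbound (evenc c) K r.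
Proof.
move=> r0 r1 hc m; have K0 := gbound_ge0 hc; rewrite /evenc; case: ifPn => om.
  by rewrite cmod0 divr_ge0// exprn_ge0// ltW.
have := hc m./2; rewrite -exprM mul2n halfK (negbTE om) subn0; exact.
Qed.

Lemma evenc_cvg c K r (t l : C) : 0 < r -> r <= 1 -> gbound c K (r ^+ 2) -> cmod t < r ->
  ps c (t ^+ 2) @ \oo --> l -> ps (evenc c) t @ \oo --> l.
Proof.
move=> r0 r1 hc tr hl.
have [l' hl'] := ps_cvg r0 (evenc_gbound r0 r1 hc) tr.
suff <- : l' = l by [].
apply: (fun h => cvgC_unique h hl).
apply/cvgCP => e e0; have [N hN] := (cvgCP _ _).1 hl' e e0.
exists N => m Nm.
have E : ps (evenc c) t m.*2 = ps c (t ^+ 2) m.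
  rewrite ps_even; last by move=> j; rewrite /evenc /= odd_double.
  by congr (ps _ _ _); apply: funext => j; rewrite /evenc odd_double doubleK.
by rewrite -E; apply: hN; rewrite (leq_trans Nm)// -addnn leq_addr.
Qed.
End sums.

(** * Convergence *)

Section PartI.
Variables (R : realType) (n : nat).
Local Notation C := (Cx R).
Local Notation V := 'rV[C]_n.
Variables (u : nat -> V -> C) (M : V -> C -> C) (kap : nat -> R) (h : nat) (rho0 r0 K0 : R).
Hypotheses (rho00 : 0 < rho0) (r00 : 0 < r0) (r01 : r0 <= 1).
Hypothesis u_holo : forall j, holo_on (u j) [set z | rnorm z < rho0].
Hypothesis kap0 : kap 0%N != 0.
Hypothesis kapS : forall j, kap j = kap j.+1 * (2 * (j.*2 + h.+1))%:R.
Definition ku z j : C := rc (kap j) * u j z.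
Hypothesis kub : forall z, rnorm z < rho0 -> gbound (ku z) K0 (r0 ^+ 2).
Hypothesis kuM : forall z t, rnorm z < rho0 -> cmod t < r0 -> ps (ku z) (t ^+ 2) @ \oo --> M z t.

Lemma kap_le j : `|kap j| * (2 ^+ j * (j`!)%:R) <= `|kap 0%N|.
Proof.
elim: j => [|j IH]; first by rewrite fact0 expr0 !mulr1.
apply: le_trans IH; rewrite (kapS j) normrM normr_nat -mulrA ler_wpM2l//.
have -> : 2 ^+ j.+1 * (j.+1)`!%:R = (2 * j.+1)%:R * (2 ^+ j * j`!%:R) :> R.
  by rewrite factS !natrM exprS; ring.
rewrite ler_wpM2r ?mulr_ge0 ?exprn_ge0// ler_nat leq_mul2l /= -addnn; lia.
Qed.

(** Together with [kap_le] this compares [kap j] with [1 / j!] up to geometric factors: the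
    recurrence factor [2 (2j + h + 1)] lies between [2 (j + 1)] and [4 (h + 1) (j + 1)]. *)
Lemma kap_ge j : `|kap 0%N| <= `|kap j| * ((4 * h.+1)%:R ^+ j * (j`!)%:R).
Proof.
elim: j => [|j IH]; first by rewrite expr0 mul1r fact0 mulr1.
apply: le_trans IH _; rewrite (kapS j) normrM normr_nat -mulrA ler_wpM2l//.
have -> : (4 * h.+1)%:R ^+ j.+1 * (j.+1)`!%:R = (4 * h.+1 * j.+1)%:R * ((4 * h.+1)%:R ^+ j * j`!%:R) :> R.
  by rewrite factS !natrM exprS; ring.
rewrite ler_wpM2r ?mulr_ge0 ?exprn_ge0// ler_nat -addnn; nia.
Qed.

Lemma kap_neq0 j : kap j != 0.
Proof.
rewrite -normr_gt0 lt_neqAle normr_ge0 andbT eq_sym; apply/eqP => h0.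
have := kap_ge j; rewrite h0 mul0r normr_le0; exact/negP.
Qed.

Definition Bnd := exists rho K r : R, [/\ 0 < rho, rho <= rho0, 0 < r &
  forall z, rnorm z < rho -> gbound (u ^~ z) K r].

(** Convergence is only pointwise; the bound uniform in [z] comes from Cauchy estimates for the
    holomorphic sum [U], whose Taylor coefficients in [t] are the [u j] by uniqueness. *)
Lemma conv_bnd : converges_holo u -> Bnd.
Proof.
move=> [r [rr0 [U [hU hc]]]]; set D := [set p | _] in hU hc.
pose s := r / 2 / n.+1%:R; have s0 : 0 < s by rewrite !divr_gt0.
have inD z t : rnorm z < s -> cmod t < s -> D (z, t).
  move=> zs ts; have z2 : enorm z < r / 2 by apply: enorm_small zs; rewrite divr_gt0.
  have t2 : cmod t < r / 2.
    apply: lt_le_trans ts _; rewrite /s ler_pdivrMr// ler_peMr ?divr_ge0 ?(ltW rr0)//.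
    by rewrite ler1n.
  rewrite /D /=; have := enorm_ge0 z; have := cmod_ge0 t.
  move: (enorm z) (cmod t) z2 t2 => a b a2 b2 b0 a0; nra.
have nearU : \forall q \near (0 : V * C), differentiable (unc U) q.
  apply/near_rnorm; exists s => // q; rewrite subr0 => /rnorm_prodP [q1 q2].
  by apply: hU; rewrite [q]surjective_pairing; apply: inD => //; rewrite -rnormC.
have [d [B [d0 hB]]] := near_holoball nearU.
pose rho := Num.min rho0 (Num.min d s).
have rho_gt0 : 0 < rho by rewrite !lt_min rho00 d0.
have rle0 : rho <= rho0 by rewrite /rho ge_min lexx.
have rled : rho <= d by rewrite /rho !ge_min lexx orbT.
have rles : rho <= s by rewrite /rho !ge_min lexx !orbT.
exists rho, (2 * B), rho; split=> // z zr.
have inB t : cmod t <= rho -> rnorm ((z, t) - (0 : V * C)) < d + d.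
  move=> tr; rewrite subr0; apply/rnorm_prodP; split=> /=.
    by apply: (lt_le_trans zr); apply: le_trans rled _; rewrite lerDl ltW.
  rewrite rnormC; apply: (le_lt_trans tr); apply: le_lt_trans rled _; by rewrite ltrDl.
have [c [cb cc]] := @taylor_gbound R (U z) rho B rho_gt0
  (fun t ht => slice_cdiff (hB _ (inB t ht)).1) (fun t ht => (hB _ (inB t ht)).2).
have uc t : cmod t < rho -> ps (u ^~ z) t @ \oo --> U z t.
  move=> tr; apply: hc; apply: inD; [exact: lt_le_trans rles|exact: lt_le_trans tr rles].
have r2 : cmod (rc (rho / 2) : C) = rho / 2 by rewrite cmod_rc ger0_norm ?divr_ge0// ltW.
have r2lt : rho / 2 < rho by rewrite ltr_pdivrMr// ltr_pMr// ltr1n.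
have t0 : rc (rho / 2) != 0 :> C by rewrite rc_eq0 mulf_neq0 ?gt_eqF.
have r2' : cmod (rc (rho / 2) : C) < rho by rewrite r2.
(* [ps_uniq] wants some geometric bound on the [u j]. Convergence at [rho / 2] supplies one that may
   depend on [z]; the uniform bound is then read off from [c]. *)
have [K' hK'] := ps_cvg_gbound t0 (uc _ r2').
rewrite r2 in hK'.
have r20 : 0 < rho / 2 by rewrite divr_gt0.
have E := ps_uniq rho_gt0 r20 rho_gt0 cb hK' cc uc.
by move=> m; rewrite -E.
Qed.

Lemma bnd_conv : Bnd -> converges_holo u.
Proof.
move=> [rho [K [r [rho1 rle r1 hb]]]].
have hcv z t : rnorm z < rho -> cmod t < r -> ps (u ^~ z) t @ \oo --> psl (u ^~ z) t.
  by move=> zr tr; exact: (psl_gb r1 (hb z zr) tr).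
pose s := Num.min rho r; have s0 : 0 < s by rewrite lt_min rho1.
have srho : s <= rho by rewrite ge_min lexx.
have sr : s <= r by rewrite ge_min lexx orbT.
have uh j : holo_on (u j) [set z | rnorm z < rho].
  by move=> z zr; apply: u_holo; exact: lt_le_trans zr rle.
exists s; split=> //; exists (fun z t => psl (u ^~ z) t).
have inD z t : enorm z ^+ 2 + cmod t ^+ 2 < s ^+ 2 -> rnorm z < rho /\ cmod t < r.
  move=> hs; have e0 := enorm_ge0 z; have c0 := cmod_ge0 t; split.
    apply: le_lt_trans (rnorm_enorm z) _; apply: lt_le_trans srho.
    rewrite -(ltr_pXn2r (n := 2)) ?nnegrE// ?(ltW s0)//; apply: le_lt_trans hs.
    by rewrite lerDl sqr_ge0.
  apply: lt_le_trans sr; rewrite -(ltr_pXn2r (n := 2)) ?nnegrE// ?(ltW s0)//.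
  by apply: le_lt_trans hs; rewrite lerDr sqr_ge0.
split; last by move=> z t /inD [z1 t1]; exact: hcv.
move=> [z t] /inD [/= z1 t1].
exact: (series_holo r1 uh hb hcv z1 t1).
Qed.

(** By [kap_le] a factor [1 / j!] is gained, and [(S / (2 r))^j / j!] is at most the exponential. As
    [S] is arbitrary the radius is infinite, at the price of a constant exponential in [S]. *)
Lemma ku_gbound z K r S : 0 < r -> 0 < S -> gbound (u ^~ z) K r ->
  gbound (ku z) (`|kap 0%N| * K * expR (S / (2 * r))) S.
Proof.
move=> r1 S0 hb j; have K1 := gbound_ge0 hb.
rewrite /ku cmodM cmod_rc ler_pdivlMr ?exprn_gt0//.
have e1 := exp_term j (_ : 0 <= S / (2 * r)); have {}e1 := e1 (divr_ge0 (ltW S0) (mulr_ge0 (ler0n _ 2) (ltW r1))).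
apply: (@le_trans _ _ (`|kap j| * (2 ^+ j * (j`!)%:R) * K * ((S / (2 * r)) ^+ j / (j`!)%:R))).
  have f0 : (j`!)%:R != 0 :> R by rewrite pnatr_eq0 -lt0n fact_gt0.
  have p0 : 2 ^+ j != 0 :> R by rewrite expf_neq0// pnatr_eq0.
  rewrite expr_div_n exprMn.
  rewrite (_ : _ * (_ / _) = `|kap j| * (K / r ^+ j) * S ^+ j).
    by rewrite ler_wpM2r ?exprn_ge0 ?(ltW S0)// ler_wpM2l//; exact: hb.
  have q0 : r ^+ j != 0 by rewrite expf_neq0// gt_eqF.
  by move: (`|_|) ((j`!)%:R : R) (2 ^+ j) (r ^+ j) (S ^+ j) f0 p0 q0 => a b c d e f0 p0 q0; field; rewrite f0 q0.
rewrite ler_pM ?mulr_ge0 ?divr_ge0 ?exprn_ge0 ?(ltW S0) ?(ltW r1)//.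
  exact: divr_ge0 (ltW S0) (mulr_ge0 (ler0n _ 2) (ltW r1)).
by rewrite ler_wpM2r//; exact: kap_le.
Qed.

Lemma holo_ku j (rho : R) : rho <= rho0 -> holo_on (fun z => ku z j) [set z | rnorm z < rho].
Proof.
move=> rle z zr; apply: diff_mul; first exact: differentiable_cst.
by apply: u_holo; exact: lt_le_trans zr rle.
Qed.

Lemma bnd_entire : Bnd -> Ok_entire 2 (germ_fun M).
Proof.
move=> [rho [K [r [rho1 rle r1 hb]]]].
exists rho; split=> //; exists (fun z t => psl (ku z) (t ^+ 2)).
have gb z S : rnorm z < rho -> 0 < S -> gbound (ku z) (`|kap 0%N| * K * expR (S / (2 * r))) S.
  by move=> zr S0; apply: ku_gbound => //; exact: hb.
have hcv z t : rnorm z < rho -> ps (ku z) t @ \oo --> psl (ku z) t.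
  move=> zr; have S0 : 0 < cmod t + 1 by rewrite ltr_wpDl ?cmod_ge0.
  by apply: (psl_gb S0 (gb z _ zr S0)); rewrite ltrDl.
split.
- exists (Num.min rho r0); first by rewrite lt_min rho1.
  move=> z t; rewrite !lt_min => /andP[z1 _] /andP[_ t1].
  have zr : rnorm z < rho by apply: le_lt_trans (rnorm_enorm z) _.
  apply: cvgC_unique (hcv z _ zr) (kuM _ t1); exact: lt_le_trans zr rle.
- move=> [z t] /= zr0; have zr : rnorm z < rho by apply: le_lt_trans (rnorm_enorm z) _.
  have S0 : 0 < cmod (t ^+ 2) + 1 by rewrite ltr_wpDl ?cmod_ge0.
  have tS : cmod (t ^+ 2) < cmod (t ^+ 2) + 1 by rewrite ltrDl.
  have H := @series_holo R V (fun j z => ku z j) rho _ _ S0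
    (fun j => @holo_ku j rho rle) (fun z zr => gb z _ zr S0) (fun z t => psl (ku z) t)
    (fun z t zr _ => hcv z t zr) z (t ^+ 2) zr tS.
  apply: (@differentiable_comp _ _ _ _ (fun p : V * C => (p.1, p.2 ^+ 2))
     (fun p : V * C => psl (ku p.1) p.2) (z, t)); last exact: H.
  apply: differentiable_pair; first exact: diff_fst.
  by apply: diff_pow; exact: diff_snd.
- move=> r' r'r; exists (2 * (`|kap 0%N| * K * expR r^-1)), r^-1 => z t zr'.
  have zr : rnorm z < rho by apply: le_lt_trans (rnorm_enorm z) _; exact: le_lt_trans zr' r'r.
  have K1 : 0 <= K := gbound_ge0 (hb z zr).
  (* Choosing the radius according to [t]: the ratio [cmod (t ^+ 2) / S] stays below one half, and
     [S / (2 r)] is [r^-1 + r^-1 |t|^2], which is growth of order 2. *)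
  pose S := 2 * cmod t ^+ 2 + 2.
  have S0 : 0 < S by rewrite ltr_wpDl// mulr_ge0// exprn_ge0// cmod_ge0.
  have x12 : cmod (t ^+ 2) / S <= 1 / 2.
    by rewrite ler_pdivrMr// cmodX /S; lra.
  have tS : cmod (t ^+ 2) < S.
    by rewrite cmodX /S; have := sqr_ge0 (cmod t); lra.
  have kk : 0 <= `|kap 0%N| * K * expR (S / (2 * r)) by rewrite !mulr_ge0// expR_ge0.
  have hN N : cmod (ps (ku z) (t ^+ 2) N - 0) <= 2 * (`|kap 0%N| * K * expR (S / (2 * r))).
    rewrite subr0; apply: le_trans (ps_bound N S0 (gb z S zr S0) tS) _.
    rewrite mulrC ler_wpM2r// invf_ple ?posrE//; lra.
  have := cvgC_le (hcv z (t ^+ 2) zr) hN; rewrite subr0 => h1; apply: le_trans h1 _.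
  rewrite -(powR_mulrn 2 (cmod_ge0 t)) in S S0 x12 tS kk hN *.
  have -> : S / (2 * r) = r^-1 + r^-1 * cmod t `^ 2.
    rewrite /S; move: (cmod t `^ 2) => a; field; by rewrite gt_eqF.
  by rewrite expRD !mulrA.
Qed.

Lemma fact_le_pow j : (j`! <= j.+1 ^ j)%N.
Proof.
elim: j => [//|j IH]; rewrite factS expnS leq_mul//.
by apply: leq_trans IH _; case: j => [|j]; rewrite ?expn0// leq_exp2r.
Qed.

(** A Cauchy estimate on a circle adapted to [j] bounds [kap j * u j] by a geometric factor over
    [(j + 1)^j]. Dividing by [kap j] costs [j!] up to a geometric factor ([kap_ge]), and
    [j! <= (j + 1)^j]. *)
Lemma entire_bnd : Ok_entire 2 (germ_fun M) -> Bnd.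
Proof.
move=> [r [rr0 [F [[de de0 hF] hol gr]]]].
have r2 : r / 2 < r by rewrite ltr_pdivrMr// ltr_pMr// ltr1n.
have [A [B hAB]] := gr _ r2.
pose rho := Num.min rho0 (Num.min (de / n.+1%:R) (r / 2 / n.+1%:R)).
have rho1 : 0 < rho by rewrite !lt_min rho00 !divr_gt0.
pose b := expR `|B|; have b0 : 0 < b by exact: expR_gt0.
pose L := (4 * h.+1)%:R * b.
have L0 : 0 < L by rewrite mulr_gt0.
have k0 : 0 < `|kap 0%N| by rewrite normr_gt0.
exists rho, (2 * `|A| * b / `|kap 0%N|), L^-1; split=> //.
- by rewrite ge_min lexx.
- by rewrite invr_gt0.
move=> z zr j.
have z0 : rnorm z < rho0 by apply: lt_le_trans zr _; rewrite ge_min lexx.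
have zde : enorm z < de.
  by apply: enorm_small => //; apply: lt_le_trans zr _; rewrite !ge_min lexx orbT.
have zr2 : enorm z < r / 2.
  by apply: enorm_small; [rewrite divr_gt0|apply: lt_le_trans zr _; rewrite !ge_min lexx !orbT].
have zrr : enorm z < r by exact: lt_trans zr2 r2.
have dk t : exists d, cdiff (F z) t d by apply: slice_cdiff; exact: (hol (z, t)).
(* The coefficient of [t^(2j)] is estimated on the circle of squared radius [j + 1], where growth of
   order 2 contributes only a geometric factor in [j]. *)
pose Q := Num.sqrt (j.+1%:R : R).
have Q0 : 0 < Q by rewrite sqrtr_gt0.
have Q2 : Q ^+ 2 = j.+1%:R by rewrite sqr_sqrtr.
have bd t : cmod t <= Q -> cmod (F z t) <= `|A| * expR (`|B| * j.+1%:R).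
  move=> tQ; apply: le_trans (hAB z t (ltW zr2)) _.
  apply: (@le_trans _ _ (`|A| * expR (B * cmod t `^ 2))).
    by rewrite ler_wpM2r ?expR_ge0// ler_norm.
  rewrite ler_wpM2l// ler_expR (powR_mulrn 2 (cmod_ge0 t)).
  apply: (@le_trans _ _ (`|B| * cmod t ^+ 2)).
    by rewrite ler_wpM2r ?sqr_ge0// ler_norm.
  by rewrite ler_wpM2l// -Q2 lerXn2r ?nnegrE ?cmod_ge0// ltW.
have [c [cb cc]] := taylor_gbound Q0 (fun t _ => dk t) bd.
pose d := Num.min Q (Num.min de r0); have d0 : 0 < d by rewrite !lt_min Q0 de0.
have E : forall m, c m = evenc (ku z) m.
  apply: (@ps_uniq _ c (evenc (ku z)) _ K0 Q r0 d (F z) Q0 r00 d0 cb).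
  - by apply: evenc_gbound => //; exact: kub.
  - by move=> t td; apply: cc; apply: lt_le_trans td _; rewrite ge_min lexx.
  - move=> t; rewrite !lt_min => /and3P[_ t1 t2]; rewrite hF//.
    apply: (evenc_cvg r00 r01 (kub z0) t2); exact: kuM.
have := cb j.*2; rewrite E /evenc odd_double doubleK -mul2n exprM Q2 /ku cmodM cmod_rc => H.
rewrite exprVn invrK.
have f0 : 0 < (j`!)%:R :> R by rewrite ltr0n fact_gt0.
have kj : 0 < `|kap j| by rewrite normr_gt0 kap_neq0.
rewrite -(ler_pM2l kj); apply: le_trans H _.
rewrite ler_pdivrMr; last by rewrite exprn_gt0.
have E1 : expR (`|B| * j.+1%:R) = b * b ^+ j.
  by rewrite -exprS -expRM_natr.
rewrite E1.
apply: (@le_trans _ _ (2 * `|A| * b * b ^+ j * ((`|kap j| * ((4 * h.+1)%:R ^+ j * (j`!)%:R)) / `|kap 0%N|))).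
  rewrite [leLHS](_ : _ = 2 * `|A| * b * b ^+ j * 1); last by ring.
  rewrite ler_wpM2l//.
    by rewrite mulr_ge0 ?exprn_ge0 ?(ltW b0)// mulr_ge0 ?(ltW b0)// mulr_ge0.
  by rewrite ler_pdivlMr// mul1r; exact: kap_ge.
rewrite [leLHS](_ : _ = `|kap j| * (2 * `|A| * b / `|kap 0%N| * L ^+ j) * (j`!)%:R); last first.
  by rewrite /L exprMn; ring.
rewrite ler_wpM2l//.
  rewrite !mulr_ge0// ?invr_ge0 ?exprn_ge0 ?(ltW b0) ?(ltW L0)//.
by rewrite -natrX ler_nat; exact: fact_le_pow.
Qed.

Theorem part_i : converges_holo u <-> Ok_entire 2 (germ_fun M).
Proof.
by split=> [/conv_bnd/bnd_entire|/entire_bnd/bnd_conv].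
Qed.
End PartI.

(** * Summability *)

Section Wallis.
Variable R : realType.
Local Notation C := (Cx R).
Local Notation leb := (@lebesgue_measure R).

Lemma Rint_FTC (F f : R -> R) a b : a < b -> (forall x : R, is_derive x 1 F (f x)) ->
  continuous f -> Rintegral leb `[a, b] f = F b - F a.
Proof.
move=> ab dF cf.
have cF : continuous F.
  by move=> x; apply/differentiable_continuous/derivable1_diffP; case: (dF x).
rewrite /Rintegral (@continuous_FTC2 R f F a b ab).
- by [].
- exact: continuous_subspaceT.
- split.
  + by move=> x _; case: (dF x).
  + by apply: cvg_at_right_filter; exact: cF.
  + by apply: cvg_at_left_filter; exact: cF.
- by move=> x _; rewrite derive1E; case: (dF x).
Qed.

Definition Wal m : R := Rintegral leb `[0, pi / 2] (fun x => sin x ^+ m).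

Lemma continuous_sinX m : continuous (fun x : R => sin x ^+ m).
Proof.
move=> x; elim: m => [|m IH].
  by rewrite (_ : (fun y : R => _) = fun=> 1); [exact: cvg_cst|apply: funext => y; rewrite expr0].
rewrite (_ : (fun y : R => _) = fun y : R => sin y * sin y ^+ m); last by apply: funext => y; rewrite exprS.
by apply: cvgM; [exact: continuous_sin|exact: IH].
Qed.

Lemma pihalf_gt0 : 0 < pi / 2 :> R. Proof. by rewrite divr_gt0// pi_gt0. Qed.

Lemma continuous_sX (f : R -> R) : continuous f -> leb.-integrable `[0, pi / 2] (EFin \o f).
Proof.
by move=> cf; apply: continuous_compact_integrable; [exact: segment_compact|exact: continuous_subspaceT].
Qed.

(** The function [sin^(m+1) cos] vanishes at both ends of the interval, so its derivative has zero
    integral. *)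
Lemma Wal_rec m : m.+1%:R * Wal m = m.+2%:R * Wal m.+2.
Proof.
have d (x : R) : is_derive x 1 (fun x : R => sin x ^+ m.+1 * cos x)
    (m.+1%:R * sin x ^+ m - m.+2%:R * sin x ^+ m.+2).
  have h1 := is_deriveX m.+1 (is_derive_sin x).
  have h := is_deriveM h1 (is_derive_cos x).
  have e : (sin ^+ m.+1) x *: - sin x + cos x *: ((m.+1%:R * sin x ^+ m.+1.-1) *: cos x) =
     m.+1%:R * sin x ^+ m - m.+2%:R * sin x ^+ m.+2.
    rewrite /= /GRing.scale /=.
    have -> : (sin ^+ m.+1) x = sin x * sin x ^+ m by rewrite -exprS !fctE.
    have -> : m.+2%:R = m.+1%:R + 1 :> R by rewrite natr1.
    have -> : sin x ^+ m.+2 = sin x * (sin x * sin x ^+ m) by rewrite !exprS.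
    have := cos2Dsin2 x; rewrite !expr2.
    move: (sin x) (cos x) (m.+1%:R : R) => s c q H; move: (s ^+ m) => p.
    have -> : c * (q * p * c) = q * p * (c * c) by ring.
    have -> : c * c = 1 - s * s by rewrite -H; ring.
    ring.
  rewrite -e; have -> : (fun x : R => sin x ^+ m.+1 * cos x) = sin ^+ m.+1 * cos.
    by apply: funext => y; rewrite !fctE.
  exact: h.
have c1 : continuous (fun x : R => m.+1%:R * sin x ^+ m).
  by move=> x; apply: cvgM; [exact: cvg_cst|exact: continuous_sinX].
have c2 : continuous (fun x : R => m.+2%:R * sin x ^+ m.+2).
  by move=> x; apply: cvgM; [exact: cvg_cst|exact: continuous_sinX].
have cc : continuous (fun x : R => m.+1%:R * sin x ^+ m - m.+2%:R * sin x ^+ m.+2).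
  by move=> x; apply: cvgB; [exact: c1|exact: c2].
have := Rint_FTC pihalf_gt0 d cc.
rewrite cos_pihalf sin0 expr0n /= !mul0r mulr0 subrr RintegralB//; [|exact: continuous_sX|exact: continuous_sX].
rewrite !RintegralZl//; [|apply: continuous_sX; exact: continuous_sinX|apply: continuous_sX; exact: continuous_sinX].
by move=> /eqP; rewrite subr_eq0 => /eqP.
Qed.

Lemma Wal0 : Wal 0 = pi / 2.
Proof.
have d (x : R) : is_derive x 1 (fun x : R => x) 1 by exact: is_derive_id.
have c : continuous (fun _ : R => 1 : R) by move=> x; exact: cvg_cst.
have := Rint_FTC pihalf_gt0 d c; rewrite subr0 => <-.
by apply: eq_Rintegral => x _; rewrite expr0.
Qed.

Lemma Wal1 : Wal 1 = 1.
Proof.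
have d (x : R) : is_derive x 1 (fun x : R => - cos x) (sin x).
  by have := is_deriveN (is_derive_cos x); rewrite opprK.
have := Rint_FTC pihalf_gt0 d (@continuous_sin R).
rewrite cos_pihalf cos0 oppr0 sub0r opprK => <-.
by apply: eq_Rintegral => x _; rewrite expr1.
Qed.

Lemma Wal_neq0 m : Wal m != 0.
Proof.
suff [] : Wal m != 0 /\ Wal m.+1 != 0 by [].
elim: m => [|m [h1 h2]].
  by rewrite Wal0 Wal1 oner_eq0 gt_eqF// pihalf_gt0.
split=> //; apply/eqP => h; have := Wal_rec m; rewrite h mulr0 => /eqP.
by rewrite mulf_eq0 pnatr_eq0 /= (negbTE h1).
Qed.

Fixpoint qc (h j : nat) : R := if j is j'.+1 then qc h j' * (2 / (j'.*2 + h.+1)%:R) else 1.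

(** Averaging [(s sin^2 x)^j sin^h x] multiplies the coefficient of [s^j] by [Wal (j.*2 + h)];
    normalised by [Wal h] this turns [qc h] into [qc h.+1]. Both sides obey the same recursion by
    [Wal_rec]. *)
Lemma qc_up h j : Wal (j.*2 + h) * qc h j = Wal h * qc h.+1 j.
Proof.
elim: j => [|j IH]; first by rewrite /= mulr1.
have n1 : (j.*2 + h).+1%:R != 0 :> R by rewrite pnatr_eq0.
have n2 : (j.*2 + h).+2%:R != 0 :> R by rewrite pnatr_eq0.
apply: (mulfI n2); have -> : (j.+1.*2 + h = (j.*2 + h).+2)%N by [].
rewrite [LHS]mulrA -Wal_rec /= !addnS.
rewrite (_ : _ * _ * (qc h j * _) = (j.*2 + h).+1%:R * (2 / (j.*2 + h).+1%:R) * (Wal (j.*2 + h) * qc h j)); last by ring.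
rewrite IH.
by move: (Wal h) (qc h.+1 j) ((j.*2 + h).+1%:R : R) ((j.*2 + h).+2%:R : R) n1 n2 => a b c d n1 n2; field; rewrite n1 n2.
Qed.

(** The operator [2 s d/ds + (h + 1)] multiplies [s^j] by [2j + h + 1]; the product telescopes
    against the factors of [qc h.+2]. *)
Lemma qc_down h j : (j.*2 + h.+1)%:R * qc h.+2 j = h.+1%:R * qc h j.
Proof.
elim: j => [|j IH]; first by rewrite /= !mulr1.
have n1 : (j.*2 + h.+1)%:R != 0 :> R by rewrite pnatr_eq0 addnS.
have n3 : (j.*2 + h.+3)%:R != 0 :> R by rewrite pnatr_eq0 addnS.
have -> : (j.+1.*2 + h.+1)%N = (j.*2 + h.+3)%N by rewrite doubleS; lia.
rewrite /= mulrCA mulrA [h.+1%:R * _]mulrA -IH.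
by move: (qc h.+2 j) ((j.*2 + h.+1)%:R : R) ((j.*2 + h.+3)%:R : R) n1 n3 => a b c n1 n3; field; rewrite n1 n3.
Qed.

Lemma qc1 j : qc 1 j = (j`!%:R)^-1.
Proof.
elim: j => [|j IH]; first by rewrite fact0 invr1.
rewrite /= IH factS natrM invfM mulrC; congr (_ * _).
have -> : (j.*2 + 2)%N = (2 * j.+1)%N by lia.
by rewrite natrM invfM mulrA divff// mul1r.
Qed.
End Wallis.

(** * Disc-sectors under relative perturbations *)

Section Geometry.
Variable R : realType.
Local Notation C := (Cx R).

Lemma cisD (a b : R) : cis (a + b) = cis a * cis b.
Proof.
rewrite /cis cosD sinD rcB !rcD !rcM; have := sqr_ic R.
move: (ic R) (rc (cos a)) (rc (cos b)) (rc (sin a)) (rc (sin b)) => i p q r s hi.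
rewrite (_ : (p + i * r) * (q + i * s) = p * q + (i * i) * (r * s) + i * (r * q + p * s)); last by ring.
rewrite hi; ring.
Qed.

Lemma cis0 : cis (0 : R) = 1.
Proof. by rewrite /cis cos0 sin0 rc0 rc1 mulr0 addr0. Qed.

Lemma cis_neq0 (a : R) : cis a != 0.
Proof. by rewrite -cmod_gt0 cmod_cis. Qed.

Lemma cisN (a : R) : cis a * cis (- a) = 1.
Proof. by rewrite -cisD subrr cis0. Qed.

Lemma Re_cis (a : R) : complex.Re (cis a) = cos a.
Proof. by rewrite /cis cReD cReM /= !mul0r mul1r subr0 addr0. Qed.

Lemma Im_cis (a : R) : complex.Im (cis a) = sin a.
Proof. by rewrite /cis cImD cImM /= !mul0r mul1r !add0r. Qed.

Lemma sectorP (d eps : R) (t : C) : sector d eps t <->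
  exists rho th : R, [/\ 0 < rho, `|th - d| < eps / 2 & t = rc rho * cis th].
Proof.
split=> [[rho [th [r0 [hth e]]]]|[rho [th [r0 hth e]]]]; exists rho, th.
  by split=> //; rewrite e; apply: ReIm_eq; rewrite (cReM, cImM) Re_cis Im_cis /= ?mul0r ?subr0 ?addr0.
by split=> //; split=> //; rewrite e; apply: ReIm_eq; rewrite (cReM, cImM) Re_cis Im_cis /= ?mul0r ?subr0 ?addr0.
Qed.

Lemma polar_near (e : R) : 0 < e -> exists2 eta : R, 0 < eta & forall z : C, cmod z <= eta ->
  exists rho a : R, [/\ 0 < rho, `|a| < e & 1 + z = rc rho * cis a].
Proof.
move=> e0; have /cvgrPdist_lt /(_ e e0) := @continuous_atan R 0.
rewrite atan0 => -[x /= x0 hx].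
pose eta := Num.min (1 / 2) (x / 4); have eta0 : 0 < eta by rewrite lt_min !divr_gt0.
exists eta => // z; rewrite le_min => /andP[z1 z2].
have re : `|complex.Re z| <= 1 / 2 by exact: le_trans (Re_cmod z) z1.
have im : `|complex.Im z| <= x / 4 by exact: le_trans (Im_cmod z) z2.
set p := 1 + complex.Re z; have p12 : 1 / 2 <= p by move: re; rewrite ler_norml => /andP[h _]; rewrite /p; lra.
have p0 : 0 < p by lra.
pose y := complex.Im z / p.
have hy : `|0 - y| < x.
  rewrite sub0r normrN normrM normfV (ger0_norm (ltW p0)) ltr_pdivrMr//.
  apply: le_lt_trans im _.
  have : x * (1 / 2) <= x * p by rewrite ler_wpM2l// ltW.
  lra.
have := hx y hy; rewrite sub0r normrN => ha.
have s0 : 0 < Num.sqrt (1 + y ^+ 2) by rewrite sqrtr_gt0 ltr_wpDr// sqr_ge0.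
exists (p * Num.sqrt (1 + y ^+ 2)), (atan y); split=> //; first by rewrite mulr_gt0.
have ca : cos (atan y) = (Num.sqrt (1 + y ^+ 2))^-1 := cos_atan y.
have sa : sin (atan y) = y * (Num.sqrt (1 + y ^+ 2))^-1.
  have c0 : cos (atan y) != 0 by rewrite ca invr_neq0// gt_eqF.
  rewrite -ca -{2}(atanK y) /tan mulfVK//.
apply: ReIm_eq; rewrite (cReM, cImM) Re_cis Im_cis /= ?mul0r ?subr0 ?addr0 ?cReD ?cImD.
  by rewrite ca mulfK// gt_eqF.
rewrite sa mulrACA mulfV ?gt_eqF// mulr1 /y mulrCA mulfV ?gt_eqF// mulr1.
by rewrite /= add0r.
Qed.

Lemma sector_neq0 (d eps : R) (t : C) : sector d eps t -> t != 0.
Proof.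
move=> /sectorP [rho [th [r0 _ ->]]]; by rewrite mulf_neq0 ?cis_neq0// rc_eq0 gt_eqF.
Qed.

(** Multiplication by [1 + z] turns the argument by a small angle, uniformly in [s]. Such relative
    neighbourhoods grow with [s], as Cauchy estimates up to infinity require. *)
Lemma sector_fat (d e1 e2 : R) : e1 < e2 -> exists2 eta : R, 0 < eta &
  forall s z : C, sector d e1 s -> cmod z <= eta -> sector d e2 (s * (1 + z)).
Proof.
move=> e12; have e0 : 0 < (e2 - e1) / 2 by rewrite divr_gt0// subr_gt0.
have [eta eta0 h] := polar_near e0; exists eta => // s z /sectorP [rho [th [r0 hth ->]]] /h.
move=> [rho' [a [r0' ha ->]]]; apply/sectorP; exists (rho * rho'), (th + a); split.
- exact: mulr_gt0.
- rewrite addrAC; apply: le_lt_trans (ler_normD _ _) _; lra.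
- by rewrite rcM cisD mulrACA.
Qed.

Lemma dsector_fat (d e1 e2 r1 r2 : R) : e1 < e2 -> r1 < r2 -> exists2 eta : R, 0 < eta &
  forall s z : C, dsector d e1 r1 s -> cmod z <= eta -> dsector d e2 r2 (s * (1 + z)).
Proof.
move=> e12 r12; have [eta eta0 h] := sector_fat d e12.
(* The disc is empty when [r1] is not positive, hence the absolute value; the added 1 keeps the
   denominator positive. *)
pose et := Num.min eta ((r2 - r1) / (`|r1| + 1)).
have r10 : 0 < `|r1| + 1 by rewrite ltr_wpDl.
exists et; first by rewrite lt_min eta0 divr_gt0// subr_gt0.
move=> s z [hs|/= hs] hz.
  by left; apply: h => //; apply: le_trans hz _; rewrite ge_min lexx.
right=> /=; rewrite cmodM.
have hz2 : cmod z <= (r2 - r1) / (`|r1| + 1) by apply: le_trans hz _; rewrite ge_min lexx orbT.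
have s0 := cmod_ge0 s; have rr1 : 0 < r1 by exact: le_lt_trans s0 hs.
rewrite (gtr0_norm rr1) ler_pdivlMr in hz2; last by rewrite addr_gt0.
have h1 : cmod (1 + z) <= 1 + cmod z by apply: le_trans (cmodD _ _) _; rewrite cmod1.
have z0 := cmod_ge0 z.
apply: le_lt_trans (ler_wpM2l s0 h1) _.
move: (cmod s) (cmod z) s0 hs z0 hz2 => a b a0 ar b0 hb; nra.
Qed.

Lemma sector_sub (d e1 e2 : R) t : e1 <= e2 -> sector d e1 t -> sector d e2 t.
Proof.
move=> e12 /sectorP [rho [th [r0 hth ->]]]; apply/sectorP; exists rho, th; split=> //.
by apply: lt_le_trans hth _; rewrite ler_pM2r.
Qed.

Lemma dsector_sub (d e1 e2 r1 r2 : R) t : e1 <= e2 -> r1 <= r2 -> dsector d e1 r1 t -> dsector d e2 r2 t.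
Proof.
move=> e12 r12 [h|/= h]; [left; exact: sector_sub h|right; exact: lt_le_trans r12].
Qed.

(** Star-shapedness about 0 is what lets [s sin^2 x] stay in the domain when averaging. *)
Lemma dsector_star (d e r1 l : R) t : 0 < r1 -> 0 <= l <= 1 -> dsector d e r1 t ->
  dsector d e r1 (rc l * t).
Proof.
move=> r10 /andP[l0 l1]; have [->|ln0] := eqVneq l 0.
  by move=> _; right; rewrite /= rc0 mul0r cmod0.
move=> [/sectorP [rho [th [r0 hth ->]]]|/= h].
  left; apply/sectorP; exists (l * rho), th; split=> //; last by rewrite rcM mulrA.
  by rewrite mulr_gt0// lt_def ln0.
right=> /=; rewrite cmodM cmod_rc ger0_norm//; apply: le_lt_trans h.
by rewrite ler_piMl// cmod_ge0.
Qed.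

Lemma sector_shrink (d eps : R) t : sector d eps t -> exists2 e' : R, e' < eps & sector d e' t.
Proof.
move=> /sectorP [rho [th [r0 hth ->]]]; exists (`|th - d| + eps / 2); first by lra.
by apply/sectorP; exists rho, th; split=> //; lra.
Qed.

Lemma mul_nbhs (t : C) (eta : R) : 0 < eta -> t != 0 -> exists2 sg : R, 0 < sg &
  forall t', cmod (t' - t) < sg -> exists2 z, cmod z <= eta & t' = t * (1 + z).
Proof.
move=> eta0 t0; exists (eta * cmod t); first by rewrite mulr_gt0// cmod_gt0.
move=> t' ht; exists ((t' - t) / t); last by rewrite mulrDr mulr1 mulrC divfK// addrC subrK.
by rewrite cmodM cmodV ltW// ltr_pdivrMr// cmod_gt0.
Qed.

Lemma sector_open (d eps : R) t : sector d eps t -> exists2 sg : R, 0 < sg &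
  forall t', cmod (t' - t) < sg -> sector d eps t'.
Proof.
move=> h; have [e' e'e h'] := sector_shrink h; have [eta eta0 hf] := sector_fat d e'e.
have [sg sg0 hm] := mul_nbhs eta0 (sector_neq0 h); exists sg => // t' /hm [z hz ->].
exact: hf.
Qed.

(** The neighbourhood is placed inside a strictly smaller disc-sector, because growth bounds are
    available only there. *)
Lemma dsector_open (d eps r1 : R) t : 0 < r1 -> dsector d eps r1 t ->
  exists e' r' sg : R, [/\ e' < eps, 0 < r', r' < r1, 0 < sg &
    forall t', cmod (t' - t) < sg -> dsector d e' r' t'].
Proof.
move=> r10 [h|/= h].
  have [e1 e1e h1] := sector_shrink h.
  have [sg sg0 hs] := sector_open (sector_sub (t := t) (d := d) (e1 := e1) (e2 := (e1 + eps) / 2) ltac:(lra) h1).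
  exists ((e1 + eps) / 2), (r1 / 2), sg; split=> //; [lra|lra|lra|].
  by move=> t' /hs ?; left.
(* Here the disc alone contains the neighbourhood, and any opening below [eps] will do. *)
exists (eps - 1), ((r1 + cmod t) / 2), ((r1 - cmod t) / 2).
have c0 := cmod_ge0 t.
split; [lra|lra|lra|lra|].
move=> t' ht; right=> /=; have := cmodD (t' - t) t; rewrite subrK.
move: (cmod (t' - t)) (cmod t') (cmod t) ht => a b c; lra.
Qed.
End Geometry.

(** * Averaging and differentiating on a disc-sector *)

Section SOk.
Variables (R : realType) (n : nat).
Local Notation C := (Cx R).
Local Notation V := 'rV[C]_n.
Implicit Types (G : V -> C -> C).

(* [Ok_sector] with the supremum norm on the space variable and uniform growth on the whole
   polydisc. *)
Definition SOk (k d : R) (P : (V -> C -> C) -> Prop) := exists rho eps r1 : R,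
  [/\ 0 < rho, 0 < eps, eps < 2 * pi & 0 < r1] /\ exists G, [/\ P G,
   (forall z t, rnorm z < rho -> dsector d eps r1 t -> differentiable (unc G) (z, t)) &
   forall e' r', e' < eps -> r' < r1 -> exists A B : R, [/\ 0 <= A, 0 <= B &
     forall z t, rnorm z < rho -> dsector d e' r' t -> cmod (G z t) <= A * expR (B * cmod t `^ k)]].

Lemma SOkP k d P : Ok_sector k d P <-> SOk k d P.
Proof.
split=> [[r [eps [r1 [[r0 e0 e2 r10] [F [PF hF gF]]]]]]|[rho [eps [r1 [[rho0 e0 e2 r10] [G [PG hG gG]]]]]]].
  exists (r / n.+1%:R), eps, r1; split; first by split=> //; rewrite divr_gt0.
  exists F; split=> // [z t zr ts|e' r' he hr].
    by apply: hF; split=> //=; exact: enorm_small.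
  have nr : n%:R * (r / n.+1%:R) < r.
    by rewrite mulrCA -[ltRHS]mulr1 ltr_pM2l// ltr_pdivrMr// mul1r ltr_nat.
  have [A [B hAB]] := gF _ e' r' nr he hr.
  exists `|A|, `|B|; split=> // z t zr ts.
  have zn : enorm z <= n%:R * (r / n.+1%:R).
    by apply: le_trans (enorm_rnorm z) _; rewrite ler_wpM2l// ltW.
  apply: le_trans (hAB z t zn ts) _.
  apply: le_trans (ler_wpM2r (expR_ge0 _) (ler_norm A)) _.
  by rewrite ler_wpM2l// ler_expR ler_wpM2r ?powR_ge0// ler_norm.
exists rho, eps, r1; split=> //; exists G; split=> // [[z t] [/= zr ts]|r' e' r1' hr he hr1].
  by apply: hG => //; exact: le_lt_trans (rnorm_enorm z) zr.
have [A [B [A0 B0 hAB]]] := gG e' r1' he hr1.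
exists A, B => z t zr ts; apply: hAB => //.
by apply: le_lt_trans (rnorm_enorm z) _; exact: le_lt_trans zr hr.
Qed.

Lemma cvg_S (f : nat -> C) (l : C) : (fun N => f N.+1) @ \oo --> l -> f @ \oo --> l.
Proof.
move=> /cvgCP H; apply/cvgCP => e e0; have [N hN] := H e e0.
by exists N.+1 => -[//|m] Nm; exact: hN.
Qed.

Lemma ps_jc (c : nat -> C) s N : ps (fun j => j%:R * c j) s N.+1 = s * ps (dcoef c) s N.
Proof.
rewrite /ps big_ord_recl mul0r mul0r add0r mulr_sumr; apply: eq_bigr => j _.
by rewrite /dcoef /= /bump /= add1n exprS; ring.
Qed.

Lemma cauchy1 (k : C -> C) (r M : R) d : 0 < r ->
  (forall z, cmod z <= r -> exists d, cdiff k z d) ->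
  (forall z, cmod z <= r -> cmod (k z) <= M) -> cdiff k 0 d -> cmod d <= 2 * M / r.
Proof.
move=> r0 dk hk hd; have [c [cb cc]] := taylor_gbound r0 dk hk.
have z0 : cmod (0 : C) < r by rewrite cmod0.
have [_ h] := ps_deriv r0 cb cc z0; have [_ e] := cdiff_is_derive hd; rewrite e in h.
have -> : d = c 1%N.
  apply: (cvgC_unique h); apply: cvg_S; apply/cvgCP => x x0; exists 0%N => N _.
  by rewrite ps0 /dcoef mul1r subrr cmod0.
by have := cb 1%N; rewrite expr1.
Qed.

Lemma slice_deriv G z s : differentiable (unc G) (z, s) ->
  cdiff (G z) s ('D_((0 : V), (1 : C)) (unc G) (z, s)).
Proof.
move=> h; have e : (z, 0) + s *: ((0 : V), (1 : C)) = (z, s) by rewrite pair_line add0r.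
have h' : differentiable (unc G) ((z, 0) + s *: ((0 : V), (1 : C))) by rewrite e.
have := diff_line h'; rewrite e => hd.
apply: (eq_ind _ (fun k => cdiff k s _) hd); apply: funext => x.
by rewrite pair_line add0r.
Qed.

Variables (d eps r1 rho : R) (G : V -> C -> C).
Hypotheses (r10 : 0 < r1) (rho_gt0 : 0 < rho).
Hypothesis hG : forall z t, rnorm z < rho -> dsector d eps r1 t -> differentiable (unc G) (z, t).
Hypothesis gG : forall e' r', e' < eps -> r' < r1 -> exists A B : R, [/\ 0 <= A, 0 <= B &
     forall z t, rnorm z < rho -> dsector d e' r' t -> cmod (G z t) <= A * expR (B * cmod t `^ 1)].

Lemma dom_open z s : rnorm z < rho -> dsector d eps r1 s ->
  exists e' r' sg : R, [/\ e' < eps, 0 < r', r' < r1, 0 < sg &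
    forall q : V * C, rnorm (q - (z, s)) < sg -> rnorm q.1 < rho /\ dsector d e' r' q.2].
Proof.
move=> zr sD; have [e' [r' [sg [he hr0 hr sg0 H]]]] := dsector_open r10 sD.
exists e', r', (Num.min sg (rho - rnorm z)); split=> //; first by rewrite lt_min sg0 subr_gt0.
move=> q /rnorm_prodP; rewrite !lt_min => -[/andP[_ q1] /andP[q2 _]]; split.
  by have := rnormD (q.1 - z) z; rewrite subrK => h; apply: le_lt_trans h _; rewrite -ltrBrDr.
by apply: H; rewrite -rnormC.
Qed.

Lemma dom_diff_near z s : rnorm z < rho -> dsector d eps r1 s ->
  \forall q \near (z, s), differentiable (unc G) q.
Proof.
move=> zr sD; have [e' [r' [sg [he hr0 hr sg0 H]]]] := dom_open zr sD.
apply/near_rnorm; exists sg => // q /H [q1 q2]; rewrite [q]surjective_pairing.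
by apply: hG => //; apply: dsector_sub q2; exact: ltW.
Qed.

Section up.
Variable h : nat.
Definition upK (q : V * C) (x : R) : C := G q.1 (rc (sin x ^+ 2) * q.2) * rc (sin x ^+ h).

Lemma sin01 (x : R) : 0 <= sin x ^+ 2 <= 1.
Proof. by rewrite sqr_ge0 -(cos2Dsin2 x) lerDr sqr_ge0. Qed.

Lemma cont_rcsin m : continuous (fun x : R => rc (sin x ^+ m) : C).
Proof.
move=> x; apply: (@continuous_comp R R C (fun x : R => sin x ^+ m) (fun a : R => rc a : C)).
  exact: continuous_sinX.
exact: rc_continuous.
Qed.

Lemma upK_cont q : rnorm q.1 < rho -> dsector d eps r1 q.2 -> continuous (upK q).
Proof.
move=> q1 q2 x.
apply: (@contM R R (fun x => G q.1 (rc (sin x ^+ 2) * q.2)) (fun x => rc (sin x ^+ h))); last exact: cont_rcsin.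
have sD := dsector_star r10 (sin01 x) q2.
have [dd hd] := slice_cdiff (hG q1 sD).
have cG : {for rc (sin x ^+ 2) * q.2, continuous (G q.1)}.
  apply/differentiable_continuous/derivable1_diffP; case: (cdiff_is_derive hd) => //.
apply: (@continuous_comp R C C (fun x : R => rc (sin x ^+ 2) * q.2) (G q.1)); last exact: cG.
apply: (@contM R R (fun x => rc (sin x ^+ 2)) (fun=> q.2)); first exact: cont_rcsin.
exact: cvg_cst.
Qed.

Lemma sin_pow_le1 (x : R) m : `|sin x ^+ m| <= 1.
Proof.
rewrite normrX exprn_ile1// -(ler_pXn2r (n := 2)) ?nnegrE//.
by rewrite expr1n real_normK ?num_real//; have /andP[] := sin01 x.
Qed.

Lemma upK_bound e' r' A B z s x (S : R) : 0 < r' -> 0 <= A -> 0 <= B ->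
  (forall z t, rnorm z < rho -> dsector d e' r' t -> cmod (G z t) <= A * expR (B * cmod t `^ 1)) ->
  rnorm z < rho -> dsector d e' r' s -> cmod s <= S -> cmod (upK (z, s) x) <= A * expR (B * S).
Proof.
move=> r0 A0 B0 H zr sD sS; rewrite /upK cmodM cmod_rc -[leRHS]mulr1.
have sD' := dsector_star r0 (sin01 x) sD.
apply: ler_pM; rewrite ?cmod_ge0//; last exact: sin_pow_le1.
apply: le_trans (H _ _ zr sD') _; rewrite ler_wpM2l// ler_expR ler_wpM2l//.
rewrite powRr1 ?cmod_ge0// cmodM cmod_rc ger0_norm; last by have /andP[] := sin01 x.
apply: le_trans sS; rewrite ler_piMl ?cmod_ge0//; by have /andP[] := sin01 x.
Qed.

Definition upG z s : C := rc (Wal R h)^-1 * sI (upK (z, s)) 0 (pi / 2).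

Lemma upG_diff z s : rnorm z < rho -> dsector d eps r1 s -> differentiable (unc upG) (z, s).
Proof.
move=> zr sD; have [e' [r' [sg [he hr0 hr sg0 H]]]] := dom_open zr sD.
have [A [B [A0 B0 hAB]]] := gG he hr.
apply: diff_mul; first exact: differentiable_cst.
rewrite (_ : (fun q : V * C => _) = fun q => sI (upK q) 0 (pi / 2)); last by apply: funext => -[a b].
have p0 : 0 <= pi / 2 :> R := ltW (pihalf_gt0 R).
have full q : rnorm (q - (z, s)) < sg -> rnorm q.1 < rho /\ dsector d eps r1 q.2.
  by move=> /H [q1 q2]; split=> //; apply: dsector_sub q2; exact: ltW.
apply: (@integral_differentiable R _ upK 0 (pi / 2) (z, s) sg (A * expR (B * (cmod s + sg))) sg0 p0).
  by move=> q /full [q1 q2]; exact: upK_cont.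
move=> x _ q hq; have [q1 q2] := full q hq; split.
  apply: diff_mul; last exact: differentiable_cst.
  have sD' := dsector_star r10 (sin01 x) q2.
  apply: (@differentiable_comp _ _ _ _ (fun p : V * C => (p.1, rc (sin x ^+ 2) * p.2)) (unc G) q); last exact: hG.
  apply: differentiable_pair; first exact: diff_fst.
  by apply: diff_mul; [exact: differentiable_cst|exact: diff_snd].
have [_ q2'] := H q hq; rewrite [q]surjective_pairing.
apply: (upK_bound x hr0 A0 B0 hAB q1 q2').
move/rnorm_prodP: hq => [_ h2]; have := cmodD (q.2 - s) s; rewrite subrK => h3.
by apply: le_trans h3 _; rewrite addrC lerD2l -rnormC ltW.
Qed.

Lemma upG_growth e' r' : e' < eps -> r' < r1 -> exists A B : R, [/\ 0 <= A, 0 <= B &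
     forall z t, rnorm z < rho -> dsector d e' r' t -> cmod (upG z t) <= A * expR (B * cmod t `^ 1)].
Proof.
(* The given [r'] need not be positive, whereas star-shapedness wants a genuine disc. *)
move=> he hr; pose r2 := Num.max r' (r1 / 2).
have r20 : 0 < r2 by rewrite lt_max divr_gt0// orbT.
have r21 : r2 < r1 by rewrite gt_max hr ltr_pdivrMr// ltr_pMr// ltr1n.
have [A [B [A0 B0 hAB]]] := gG he r21.
have p0 : 0 <= pi / 2 :> R := ltW (pihalf_gt0 R).
exists (`|(Wal R h)^-1| * (2 * A * (pi / 2))), B; split=> //; first by do 3 (apply: mulr_ge0 => //).
move=> z t zr tD; have tD2 : dsector d e' r2 t by apply: dsector_sub tD => //; rewrite le_max lexx.
have tD3 : dsector d eps r1 t by apply: dsector_sub tD2; exact: ltW.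
rewrite /upG cmodM cmod_rc -[leRHS]mulrA; apply: ler_wpM2l => //.
have cK := @upK_cont (z, t) zr tD3.
apply: le_trans (sI_bound p0 cK (M := A * expR (B * cmod t)) _) _.
  by move=> x _; exact: (upK_bound x r20 A0 B0 hAB zr tD2 (lexx _)).
by rewrite subr0 powRr1 ?cmod_ge0// le_eqVlt; apply/orP; left; apply/eqP; ring.
Qed.

(** Along [s sin^2 x] the modulus never exceeds that of [s], so the remainder of the series is
    bounded uniformly in [x] and integrates to 0; each term integrates to a Wallis number. *)
Lemma upG_germ (c : nat -> C) z (K r : R) : 0 < r -> r <= r1 -> rnorm z < rho -> gbound c K r ->
  (forall s, cmod s < r -> ps c s @ \oo --> G z s) ->
  forall s, cmod s < r ->
   ps (fun j => rc (Wal R (j.*2 + h) / Wal R h) * c j) s @ \oo --> upG z s.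
Proof.
move=> r0 rr1 zr cb cc s sr.
have sD : dsector d eps r1 s by right; exact: lt_le_trans rr1.
have x0 : 0 <= cmod s / r by rewrite divr_ge0 ?cmod_ge0// ltW.
have x1 : cmod s / r < 1 by rewrite ltr_pdivrMr// mul1r.
have K0 := gbound_ge0 cb.
have p0 : 0 <= pi / 2 :> R := ltW (pihalf_gt0 R).
have ctrm (j : nat) : continuous (fun x : R => c j * s ^+ j * rc (sin x ^+ (j.*2 + h))).
  by move=> x; apply: (@contM R R (fun=> c j * s ^+ j) (fun x => rc (sin x ^+ (j.*2 + h)))); [exact: cvg_cst|exact: cont_rcsin].
pose P N x := \sum_(j < N) c j * s ^+ j * rc (sin x ^+ (j.*2 + h)).
have cP N : continuous (P N).
  by move=> x; apply: (cont_sum (f := fun j (x : R) => c j * s ^+ j * rc (sin x ^+ (j.*2 + h)))) => m; exact: ctrm.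
have sIW j : sI (fun x : R => rc (sin x ^+ j)) 0 (pi / 2) = rc (Wal R j).
  apply: ReIm_eq; first by rewrite Re_CI.
  by rewrite Im_CI /= Rintegral_cst// mul0r.
have sIP N : rc (Wal R h)^-1 * sI (P N) 0 (pi / 2) = ps (fun j => rc (Wal R (j.*2 + h) / Wal R h) * c j) s N.
  rewrite /P (sI_sum N 0 (pi / 2) ctrm) mulr_sumr /ps; apply: eq_bigr => j _.
  rewrite sI_Z; last exact: cont_rcsin.
  by rewrite sIW rcM; ring.
have PE N x : P N x = ps c (rc (sin x ^+ 2) * s) N * rc (sin x ^+ h).
  rewrite /P /ps mulr_suml; apply: eq_bigr => j _.
  by rewrite exprMn -rcX -exprM mul2n exprD rcM; ring.
have cK := @upK_cont (z, s) zr sD.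
have rem N x : cmod (upK (z, s) x - P N x) <= K / (1 - cmod s / r) * (cmod s / r) ^+ N.
  rewrite PE /upK -mulrBl cmodM cmod_rc.
  have /andP[s0 s1] := sin01 x.
  have cs : cmod (rc (sin x ^+ 2) * s) <= cmod s.
    by rewrite cmodM cmod_rc ger0_norm// ler_piMl// cmod_ge0.
  have csr : cmod (rc (sin x ^+ 2) * s) < r by exact: le_lt_trans sr.
  have := ps_rem N r0 cb csr (cc _ csr) => hrem.
  apply: (@le_trans _ _ (K * (cmod s / r) ^+ N / (1 - cmod s / r) * 1)).
    apply: ler_pM; rewrite ?cmod_ge0//; last exact: sin_pow_le1.
    apply: le_trans hrem _.
    have y0 : 0 <= cmod (rc (sin x ^+ 2) * s) / r by rewrite divr_ge0 ?cmod_ge0// ltW.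
    have yx : cmod (rc (sin x ^+ 2) * s) / r <= cmod s / r by rewrite ler_pM2r ?invr_gt0.
    have y1 : cmod (rc (sin x ^+ 2) * s) / r < 1 by exact: le_lt_trans x1.
    apply: ler_pM; rewrite ?mulr_ge0 ?exprn_ge0 ?invr_ge0 ?subr_ge0 ?(ltW y1)//.
      by rewrite ler_wpM2l// lerXn2r ?nnegrE.
    by rewrite lef_pV2 ?posrE ?subr_gt0// lerD2l lerN2.
  by rewrite mulr1 mulrAC.
pose Q := `|(Wal R h)^-1| * (2 * (K / (1 - cmod s / r)) * (pi / 2)).
apply/cvgCP => e e0.
have /cvgrPdist_lt /(_ e e0) [N _ hN] := geo_cvg Q x0 x1.
exists N => m Nm; rewrite -sIP cmodC /upG -mulrBr -(sI_B 0 (pi / 2) cK (cP m)).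
rewrite cmodM cmod_rc.
have cB : continuous (fun x => upK (z, s) x - P m x).
  by move=> x; apply: cvgB; [exact: cK|exact: cP].
apply: le_lt_trans (ler_wpM2l (normr_ge0 _) (sI_bound p0 cB (fun x _ => rem m x))) _.
have := hN m Nm; rewrite /= sub0r normrN subr0 => hq.
apply: le_lt_trans hq; apply: le_trans (ler_norm _).
by rewrite /Q le_eqVlt; apply/orP; left; apply/eqP; ring.
Qed.
End up.

Section down.
Variable h : nat.
Let Ds z s : C := 'D_((0 : V), (1 : C)) (unc G) (z, s).
Definition downG z s : C := rc h.+1%:R^-1 * (2 * (s * 'D_((0 : V), (1 : C)) (unc G) (z, s)) + h.+1%:R * G z s).

Lemma downG_diff z s : rnorm z < rho -> dsector d eps r1 s -> differentiable (unc downG) (z, s).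
Proof.
move=> zr sD.
have [d1 _] := differentiable_derive ((0 : V), (1 : C)) (dom_diff_near zr sD).
apply: diff_mul; first exact: differentiable_cst.
apply: diff_add; (apply: diff_mul; first exact: differentiable_cst).
  apply: diff_mul; first exact: diff_snd.
  have e : 'D_((0 : V), (1 : C)) (unc G) = fun q : V * C => 'D_((0 : V), (1 : C)) (unc G) (q.1, q.2).
    by apply: funext => -[a b].
  by rewrite e in d1; exact: d1.
exact: (hG zr sD).
Qed.

(** The function [x -> G z (t (1 + x))] has derivative [t d_t G] at 0. A Cauchy estimate on the disc
    of fixed radius [eta], a relative neighbourhood of [t], bounds it however large [t] is. As
    [eta <= 1], the modulus at most doubles, and so does [B]. *)
Lemma downG_growth e' r' : e' < eps -> r' < r1 -> exists A B : R, [/\ 0 <= A, 0 <= B &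
     forall z t, rnorm z < rho -> dsector d e' r' t -> cmod (downG z t) <= A * expR (B * cmod t `^ 1)].
Proof.
move=> he hr; pose e2 := (e' + eps) / 2; pose r2 := (r' + r1) / 2.
have e'2 : e' < e2 by rewrite /e2; lra.
have e2e : e2 < eps by rewrite /e2; lra.
have r'2 : r' < r2 by rewrite /r2; lra.
have r2r : r2 < r1 by rewrite /r2; lra.
have [A [B [A0 B0 hAB]]] := gG e2e r2r.
have [eta0 eta00 hf0] := dsector_fat d e'2 r'2.
pose eta := Num.min 1 eta0; have eta1 : 0 < eta by rewrite lt_min ltr01.
have etale : eta <= 1 by rewrite ge_min lexx.
have hf s z : dsector d e' r' s -> cmod z <= eta -> dsector d e2 r2 (s * (1 + z)).
  by move=> hs hz; apply: hf0 => //; apply: le_trans hz _; rewrite ge_min lexx orbT.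
exists (4 * A / eta + h.+1%:R * A), (2 * B); split; rewrite ?addr_ge0 ?mulr_ge0 ?invr_ge0 ?(ltW eta1)//.
move=> z t zr tD.
have tD2 : dsector d e2 r2 t by have := hf t 0 tD; rewrite cmod0 addr0 mulr1; apply; exact: ltW.
have tD3 : dsector d eps r1 t by apply: dsector_sub tD2; exact: ltW.
have lineE x : (z, t) + x *: ((0 : V), t) = (z, t * (1 + x)).
  have -> : (z, t) + x *: ((0 : V), t) = (z + x *: 0, t + x * t) by [].
  by rewrite scaler0 addr0 mulrDr mulr1 (mulrC x).
have dline x : cmod x <= eta -> cdiff (fun x => unc G ((z, t) + x *: ((0 : V), t))) x
   ('D_((0 : V), t) (unc G) ((z, t) + x *: ((0 : V), t))).
  move=> hx; apply: diff_line; rewrite lineE; apply: hG => //.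
  by apply: dsector_sub (hf t x tD hx); exact: ltW.
have kb x : cmod x <= eta -> cmod (unc G ((z, t) + x *: ((0 : V), t))) <= A * expR (2 * B * cmod t).
  move=> hx; rewrite lineE; apply: le_trans (hAB _ _ zr (hf t x tD hx)) _.
  rewrite ler_wpM2l// ler_expR powRr1 ?cmod_ge0// cmodM.
  have h1 : cmod (1 + x) <= 2.
    apply: le_trans (cmodD _ _) _; rewrite cmod1; lra.
  rewrite [2 * B]mulrC -!mulrA ler_wpM2l// mulrC ler_wpM2r// cmod_ge0//.
have z0 : cmod (0 : C) <= eta by rewrite cmod0 ltW.
have H := cauchy1 eta1 (fun x hx => ex_intro _ _ (dline x hx)) kb (dline 0 z0).
rewrite scale0r addr0 in H.
have e1 : 'D_((0 : V), t) (unc G) (z, t) = t * 'D_((0 : V), (1 : C)) (unc G) (z, t).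
  have -> : ((0 : V), t) = t *: ((0 : V), (1 : C)).
    have -> : t *: ((0 : V), (1 : C)) = (t *: 0, t * 1) by [].
    by rewrite scaler0 mulr1.
  exact: derive_scale (hG zr tD3).
rewrite e1 in H.
have G1 : cmod (G z t) <= A * expR (2 * B * cmod t).
  by have := kb 0 z0; rewrite scale0r addr0.
rewrite /downG cmodM cmod_rc ger0_norm ?invr_ge0//.
have i1 : (h.+1%:R : R)^-1 <= 1 by rewrite invf_le1// ler1n.
apply: (@le_trans _ _ (1 * cmod (2 * (t * 'D_((0 : V), (1 : C)) (unc G) (z, t)) + h.+1%:R * G z t))).
  by rewrite ler_wpM2r// cmod_ge0.
rewrite mul1r powRr1 ?cmod_ge0//; apply: le_trans (cmodD _ _) _.
rewrite (cmodM 2) (cmodM h.+1%:R) !cmod_nat [leRHS]mulrDl; apply: lerD.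
  rewrite (_ : 4 * A / eta * _ = 2 * (2 * (A * expR (2 * B * cmod t)) / eta)); last by ring.
  by rewrite ler_wpM2l.
by rewrite -mulrA ler_wpM2l.
Qed.

Lemma downG_germ (c : nat -> C) z (K r : R) : 0 < r -> r <= r1 -> rnorm z < rho -> gbound c K r ->
  (forall s, cmod s < r -> ps c s @ \oo --> G z s) ->
  forall s, cmod s < r ->
   ps (fun j => rc ((j.*2 + h.+1)%:R / h.+1%:R) * c j) s @ \oo --> downG z s.
Proof.
move=> r0 rr1 zr cb cc s sr.
have sD : dsector d eps r1 s by right; exact: lt_le_trans rr1.
have [_ hd] := ps_deriv r0 cb cc sr.
have [_ e] := cdiff_is_derive (slice_deriv (hG zr sD)); rewrite e in hd.
apply: cvg_S.
have E N : ps (fun j => rc ((j.*2 + h.+1)%:R / h.+1%:R) * c j) s N.+1 =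
   rc h.+1%:R^-1 * (2 * (s * ps (dcoef c) s N) + h.+1%:R * ps c s N.+1).
  rewrite -ps_jc /ps (mulr_sumr _ _ _ 2) (mulr_sumr _ _ _ h.+1%:R) -big_split /= mulr_sumr.
  apply: eq_bigr => j _; rewrite rcM rc_nat natrD -muln2 natrM; ring.
rewrite (_ : (fun N => _) = fun N => rc h.+1%:R^-1 * (2 * (s * ps (dcoef c) s N) + h.+1%:R * ps c s N.+1)); last first.
  by apply: funext => N; exact: E.
have c2 : (fun N => ps c s N.+1) @ \oo --> G z s.
  apply/cvgCP => x x0; have [N hN] := (cvgCP _ _).1 (cc s sr) x x0.
  by exists N => m Nm; apply: hN; exact: leqW.
apply: cvgM; first exact: cvg_cst.
apply: cvgD; apply: cvgM; [exact: cvg_cst| |exact: cvg_cst|exact: c2].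
by apply: cvgM; [exact: cvg_cst|exact: hd].
Qed.
End down.
End SOk.

(** * Independence of the index *)

Section chain.
Variables (R : realType) (n : nat).
Local Notation C := (Cx R).
Local Notation V := 'rV[C]_n.
Variables (d : R) (u : nat -> V -> C).

Definition cq h (j : nat) (z : V) : C := rc (qc R h j) * u j z.
Definition Xs h := SOk 1 d (germ_series (cq h)).

(** Convergence at the single point [rc de] bounds the coefficients; the constant may depend on [z],
    which is enough for identifying germs. *)
Lemma germ_ps (c : nat -> V -> C) (G : V -> C -> C) : germ_series c G ->
  exists2 de : R, 0 < de & forall z, rnorm z < de ->
    (exists K, gbound (c ^~ z) K de) /\ forall s, cmod s < de -> ps (c ^~ z) s @ \oo --> G z s.
Proof.
move=> [e e0 H]; pose de := Num.min (e / n.+1%:R) (e / 2).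
have de0 : 0 < de by rewrite lt_min !divr_gt0.
have dee : de < e.
  by apply: (@le_lt_trans _ _ (e / 2)); [rewrite ge_min lexx orbT|rewrite ltr_pdivrMr// ltr_pMr// ltr1n].
exists de => // z zd; have ze : enorm z < e.
  by apply: enorm_small => //; apply: lt_le_trans zd _; rewrite ge_min lexx.
have hs s : cmod s < e -> ps (c ^~ z) s @ \oo --> G z s by move=> se; exact: H.
split; last by move=> s sd; apply: hs; exact: lt_trans dee.
have cde : cmod (rc de : C) = de by rewrite cmod_rc ger0_norm// ltW.
have t0 : rc de != 0 :> C by rewrite rc_eq0 gt_eqF.
have t1 : cmod (rc de : C) < e by rewrite cde.
by have [K hK] := ps_cvg_gbound t0 (hs _ t1); exists K; rewrite -cde.
Qed.

Lemma Xs_up h : Xs h -> Xs h.+1.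
Proof.
move=> [rho [eps [r1 [[rho0 e0 e2 r10] [G [PG hG gG]]]]]].
have [de de0 hde] := germ_ps PG.
exists rho, eps, r1; split=> //; exists (upG G h); split.
- pose r := Num.min de r1; have r0 : 0 < r by rewrite lt_min de0.
  exists (Num.min rho r); first by rewrite lt_min rho0.
  move=> z t; rewrite !lt_min => /andP[zr /andP[zd _]] /andP[_ /andP[td t1]].
  have zr' : rnorm z < rho by exact: le_lt_trans (rnorm_enorm z) zr.
  have zd' : rnorm z < de by exact: le_lt_trans (rnorm_enorm z) zd.
  have [[K hK] hc] := hde z zd'.
  have rde : r <= de by rewrite ge_min lexx.
  have rr1 : r <= r1 by rewrite ge_min lexx orbT.
  have tr : cmod t < r by rewrite lt_min td.
  have := @upG_germ R n d eps r1 rho G r10 hG h (cq h ^~ z) z K r r0 rr1 zr'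
    (gbound_sub r0 rde hK) (fun s sr => hc s (lt_le_trans sr rde)) t tr.
  rewrite (_ : (fun j => _) = cq h.+1 ^~ z)//.
  apply: funext => j; rewrite /cq mulrA -rcM; congr (rc _ * _).
  by rewrite mulrAC qc_up mulrAC mulfV ?Wal_neq0// mul1r.
- by move=> z t zr tD; apply: (upG_diff r10 hG gG).
- by move=> e' r' he hr; apply: (upG_growth r10 hG gG).
Qed.

Lemma Xs_down h : Xs h.+2 -> Xs h.
Proof.
move=> [rho [eps [r1 [[rho0 e0 e2 r10] [G [PG hG gG]]]]]].
have [de de0 hde] := germ_ps PG.
exists rho, eps, r1; split=> //; exists (downG G h); split.
- pose r := Num.min de r1; have r0 : 0 < r by rewrite lt_min de0.
  exists (Num.min rho r); first by rewrite lt_min rho0.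
  move=> z t; rewrite !lt_min => /andP[zr /andP[zd _]] /andP[_ /andP[td t1]].
  have zr' : rnorm z < rho by exact: le_lt_trans (rnorm_enorm z) zr.
  have zd' : rnorm z < de by exact: le_lt_trans (rnorm_enorm z) zd.
  have [[K hK] hc] := hde z zd'.
  have rde : r <= de by rewrite ge_min lexx.
  have rr1 : r <= r1 by rewrite ge_min lexx orbT.
  have tr : cmod t < r by rewrite lt_min td.
  have := @downG_germ R n d eps r1 rho G hG h (cq h.+2 ^~ z) z K r r0 rr1 zr'
    (gbound_sub r0 rde hK) (fun s sr => hc s (lt_le_trans sr rde)) t tr.
  rewrite (_ : (fun j => _) = cq h ^~ z)//.
  apply: funext => j; rewrite /cq mulrA -rcM; congr (rc _ * _).
  by rewrite mulrAC qc_down mulrAC mulfV ?pnatr_eq0// mul1r.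
- by move=> z t zr tD; apply: (downG_diff r10 hG).
- by move=> e' r' he hr; apply: (downG_growth hG gG).
Qed.

Lemma Xs_le h k : Xs h -> Xs (h + k).
Proof. by elim: k => [|k IH]; rewrite ?addn0// addnS => /IH /Xs_up. Qed.

(** Raising goes one by one and lowering two by two: from [j] one climbs to the even number [j.*2],
    descends to 0 and climbs again to [k]. *)
Lemma Xs_iff h k : Xs h -> Xs k.
Proof.
suff H j : Xs j -> Xs 0 by move=> /H /(@Xs_le 0 k).
move=> h1; have {h1} : Xs j.*2.
  by rewrite -addnn; exact: Xs_le.
by elim: j => [//|j IH]; rewrite doubleS => /Xs_down.
Qed.
End chain.

(** * A holomorphic square root *)

Section Sqrt.
Variable R : realType.
Local Notation C := (Cx R).

Definition slit (w : C) : R := cmod w + complex.Re w.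
(* The principal square root, written so as to be visibly differentiable off the slit
   [slit w = 0], the closed negative half-line. *)
Definition sq (w : C) : C := (w + rc (cmod w)) / rc (Num.sqrt (2 * slit w)).

Lemma sqr_cmod (w : C) : cmod w ^+ 2 = complex.Re w ^+ 2 + complex.Im w ^+ 2.
Proof. by rewrite /cmod sqr_sqrtr// addr_ge0// sqr_ge0. Qed.

Lemma sqK w : 0 < slit w -> sq w ^+ 2 = w.
Proof.
move=> s0; have s2 : 0 <= 2 * slit w by rewrite mulr_ge0// ltW.
rewrite /sq expr_div_n -rcX sqr_sqrtr//.
have n0 : rc (2 * slit w) != 0 :> C by rewrite rc_eq0 gt_eqF// mulr_gt0.
apply: (mulIf n0); rewrite divfK//.
have hm := sqr_cmod w; move: s0 s2 n0 => _ _ _.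
move: hm; rewrite /slit; case: w => a b /=; move: (cmod _) => m hm.
apply: ReIm_eq; rewrite expr2 ?cReM ?cImM ?cReD ?cImD /=; last by ring.
have -> : (b + 0) * (b + 0) = m ^+ 2 - a ^+ 2 by rewrite hm; ring.
ring.
Qed.

Lemma Re_sq w : 0 < slit w -> 0 < complex.Re (sq w).
Proof.
move=> s0; have s2 : 0 < 2 * slit w by rewrite mulr_gt0.
have q0 : 0 < Num.sqrt (2 * slit w) by rewrite sqrtr_gt0.
rewrite /sq -rcV cReM cReD /= mulr0 subr0 mulr_gt0 ?invr_gt0//.
by move: s0; rewrite /slit addrC.
Qed.

Lemma sqr_inj (x y : C) : 0 < complex.Re x -> 0 < complex.Re y -> x ^+ 2 = y ^+ 2 -> x = y.
Proof.
move=> x0 y0 /eqP; rewrite -subr_eq0 subr_sqr mulf_eq0 => /orP[|/eqP h].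
  by rewrite subr_eq0 => /eqP.
have := congr1 (fun z : C => complex.Re z) h; rewrite cReD /= => h2; exfalso; lra.
Qed.

Lemma slit_near w w' : `|slit w' - slit w| <= 2 * cmod (w' - w).
Proof.
rewrite /slit (_ : _ - _ = (cmod w' - cmod w) + complex.Re (w' - w)); last by rewrite cReD cReN; ring.
apply: le_trans (ler_normD _ _) _; rewrite mulr_natl mulr2n lerD ?Re_cmod//.
rewrite ler_norml cmod_triB andbT lerNl opprB cmodC; exact: cmod_triB.
Qed.

(** From [w' - w = (sq w' - sq w) (sq w' + sq w)] the first-order error is exactly
    [- (w' - w)^2 / (2 sq w (sq w' + sq w)^2)]. Both square roots have positive real part, so the
    denominator is at least twice the cube of [a], the real part of [sq w]. *)
Lemma sq_cdiff w : 0 < slit w -> cdiff sq w (2 * sq w)^-1.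
Proof.
move=> s0 e e0; set a := complex.Re (sq w); have a0 : 0 < a := Re_sq s0.
have a3 : 0 < 2 * a ^+ 3 by rewrite mulr_gt0// exprn_gt0.
exists (Num.min (slit w / 4) (e * (2 * a ^+ 3))).
  by rewrite lt_min divr_gt0// mulr_gt0.
move=> w'; rewrite lt_min => /andP[h1 h2].
have s0' : 0 < slit w'.
  by have := slit_near w w'; rewrite ler_norml => /andP[h3 _]; lra.
have q' := Re_sq s0'.
have sa : a <= cmod (sq w) := le_trans (ler_norm _) (Re_cmod _).
have sa' : a <= cmod (sq w' + sq w).
  apply: le_trans (le_trans (ler_norm _) (Re_cmod _)); rewrite cReD -/a; lra.
have n1 : sq w != 0 by rewrite -cmod_gt0 (lt_le_trans a0).
have n2 : sq w' + sq w != 0 by rewrite -cmod_gt0 (lt_le_trans a0).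
have e1 : w' - w = (sq w' - sq w) * (sq w' + sq w) by rewrite -subr_sqr !sqK.
have -> : sq w' - sq w - (2 * sq w)^-1 * (w' - w) =
   - ((w' - w) ^+ 2 / (2 * sq w * (sq w' + sq w) ^+ 2)).
  rewrite e1; move: (sq w') (sq w) n1 n2 => x y n1 n2; field.
  by rewrite n1 n2.
rewrite cmodN (cmodM ((w' - w) ^+ 2)) cmodV (cmodX (w' - w)) (cmodM (2 * sq w)) (cmodM 2) cmod_nat.
have hb : 2 * a ^+ 3 <= 2 * cmod (sq w) * cmod ((sq w' + sq w) ^+ 2).
  rewrite -mulrA ler_pM2l// cmodX exprS ler_pM ?(ltW a0)// ?exprn_ge0 ?(ltW a0)//.
  by rewrite lerXn2r ?nnegrE ?(ltW a0)// cmod_ge0.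
have c0 := cmod_ge0 (w' - w).
rewrite ler_pdivrMr; last exact: lt_le_trans hb.
rewrite expr2 mulrAC ler_wpM2r//; apply: le_trans (ltW h2) _.
by rewrite ler_wpM2l// ltW.
Qed.

(* The branch of [2 sqrt s] in direction [d / 2]. *)
Definition tau (d : R) (s : C) : C := 2 * cis (d / 2) * sq (s * cis (- d)).

(** An opening of at most [pi] puts [s * cis (- d)] in the right half-plane, off the slit. Its root
    is then identified in polar form: two numbers with positive real part and equal squares
    coincide. *)
Lemma tau_sector d e s : e <= pi -> sector d e s ->
  [/\ tau d s ^+ 2 = 4 * s, sector (d / 2) (e / 2) (tau d s) & 0 < slit (s * cis (- d))].
Proof.
move=> epi /sectorP [rho [th [r0 hth ->]]].
have E : rc rho * cis th * cis (- d) = rc rho * cis (th - d) by rewrite -mulrA -cisD.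
have := hth; rewrite ltr_norml => /andP[t1 t2].
have pp : 0 < pi :> R := pi_gt0 R.
have ca : 0 < cos (th - d) by apply: cos_gt0_pihalf; apply/andP; split; lra.
have ca2 : 0 < cos ((th - d) / 2) by apply: cos_gt0_pihalf; apply/andP; split; lra.
have sl : 0 < slit (rc rho * cis th * cis (- d)).
  rewrite E /slit cmodM cmod_rc cmod_cis cReM Re_cis /= mul0r subr0 addr_gt0//.
    by rewrite mulr1 normr_gt0 gt_eqF.
  exact: mulr_gt0.
have sqE : sq (rc rho * cis th * cis (- d)) = rc (Num.sqrt rho) * cis ((th - d) / 2).
  apply: sqr_inj; first exact: Re_sq.
    by rewrite cReM Re_cis /= mul0r subr0 mulr_gt0// sqrtr_gt0.
  rewrite sqK// E exprMn -rcX sqr_sqrtr ?(ltW r0)// expr2 -cisD; congr (_ * cis _); lra.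
split=> //.
- rewrite /tau exprMn sqK// exprMn [cis (d / 2) ^+ 2]expr2 -cisD.
  have -> : d / 2 + d / 2 = d by lra.
  have := cisN d; move: (cis d) (cis (- d)) (rc rho * cis th) => x y z h.
  rewrite (_ : 2 ^+ 2 * x * (z * y) = 4 * z * (x * y)); last by ring.
  by rewrite h mulr1.
- rewrite /tau sqE; apply/sectorP; exists (2 * Num.sqrt rho), (th / 2); split.
  + by rewrite mulr_gt0// sqrtr_gt0.
  + by rewrite (_ : th / 2 - d / 2 = (th - d) / 2) ?normrM ?(ger0_norm (x := 2^-1))// ?ltr_pM2r//; lra.
  + rewrite mulrACA -cisD rcM rc_nat; congr (_ * cis _); lra.
Qed.

Lemma tau_diff d s : 0 < slit (s * cis (- d)) -> differentiable (tau d) s.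
Proof.
move=> s0; apply: diff_mul; first exact: differentiable_cst.
apply: (@differentiable_comp _ _ _ _ (fun s : C => s * cis (- d)) sq).
  apply: diff_mul; last exact: differentiable_cst.
  by apply/derivable1_diffP; exact: derivable_id.
by apply/derivable1_diffP; case: (cdiff_is_derive (sq_cdiff s0)).
Qed.

(** Used to read a function defined by cases through whichever formula holds near the point. *)
Lemma diff_nearby (W : normedModType C) (f g : W -> C) p : (\forall q \near p, f q = g q) ->
  (\forall q \near p, differentiable f q) -> differentiable g p.
Proof.
move=> fg hf; have [a [M [a0 hb]]] := near_holoball hf.
have /near_rnorm[r r0 hr] := fg.
pose s := Num.min a r; have s0 : 0 < s by rewrite lt_min a0.
apply: (@limit_differentiable _ _ (fun _ => f) g p s M s0).
  move=> _ q hq; apply: hb; apply: (lt_trans (y := a)); first by rewrite (lt_le_trans hq)// ge_min lexx.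
  by rewrite ltrDl.
move=> q hq; rewrite -hr; first exact: cvg_cst.
by rewrite (lt_le_trans hq)// ge_min lexx orbT.
Qed.
End Sqrt.

(** * Transport between the mean and the series *)

Section PartII.
Variables (R : realType) (n : nat).
Local Notation C := (Cx R).
Local Notation V := 'rV[C]_n.
Variables (u : nat -> V -> C) (M : V -> C -> C) (kap : nat -> R) (h : nat) (rho0 r0 K0 : R).
Hypotheses (rho00 : 0 < rho0) (r00 : 0 < r0).
Hypothesis u_holo : forall j, holo_on (u j) [set z | rnorm z < rho0].
Hypothesis kap0 : kap 0%N != 0.
Hypothesis kapS : forall j, kap j = kap j.+1 * (2 * (j.*2 + h.+1))%:R.
Hypothesis kub : forall z, rnorm z < rho0 -> gbound (ku u kap z) K0 (r0 ^+ 2).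
Hypothesis kuM : forall z t, rnorm z < rho0 -> cmod t < r0 -> ps (ku u kap z) (t ^+ 2) @ \oo --> M z t.

Lemma kap_qc j : kap j * 4 ^+ j = kap 0%N * qc R h j.
Proof.
elim: j => [|j IH]; first by rewrite expr0.
have n0 : (j.*2 + h.+1)%:R != 0 :> R by rewrite pnatr_eq0 addnS.
have := kapS j; rewrite natrM => E.
rewrite /= mulrA -IH E exprS.
by move: (kap j.+1) (4 ^+ j) ((j.*2 + h.+1)%:R : R) n0 => a b c n0; field.
Qed.

Lemma ku_cq z s N : ps (ku u kap z) s N = rc (kap 0%N) * ps (cq u h ^~ z) (s * rc 4^-1) N.
Proof.
rewrite /ps mulr_sumr; apply: eq_bigr => j _; rewrite /ku /cq exprMn -rcX.
have f0 : 4 ^+ j != 0 :> R by rewrite expf_neq0// pnatr_eq0.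
have -> : kap j = kap 0%N * qc R h j / 4 ^+ j by rewrite -kap_qc mulfK.
rewrite exprVn !rcM; ring.
Qed.

Lemma cq_gbound z : rnorm z < rho0 -> gbound (cq u h ^~ z) (K0 / `|kap 0%N|) (r0 ^+ 2 / 4).
Proof.
move=> zr j; have H := kub zr j.
have k0 : 0 < `|kap 0%N| by rewrite normr_gt0.
have f0 : 4 ^+ j != 0 :> R by rewrite expf_neq0// pnatr_eq0.
have -> : cq u h j z = rc (4 ^+ j / kap 0%N) * ku u kap z j.
  rewrite /cq /ku mulrA -rcM; congr (rc _ * _).
  by rewrite mulrAC [4 ^+ j * _]mulrC kap_qc mulrAC mulfV// mul1r.
rewrite cmodM cmod_rc normrM normfV normrX normr_nat expr_div_n.
have -> : K0 / `|kap 0%N| / ((r0 ^+ 2) ^+ j / 4 ^+ j) = 4 ^+ j / `|kap 0%N| * (K0 / (r0 ^+ 2) ^+ j).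
  by rewrite invf_div; ring.
by rewrite ler_wpM2l// mulr_ge0 ?invr_ge0 ?exprn_ge0.
Qed.

Lemma cq_cvg z s : rnorm z < rho0 -> cmod s < r0 ^+ 2 / 4 -> ps (cq u h ^~ z) s @ \oo --> psl (cq u h ^~ z) s.
Proof.
move=> zr sr; apply: (psl_gb _ (cq_gbound zr) sr).
by rewrite divr_gt0// exprn_gt0.
Qed.

Lemma M_psl z t : rnorm z < rho0 -> cmod t < r0 -> M z t = rc (kap 0%N) * psl (cq u h ^~ z) (t ^+ 2 * rc 4^-1).
Proof.
move=> zr tr; apply: cvgC_unique (kuM zr tr) _.
rewrite (_ : ps _ _ = fun N => rc (kap 0%N) * ps (cq u h ^~ z) (t ^+ 2 * rc 4^-1) N); last first.
  by apply: funext => N; exact: ku_cq.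
apply: cvgM; first exact: cvg_cst.
apply: cq_cvg => //; rewrite cmodM cmod_rc cmodX ger0_norm ?invr_ge0//.
by rewrite ltr_pM2r ?invr_gt0// ltrXn2r// ?nnegrE ?cmod_ge0// ltW.
Qed.

Lemma rnorm_sub_lt (W : normedModType C) (x y : W) b : rnorm (x - y) < b - rnorm y -> rnorm x < b.
Proof.
move=> h1; have := rnormD (x - y) y; rewrite subrK => h3.
by apply: (le_lt_trans h3); rewrite -ltrBrDr.
Qed.

(** The hypothesis on [cis] treats [d' = d / 2] and [d' = d / 2 + pi] at once: doubling the angle
    gives an argument near [2 d'], which is brought near [d] by subtracting a full number of
    turns. *)
Lemma sector_sqr d d' e (t : C) : cis (2 * d' - d) = 1 -> sector d' e t -> sector d (2 * e) (t ^+ 2 * rc 4^-1).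
Proof.
move=> hd /sectorP [rho [th [r1 hth ->]]]; apply/sectorP.
exists (rho ^+ 2 / 4), (2 * th - (2 * d' - d)); split.
- by rewrite divr_gt0// exprn_gt0.
- have -> : 2 * th - (2 * d' - d) - d = 2 * (th - d') by ring.
  rewrite normrM normr_nat; lra.
- have hc : cis (2 * th - (2 * d' - d)) = cis (2 * th).
    transitivity (cis (2 * th - (2 * d' - d)) * cis (2 * d' - d)); first by rewrite hd mulr1.
    by rewrite -cisD subrK.
  rewrite hc exprMn -rcX rcM.
  have -> : 2 * th = th + th by ring.
  by rewrite cisD expr2; ring.
Qed.

Lemma ii_fwd d d' : cis (2 * d' - d) = 1 -> Xs d u h -> SOk 2 d' (germ_fun M).
Proof.
move=> hd [rho [eps [r1 [[rho1 e0 e2 r10] [G [PG hG gG]]]]]].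
have [de de0 hde] := germ_ps PG.
pose rr := Num.min 1 r1; have rr0 : 0 < rr by rewrite lt_min ltr01.
have sm (t : C) : cmod t < rr -> cmod (t ^+ 2 * rc 4^-1) < r1 / 2.
  rewrite lt_min => /andP[t1 t2]; rewrite cmodM cmod_rc cmodX ger0_norm ?invr_ge0//.
  have c0 := cmod_ge0 t; nra.
have dmap e r t : r <= rr -> dsector d' e r t -> dsector d (2 * e) (r1 / 2) (t ^+ 2 * rc 4^-1).
  move=> rle [hs|/= hs]; first by left; exact: (sector_sqr hd hs).
  by right; apply: sm; exact: lt_le_trans rle.
have r12 : r1 / 2 < r1 by rewrite ltr_pdivrMr// ltr_pMr// ltr1n.
exists rho, (eps / 2), rr; split; first by split=> //; lra.
exists (fun z t => rc (kap 0%N) * G z (t ^+ 2 * rc 4^-1)); split.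
- pose dd := Num.min (Num.min rho0 r0) (Num.min de 1).
  exists dd; first by rewrite !lt_min rho00 r00 de0 ltr01.
  move=> z t; rewrite !lt_min => /andP[/andP[z1 _] /andP[z2 _]] /andP[/andP[_ t1] /andP[t2 t3]].
  have zr : rnorm z < rho0 by exact: le_lt_trans (rnorm_enorm z) z1.
  have zd : rnorm z < de by exact: le_lt_trans (rnorm_enorm z) z2.
  rewrite M_psl//; congr (_ * _).
  have [_ hc] := hde z zd.
  have s1 : cmod (t ^+ 2 * rc 4^-1) < de.
    rewrite cmodM cmod_rc cmodX ger0_norm ?invr_ge0//.
    have c0 := cmod_ge0 t; nra.
  apply: cvgC_unique (hc _ s1) (cq_cvg zr _).
  rewrite cmodM cmod_rc cmodX ger0_norm ?invr_ge0//.
  by rewrite ltr_pM2r ?invr_gt0// ltrXn2r// ?nnegrE ?cmod_ge0// ltW.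
- move=> z t zr tD; apply: diff_mul; first exact: differentiable_cst.
  apply: (@differentiable_comp _ _ _ _ (fun p : V * C => (p.1, p.2 ^+ 2 * rc 4^-1)) (unc G) (z, t)).
    apply: differentiable_pair; first exact: diff_fst.
    by apply: diff_mul; [apply: diff_pow; exact: diff_snd|exact: differentiable_cst].
  apply: hG => //=; have := dmap _ _ _ (lexx rr) tD; rewrite mulrC divfK//.
  by apply: dsector_sub => //; exact: ltW.
- move=> e' r' he hr; have e'2 : 2 * e' < eps by lra.
  have [A [B [A0 B0 H]]] := gG _ _ e'2 r12.
  exists (`|kap 0%N| * A), B; split=> //; first exact: mulr_ge0.
  move=> z t zr tD; rewrite (cmodM (rc (kap 0%N))) cmod_rc -[leRHS]mulrA; apply: ler_wpM2l; first exact: normr_ge0.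
  apply: le_trans (H z _ zr (dmap _ _ _ (ltW hr) tD)) _.
  apply: (ler_wpM2l A0); rewrite ler_expR; apply: (ler_wpM2l B0).
  rewrite powRr1 ?cmod_ge0// (powR_mulrn 2 (cmod_ge0 t)).
  rewrite cmodM cmod_rc cmodX ger0_norm ?invr_ge0//.
  by have := sqr_ge0 (cmod t); lra.
Qed.

(** The continuation is glued from two formulas: the power series near 0, where [tau] is not
    holomorphic, and the continued mean composed with [tau] on the sector. They agree on the overlap
    because the mean is a power series in [t ^+ 2]. *)
Lemma ii_bwd d : SOk 2 (d / 2) (germ_fun M) -> Xs d u h.
Proof.
move=> [rho [eps [r1 [[rho1 e0 e2 r10] [F [[de de0 hF] dF gF]]]]]].
have pp : 0 < pi :> R := pi_gt0 R.
pose ep := Num.min eps pi; have ep0 : 0 < ep by rewrite lt_min e0.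
have epe : ep <= eps by rewrite ge_min lexx.
have epi : ep <= pi by rewrite ge_min lexx orbT.
(* As [|tau|^2 = 4 |s|], this disc is mapped into the range where [M] is both the germ of [F] and
   the sum of its series. It is also at most half the disc of convergence, so the series is bounded
   there by twice its constant. *)
pose q := Num.min (r0 ^+ 2 / 8) (de ^+ 2 / 8).
have q0 : 0 < q by rewrite lt_min !divr_gt0// exprn_gt0.
have q1 : q <= r0 ^+ 2 / 8 by rewrite ge_min lexx.
have q2 : q <= de ^+ 2 / 8 by rewrite ge_min lexx orbT.
have r02 : 0 < r0 ^+ 2 by rewrite exprn_gt0.
have de2 : 0 < de ^+ 2 by rewrite exprn_gt0.
pose rh := Num.min (Num.min rho rho0) (de / n.+1%:R).
have rh0 : 0 < rh by rewrite !lt_min rho1 rho00 divr_gt0.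
have rhP (z : V) : rnorm z < rh -> [/\ rnorm z < rho, rnorm z < rho0 & enorm z < de].
  by rewrite !lt_min => /andP[/andP[? ?] ?]; split=> //; exact: (enorm_small de0).
pose G z s := if cmod s < q then psl (cq u h ^~ z) s else (rc (kap 0%N))^-1 * F z (tau d s).
have k0 : rc (kap 0%N) != 0 :> C by rewrite rc_eq0.
have four (x : C) : 4 * x * rc 4^-1 = x.
  by rewrite mulrC mulrA -(rc_nat R 4) -rcM mulVf ?rc1 ?mul1r// pnatr_eq0.
have GS z s : rnorm z < rh -> sector d ep s -> G z s = (rc (kap 0%N))^-1 * F z (tau d s).
  move=> /rhP [z1 z2 z3] sD; rewrite /G; case: ifPn => // sq1.
  have [t2 _ _] := tau_sector epi sD.
  have ct : cmod (tau d s) ^+ 2 = 4 * cmod s by rewrite -cmodX t2 cmodM cmod_nat.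
  have tde : cmod (tau d s) < de.
    rewrite -(ltr_pXn2r (n := 2)) ?nnegrE ?cmod_ge0 ?(ltW de0)// ct; lra.
  have tr0 : cmod (tau d s) < r0.
    rewrite -(ltr_pXn2r (n := 2)) ?nnegrE ?cmod_ge0 ?(ltW r00)// ct; lra.
  by rewrite hF// M_psl// t2 four mulKf.
exists rh, ep, q; split.
  by split=> //; apply: le_lt_trans epe e2.
exists G; split.
- exists (Num.min rh q); first by rewrite lt_min rh0.
  move=> z t; rewrite lt_min => /andP[z1 _]; rewrite lt_min => /andP[_ t1].
  have [_ z2 _] := rhP z (le_lt_trans (rnorm_enorm z) z1).
  rewrite /G t1; apply: cq_cvg => //; lra.
- move=> z s zr [sD|/= sq1].
    have [z1 z2 z3] := rhP z zr.
    have [sg sg0 hsg] := sector_open sD.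
    have nb q' : rnorm (q' - (z, s)) < Num.min sg (rh - rnorm z) -> rnorm q'.1 < rh /\ sector d ep q'.2.
      move=> /rnorm_prodP; rewrite (lt_min _ sg) (lt_min _ sg) => -[/andP[_ h1] /andP[h2 _]]; split.
        exact: rnorm_sub_lt h1.
      by apply: hsg; rewrite -rnormC.
    have mn0 : 0 < Num.min sg (rh - rnorm z) by rewrite lt_min sg0 subr_gt0.
    apply: (@diff_nearby _ _ (fun p : V * C => (rc (kap 0%N))^-1 * F p.1 (tau d p.2))).
      apply/near_rnorm; exists (Num.min sg (rh - rnorm z)) => // -[a b] /nb [/= h1 h2].
      by rewrite /unc /= GS.
    apply/near_rnorm; exists (Num.min sg (rh - rnorm z)); first exact: mn0.
    move=> -[a b] /nb [/= h1 h2].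
    have [_ t2 sl] := tau_sector epi h2; have [a1 _ _] := rhP a h1.
    apply: diff_mul; first exact: differentiable_cst.
    apply: (@differentiable_comp _ _ _ _ (fun p : V * C => (p.1, tau d p.2)) (unc F) (a, b)).
      apply: differentiable_pair; first exact: diff_fst.
      apply: (@differentiable_comp _ _ _ _ (fun p : V * C => p.2) (tau d)); first exact: diff_snd.
      exact: tau_diff.
    by apply: dF => //=; left; apply: sector_sub t2; lra.
  have [z1 z2 z3] := rhP z zr.
  pose sg := Num.min (rh - rnorm z) (q - cmod s).
  have sg0 : 0 < sg by rewrite lt_min !subr_gt0 zr.
  have nb q' : rnorm (q' - (z, s)) < sg -> rnorm q'.1 < rh /\ cmod q'.2 < q.
    move=> /rnorm_prodP; rewrite /sg (lt_min _ (rh - rnorm z)) (lt_min _ (rh - rnorm z)) => -[/andP[h1 _] /andP[_ h2]]; split.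
      exact: rnorm_sub_lt h1.
    by have := cmodD (q'.2 - s) s; rewrite subrK => h3; apply: le_lt_trans h3 _; rewrite -ltrBrDr -rnormC.
  apply: (@diff_nearby _ _ (fun p : V * C => psl (cq u h ^~ p.1) p.2)).
    apply/near_rnorm; exists sg => // -[a b] /nb [/= h1 h2].
    by rewrite /unc /= /G h2.
  apply/near_rnorm; exists sg => // -[a b] /nb [/= h1 h2].
  have [_ a2 _] := rhP a h1.
  have qq : 0 < r0 ^+ 2 / 4 by rewrite divr_gt0.
  apply: (@series_holo R V (cq u h) rho0 _ _ qq _ (fun z zr => @cq_gbound z zr) (fun z t => psl (cq u h ^~ z) t)
    (fun z t zr tr => @cq_cvg z t zr tr) a b a2); last by lra.
  move=> j x xr; apply: diff_mul; first exact: differentiable_cst.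
  exact: u_holo.
- move=> e' r' he hr; have e'2 : e' / 2 < eps by lra.
  have r12 : r1 / 2 < r1 by lra.
  have [A [B [A0 B0 H]]] := gF _ _ e'2 r12.
  pose A1 := 2 * (`|K0| / `|kap 0%N|).
  exists (A1 + `|kap 0%N|^-1 * A), (4 * B); split.
  + by rewrite addr_ge0// !mulr_ge0// invr_ge0.
  + by rewrite mulr_ge0.
  move=> z s zr sD; have [z1 z2 z3] := rhP z zr.
  have E1 : 1 <= expR (4 * B * cmod s `^ 1).
    by rewrite -expR0 ler_expR mulr_ge0// ?mulr_ge0// powR_ge0.
  have A10 : 0 <= A1 by rewrite /A1 !mulr_ge0// invr_ge0.
  have B10 : 0 <= `|kap 0%N|^-1 * A by rewrite mulr_ge0// invr_ge0.
  have [sq1|sq1] := ltP (cmod s) q.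
    rewrite /G sq1; apply: (@le_trans _ _ (A1 * 1)); last by rewrite ler_pM// lerDl.
    have sr4 : cmod s < r0 ^+ 2 / 4 by lra.
    have qq : 0 < r0 ^+ 2 / 4 by rewrite divr_gt0.
    have hN N : cmod (ps (cq u h ^~ z) s N - 0) <= A1.
      rewrite subr0; apply: le_trans (ps_bound N qq (cq_gbound z2) sr4) _.
      have x2 : cmod s / (r0 ^+ 2 / 4) <= 1 / 2 by rewrite ler_pdivrMr//; lra.
      have kk : K0 / `|kap 0%N| <= `|K0| / `|kap 0%N| by rewrite ler_wpM2r ?invr_ge0// ler_norm.
      rewrite /A1 mulrC; apply: ler_pM => //.
      + by rewrite invr_ge0; lra.
      + exact: gbound_ge0 (cq_gbound z2).
      + by rewrite invf_ple ?posrE//; lra.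
    by have := cvgC_le (cq_cvg z2 sr4) hN; rewrite subr0 mulr1.
  have sS : sector d e' s.
    (* Points of the smaller disc-sector outside the disc of radius [q] can only come from the
       sector, since [r' < q]. *)
    by case: sD => // /= h1; move: (lt_trans h1 hr); rewrite ltNge sq1.
  have sE : sector d ep s by apply: sector_sub sS; exact: ltW.
  have e'pi : e' <= pi by apply: le_trans epi; exact: ltW.
  have [t2 tS _] := tau_sector e'pi sS.
  rewrite GS// cmodM cmodV cmod_rc.
  have ct : cmod (tau d s) ^+ 2 = 4 * cmod s by rewrite -cmodX t2 cmodM cmod_nat.
  apply: (@le_trans _ _ (`|kap 0%N|^-1 * (A * expR (4 * B * cmod s `^ 1)))).
    rewrite ler_wpM2l ?invr_ge0//; apply: le_trans (H z _ z1 (or_introl tS)) _.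
    apply: (ler_wpM2l A0); rewrite ler_expR (powR_mulrn 2 (cmod_ge0 _)) ct (powRr1 (cmod_ge0 _)).
    by rewrite le_eqVlt; apply/orP; left; apply/eqP; ring.
  by rewrite mulrA ler_wpM2r ?expR_ge0// lerDr.
Qed.

(** Both [d / 2] and [d / 2 + pi] lie over [d] under [s = t^2 / 4], so a continuation in [s] gives
    the two sectors in [t]; back from [t] to [s] the branch [tau] inverts the map over the first of
    them. *)
Theorem part_ii d : Xs d u 1 <->
  (Ok_sector 2 (d / 2) (germ_fun M) /\ Ok_sector 2 (d / 2 + pi) (germ_fun M)).
Proof.
split=> [/(Xs_iff h) H|[/SOkP/ii_bwd H _]]; last exact: Xs_iff H.
have c1 : cis (2 * (d / 2) - d) = 1 by rewrite mulrC divfK// subrr cis0.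
have c2 : cis (2 * (d / 2 + pi) - d) = 1.
  have -> : 2 * (d / 2 + pi) - d = pi *+ 2 by transitivity (pi + pi : R); [lra|].
  by rewrite /cis cos2pi sin2pi rc0 rc1 mulr0 addr0.
by split; apply/SOkP; [exact: ii_fwd c1 H|exact: ii_fwd c2 H].
Qed.
End PartII.

(** * Values of Gamma and conclusion *)

Section GammaValues.
Variable R : realType.
Local Notation lam := (@lebesgue_measure R).

(** The antiderivative of [x^j exp (-x)] that vanishes at infinity, obtained by repeated integration
    by parts; its value at 0 is [- j!]. *)
Definition gam_prim (j : nat) (x : R) : R :=
  - ((\sum_(k < j.+1) (j`!%:R / k`!%:R) * x ^+ k) * expR (- x)).

Lemma gam_prim_derive j x : is_derive x (1 : R) (gam_prim j) (x ^+ j * expR (- x)).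
Proof.
elim: j => [|j IH].
  have -> : gam_prim 0 = (fun x => - expR (- x)).
    by apply/funext => y; rewrite /gam_prim big_ord1 expr0 mulr1 divff ?mul1r// pnatr_eq0.
  by apply: is_derive_eq; rewrite /GRing.scale/=; ring.
have E : gam_prim j.+1 = (fun y => j.+1%:R * gam_prim j y - y ^+ j.+1 * expR (- y)).
  apply/funext => y; rewrite /gam_prim big_ord_recr/= divff ?pnatr_eq0 -?lt0n ?fact_gt0// mul1r.
  rewrite mulrDl opprD mulrN; congr (- _ - _).
  rewrite mulrA mulr_sumr; congr (_ * _); apply: eq_bigr => k _.
  by rewrite factS natrM; ring.
have a1 := @is_deriveZ R R R (gam_prim j) j.+1%:R x 1 _ IH.
have a2 : is_derive x (1 : R) (fun y => y ^+ j.+1 * expR (- y)) (j.+1%:R * x ^+ j * expR (- x) - x ^+ j.+1 * expR (- x)).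
  have b1 : is_derive x (1 : R) (fun y : R => y ^+ j.+1) (j.+1%:R * x ^+ j).
    by split; [exact: exprn_derivable|rewrite exp_derive /GRing.scale/= mulr1].
  have b2 : is_derive x (1 : R) (fun y : R => expR (- y)) (- expR (- x)).
    by apply: is_derive_eq; rewrite /GRing.scale/=; ring.
  apply: (@is_derive_eq _ _ _ _ _ _ _ _ (is_deriveM b1 b2)).
  by rewrite /GRing.scale/=; ring.
rewrite E; apply: (@is_derive_eq _ _ _ _ _ _ _ _ (is_deriveB a1 a2)).
by rewrite /GRing.scale/=; ring.
Qed.

Lemma gam_prim0 j : gam_prim j 0 = - j`!%:R.
Proof.
rewrite /gam_prim oppr0 expR0 mulr1 big_ord_recl/= expr0 mulr1 divr1.
by rewrite big1 ?addr0// => i _; rewrite /bump/= exprS mul0r mulr0.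
Qed.

Lemma pow_expR_cvg (k : nat) : x ^+ k * expR (- x) @[x --> +oo] --> (0 : R).
Proof.
apply: (@squeeze_cvgr _ _ _ _ (fun=> 0) (fun x : R => k.+1`!%:R * x^-1)); last 2 first.
- exact: cvg_cst.
- rewrite -[X in _ --> X](mulr0 k.+1`!%:R); apply: cvgM; first exact: cvg_cst.
  by apply/gtr0_cvgV0 => //; near=> x; near: x; exact: nbhs_pinfty_gt.
near=> x; have x0 : 0 < x by near: x; exact: nbhs_pinfty_gt.
rewrite mulr_ge0 ?exprn_ge0 ?expR_ge0 ?(ltW x0)//=.
have f0 : 0 < k.+1`!%:R :> R by rewrite ltr0n fact_gt0.
rewrite expRN ler_pdivrMr ?expR_gt0// -mulrA -ler_pdivrMl//.
rewrite -(ler_pM2l x0) (mulrA x x^-1) divff ?gt_eqF// mul1r mulrCA -exprS mulrC.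
exact: exp_term (ltW x0).
Unshelve. all: by end_near. Qed.

Lemma gam_prim_cvg j : gam_prim j x @[x --> +oo] --> (0 : R).
Proof.
rewrite /gam_prim -[X in _ --> X]oppr0; apply: cvgN.
under eq_fun do rewrite mulr_suml.
have s0 : \sum_(k < j.+1) 0 = 0 :> R by rewrite big1.
suff H : \sum_(k < j.+1) j`!%:R / k`!%:R * x ^+ k * expR (- x) @[x --> +oo] --> \sum_(k < j.+1) (0 : R).
  by rewrite s0 in H; exact: H.
apply: cvg_big => [|k _]; first exact: add_continuous.
under eq_fun do rewrite -mulrA.
suff : (j`!%:R / k`!%:R) * (x ^+ k * expR (- x)) @[x --> +oo] --> (j`!%:R / k`!%:R) * (0 : R).
  by rewrite mulr0.
apply: cvgM; first exact: cvg_cst.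
exact: pow_expR_cvg.
Qed.

Lemma pow_expR_continuous j : continuous (fun x : R => x ^+ j * expR (- x)).
Proof.
move=> x; apply: cvgM; first exact: exprn_continuous.
by apply: continuous_comp; [exact: opp_continuous|exact: continuous_expR].
Qed.

Lemma int_pow_expR j : (\int[lam]_(x in `]0%R, +oo[) (x ^+ j * expR (- x))%:E = (j`!%:R)%:E)%E.
Proof.
have cf := @pow_expR_continuous j.
rewrite integral_itv_obnd_cbnd; last first.
  apply/measurable_EFinP; apply: measurable_funTS; exact: continuous_measurable_fun.
rewrite (@ge0_continuous_FTC2y R _ (gam_prim j) 0 0).
- by rewrite gam_prim0 -EFinB sub0r opprK.
- by move=> x x0; rewrite mulr_ge0 ?exprn_ge0 ?expR_ge0.
- exact: continuous_subspaceT.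
- exact: gam_prim_cvg.
- by move=> x _; have [] := gam_prim_derive j x.
- apply: cvg_at_right_filter; apply: differentiable_continuous; apply/derivable1_diffP.
  by have [] := gam_prim_derive j 0.
- move=> x _; rewrite derive1E; have h := gam_prim_derive j x; exact: derive_val.
Qed.

Lemma Gamma_nat (j : nat) : Gamma (1 + j%:R / 1 : R) = j`!%:R.
Proof.
rewrite /Gamma /Rintegral (_ : 1 + _ - 1 = j%:R); last by rewrite divr1 addrC addKr.
rewrite -[RHS]/(fine (j`!%:R)%:E) -int_pow_expR; congr fine; apply: eq_integral => x.
by rewrite inE/= in_itv/= andbT => x0; rewrite powR_mulrn// ltW.
Qed.

(** Finiteness matters as much as positivity, because [fine] sends an infinite integral to 0. The
    interval from 1 to 2 bounds the integral below, and [x^(m/2) <= 1 + x^m] bounds it above by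
    factorials. *)
Lemma Gamma_half_gt0 (m : nat) : 0 < Gamma (1 + m%:R / 2 : R).
Proof.
rewrite /Gamma /Rintegral (_ : 1 + _ - 1 = m%:R / 2); last by rewrite addrC addKr.
pose f x : R := x `^ (m%:R / 2) * expR (- x).
have mf : measurable_fun [set: R] f.
  apply: measurable_funM; first exact: measurable_powR.
  by apply: continuous_measurable_fun => x; apply: continuous_comp; [exact: opp_continuous|exact: continuous_expR].
have f0 x : 0 <= f x by rewrite mulr_ge0 ?powR_ge0 ?expR_ge0.
rewrite fine_gt0//; apply/andP; split.
- apply: (@lt_le_trans _ _ (\int[lam]_(x in `]1%R, 2%R[) (cst (expR (-2))%:E x))%E).
    rewrite (integral_cst lam)//.
    have hl : (lam `]1%R, 2%R[%classic = (2 - 1)%:E)%E.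
      by apply: (etrans (lebesgue_measure_itv _)); rewrite /= lte_fin ltr1n.
    apply: (lt_le_trans (y := ((expR (-2))%:E * (2 - 1)%:E)%E)).
      by rewrite -EFinM lte_fin mulr_gt0 ?expR_gt0// subr_gt0 ltr1n.
    by rewrite le_eqVlt; apply/orP; left; apply/eqP; exact: esym (congr1 _ hl).
  apply: (@le_trans _ _ (\int[lam]_(x in `]1%R, 2%R[) (f x)%:E)%E).
    apply: ge0_le_integral => //.
    + by move=> x _; rewrite lee_fin expR_ge0.
    + by apply/measurable_EFinP; exact: measurable_funTS.
    + move=> x /=; rewrite in_itv/= => /andP[x1 x2]; rewrite lee_fin.
      rewrite -[leLHS]mul1r; apply: ler_pM; rewrite ?expR_ge0//.
        rewrite -[leLHS](powRr0 x); apply: ler_powR; [exact: ltW|exact: divr_ge0].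
      by rewrite ler_expR lerN2 ltW.
  apply: ge0_subset_integral => //.
  + by apply/measurable_EFinP; exact: measurable_funTS.
  + by move=> x _; rewrite lee_fin.
  + by move=> x /=; rewrite !in_itv/= andbT => /andP[x1 _]; apply: lt_trans x1.
- apply: (@le_lt_trans _ _ (\int[lam]_(x in `]0%R, +oo[) ((x ^+ 0 * expR (- x))%:E + (x ^+ m * expR (- x))%:E))%E).
    apply: ge0_le_integral => //.
    + by move=> x _; rewrite lee_fin; exact: f0.
    + by apply/measurable_EFinP; exact: measurable_funTS.
    + by apply: emeasurable_funD; apply/measurable_EFinP; apply: measurable_funTS; apply: continuous_measurable_fun; exact: pow_expR_continuous.
    + move=> x /=; rewrite in_itv/= andbT => x0; rewrite lee_fin -mulrDl ler_wpM2r ?expR_ge0// expr0.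
      have [x1|x1] := leP x 1.
        rewrite -[leLHS]addr0; apply: lerD; last exact: exprn_ge0 (ltW x0).
        by rewrite -[leRHS](powRr0 x); apply: ger_powR; [rewrite x0|exact: divr_ge0].
      rewrite -[leLHS]add0r; apply: lerD => //; rewrite -powR_mulrn ?(ltW x0)//.
      by apply: ler_powR; [exact: ltW|rewrite ler_pdivrMr// ler_peMr// ler1n].
  rewrite ge0_integralD//.
  + by rewrite !int_pow_expR -EFinD ltry.
  + by move=> x _; rewrite lee_fin mulr_ge0 ?expR_ge0.
  + by apply/measurable_EFinP; apply: measurable_funTS; apply: continuous_measurable_fun; exact: pow_expR_continuous.
  + by move=> x /=; rewrite in_itv/= andbT => x0; rewrite lee_fin mulr_ge0 ?expR_ge0 ?exprn_ge0 ?(ltW x0).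
  + by apply/measurable_EFinP; apply: measurable_funTS; apply: continuous_measurable_fun; exact: pow_expR_continuous.
Qed.

Lemma alpha_neq0 (m : nat) : alpha R m != 0.
Proof. by rewrite /alpha mulf_neq0 ?invr_eq0 ?gt_eqF ?Gamma_half_gt0 ?powR_gt0 ?pi_gt0. Qed.

End GammaValues.

Lemma kap_alg (R : realType) (a b f g x y : R) : f != 0 -> x != 0 -> y != 0 ->
  a * b / f * g = a * (b * x) / (2 * y * (x * f)) * (2 * (y * g)).
Proof. by move=> f0 x0 y0; field; rewrite f0 x0 y0. Qed.

(** * Both means as instances of one statement *)

Section Assembly.
Variables (R : realType) (n : nat).
Local Notation C := (Cx R).
Local Notation V := 'rV[C]_n.
Local Notation T := (n.-tuple R).
Variables (A Cm : 'M[R]_n).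
Hypothesis Cm_orth : Cm^T *m Cm = 1%:M.
Hypothesis Lam_diag : is_diag_mx (Lam A Cm).
Hypothesis A_posdef : forall x : 'rV[R]_n, x != 0 -> 0 < (x *m A *m x^T) 0 0.
Variable phi : V -> C.
Hypothesis phi_holo : exists2 r0 : R, 0 < r0 & holo_on phi (Dn r0).
Local Notation u := (formal_coef A phi).

Lemma k_summable1 d : k_summable 1 d u <-> Xs d u 1.
Proof.
rewrite /Xs -SOkP /k_summable.
rewrite (_ : (fun j z => u j z / _) = cq u 1)//.
by apply/funext => j; apply/funext => z; rewrite /cq qc1 -Gamma_nat rcV mulrC.
Qed.

(** Ball and sphere enter only through their even moments [kD], the vanishing of the odd ones, and
    the recurrence that determines [h]. *)
Lemma mean_equiv (nu : {measure set T -> \bar R}) (D : set T) (kD : nat -> R) (h : nat) (a : R) :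
  measurable D -> (nu D < +oo)%E -> (forall y, D y -> nrm y <= 1) ->
  (forall (j : nat) (b : seq 'I_n -> C), symseq b -> CI nu D (qk j.*2.+1 b) = 0) ->
  (forall (j : nat) (b : seq 'I_n -> C), symseq b ->
     CI nu D (qk j.*2 b) = rc (kD j) * iter j (@lap R n) b [::]) ->
  kD 0%N != 0 -> a != 0 ->
  (forall j, kD j * j.*2.+1%:R = kD j.+1 * (j.*2 + h.+1)%:R) ->
  let M z t := rc a * CI nu D (fun y => phi (shifted A Cm z t y)) in
  (converges_holo u <-> Ok_entire 2 (germ_fun M)) /\
  forall d, k_summable 1 d u <->
    Ok_sector 2 (d / 2) (germ_fun M) /\ Ok_sector 2 (d / 2 + pi) (germ_fun M).
Proof.
move=> mD fD D1 modd meven k0 a0 kS M.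
have [r1 r10 hphi] := phi_holo.
have [|rho [B [rho0 hB]]] := @near_holoball R V phi 0.
  apply/near_rnorm; exists (r1 / n.+1%:R); first by rewrite divr_gt0.
  move=> q; rewrite subr0 => hq; apply: hphi; exact: enorm_small.
have [tau tau0 htau] := @wdir_bound R n A Cm.
have rt0 : 0 < rho / tau by exact: divr_gt0.
pose r0 := Num.min 1 (rho / tau).
have r00 : 0 < r0 by rewrite lt_min ltr01.
have r01 : r0 <= 1 by rewrite ge_min lexx.
have r0t : r0 <= rho / tau by rewrite ge_min lexx orbT.
have hU : holo_on phi [set z : V | rnorm z < rho].
  by move=> z zr; have [] := hB z; rewrite ?subr0//; apply: (lt_trans zr); rewrite ltrDl.
(* The term in [t^(2j)] carries [kD j / (2j)!] and the formal coefficient already contains [1 / j!],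
   so the ratio is [j! / (2j)!]. Its quotient over one step, [2 (2j + 1)], cancels the factor
   [2j + 1] of the moment recurrence. *)
pose kap j := a * kD j / (j.*2`!)%:R * j`!%:R.
have f0 m : m`!%:R != 0 :> R by rewrite pnatr_eq0 -lt0n fact_gt0.
have uh j : holo_on (u j) [set z | rnorm z < rho].
  move=> z zr; apply: diff_mul; last exact: differentiable_cst.
  exact: (holo_iter_Pop Cm_orth Lam_diag A_posdef j hU).
have kap0 : kap 0%N != 0 by rewrite /kap !mulf_neq0.
have kapS j : kap j = kap j.+1 * (2 * (j.*2 + h.+1))%:R.
  rewrite /kap natrM; transitivity (a * (kD j.+1 * (j.*2 + h.+1)%:R) / (j.+1.*2`!)%:R * (2 * j.+1`!%:R)); last by ring.
  rewrite -kS doubleS !factS !natrM.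
  have -> : j.*2.+2 = (2 * j.+1)%N by rewrite -doubleS mul2n.
  by rewrite natrM; apply: kap_alg; rewrite ?f0 ?pnatr_eq0.
pose K0 := `|a| * (4 * B * fine (nu D)).
have kuE z j : rnorm z < rho -> ku u kap z j = rc a * (rc (kD j / (j.*2`!)%:R) * iter j (lapl (Tv A Cm)) phi z).
  move=> zr; rewrite /ku /formal_coef (iter_Pop Cm_orth Lam_diag A_posdef j hU)//.
  transitivity (rc (kap j / j`!%:R) * iter j (lapl (Tv A Cm)) phi z).
    by rewrite rcM rcV rc_nat -mulrA (mulrC _ (iter _ _ _ _)).
  by rewrite mulrA -rcM; congr (rc _ * _); rewrite /kap mulfK// mulrA.
have kE z : rnorm z < rho -> gbound (ku u kap z) K0 (r0 ^+ 2) /\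
    forall t, cmod t < r0 -> ps (ku u kap z) (t ^+ 2) @ \oo --> M z t.
  move=> zr; have [h1 h2] := @CI_line_even R V n (Tv A Cm) phi rho B tau rho0 tau0 hB htau nu D mD fD D1 kD modd meven z zr.
  split.
    have rr : r0 ^+ 2 <= (rho / tau) ^+ 2 by rewrite lerXn2r// nnegrE ltW.
    apply: (gbound_sub (exprn_gt0 2 r00) rr).
    move=> j; rewrite kuE// (cmodM (rc a)) cmod_rc /K0 -[leRHS]mulrA.
    by apply: ler_wpM2l; [exact: normr_ge0|exact: h1].
  move=> t tr; have hc := h2 t (lt_le_trans tr r0t).
  have -> : M z t = rc a * CI nu D (fun y => phi (z + t *: wdir (Tv A Cm) y)).
    by rewrite /M; congr (_ * CI _ _ _); apply/funext => y; rewrite shiftedE.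
  pose c j := rc (kD j / (j.*2`!)%:R) * iter j (lapl (Tv A Cm)) phi z.
  rewrite (_ : ps (ku u kap z) (t ^+ 2) = fun N => rc a * ps c (t ^+ 2) N).
    by apply: cvgM; [exact: cvg_cst|exact: hc].
  apply/funext => N; rewrite /ps mulr_sumr; apply: eq_bigr => j _.
  by rewrite (kuE z j zr) [RHS]mulrA.
split.
  exact: (@part_i R n u M kap h rho r0 K0 rho0 r00 r01 uh kap0 kapS (fun z zr => (kE z zr).1) (fun z t zr => (kE z zr).2 t)).
move=> d; rewrite k_summable1.
exact: (@part_ii R n u M kap h rho r0 K0 rho0 r00 uh kap0 kapS (fun z zr => (kE z zr).1) (fun z t zr => (kE z zr).2 t) d).
Qed.
End Assembly.

Theorem theorem2 (R : realType) (n : nat) (hn : (0 < n)%N)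
  (A : 'M[R]_n)
  (A_sym : A^T = A)
  (A_posdef : forall x : 'rV[R]_n, x != 0 -> 0 < (x *m A *m x^T) 0 0)
  (Cm : 'M[R]_n)
  (Cm_orth : Cm^T *m Cm = 1%:M)
  (Lam_diag : is_diag_mx (Lam A Cm))
  (phi : 'rV[Cx R]_n -> Cx R)
  (phi_holo : exists2 r0 : R, 0 < r0 & holo_on phi (Dn r0))
  (mu : {measure set (n.-tuple R) -> \bar R}) (mu_leb : lebesgue_n mu)
  (sigma : {measure set (n.-tuple R) -> \bar R}) (sigma_surf : surface_n mu sigma) :
  let u := formal_coef A phi in
  let MB := M_B mu A Cm phi in
  let MS := M_S sigma A Cm phi in
  ((converges_holo u <-> Ok_entire 2 (germ_fun MB)) /\
   (converges_holo u <-> Ok_entire 2 (germ_fun MS))) /\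
  (forall d : R,
    (k_summable 1 d u <->
       Ok_sector 2 (d / 2) (germ_fun MB) /\ Ok_sector 2 (d / 2 + pi) (germ_fun MB)) /\
    (k_summable 1 d u <->
       Ok_sector 2 (d / 2) (germ_fun MS) /\ Ok_sector 2 (d / 2 + pi) (germ_fun MS))).
Proof.
move=> u MB MS.
have al0 := alpha_neq0 R n.
have n0 : n%:R != 0 :> R by rewrite pnatr_eq0 -lt0n.
have v0 : cB mu 0 != 0 by rewrite gt_eqF// vol_gt0.
have [B1 B2] : (converges_holo u <-> Ok_entire 2 (germ_fun MB)) /\ forall d, k_summable 1 d u <->
    Ok_sector 2 (d / 2) (germ_fun MB) /\ Ok_sector 2 (d / 2 + pi) (germ_fun MB).
  (* The moment [cB j.+1] has denominator [n + 2j + 2], which is [2j + h + 1] for [h = n + 1]. *)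
  apply: (@mean_equiv R n A Cm Cm_orth Lam_diag A_posdef phi phi_holo mu (@rball R n) (cB mu) n.+1 (1 / alpha R n)).
  - rewrite rballE; exact: oball_measurable.
  - rewrite rballE; exact: oball_fin.
  - by rewrite rballE => y /ltW.
  - by move=> j b sb; rewrite rballE qk_odd.
  - by move=> j b sb; rewrite rballE qk_even.
  - exact: v0.
  - by rewrite mulf_neq0 ?invr_eq0 ?oner_eq0.
  - move=> j /=; rewrite (_ : (n + j.*2.+2 = j.*2 + n.+2)%N); last by lia.
    by rewrite -mulrA divfK// pnatr_eq0 !addnS.
have [S1 S2] : (converges_holo u <-> Ok_entire 2 (germ_fun MS)) /\ forall d, k_summable 1 d u <->
    Ok_sector 2 (d / 2) (germ_fun MS) /\ Ok_sector 2 (d / 2 + pi) (germ_fun MS).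
  have sb k b : CI sigma (@rsphere R n) (qk k b) = (n + k)%:R * CI mu (oball 1) (qk k b).
    have [K hK] := qk_bound k b.
    apply: (@sphere_ball R n hn mu mu_leb sigma sigma_surf _ k K) => //; first exact: qk_meas.
    by move=> r y _; exact: qk_scale.
  (* The factor [n + 2j] of [sphere_ball] cancels the denominator [n + 2j + 2] at the next index and
     leaves [n + 2j] in its place, so that [h] drops to [n - 1]; this is a genuine predecessor
     because [n] is positive. *)
  apply: (@mean_equiv R n A Cm Cm_orth Lam_diag A_posdef phi phi_holo sigma (@rsphere R n)
    (fun j => (n + j.*2)%:R * cB mu j) n.-1 (1 / (n%:R * alpha R n))).
  - exact: rsphere_measurable.
  - exact: (sigma_fin mu_leb sigma_surf).
  - by move=> y /rsphereE ->.
  - by move=> j b hb; rewrite sb qk_odd ?mulr0.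
  - by move=> j b hb; rewrite sb qk_even// -(rc_nat R (n + j.*2)) rcM mulrA.
  - by rewrite double0 addn0 mulf_neq0.
  - by rewrite div1r invr_neq0// mulf_neq0.
  - move=> j /=; rewrite prednK// (_ : (n + j.+1.*2 = n + j.*2.+2)%N)//.
    rewrite (_ : (j.*2 + n = n + j.*2)%N); last by rewrite addnC.
    rewrite (mulrC (cB mu j)) (mulrA (n + j.*2.+2)%:R) mulrCA divff ?mulr1.
      by rewrite mulrC mulrA mulrAC.
    by rewrite pnatr_eq0 !addnS.
by split; [split|move=> d; split; [exact: B2|exact: S2]].
Qed.
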